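(* Fix constants $a>0$ and $g>0$. Suppose $\rho_0$ is not identically zero and is smooth, bounded, nonnegative and even on $\mathbb{T}$, with $\rho_0(0)=0$ and $\rho_0'\ge 0$ on $[0,\pi)$. Let $\rho$ denote the corresponding unique local-in-time solution on $\mathbb{T}$ of \[ \partial_t \rho + u\,\partial_x \rho = 0,\qquad u = g\,H_a\rho,\qquad \rho(\cdot,0)=\rho_0 . \] Then there exists a finite time $0<T_*<\infty$ such that $\rho$ is nonnegative, bounded and smooth for all $0\le t<T_*$, while \[ \lim_{t\to T_*}\int_0^t \|\partial_x\rho(\cdot,s)\|_{L^\infty}\,ds = \infty . \] In particular, $\rho(\cdot,t)$ cannot remain in $C^\infty(\mathbb{T})$ for all time.
   Context: $\mathbb{T}=[-\pi,\pi)$ denotes the circle; functions on $\mathbb{T}$ are identified with $2\pi$-periodic functions on $\mathbb{R}$, and $C^\infty(\mathbb{T})$ denotes smooth $2\pi$-periodic functions (bounded, with all derivatives bounded). For $a>0$, $H_a f(x) := \mathrm{P.V.}\int_{\mathbb{R}} f(x-y)K_a(y)\,dy$ with $K_a(y) := \frac{a^2}{\pi y(y^2+a^2)}$, applied to the periodic extension of $f$. For smooth initial data this problem has a unique local-in-time smooth solution. *)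

(* Defs.v *)
From Stdlib Require Import Reals List.
From Coquelicot Require Import Coquelicot.
Open Scope R_scope.

(** Convention: a space-time function is [f : R -> R -> R], read [f t x]. *)

Definition periodic2pi (f : R -> R) : Prop := forall x, f (x + 2 * PI) = f x.

Definition smooth_per (f : R -> R) : Prop :=
  periodic2pi f /\
  (forall n x, ex_derive_n f n x) /\
  (forall n, exists M, forall x, Rabs (Derive_n f n x) <= M).

Definition bounded_fun (f : R -> R) : Prop := exists M, forall x, Rabs (f x) <= M.

Definition Ka (a y : R) : R := a ^ 2 / (PI * y * (y ^ 2 + a ^ 2)).

Definition Ha_trunc (a : R) (f : R -> R) (x eps : R) : R :=
  RInt_gen (fun y => f (x - y) * Ka a y) (Rbar_locally m_infty) (at_point (- eps))
  + RInt_gen (fun y => f (x - y) * Ka a y) (at_point eps) (Rbar_locally p_infty).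

Definition is_Ha (a : R) (f : R -> R) (x v : R) : Prop :=
  (forall eps, 0 < eps ->
     ex_RInt_gen (fun y => f (x - y) * Ka a y) (Rbar_locally m_infty) (at_point (- eps)) /\
     ex_RInt_gen (fun y => f (x - y) * Ka a y) (at_point eps) (Rbar_locally p_infty)) /\
  filterlim (Ha_trunc a f x) (at_right 0) (locally v).

Definition pdx (f : R -> R -> R) : R -> R -> R := fun t x => Derive (fun y => f t y) x.
Definition pdt (f : R -> R -> R) : R -> R -> R := fun t x => Derive (fun s => f s x) t.

Fixpoint pd (w : list bool) (f : R -> R -> R) : R -> R -> R :=
  match w with
  | nil => f
  | b :: w' => (if b then pdt else pdx) (pd w' f)
  end.

Definition uncurry2 (f : R -> R -> R) : R * R -> R := fun p => f (fst p) (snd p).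

(** Classical smooth solution on [0,T) x T of
    rho_t + u rho_x = 0, u = g H_a rho, rho(.,0) = rho0:
    - C^infty jointly in (t,x) on (0,T) x R,
    - all x-derivatives jointly continuous on [0,T) x R (up to t = 0),
    - 2pi-periodic in x, initial datum rho0, equation pointwise for 0 < t < T. *)
Definition classical_solution (a g : R) (rho0 : R -> R) (T : R) (rho : R -> R -> R) : Prop :=
  (forall x, rho 0 x = rho0 x) /\
  (forall t, 0 <= t < T -> periodic2pi (rho t)) /\
  (forall w t x, 0 < t < T ->
     ex_derive (fun s => pd w rho s x) t /\
     ex_derive (fun y => pd w rho t y) x /\
     continuous (uncurry2 (pd w rho)) (t, x)) /\
  (forall n t x, 0 <= t < T ->
     filterlim (uncurry2 (Nat.iter n pdx rho))
       (within (fun p : R * R => 0 <= fst p) (locally (t, x)))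
       (locally (Nat.iter n pdx rho t x))) /\
  (forall t x, 0 < t < T ->
     exists v, is_Ha a (rho t) x v /\ pdt rho t x + (g * v) * pdx rho t x = 0).

Definition Linf (f : R -> R) : R := real (Lub_Rbar (fun y => exists x, y = Rabs (f x))).

(* Main.v *)
(** Write [rho(t,x) = sum_k c_k(t) (cos kx - 1)].  Since [H_a] sends [cos kx] to
    [mk a k * sin kx] with a bounded symbol [mk a], the equation is the quadratic system
    [c' = Bser c c].  A solution is the limit, along a free ultrafilter on [nat], of explicit
    Euler schemes for the Galerkin truncations; the cancellation behind the transport
    structure bounds one step of every Sobolev energy in terms of the [H^2] energy, so the
    limit is smooth on every time interval on which the [H^2] energies of the schemes stay
    bounded (the "good" times).

    Even data increasing on [[0,pi]] stay so, by a minimum principle for the slope.  Then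
    [- H_a rho x >= kap0 * (rho x - rho ((1 - mu) x))], and the singular mass
    [J = int rho(s^2) / s^2 ds] satisfies [J' >= const * J^2]; hence the good times are
    bounded, and [Tstar] is their supremum.  If [int |rho_x|_oo] stayed bounded up to [Tstar],
    the logarithmic bound of [u_x] by [|rho_x|_oo] and the [H^2] energy would keep that energy
    bounded, and the good times would extend past [Tstar]. *)

Require Import Defs.
From Stdlib Require Import Reals Lra Lia Psatz Arith ZArith List Classical ClassicalEpsilon.
From mathcomp Require filter.
From Coquelicot Require Import Coquelicot.
Open Scope R_scope.

(** * Dominated series *)

(** The ultrafilter does the work of a compactness argument: every bounded sequence of scheme values
    has a limit, for all times and modes at once, and inequalities pass to it. Good times are
    defined through the schemes, not the limit, so the bound that prolongs the solution, obtained
    for the limit, has to be carried back to the schemes. The cancellation is an antisymmetry: after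
    symmetrisation the weight [k^(2s) j] of the energy becomes [k^(2s) j - j^(2s) k], which is small
    near the diagonal. With [x = s^2], [J] is half the integral of [rho(x) x^(-3/2)]. The velocity
    bound compares the profile at two points of fixed ratio; under this weight an integration by
    parts makes [J'] control an integrated square, and a dilation recovers [J] from it. What shapes
    the blow-up argument is that [J] must be cut off at some [de > 0], with an error governed by the
    supremum of the slope, a quantity without uniform bound near the end of the life span. So [de]
    is chosen last, and the constants of the Riccati inequality depend on neither of the two. *)

Fixpoint sm (f : nat -> R) (n : nat) : R :=
  match n with O => 0 | S m => sm f m + f m end.

Lemma sm_S f n : sm f (S n) = sm f n + f n.
Proof. reflexivity. Qed.

Lemma sm_ext f h n : (forall k, (k < n)%nat -> f k = h k) -> sm f n = sm h n.
Proof.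
  induction n; simpl; intros H; auto.
  rewrite IHn; [rewrite H; auto|]. intros; apply H; lia.
Qed.

Lemma sm_plus f h n : sm (fun k => f k + h k) n = sm f n + sm h n.
Proof. induction n; simpl; [ring|]. rewrite IHn; ring. Qed.

Lemma sm_minus f h n : sm (fun k => f k - h k) n = sm f n - sm h n.
Proof. induction n; simpl; [ring|]. rewrite IHn; ring. Qed.

Lemma sm_scal c f n : sm (fun k => c * f k) n = c * sm f n.
Proof. induction n; simpl; [ring|]. rewrite IHn; ring. Qed.

Lemma sm_le f h n : (forall k, (k < n)%nat -> f k <= h k) -> sm f n <= sm h n.
Proof.
  induction n; simpl; intros H; [lra|].
  apply Rplus_le_compat; [apply IHn; intros; apply H; lia|apply H; lia].
Qed.

Lemma sm_zero n : sm (fun _ => 0) n = 0.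
Proof. induction n; simpl; lra. Qed.

Lemma sm_const c n : sm (fun _ => c) n = INR n * c.
Proof. induction n; [simpl; ring|]. rewrite S_INR; simpl; rewrite IHn; ring. Qed.

Lemma sm_nonneg f n : (forall k, (k < n)%nat -> 0 <= f k) -> 0 <= sm f n.
Proof. intros H. rewrite <- (sm_zero n). apply sm_le, H. Qed.

Lemma sm_abs f n : Rabs (sm f n) <= sm (fun k => Rabs (f k)) n.
Proof.
  induction n; simpl; [rewrite Rabs_R0; lra|].
  eapply Rle_trans; [apply Rabs_triang|]. lra.
Qed.

Lemma sm_split f n m : sm f (n + m) = sm f n + sm (fun k => f (n + k)%nat) m.
Proof.
  induction m; simpl.
  - rewrite Nat.add_0_r; ring.
  - rewrite Nat.add_succ_r; simpl. rewrite IHm; ring.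
Qed.

Lemma sm_mono f n m : (n <= m)%nat -> (forall k, (k < m)%nat -> 0 <= f k) -> sm f n <= sm f m.
Proof.
  intros Hnm H. replace m with (n + (m - n))%nat by lia. rewrite sm_split.
  assert (0 <= sm (fun k => f (n + k)%nat) (m - n)); [|lra].
  apply sm_nonneg; intros; apply H; lia.
Qed.

Lemma sm_term_le f n k : (k < n)%nat -> (forall i, (i < n)%nat -> 0 <= f i) -> f k <= sm f n.
Proof.
  intros Hk H. apply Rle_trans with (sm f (S k)).
  - simpl. assert (0 <= sm f k); [|lra]. apply sm_nonneg; intros; apply H; lia.
  - apply sm_mono; [lia|auto].
Qed.

Lemma sm_swap (f : nat -> nat -> R) n m :
  sm (fun i => sm (fun j => f i j) m) n = sm (fun j => sm (fun i => f i j) n) m.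
Proof.
  induction n; simpl.
  - rewrite sm_zero; reflexivity.
  - rewrite IHn, sm_plus; reflexivity.
Qed.

Lemma sm_head f n : sm f (S n) = f O + sm (fun k => f (S k)) n.
Proof. induction n; [simpl; ring|]. change (sm f (S (S n))) with (sm f (S n) + f (S n)).
  rewrite IHn. simpl. ring. Qed.

Lemma sm_rev f n : sm (fun k => f (n - k)%nat) n = sm (fun k => f (S k)) n.
Proof.
  induction n; [reflexivity|].
  rewrite sm_head. rewrite Nat.sub_0_r. simpl (sm (fun k => f (S k)) (S n)).
  rewrite <- IHn. rewrite Rplus_comm. f_equal.
Qed.

Lemma sum_n_sm f n : sum_n f n = sm f (S n).
Proof.
  induction n.
  - rewrite sum_O; simpl. symmetry; apply Rplus_0_l.
  - rewrite sum_Sn, IHn; reflexivity.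
Qed.

Lemma is_series_sm f l : is_series f l -> is_lim_seq (sm f) l.
Proof.
  intros H. apply is_lim_seq_incr_1.
  apply is_lim_seq_ext with (sum_n f); [intros; apply sum_n_sm|]. exact H.
Qed.

Lemma sm_is_series f (l : R) : is_lim_seq (sm f) l -> is_series f l.
Proof.
  intros H. apply is_lim_seq_incr_1 in H.
  apply (is_lim_seq_ext _ (sum_n f)) in H; [exact H|]. intros; symmetry; apply sum_n_sm.
Qed.

Lemma series_split a n : ex_series a -> Series a = sm a n + Series (fun k => a (n + k)%nat).
Proof.
  intros H. induction n; simpl.
  - rewrite Rplus_0_l. apply Series_ext; auto.
  - rewrite IHn. rewrite (Series_incr_1 (fun k => a (n + k)%nat)).
    + rewrite Nat.add_0_r. rewrite Rplus_assoc. do 2 f_equal. apply Series_ext.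
      intros k; f_equal; lia.
    + apply ex_series_incr_n; auto.
Qed.

Lemma ex_series_dom a A : ex_series A -> (forall k, Rabs (a k) <= A k) -> ex_series a.
Proof. intros H1 H2. apply (ex_series_le a A); auto. Qed.

Lemma series_abs_le a A : ex_series A -> (forall k, Rabs (a k) <= A k) ->
  Rabs (Series a) <= Series A.
Proof.
  intros HA H. eapply Rle_trans.
  - apply Series_Rabs. apply (ex_series_le (fun k => Rabs (a k)) A); auto.
    intros k. change (Rabs (Rabs (a k)) <= A k). rewrite Rabs_Rabsolu; auto.
  - apply Series_le; auto. intros k; split; [apply Rabs_pos|auto].
Qed.

Lemma series_tail a A n : ex_series A -> (forall k, Rabs (a k) <= A k) ->
  Rabs (Series a - sm a n) <= Series A - sm A n.
Proof.
  intros HA H. rewrite (series_split a n), (series_split A n); auto.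
  2: apply ex_series_dom with A; auto.
  replace (sm a n + Series (fun k => a (n + k)%nat) - sm a n) with (Series (fun k => a (n + k)%nat)) by ring.
  replace (sm A n + Series (fun k => A (n + k)%nat) - sm A n) with (Series (fun k => A (n + k)%nat)) by ring.
  apply series_abs_le; auto. apply (ex_series_incr_n A n); auto.
Qed.

Lemma series_tail_small A eps : ex_series A -> 0 < eps ->
  exists n0, forall n, (n0 <= n)%nat -> Series A - sm A n < eps.
Proof.
  intros HA He. assert (H := is_series_sm _ _ (Series_correct _ HA)).
  apply is_lim_seq_spec in H. destruct (H (mkposreal _ He)) as [n Hn].
  exists n. intros m Hm. specialize (Hn m Hm). simpl in Hn.
  rewrite Rabs_minus_sym in Hn. apply Rabs_def2 in Hn. lra.
Qed.

Lemma series_sm_le A n : ex_series A -> (forall k, 0 <= A k) -> sm A n <= Series A.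
Proof.
  intros HA H. rewrite (series_split A n); auto.
  assert (0 <= Series (fun k => A (n + k)%nat)); [|lra].
  assert (Hn : ex_series (fun k => A (n + k)%nat)) by (apply (ex_series_incr_n A n); auto).
  eapply Rle_trans; [apply Rabs_pos|].
  apply (series_abs_le (fun k => A (n + k)%nat)); auto.
  intros k; rewrite Rabs_pos_eq; auto; lra.
Qed.

Lemma filterlim_sm {T} (F : (T -> Prop) -> Prop) {FF : Filter F} (h : T -> nat -> R) (l : nat -> R) n :
  (forall k, filterlim (fun z => h z k) F (locally (l k))) ->
  filterlim (fun z => sm (h z) n) F (locally (sm l n)).
Proof.
  intros H. induction n; simpl.
  - apply filterlim_const.
  - eapply filterlim_comp_2; [exact IHn|apply H|].
    apply (filterlim_plus (sm l n) (l n)).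
Qed.

Lemma filterlim_locally_R {T} (F : (T -> Prop) -> Prop) {FF : Filter F} (f : T -> R) (l : R) :
  filterlim f F (locally l) <-> forall eps, 0 < eps -> F (fun z => Rabs (f z - l) < eps).
Proof.
  rewrite (filterlim_locally f l). split.
  - intros H eps He. exact (H (mkposreal _ He)).
  - intros H eps. exact (H eps (cond_pos eps)).
Qed.

(* Tannery's theorem along an arbitrary filter; continuity, differentiation and
   passage to ultralimits under a series sign are all instances of it. *)
Lemma tannery {T} (F : (T -> Prop) -> Prop) {FF : Filter F}
  (h : T -> nat -> R) (l A : nat -> R) :
  ex_series A -> F (fun z => forall k, Rabs (h z k) <= A k) ->
  (forall k, Rabs (l k) <= A k) ->
  (forall k, filterlim (fun z => h z k) F (locally (l k))) ->
  filterlim (fun z => Series (h z)) F (locally (Series l)).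
Proof.
  intros HA Hh Hl Hlim. apply filterlim_locally_R; auto. intros eps He.
  destruct (series_tail_small A (eps / 3) HA) as [n Hn]; [lra|].
  specialize (Hn n (le_n n)).
  pose proof (filterlim_sm F h l n Hlim) as Hs.
  rewrite filterlim_locally_R in Hs; auto.
  assert (He3 : 0 < eps / 3) by lra.
  generalize (filter_and _ _ Hh (Hs _ He3)). apply filter_imp.
  intros z [H1 H2].
  pose proof (series_tail (h z) A n HA H1).
  pose proof (series_tail l A n HA Hl).
  replace (Series (h z) - Series l) with
    ((Series (h z) - sm (h z) n) + (sm (h z) n - sm l n) - (Series l - sm l n)) by ring.
  eapply Rle_lt_trans; [apply Rabs_triang|]. rewrite Rabs_Ropp.
  eapply Rle_lt_trans; [apply Rplus_le_compat_r, Rabs_triang|]. lra.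
Qed.

(** Tannery applied to the difference quotients along [z -> 0], [z <> 0]: by the mean value theorem
    a quotient is a value of [f'] at an intermediate point, so the majorant of [f'] also dominates
    the quotients. *)
Lemma is_derive_Series (f f' : R -> nat -> R) (A : nat -> R) (t d : R) :
  0 < d -> ex_series A ->
  (forall s k, Rabs (s - t) < d -> is_derive (fun s => f s k) s (f' s k)) ->
  (forall s k, Rabs (s - t) < d -> Rabs (f' s k) <= A k) ->
  (forall s, Rabs (s - t) < d -> ex_series (f s)) ->
  is_derive (fun s => Series (f s)) t (Series (f' t)).
Proof.
  intros Hd HA Hder Hb Hex. apply is_derive_Reals.
  pose (F := within (fun h : R => h <> 0) (locally 0)).
  assert (FF : Filter F) by apply within_filter, locally_filter.
  assert (Hc : Rabs (t - t) < d) by (rewrite Rminus_diag, Rabs_R0; auto).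
  assert (Hl : filterlim (fun z => Series (fun k => (f (t + z) k - f t k) / z)) F (locally (Series (f' t)))).
  { apply (tannery F (fun z k => (f (t + z) k - f t k) / z) (f' t) A); auto.
    - exists (mkposreal _ Hd). intros z Hz Hz0 k.
      assert (Hz' : Rabs z < d) by (change (Rabs (z - 0) < d) in Hz; rewrite Rminus_0_r in Hz; auto).
      destruct (MVT_gen (fun s => f s k) t (t + z) (fun s => f' s k)) as [c [Hc1 Hc2]].
      + intros x Hx. apply Hder. unfold Rmin, Rmax in Hx. destruct (Rle_dec t (t + z));
          apply Rabs_def2 in Hz'; apply Rabs_def1; lra.
      + intros x Hx. apply continuity_pt_filterlim, (ex_derive_continuous (fun s => f s k) x).
        exists (f' x k). apply Hder. unfold Rmin, Rmax in Hx. destruct (Rle_dec t (t + z));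
          apply Rabs_def2 in Hz'; apply Rabs_def1; lra.
      + rewrite Hc2. replace (f' c k * (t + z - t) / z) with (f' c k) by (field; auto).
        apply Hb. unfold Rmin, Rmax in Hc1. destruct (Rle_dec t (t + z));
          apply Rabs_def2 in Hz'; apply Rabs_def1; lra.
    - intros k. apply filterlim_locally_R; auto. intros eps He.
      specialize (Hder t k Hc). apply is_derive_Reals in Hder.
      destruct (Hder eps He) as [de Hde]. exists de. intros z Hz Hz0.
      apply Hde; auto. change (Rabs (z - 0) < de) in Hz. rewrite Rminus_0_r in Hz; auto. }
  intros eps He. rewrite filterlim_locally_R in Hl; auto.
  destruct (Hl eps He) as [de Hde].
  assert (Hm : 0 < Rmin de d) by (apply Rmin_pos; auto; apply cond_pos).
  exists (mkposreal _ Hm). intros h Hh0 Hh. simpl in Hh.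
  assert (H1 : Rabs h < de) by (eapply Rlt_le_trans; [apply Hh|apply Rmin_l]).
  assert (H2 : Rabs h < d) by (eapply Rlt_le_trans; [apply Hh|apply Rmin_r]).
  specialize (Hde h). replace ((Series (f (t + h)) - Series (f t)) / h) with
    (Series (fun k => (f (t + h) k - f t k) / h)).
  - apply Hde; auto. change (Rabs (h - 0) < de). rewrite Rminus_0_r; auto.
  - rewrite <- Series_minus; try apply Hex; auto.
    + unfold Rdiv. rewrite <- Series_scal_r. reflexivity.
    + replace (t + h - t) with h by ring; auto.
Qed.

Lemma is_RInt_sm (f : nat -> R -> R) a b n :
  (forall k, ex_RInt (f k) a b) ->
  is_RInt (fun x => sm (fun k => f k x) n) a b (sm (fun k => RInt (f k) a b) n).
Proof.
  intros H. induction n; simpl.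
  - pose proof (is_RInt_const a b (0 : R)) as H0.
    change (scal (b - a) (0 : R)) with ((b - a) * 0) in H0. rewrite Rmult_0_r in H0. exact H0.
  - apply (is_RInt_plus (fun x => sm (fun k => f k x) n) (f n)); auto.
    apply (RInt_correct (f n)); auto.
Qed.

Lemma is_RInt_Series (f : nat -> R -> R) (A : nat -> R) a b :
  a <= b -> ex_series A ->
  (forall k, ex_RInt (f k) a b) ->
  (forall k x, a <= x <= b -> Rabs (f k x) <= A k) ->
  is_RInt (fun x => Series (fun k => f k x)) a b (Series (fun k => RInt (f k) a b)).
Proof.
  intros Hab HA Hex Hb.
  (* [filterlim_RInt] asks for convergence uniform on the whole line, while the domination holds on
     [[a, b]]; composing with the projection onto [[a, b]] makes it global. *)
  pose (clip x := Rmax a (Rmin x b)).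
  assert (Hclip : forall x, a <= clip x <= b).
  { intros x; unfold clip, Rmax, Rmin. destruct (Rle_dec x b); destruct (Rle_dec a _); lra. }
  assert (Hid : forall x, a <= x <= b -> clip x = x).
  { intros x Hx; unfold clip, Rmax, Rmin. destruct (Rle_dec x b); destruct (Rle_dec a _); lra. }
  destruct (filterlim_RInt (fun n x => sm (fun k => f k (clip x)) n) a b eventually _
     (fun x => Series (fun k => f k (clip x))) (fun n => sm (fun k => RInt (f k) a b) n)) as [l [Hl1 Hl2]].
  - intros n. eapply is_RInt_ext; [|apply is_RInt_sm; auto].
    intros x Hx. rewrite Rmin_left, Rmax_right in Hx; auto.
    apply sm_ext; intros; rewrite Hid; auto; lra.
  - apply filterlim_locally. intros eps.
    destruct (series_tail_small A eps HA (cond_pos eps)) as [n0 Hn0].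
    exists n0. intros n Hn x.
    change (Rabs (sm (fun k => f k (clip x)) n - Series (fun k => f k (clip x))) < eps).
    rewrite Rabs_minus_sym. eapply Rle_lt_trans; [|apply (Hn0 n Hn)].
    apply series_tail; auto.
  - assert (Hs : is_series (fun k => RInt (f k) a b) l) by (apply sm_is_series; exact Hl1).
    rewrite (is_series_unique _ _ Hs).
    eapply is_RInt_ext; [|apply Hl2].
    intros x Hx. rewrite Rmin_left, Rmax_right in Hx; auto.
    apply Series_ext; intros; rewrite Hid; auto; lra.
Qed.

(** * Coefficient sequences of polynomial decay *)

Definition q (k : nat) : R := INR k + 1.
(** A majorant of [/ q k ^ 2] that telescopes: [w2 k = 2 / q k - 2 / q (S k)], so its sum is exactly
    2. It is the usual dominating sequence below. *)
Definition w2 (k : nat) : R := 2 / (q k * (q k + 1)).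

Lemma q_ge1 k : 1 <= q k.
Proof. unfold q. pose proof (pos_INR k); lra. Qed.

Lemma sm_w2 n : sm w2 n = 2 - 2 / q n.
Proof.
  unfold w2, q. induction n; simpl sm.
  - simpl; field.
  - rewrite IHn, S_INR. pose proof (pos_INR n). field. lra.
Qed.

Lemma is_series_w2 : is_series w2 2.
Proof.
  apply sm_is_series. apply is_lim_seq_ext with (fun n => 2 - 2 * / q n).
  { intros; rewrite sm_w2; reflexivity. }
  assert (H : is_lim_seq (fun n => / q n) 0).
  2: { assert (H2 : is_lim_seq (fun n => 2 - 2 * / q n) (2 - 2 * 0)).
       - apply is_lim_seq_minus'; [apply is_lim_seq_const|].
         apply is_lim_seq_mult'; [apply is_lim_seq_const|exact H].
       - replace (2 - 2 * 0) with 2 in H2 by ring. exact H2. }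
  unfold q. apply (is_lim_seq_inv (fun n => INR n + 1) p_infty).
  - apply is_lim_seq_ext with (fun n => INR (S n)); [intros; apply S_INR|].
    apply (is_lim_seq_incr_1 INR). apply is_lim_seq_INR.
  - discriminate.
Qed.

Lemma ex_series_w2 : ex_series w2.
Proof. exists 2; apply is_series_w2. Qed.

Lemma Series_w2 : Series w2 = 2.
Proof. apply is_series_unique, is_series_w2. Qed.

Lemma w2_pos k : 0 < w2 k.
Proof.
  unfold w2. pose proof (q_ge1 k). apply Rdiv_lt_0_compat; nra.
Qed.

Lemma inv_q2_le_w2 k : / q k ^ 2 <= w2 k.
Proof.
  unfold w2. pose proof (q_ge1 k).
  apply Rmult_le_reg_r with (q k ^ 2 * (q k + 1)); [nra|].
  field_simplify; nra.
Qed.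

(** The weight is [k + 1] rather than [k], so that the zero mode is controlled as well and orders
    can be lowered freely. *)
Definition bnd (s : nat) (A : R) (c : nat -> R) : Prop := forall k, q k ^ s * Rabs (c k) <= A.
Definition rapid (c : nat -> R) : Prop := forall s, exists A, bnd s A c.

Lemma qpow_ge1 s k : 1 <= q k ^ s.
Proof. apply pow_R1_Rle, q_ge1. Qed.

Lemma INR_le_q k : 0 <= INR k <= q k.
Proof. unfold q; pose proof (pos_INR k); lra. Qed.

(** Two orders of decay are traded for summability; this is the source of most shifts of the order
    below. *)
Lemma bnd_w2 s A c : bnd (s + 2) A c -> forall k, q k ^ s * Rabs (c k) <= A * w2 k.
Proof.
  intros H k. specialize (H k). rewrite pow_add in H.
  pose proof (q_ge1 k). pose proof (inv_q2_le_w2 k).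
  assert (0 < q k ^ 2) by nra.
  assert (0 <= A). { eapply Rle_trans; [|exact H]. pose proof (qpow_ge1 s k). pose proof (Rabs_pos (c k)).
    apply Rmult_le_pos; [apply Rmult_le_pos|]; lra. }
  apply Rle_trans with (A * / q k ^ 2); [|apply Rmult_le_compat_l; auto].
  apply Rmult_le_reg_r with (q k ^ 2); auto. rewrite Rmult_assoc with (r1 := A).
  rewrite Rinv_l; nra.
Qed.

Lemma bnd_nonneg s A c : bnd s A c -> 0 <= A.
Proof.
  intros H. eapply Rle_trans; [|apply (H O)].
  apply Rmult_le_pos; [pose proof (qpow_ge1 s 0); lra|apply Rabs_pos].
Qed.

Lemma bnd_le s s' A A' c : (s' <= s)%nat -> A <= A' -> bnd s A c -> bnd s' A' c.
Proof.
  intros Hs HA H k. eapply Rle_trans; [|exact HA]. eapply Rle_trans; [|apply (H k)].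
  apply Rmult_le_compat_r; [apply Rabs_pos|]. apply Rle_pow; auto. apply q_ge1.
Qed.

Lemma bnd_abs s A c k : bnd s A c -> Rabs (c k) <= A.
Proof.
  intros H. eapply Rle_trans; [|apply (H k)]. rewrite <- (Rmult_1_l (Rabs (c k))) at 1.
  apply Rmult_le_compat_r; [apply Rabs_pos|apply qpow_ge1].
Qed.

Lemma bnd_plus s A A' c d : bnd s A c -> bnd s A' d -> bnd s (A + A') (fun k => c k + d k).
Proof.
  intros H H' k. specialize (H k); specialize (H' k). pose proof (qpow_ge1 s k).
  pose proof (Rabs_triang (c k) (d k)).
  apply Rle_trans with (q k ^ s * (Rabs (c k) + Rabs (d k))).
  - apply Rmult_le_compat_l; lra.
  - lra.
Qed.

Lemma bnd_mul s A e c d : (forall k, Rabs (e k) <= d) -> 0 <= d -> bnd s A c -> bnd s (d * A) (fun k => e k * c k).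
Proof.
  intros H Hd H' k. specialize (H k); specialize (H' k). pose proof (qpow_ge1 s k).
  rewrite Rabs_mult. pose proof (Rabs_pos (c k)). pose proof (Rabs_pos (e k)).
  apply Rle_trans with (d * (q k ^ s * Rabs (c k))).
  - replace (q k ^ s * (Rabs (e k) * Rabs (c k))) with (Rabs (e k) * (q k ^ s * Rabs (c k))) by ring.
    apply Rmult_le_compat_r; auto. apply Rmult_le_pos; lra.
  - apply Rmult_le_compat_l; auto.
Qed.

Lemma bnd_kmul s A c : bnd (S s) A c -> bnd s A (fun k => INR k * c k).
Proof.
  intros H k. specialize (H k). simpl in H. rewrite Rabs_mult.
  pose proof (INR_le_q k). rewrite (Rabs_pos_eq (INR k)) by lra.
  eapply Rle_trans; [|exact H]. pose proof (qpow_ge1 s k). pose proof (Rabs_pos (c k)).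
  replace (q k * q k ^ s * Rabs (c k)) with (q k * (q k ^ s * Rabs (c k))) by ring.
  replace (q k ^ s * (INR k * Rabs (c k))) with (INR k * (q k ^ s * Rabs (c k))) by ring.
  apply Rmult_le_compat_r; [apply Rmult_le_pos; lra|lra].
Qed.

Lemma rapid_kmul c : rapid c -> rapid (fun k => INR k * c k).
Proof. intros H s. destruct (H (S s)) as [A HA]. exists A. apply bnd_kmul; auto. Qed.

Lemma rapid_mul e c d : (forall k, Rabs (e k) <= d) -> rapid c -> rapid (fun k => e k * c k).
Proof.
  intros He H s. destruct (H s) as [A HA]. exists (d * A). apply bnd_mul; auto.
  eapply Rle_trans; [apply Rabs_pos|apply (He O)].
Qed.

Lemma ex_series_Aw2 A : ex_series (fun k => A * w2 k).
Proof. apply (ex_series_scal_l A w2), ex_series_w2. Qed.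

Lemma Series_Aw2 A : Series (fun k => A * w2 k) = 2 * A.
Proof. rewrite Series_scal_l, Series_w2; ring. Qed.

Lemma sm_Aw2 A n : 0 <= A -> sm (fun k => A * w2 k) n <= 2 * A.
Proof.
  intros HA. rewrite <- Series_Aw2. apply series_sm_le; [apply ex_series_Aw2|].
  intros k; pose proof (w2_pos k); nra.
Qed.

(** * Energy estimate for one Euler step *)

Ltac nn := repeat first [assumption | apply pow_le | apply pos_INR | apply Rabs_pos | apply Rmult_le_pos | apply pow2_ge_0 | lra].

Definition ndist (k j : nat) : nat := ((j - k) + (k - j))%nat.

Lemma INR_dist k j : INR (ndist k j) = Rabs (INR j - INR k).
Proof.
  unfold ndist. destruct (Nat.le_gt_cases k j).
  - replace (j - k + (k - j))%nat with (j - k)%nat by lia.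
    rewrite minus_INR by auto. apply le_INR in H. rewrite Rabs_pos_eq; lra.
  - replace (j - k + (k - j))%nat with (k - j)%nat by lia.
    rewrite minus_INR by lia. apply lt_INR in H. rewrite Rabs_left; lra.
Qed.

Lemma sm_dist_below x k n : (n <= k)%nat -> (forall i, 0 <= x i) ->
  sm (fun j => x (ndist k j)) n <= sm x (S k).
Proof.
  intros Hn Hx.
  apply Rle_trans with (sm (fun j => x (ndist k j)) k).
  - apply sm_mono; auto.
  - rewrite (sm_ext _ (fun j => x (k - j)%nat)).
    + rewrite sm_rev, sm_head. pose proof (Hx O). lra.
    + intros j Hj. unfold ndist. f_equal; lia.
Qed.

(** For fixed [k] the distance [|j - k|] takes each value at most twice, once on either side of
    [k]. *)
Lemma sm_dist x N k : (k < N)%nat -> (forall i, 0 <= x i) ->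
  sm (fun j => x (ndist k j)) N <= 2 * sm x N.
Proof.
  intros Hk Hx. replace N with (k + (N - k))%nat at 1 by lia. rewrite sm_split.
  pose proof (sm_dist_below x k k (le_n k) Hx).
  assert (sm x (S k) <= sm x N) by (apply sm_mono; auto).
  assert (sm (fun j => x (ndist k (k + j))) (N - k) <= sm x N); [|lra].
  rewrite (sm_ext _ x).
  - apply sm_mono; auto; lia.
  - intros j _. unfold ndist. f_equal; lia.
Qed.

Lemma sm_shift x N j : (forall i, 0 <= x i) -> (forall i, (N <= i)%nat -> x i = 0) ->
  sm (fun k => x (j + k)%nat) N <= sm x N.
Proof.
  intros Hx H0. pose proof (sm_split x j N).
  assert (sm x (j + N) = sm x N).
  { rewrite Nat.add_comm, sm_split. rewrite (sm_ext (fun k => x (N + k)%nat) (fun _ => 0)); [rewrite sm_zero; ring|].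
    intros; apply H0; lia. }
  assert (0 <= sm x j) by (apply sm_nonneg; auto). lra.
Qed.

Lemma dist_sym k j : ndist k j = ndist j k.
Proof. unfold ndist; lia. Qed.

Lemma amgm x y : x * y <= / 2 * (x ^ 2 + y ^ 2).
Proof. pose proof (pow2_ge_0 (x - y)). lra. Qed.

(** * Discrete Young inequalities: one factor in l^1, two in l^2 *)

Section Young.
Variables (N : nat) (al be : nat -> R).
Hypothesis (al0 : forall i, 0 <= al i) (be0 : forall i, 0 <= be i).
Hypothesis alN : forall i, (N <= i)%nat -> al i = 0.

Let E := sm (fun k => al k ^ 2) N.
Let W := sm be N.

(** AM-GM splits [al (l k j) * al j] into squares. [C] is the multiplicity of the map [l k]: 2 for
    the distance, 1 for the shift. *)
Lemma young_aux (l : nat -> nat -> nat) (C : R) :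
  (forall k, (k < N)%nat -> sm (fun j => al (l k j) ^ 2) N <= C * E) ->
  sm (fun k => sm (fun j => be k * (al (l k j) * al j)) N) N <= / 2 * (C + 1) * W * E.
Proof.
  intros H. apply Rle_trans with (sm (fun k => be k * (/ 2 * (C + 1) * E)) N).
  - apply sm_le. intros k Hk. rewrite sm_scal. apply Rmult_le_compat_l; auto.
    apply Rle_trans with (sm (fun j => / 2 * (al (l k j) ^ 2 + al j ^ 2)) N).
    + apply sm_le. intros; apply amgm.
    + rewrite sm_scal, sm_plus. specialize (H k Hk). fold E. lra.
  - rewrite (sm_ext _ (fun k => (/ 2 * (C + 1) * E) * be k)) by (intros; ring).
    rewrite sm_scal. fold W. right; ring.
Qed.

Lemma young_dist :
  sm (fun k => sm (fun j => be k * (al (ndist k j) * al j)) N) N <= 3 / 2 * W * E.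
Proof.
  replace (3 / 2) with (/ 2 * (2 + 1)) by field. apply young_aux.
  intros k Hk. apply (sm_dist (fun i => al i ^ 2)); auto. intros; apply pow2_ge_0.
Qed.

Lemma young_plus :
  sm (fun k => sm (fun j => be k * (al (k + j)%nat * al j)) N) N <= W * E.
Proof.
  replace (W * E) with (/ 2 * (1 + 1) * W * E) by field. apply young_aux.
  intros k Hk. rewrite Rmult_1_l. apply (sm_shift (fun i => al i ^ 2)).
  - intros; apply pow2_ge_0.
  - intros i Hi. rewrite alN; auto. ring.
Qed.

Lemma young_diff :
  sm (fun k => sm (fun j => be (ndist k j) * (al k * al j)) N) N <= 2 * W * E.
Proof.
  apply Rle_trans with (sm (fun k => sm (fun j => / 2 * (be (ndist k j) * al k ^ 2) + / 2 * (be (ndist k j) * al j ^ 2)) N) N).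
  - apply sm_le; intros; apply sm_le; intros j Hj.
    pose proof (amgm (al k) (al j)). specialize (be0 (ndist k j)).
    apply Rle_trans with (be (ndist k j) * (/ 2 * (al k ^ 2 + al j ^ 2))); [apply Rmult_le_compat_l; auto|lra].
  - assert (Hh : sm (fun k => sm (fun j => / 2 * (be (ndist k j) * al k ^ 2)) N) N <= W * E).
    { apply Rle_trans with (sm (fun k => W * al k ^ 2) N).
      - apply sm_le. intros k Hk. rewrite sm_scal.
        rewrite (sm_ext _ (fun j => al k ^ 2 * be (ndist k j))) by (intros; ring). rewrite sm_scal.
        pose proof (sm_dist be N k Hk be0). fold W in H. pose proof (pow2_ge_0 (al k)). nra.
      - rewrite sm_scal. fold E. lra. }
    rewrite (sm_ext _ (fun k => sm (fun j => / 2 * (be (ndist k j) * al k ^ 2)) N + sm (fun j => / 2 * (be (ndist k j) * al j ^ 2)) N))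
      by (intros; apply sm_plus).
    rewrite sm_plus. rewrite (sm_swap (fun k j => / 2 * (be (ndist k j) * al j ^ 2))).
    assert (He : sm (fun j => sm (fun i => / 2 * (be (ndist i j) * al j ^ 2)) N) N =
            sm (fun k => sm (fun j => / 2 * (be (ndist k j) * al k ^ 2)) N) N).
    { apply sm_ext; intros; apply sm_ext; intros. rewrite dist_sym; reflexivity. }
    rewrite He. lra.
Qed.
End Young.

Lemma pow_diff_le x y n : 0 <= x <= y -> y ^ S n - x ^ S n <= INR (S n) * (y - x) * y ^ n.
Proof.
  intros H. induction n; [simpl; lra|].
  rewrite S_INR.
  replace (y ^ S (S n) - x ^ S (S n)) with (x * (y ^ S n - x ^ S n) + (y - x) * y ^ S n) by (simpl; ring).
  assert (0 <= y ^ n) by (apply pow_le; lra).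
  assert (x * (y ^ S n - x ^ S n) <= x * (INR (S n) * (y - x) * y ^ n)) by (apply Rmult_le_compat_l; lra).
  assert (x * (INR (S n) * (y - x) * y ^ n) <= y * (INR (S n) * (y - x) * y ^ n)).
  { apply Rmult_le_compat_r; [|lra]. pose proof (pos_INR (S n)). apply Rmult_le_pos; auto. apply Rmult_le_pos; lra. }
  simpl pow in *. lra.
Qed.

Lemma pow_plus_le x d n : 0 <= x -> 0 <= d -> (x + d) ^ n <= 2 ^ n * (x ^ n + d ^ n).
Proof.
  intros Hx Hd.
  assert (Hp : forall z, 0 <= z -> 0 <= z ^ n) by (intros; apply pow_le; auto).
  destruct (Rle_dec x d).
  - apply Rle_trans with ((2 * d) ^ n); [apply pow_incr; lra|]. rewrite Rpow_mult_distr.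
    apply Rmult_le_compat_l; [apply Hp; lra|]. pose proof (Hp x Hx). lra.
  - apply Rle_trans with ((2 * x) ^ n); [apply pow_incr; lra|]. rewrite Rpow_mult_distr.
    apply Rmult_le_compat_l; [apply Hp; lra|]. pose proof (Hp d Hd). lra.
Qed.

(** The factor [2 r + 1] comes from the mean value bound [pow_diff_le], the factor [2 ^ r] from
    splitting [y ^ r] with [pow_plus_le]. *)
Definition Csym (r : nat) : R := INR (S (2 * r)) * 2 ^ r.

(** Factoring out [x y] leaves [y^(2r+1) - x^(2r+1)], which gains a factor [y - x]. Splitting one
    [y^r] into powers of [x] and of [y - x] then leaves no exponent above [s = r + 1]: in
    [cross_bound] no coefficient has to bear more than [s] derivatives. *)
Lemma symbol_bound_le x y r : 0 <= x <= y ->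
  y ^ (2 * S r) * x - x ^ (2 * S r) * y <=
  Csym r * ((y - x) * (x ^ S r * y ^ S r) + (y - x) ^ S r * (x * y ^ S r)).
Proof.
  intros H.
  replace (y ^ (2 * S r) * x - x ^ (2 * S r) * y) with (x * y * (y ^ S (2 * r) - x ^ S (2 * r))).
  2: { replace (2 * S r)%nat with (S (S (2 * r))) by lia. simpl. ring. }
  assert (H1 := pow_diff_le x y (2 * r) H).
  assert (H2 := pow_plus_le x (y - x) r ltac:(lra) ltac:(lra)).
  replace (x + (y - x)) with y in H2 by ring.
  assert (0 <= y ^ r) by (apply pow_le; lra).
  assert (0 <= INR (S (2 * r))) by apply pos_INR.
  apply Rle_trans with (x * y * (INR (S (2 * r)) * (y - x) * y ^ (2 * r))).
  { apply Rmult_le_compat_l; auto. apply Rmult_le_pos; lra. }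
  replace (x * y * (INR (S (2 * r)) * (y - x) * y ^ (2 * r))) with
    ((x * y * INR (S (2 * r)) * (y - x) * y ^ r) * y ^ r).
  2: { replace (2 * r)%nat with (r + r)%nat by lia. rewrite pow_add. ring. }
  apply Rle_trans with ((x * y * INR (S (2 * r)) * (y - x) * y ^ r) * (2 ^ r * (x ^ r + (y - x) ^ r))).
  { apply Rmult_le_compat_l; auto. repeat apply Rmult_le_pos; auto; lra. }
  right. unfold Csym. simpl pow. ring.
Qed.

Lemma symbol_bound x y r : 0 <= x -> 0 <= y ->
  Rabs (x ^ (2 * S r) * y - y ^ (2 * S r) * x) <=
  Csym r * (Rabs (y - x) * (x ^ S r * y ^ S r) + Rabs (y - x) ^ S r * (x * y ^ S r)
            + Rabs (y - x) ^ S r * (x ^ S r * y)).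
Proof.
  intros Hx Hy.
  assert (0 <= Csym r).
  { unfold Csym. apply Rmult_le_pos; [apply pos_INR|apply pow_le; lra]. }
  assert (Hp : forall z, 0 <= z -> 0 <= z ^ S r) by (intros; apply pow_le; auto).
  assert (Hm : forall a b, 0 <= a <= b -> b ^ (2 * S r) * a - a ^ (2 * S r) * b >= 0).
  { intros a b Hab. replace (2 * S r)%nat with (S (S (2 * r))) by lia. simpl pow.
    assert (a ^ S (r + (r + 0)) <= b ^ S (r + (r + 0))) by (apply pow_incr; lra). simpl in H0.
    assert (0 <= a * b) by nra. nra. }
  destruct (Rle_dec x y) as [Hxy|Hxy].
  - rewrite (Rabs_pos_eq (y - x)) by lra.
    specialize (Hm x y ltac:(lra)). rewrite Rabs_left1 by lra.
    pose proof (symbol_bound_le x y r ltac:(lra)).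
    assert (0 <= (y - x) ^ S r * (x ^ S r * y)).
    { apply Rmult_le_pos; [apply Hp; lra|]. apply Rmult_le_pos; auto. }
    nra.
  - assert (Hxy' : y <= x) by lra. rewrite (Rabs_left1 (y - x)) by lra.
    replace (- (y - x)) with (x - y) by ring.
    specialize (Hm y x ltac:(lra)). rewrite Rabs_right by lra.
    pose proof (symbol_bound_le y x r ltac:(lra)).
    assert (0 <= (x - y) ^ S r * (x * y ^ S r)).
    { apply Rmult_le_pos; [apply Hp; lra|]. apply Rmult_le_pos; auto. }
    nra.
Qed.

Section Scheme.
Variables (g : R) (m : nat -> R).
Hypothesis Hg : 0 < g.
Hypothesis Hm : forall k, Rabs (m k) <= 2.

(* With [u = sum m_i c_i sin ix] and [rho = sum c_j cos jx], the [cos kx]-mode of [u * rho_x] is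
   [- / 2 * sum_j j c_j Qm c k j].  The part [Qanti] is antisymmetric in [k] and [j], which is
   what removes the top order term from the energies. *)
Definition Qanti (c : nat -> R) (k j : nat) : R :=
  if le_dec k j then m (j - k) * c (j - k)%nat else - (m (k - j) * c (k - j)%nat).
Definition Qm (c : nat -> R) (k j : nat) : R := m (j + k) * c (j + k)%nat + Qanti c k j.

(** The truncated right-hand side, kept bilinear: [c] supplies the slope and [d] the velocity, so
    that differences expand as in [FN_diff]. The zero mode does not move. *)
Definition FN (N : nat) (c d : nat -> R) (k : nat) : R :=
  if andb (Nat.leb 1 k) (Nat.ltb k N) then g / 2 * sm (fun j => INR j * c j * Qm d k j) N else 0.

Definition EN (N s : nat) (c : nat -> R) : R := sm (fun k => INR k ^ (2 * s) * c k ^ 2) N.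
Definition supp (N : nat) (c : nat -> R) : Prop := c O = 0 /\ forall k, (N <= k)%nat -> c k = 0.

Lemma Rabs_mc c i : Rabs (m i * c i) <= 2 * Rabs (c i).
Proof. rewrite Rabs_mult. apply Rmult_le_compat_r; [apply Rabs_pos|auto]. Qed.

Lemma Qanti_bound c k j : Rabs (Qanti c k j) <= 2 * Rabs (c (ndist k j)).
Proof.
  unfold Qanti. destruct (le_dec k j).
  - replace (ndist k j) with (j - k)%nat by (unfold ndist; lia). apply Rabs_mc.
  - rewrite Rabs_Ropp. replace (ndist k j) with (k - j)%nat by (unfold ndist; lia). apply Rabs_mc.
Qed.

Lemma Qm_bound c k j : Rabs (Qm c k j) <= 2 * (Rabs (c (j + k)%nat) + Rabs (c (ndist k j))).
Proof.
  unfold Qm. eapply Rle_trans; [apply Rabs_triang|].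
  pose proof (Rabs_mc c (j + k)). pose proof (Qanti_bound c k j). lra.
Qed.

Lemma Qanti_anti c k j : c O = 0 -> Qanti c j k = - Qanti c k j.
Proof.
  intros H0. unfold Qanti. destruct (le_dec k j), (le_dec j k); try lia; try ring.
  replace (k - j)%nat with O by lia. replace (j - k)%nat with O by lia. rewrite H0; ring.
Qed.

Lemma FN_supp N c d : supp N (FN N c d).
Proof.
  split; [reflexivity|]. intros k Hk. unfold FN.
  replace (Nat.ltb k N) with false; [rewrite Bool.andb_false_r; auto|].
  symmetry; apply Nat.ltb_ge; auto.
Qed.

Lemma FN_in N c d k : (1 <= k < N)%nat -> FN N c d k = g / 2 * sm (fun j => INR j * c j * Qm d k j) N.
Proof.
  intros H. unfold FN. replace (Nat.leb 1 k) with true by (symmetry; apply Nat.leb_le; lia).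
  replace (Nat.ltb k N) with true by (symmetry; apply Nat.ltb_lt; lia). reflexivity.
Qed.

Lemma FN_cases N c d k : FN N c d k = 0 \/ FN N c d k = g / 2 * sm (fun j => INR j * c j * Qm d k j) N.
Proof. unfold FN. destruct (andb _ _); auto. Qed.

(** Exchange the names of the two indices and average: only the antisymmetric part of [f] meets an
    antisymmetric [P]. *)
Lemma antisym_sum (f P : nat -> nat -> R) N :
  (forall k j, P j k = - P k j) ->
  sm (fun k => sm (fun j => f k j * P k j) N) N =
  / 2 * sm (fun k => sm (fun j => (f k j - f j k) * P k j) N) N.
Proof.
  intros HP.
  assert (H : sm (fun k => sm (fun j => f k j * P k j) N) N = sm (fun k => sm (fun j => - (f j k * P k j)) N) N).
  { rewrite sm_swap. apply sm_ext; intros k Hk; apply sm_ext; intros j Hj. rewrite (HP k j); ring. }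
  assert (H2 : sm (fun k => sm (fun j => (f k j - f j k) * P k j) N) N =
     sm (fun k => sm (fun j => f k j * P k j) N) N + sm (fun k => sm (fun j => - (f j k * P k j)) N) N).
  { rewrite <- sm_plus. apply sm_ext; intros k Hk. rewrite <- sm_plus. apply sm_ext; intros; ring. }
  rewrite H2, <- H. field.
Qed.

Section OneStep.
Variables (N r : nat) (c : nat -> R).
Hypothesis Hc : supp N c.
Let s := S r.
Let al k := INR k ^ s * Rabs (c k).
Let be k := INR k * Rabs (c k).
Let E := EN N s c.
Let W := sm be N.

Lemma al_pos k : 0 <= al k.
Proof. apply Rmult_le_pos; [apply pow_le, pos_INR|apply Rabs_pos]. Qed.
Lemma be_pos k : 0 <= be k.
Proof. apply Rmult_le_pos; [apply pos_INR|apply Rabs_pos]. Qed.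
Lemma al_supp i : (N <= i)%nat -> al i = 0.
Proof. intros H. unfold al. rewrite (proj2 Hc i H), Rabs_R0; ring. Qed.
Lemma al_sq k : al k ^ 2 = INR k ^ (2 * s) * c k ^ 2.
Proof. unfold al. rewrite Rpow_mult_distr, pow2_abs, <- pow_mult. f_equal. f_equal. lia. Qed.
Lemma E_al : sm (fun k => al k ^ 2) N = E.
Proof. apply sm_ext; intros; apply al_sq. Qed.

(** In the part with [j + k], the inequality [k^s <= (j+k)^s] puts [s] derivatives on two factors
    and one on the third, for a cost of [2 W E]. In the antisymmetric part the symmetrised weight is
    bounded by [symbol_bound], whose three terms cost [2], [3/2] and [3/2] by the Young
    inequalities; this is the 5. *)
Lemma cross_bound :
  Rabs (sm (fun k => INR k ^ (2 * s) * c k * FN N c c k) N) <= g / 2 * (2 + 5 * Csym r) * W * E.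
Proof.
  assert (HCs : 0 <= Csym r).
  { unfold Csym. apply Rmult_le_pos; [apply pos_INR|apply pow_le; lra]. }
  rewrite (sm_ext _ (fun k => g / 2 * (sm (fun j => (INR k ^ (2 * s) * INR j * (c k * c j)) * (m (j + k) * c (j + k)%nat)) N
     + sm (fun j => (INR k ^ (2 * s) * INR j * (c k * c j)) * Qanti c k j) N))).
  2: { intros k Hk. destruct k.
       - rewrite (proj1 Hc). rewrite (sm_ext _ (fun _ => 0)) by (intros; ring).
         rewrite (sm_ext (fun j => _ * Qanti c 0 j) (fun _ => 0)) by (intros; ring).
         rewrite !sm_zero. ring.
       - rewrite FN_in by lia. rewrite <- sm_plus.
         replace (INR (S k) ^ (2 * s) * c (S k) * (g / 2 * sm (fun j => INR j * c j * Qm c (S k) j) N))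
           with (g / 2 * ((INR (S k) ^ (2 * s) * c (S k)) * sm (fun j => INR j * c j * Qm c (S k) j) N)) by ring.
         rewrite <- sm_scal. f_equal. apply sm_ext; intros; unfold Qm; ring. }
  rewrite sm_scal, sm_plus, Rabs_mult, (Rabs_pos_eq (g / 2)) by lra.
  rewrite !Rmult_assoc. apply Rmult_le_compat_l; [lra|].
  eapply Rle_trans; [apply Rabs_triang|].
  assert (H1 : Rabs (sm (fun k => sm (fun j => (INR k ^ (2 * s) * INR j * (c k * c j)) * (m (j + k) * c (j + k)%nat)) N) N) <= 2 * (W * E)).
  { eapply Rle_trans; [apply sm_abs|].
    apply Rle_trans with (2 * sm (fun k => sm (fun j => be k * (al (k + j)%nat * al j)) N) N).
    - rewrite (sm_swap (fun k j => be k * (al (k + j)%nat * al j))).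
      rewrite <- sm_scal. apply sm_le; intros k Hk. rewrite <- sm_scal.
      eapply Rle_trans; [apply sm_abs|]. apply sm_le; intros j Hj.
      rewrite Rabs_mult.
      replace (Rabs (INR k ^ (2 * s) * INR j * (c k * c j))) with (INR k ^ s * be j * al k).
      2: { rewrite !Rabs_mult. rewrite (Rabs_pos_eq (INR k ^ _)) by (apply pow_le, pos_INR).
           rewrite (Rabs_pos_eq (INR j)) by apply pos_INR. unfold be, al.
           replace (2 * s)%nat with (s + s)%nat by lia. rewrite pow_add. ring. }
      apply Rle_trans with (INR k ^ s * be j * al k * (2 * Rabs (c (j + k)%nat))).
      + apply Rmult_le_compat_l; [|apply Rabs_mc].
        pose proof (be_pos j); pose proof (al_pos k). nn.
      + unfold al at 2.
        assert (INR k ^ s <= INR (j + k) ^ s).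
        { apply pow_incr. split; [apply pos_INR|]. rewrite plus_INR. pose proof (pos_INR j); lra. }
        assert (0 <= be j * al k * Rabs (c (j + k)%nat)).
        { pose proof (be_pos j); pose proof (al_pos k). nn. }
        nra.
    - pose proof (young_plus N al be be_pos al_supp) as HY. rewrite E_al in HY.
      fold W in HY. lra. }
  assert (H2 : Rabs (sm (fun k => sm (fun j => (INR k ^ (2 * s) * INR j * (c k * c j)) * Qanti c k j) N) N) <= 5 * Csym r * (W * E)).
  { rewrite (antisym_sum (fun k j => INR k ^ (2 * s) * INR j * (c k * c j)) (Qanti c) N) by (intros; apply Qanti_anti, (proj1 Hc)).
    rewrite Rabs_mult, Rabs_pos_eq by lra.
    pose proof (young_diff N al be be_pos) as Y1.
    pose proof (young_dist N al be be_pos) as Y2.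
    rewrite E_al in Y1, Y2. fold W in Y1, Y2.
    apply Rle_trans with (/ 2 * sm (fun k => sm (fun j => 2 * Csym r * (be (ndist k j) * (al k * al j) + be k * (al (ndist k j) * al j) + be j * (al (ndist j k) * al k))) N) N).
    - apply Rmult_le_compat_l; [lra|]. eapply Rle_trans; [apply sm_abs|]. apply sm_le; intros k Hk.
      eapply Rle_trans; [apply sm_abs|]. apply sm_le; intros j Hj. rewrite Rabs_mult.
      replace (INR k ^ (2 * s) * INR j * (c k * c j) - INR j ^ (2 * s) * INR k * (c j * c k)) with
        ((INR k ^ (2 * s) * INR j - INR j ^ (2 * s) * INR k) * (c k * c j)) by ring.
      rewrite Rabs_mult.
      pose proof (symbol_bound (INR k) (INR j) r (pos_INR k) (pos_INR j)) as Hsb.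
      fold s in Hsb. rewrite <- INR_dist in Hsb.
      pose proof (Qanti_bound c k j) as HQ.
      eapply Rle_trans.
      { apply Rmult_le_compat; [apply Rmult_le_pos; apply Rabs_pos|apply Rabs_pos| |exact HQ].
        apply Rmult_le_compat_r; [apply Rabs_pos|exact Hsb]. }
      rewrite Rabs_mult, (dist_sym j k). unfold al, be. right. ring.
    - rewrite (sm_ext _ (fun k => 2 * Csym r * (sm (fun j => be (ndist k j) * (al k * al j)) N + sm (fun j => be k * (al (ndist k j) * al j)) N + sm (fun j => be j * (al (ndist j k) * al k)) N))).
      2: { intros k Hk. rewrite sm_scal, !sm_plus. reflexivity. }
      rewrite sm_scal, !sm_plus. rewrite (sm_swap (fun k j => be j * (al (ndist j k) * al k))).
      nra. }
  lra.
Qed.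

Lemma E2_term k : (k < N)%nat -> Rabs (c k) <= sqrt (EN N 2 c) /\ be k <= sqrt (EN N 2 c).
Proof.
  intros Hk. destruct k.
  - unfold be. rewrite (proj1 Hc), Rabs_R0, Rmult_0_r. split; apply sqrt_pos.
  - assert (H1 : 1 <= INR (S k)) by (rewrite S_INR; pose proof (pos_INR k); lra).
    assert (H : INR (S k) ^ (2 * 2) * c (S k) ^ 2 <= EN N 2 c).
    { apply (sm_term_le (fun k => INR k ^ (2 * 2) * c k ^ 2) N (S k) Hk).
      intros; apply Rmult_le_pos; [apply pow_le, pos_INR|apply pow2_ge_0]. }
    assert (Hb : be (S k) <= sqrt (EN N 2 c)).
    { rewrite <- (sqrt_pow2 (be (S k))) by apply be_pos. apply sqrt_le_1_alt.
      unfold be. rewrite Rpow_mult_distr, pow2_abs. eapply Rle_trans; [|exact H].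
      apply Rmult_le_compat_r; [apply pow2_ge_0|]. apply Rle_pow; [auto|lia]. }
    split; auto. eapply Rle_trans; [|exact Hb]. unfold be.
    pose proof (Rabs_pos (c (S k))). nra.
Qed.

Lemma al_term k : al k <= sqrt E.
Proof.
  destruct (Nat.lt_ge_cases k N) as [Hk|Hk].
  - rewrite <- (sqrt_pow2 (al k)) by apply al_pos. apply sqrt_le_1_alt. rewrite al_sq.
    apply (sm_term_le (fun k => INR k ^ (2 * s) * c k ^ 2) N k Hk).
    intros; apply Rmult_le_pos; [apply pow_le, pos_INR|apply pow2_ge_0].
  - rewrite al_supp; auto. apply sqrt_pos.
Qed.

Lemma c_term k : Rabs (c k) <= sqrt (EN N 2 c).
Proof.
  destruct (Nat.lt_ge_cases k N) as [Hk|Hk].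
  - apply E2_term; auto.
  - rewrite (proj2 Hc), Rabs_R0; auto. apply sqrt_pos.
Qed.

Lemma EN_nonneg s' : 0 <= EN N s' c.
Proof. apply sm_nonneg; intros; apply Rmult_le_pos; [apply pow_le, pos_INR|apply pow2_ge_0]. Qed.

(** No cancellation here, at the price of [N ^ 2]: one [N] from the derivative and one from the
    number of terms. It serves for the quadratic remainder of an Euler step, where the step size
    pays for it. *)
Lemma FN_crude k : INR k ^ s * Rabs (FN N c c k) <= 4 * g * 2 ^ s * INR N ^ 2 * (sqrt E * sqrt (EN N 2 c)).
Proof.
  set (e := sqrt E). set (f := sqrt (EN N 2 c)).
  assert (He : 0 <= e) by apply sqrt_pos. assert (Hf : 0 <= f) by apply sqrt_pos.
  assert (H2 : 1 <= 2 ^ s) by (apply pow_R1_Rle; lra).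
  assert (Hef : 0 <= e * f) by (apply Rmult_le_pos; auto).
  assert (HR : 0 <= 4 * g * 2 ^ s * INR N ^ 2 * (e * f)).
  { nn. }
  destruct (Nat.lt_ge_cases k N) as [Hk|Hk].
  2: { rewrite (proj2 (FN_supp N c c) k Hk), Rabs_R0, Rmult_0_r. exact HR. }
  assert (HN : 1 <= INR N) by (change 1 with (INR 1); apply le_INR; lia).
  destruct (FN_cases N c c k) as [H0|H0]; rewrite H0.
  { rewrite Rabs_R0, Rmult_0_r. exact HR. }
  assert (Hs : INR k ^ s * Rabs (sm (fun j => INR j * c j * Qm c k j) N) <= sm (fun j => 8 * 2 ^ s * INR N * (e * f)) N).
  { eapply Rle_trans; [apply Rmult_le_compat_l; [apply pow_le, pos_INR|apply sm_abs]|].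
    rewrite <- sm_scal. apply sm_le; intros j Hj.
    rewrite !Rabs_mult, (Rabs_pos_eq (INR j)) by apply pos_INR. fold (be j).
    pose proof (Qm_bound c k j) as HQ.
    pose proof (be_pos j) as Hb0. pose proof (proj2 (E2_term j Hj)) as Hb1. fold f in Hb1.
    pose proof (al_term (j + k)) as Ha1. pose proof (al_term (ndist k j)) as Ha2.
    pose proof (al_term j) as Ha3. fold e in Ha1, Ha2, Ha3.
    pose proof (c_term (ndist k j)) as Hc1. fold f in Hc1.
    pose proof (al_pos (j + k)) as P1. pose proof (al_pos (ndist k j)) as P2. pose proof (al_pos j) as P3.
    pose proof (Rabs_pos (c (ndist k j))) as P4. pose proof (Rabs_pos (c (j + k)%nat)) as P5.
    assert (Hk1 : INR k ^ s * Rabs (c (j + k)%nat) <= al (j + k)).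
    { unfold al. apply Rmult_le_compat_r; auto. apply pow_incr. split; [apply pos_INR|].
      rewrite plus_INR. pose proof (pos_INR j); lra. }
    assert (Hk2 : INR k ^ s <= 2 ^ s * (INR j ^ s + INR (ndist k j) ^ s)).
    { eapply Rle_trans; [|apply pow_plus_le; apply pos_INR]. apply pow_incr. split; [apply pos_INR|].
      rewrite INR_dist. destruct (Rle_dec (INR k) (INR j)).
      - pose proof (Rabs_pos (INR j - INR k)); lra.
      - rewrite Rabs_left; lra. }
    assert (Hjp : 0 <= INR j ^ s) by apply pow_le, pos_INR.
    assert (Hkp : 0 <= INR k ^ s) by apply pow_le, pos_INR.
    assert (HjN : INR j <= INR N) by (apply le_INR; lia). pose proof (pos_INR j) as Hj0.
    assert (T1 : be j * (INR k ^ s * Rabs (c (j + k)%nat)) <= e * f).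
    { rewrite (Rmult_comm e). apply Rmult_le_compat; auto; [apply Rmult_le_pos; auto|lra]. }
    assert (T2 : be j * (INR k ^ s * Rabs (c (ndist k j))) <= 2 ^ s * (INR N * (e * f) + e * f)).
    { apply Rle_trans with (be j * (2 ^ s * (INR j ^ s + INR (ndist k j) ^ s) * Rabs (c (ndist k j)))).
      - apply Rmult_le_compat_l; auto. apply Rmult_le_compat_r; auto.
      - replace (be j * (2 ^ s * (INR j ^ s + INR (ndist k j) ^ s) * Rabs (c (ndist k j)))) with
          (2 ^ s * (INR j * (al j * Rabs (c (ndist k j))) + be j * al (ndist k j))) by (unfold al, be; ring).
        apply Rmult_le_compat_l; [lra|]. apply Rplus_le_compat.
        + apply Rmult_le_compat; auto; [apply Rmult_le_pos; auto|]. apply Rmult_le_compat; auto.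
        + rewrite (Rmult_comm e). apply Rmult_le_compat; auto. }
    apply Rle_trans with (2 * (be j * (INR k ^ s * Rabs (c (j + k)%nat)) + be j * (INR k ^ s * Rabs (c (ndist k j))))).
    - apply Rle_trans with (INR k ^ s * (be j * (2 * (Rabs (c (j + k)%nat) + Rabs (c (ndist k j)))))).
      + apply Rmult_le_compat_l; auto. apply Rmult_le_compat_l; auto.
      + right; ring.
    - assert (e * f <= 2 ^ s * (INR N * (e * f))).
      { assert (e * f <= INR N * (e * f)) by nra. nra. }
      assert (2 ^ s * (e * f) <= 2 ^ s * (INR N * (e * f))).
      { apply Rmult_le_compat_l; [lra|]. nra. }
      nra. }
  rewrite sm_const in Hs. rewrite Rabs_mult, (Rabs_pos_eq (g / 2)) by lra.
  apply Rle_trans with (g / 2 * (INR N * (8 * 2 ^ s * INR N * (e * f)))).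
  - replace (INR k ^ s * (g / 2 * Rabs (sm (fun j => INR j * c j * Qm c k j) N))) with
      (g / 2 * (INR k ^ s * Rabs (sm (fun j => INR j * c j * Qm c k j) N))) by ring.
    apply Rmult_le_compat_l; lra.
  - right; field.
Qed.

(** AM-GM in the form [2 k |c_k| <= / k ^ 2 + k ^ 4 c_k ^ 2], the first term being summable. *)
Lemma W_bound : W <= 4 * (1 + EN N 2 c).
Proof.
  apply Rle_trans with (sm (fun k => / 2 * (4 * w2 k + INR k ^ (2 * 2) * c k ^ 2)) N).
  - apply sm_le; intros k Hk. destruct k.
    + unfold be. rewrite (proj1 Hc), Rabs_R0. pose proof (w2_pos 0). simpl INR. nra.
    + unfold be. pose proof (inv_q2_le_w2 (S k)) as Hw. unfold q in Hw.
      set (x := INR (S k)) in *. set (y := Rabs (c (S k))). rewrite <- (pow2_abs (c (S k))). fold y.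
      assert (Hx : 1 <= x) by (unfold x; rewrite S_INR; pose proof (pos_INR k); lra).
      assert (/ x ^ 2 <= 4 * w2 (S k)).
      { apply Rle_trans with (4 * / (x + 1) ^ 2); [|lra].
        apply Rmult_le_reg_r with (x ^ 2 * (x + 1) ^ 2); [nra|].
        replace (/ x ^ 2 * (x ^ 2 * (x + 1) ^ 2)) with ((x + 1) ^ 2) by (field; lra).
        replace (4 * / (x + 1) ^ 2 * (x ^ 2 * (x + 1) ^ 2)) with (4 * x ^ 2) by (field; lra). nra. }
      assert (2 * (x * y) <= / x ^ 2 + x ^ (2 * 2) * y ^ 2).
      { pose proof (pow2_ge_0 (/ x - x ^ 2 * y)).
        replace ((/ x - x ^ 2 * y) ^ 2) with (/ x ^ 2 + x ^ (2 * 2) * y ^ 2 - 2 * (x * y)) in H0 by (simpl; field; lra).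
        lra. }
      lra.
  - rewrite sm_scal, sm_plus. fold (EN N 2 c). pose proof (sm_Aw2 4 N ltac:(lra)).
    pose proof (EN_nonneg 2). lra.
Qed.

(* This step size absorbs the derivative lost by the quadratic term of an Euler step on [N] modes. *)
Definition hN : R := / q N ^ 5.

Lemma hN_pos : 0 < hN.
Proof. apply Rinv_0_lt_compat. pose proof (qpow_ge1 5 N). lra. Qed.

(** First summand: [cross_bound] combined with [W_bound]. Second: the square of the constant of
    [FN_crude]. *)
Definition Kst : R := g * (2 + 5 * Csym r) * 4 + 16 * g ^ 2 * 4 ^ s.

Lemma Kst_nonneg : 0 <= Kst.
Proof.
  unfold Kst. assert (HCs : 0 <= Csym r).
  { unfold Csym. apply Rmult_le_pos; [apply pos_INR|apply pow_le; lra]. }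
  assert (0 <= 4 ^ s) by (apply pow_le; lra). nra.
Qed.

(** Expand the square. The linear term is the pairing of [cross_bound]. In the term with [hN ^ 2],
    one factor [hN] absorbs [N ^ 5]: [N ^ 4] from the square of [FN_crude] and [N] from summing it
    over the modes. *)
Lemma energy_step :
  EN N s (fun k => c k + hN * FN N c c k) <= E * (1 + hN * (Kst * (1 + EN N 2 c))).
Proof.
  assert (HCs : 0 <= Csym r).
  { unfold Csym. apply Rmult_le_pos; [apply pos_INR|apply pow_le; lra]. }
  pose proof hN_pos as Hh. pose proof (EN_nonneg s) as HE. fold E in HE. pose proof (EN_nonneg 2) as HE2.
  unfold EN at 1.
  rewrite (sm_ext _ (fun k => INR k ^ (2 * s) * c k ^ 2 + (2 * hN * (INR k ^ (2 * s) * c k * FN N c c k) + hN ^ 2 * (INR k ^ s * Rabs (FN N c c k)) ^ 2))).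
  2: { intros k _. rewrite Rpow_mult_distr, pow2_abs, <- pow_mult.
       replace (s * 2)%nat with (2 * s)%nat by lia. ring. }
  rewrite !sm_plus, !sm_scal. fold (EN N s c). fold E.
  pose proof cross_bound as HX. apply Rabs_le_between in HX.
  pose proof W_bound as HW.
  set (X := sm (fun k => INR k ^ (2 * s) * c k * FN N c c k) N) in *.
  assert (HX2 : 2 * X <= g * (2 + 5 * Csym r) * 4 * ((1 + EN N 2 c) * E)).
  { destruct HX as [_ HX].
    assert (W * E <= 4 * (1 + EN N 2 c) * E) by (apply Rmult_le_compat_r; auto).
    assert (0 <= g / 2 * (2 + 5 * Csym r)) by (apply Rmult_le_pos; lra).
    assert (g / 2 * (2 + 5 * Csym r) * (W * E) <= g / 2 * (2 + 5 * Csym r) * (4 * (1 + EN N 2 c) * E)) by (apply Rmult_le_compat_l; auto).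
    lra. }
  assert (HF : hN * sm (fun k => (INR k ^ s * Rabs (FN N c c k)) ^ 2) N <= 16 * g ^ 2 * 4 ^ s * (E * EN N 2 c)).
  { apply Rle_trans with (hN * sm (fun k => (4 * g * 2 ^ s * INR N ^ 2 * (sqrt E * sqrt (EN N 2 c))) ^ 2) N).
    - apply Rmult_le_compat_l; [lra|]. apply sm_le; intros k Hk. apply pow_incr. split; [|apply FN_crude].
      apply Rmult_le_pos; [apply pow_le, pos_INR|apply Rabs_pos].
    - rewrite sm_const.
      replace ((4 * g * 2 ^ s * INR N ^ 2 * (sqrt E * sqrt (EN N 2 c))) ^ 2) with
        (16 * g ^ 2 * (2 ^ s) ^ 2 * INR N ^ 4 * (sqrt E ^ 2 * sqrt (EN N 2 c) ^ 2)) by ring.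
      rewrite !pow2_sqrt by auto. rewrite <- pow_mult, Nat.mul_comm, pow_mult.
      replace (2 ^ 2) with 4 by ring.
      assert (0 <= 16 * g ^ 2 * 4 ^ s * (E * EN N 2 c)).
      { apply Rmult_le_pos; [|nra]. apply Rmult_le_pos; [nra|apply pow_le; lra]. }
      replace (hN * (INR N * (16 * g ^ 2 * 4 ^ s * INR N ^ 4 * (E * EN N 2 c)))) with
        ((hN * INR N ^ 5) * (16 * g ^ 2 * 4 ^ s * (E * EN N 2 c))) by ring.
      rewrite <- (Rmult_1_l (16 * g ^ 2 * 4 ^ s * (E * EN N 2 c))) at 2.
      apply Rmult_le_compat_r; auto.
      unfold hN. pose proof (qpow_ge1 5 N).
      apply Rmult_le_reg_l with (q N ^ 5); [lra|]. rewrite <- Rmult_assoc, Rinv_r by lra.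
      rewrite Rmult_1_l, Rmult_1_r. apply pow_incr. apply INR_le_q. }
  unfold Kst.
  assert (H4 : 0 <= 4 ^ s) by (apply pow_le; lra).
  assert (hN * (2 * X) <= hN * (g * (2 + 5 * Csym r) * 4 * ((1 + EN N 2 c) * E))) by (apply Rmult_le_compat_l; lra).
  assert (hN * (hN * sm (fun k => (INR k ^ s * Rabs (FN N c c k)) ^ 2) N) <= hN * (16 * g ^ 2 * 4 ^ s * (E * EN N 2 c))) by (apply Rmult_le_compat_l; lra).
  assert (hN * (16 * g ^ 2 * 4 ^ s * (E * EN N 2 c)) <= hN * (16 * g ^ 2 * 4 ^ s * (E * (1 + EN N 2 c)))).
  { apply Rmult_le_compat_l; [lra|]. apply Rmult_le_compat_l; [nra|]. nra. }
  nra.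
Qed.
End OneStep.
End Scheme.

(** * Ultralimit of the Galerkin schemes *)

(** The ultrafilter lemma of MathComp applied to [eventually]. Its properness (the empty set is not
    a member) is turned into that of Coquelicot (every member is inhabited) by classical logic. *)
Lemma free_ultrafilter : exists U : (nat -> Prop) -> Prop,
  ProperFilter U /\ (forall n, U (fun N => (n <= N)%nat)) /\
  (forall P, U P \/ U (fun N => ~ P N)).
Proof.
  assert (FE : @filter.ProperFilter nat eventually).
  { constructor.
    - intros [n Hn]. exact (Hn n (le_n n)).
    - constructor.
      + exists 0%nat. intros; exact Logic.I.
      + intros P Q HP HQ. exact (filter_and _ _ HP HQ).
      + intros P Q HPQ [n Hn]. exists n. intros k Hk. apply HPQ. auto. }
  destruct (filter.ultraFilterLemma FE) as [U [HU HEU]].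
  exists U.
  pose proof (filter.ultra_proper (F:=U)) as PU.
  destruct PU as [P0 [PT PI PS]].
  repeat split.
  - intros P HP. apply NNPP. intros Hn. apply P0.
    apply (PS P). 2: exact HP. intros x Hx. apply Hn. exists x. exact Hx.
  - exact PT.
  - intros P Q HP HQ. exact (PI P Q HP HQ).
  - intros P Q HPQ HP. exact (PS P Q HPQ HP).
  - intros n. apply HEU. exists n. auto.
  - intros P. destruct (filter.in_ultra_setVsetC (F:=U) P) as [H|H]; auto.
Qed.

(** * Limits along a filter and the time grid *)

Section FilterLimits.
Context {T : Type} (F : (T -> Prop) -> Prop) {FF : ProperFilter F}.

Lemma flim_plus (f h : T -> R) l l' : filterlim f F (locally l) -> filterlim h F (locally l') ->
  filterlim (fun z => f z + h z) F (locally (l + l')).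
Proof. intros H1 H2. eapply filterlim_comp_2; [exact H1|exact H2|]. apply (filterlim_plus l l'). Qed.

Lemma flim_mult (f h : T -> R) l l' : filterlim f F (locally l) -> filterlim h F (locally l') ->
  filterlim (fun z => f z * h z) F (locally (l * l')).
Proof. intros H1 H2. eapply filterlim_comp_2; [exact H1|exact H2|]. apply (filterlim_mult l l'). Qed.

Lemma flim_const (l : R) : filterlim (fun _ : T => l) F (locally l).
Proof. apply filterlim_const. Qed.

Lemma flim_minus (f h : T -> R) l l' : filterlim f F (locally l) -> filterlim h F (locally l') ->
  filterlim (fun z => f z - h z) F (locally (l - l')).
Proof.
  intros H1 H2. apply flim_plus; auto. eapply filterlim_comp; [exact H2|]. apply (filterlim_opp l').
Qed.

Lemma flim_abs (f : T -> R) l : filterlim f F (locally l) -> filterlim (fun z => Rabs (f z)) F (locally (Rabs l)).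
Proof. intros H. eapply filterlim_comp; [exact H|]. apply (filterlim_norm l). Qed.

Lemma flim_le (f h : T -> R) l l' : F (fun z => f z <= h z) ->
  filterlim f F (locally l) -> filterlim h F (locally l') -> l <= l'.
Proof.
  intros H H1 H2. rewrite filterlim_locally_R in H1; try apply FF. rewrite filterlim_locally_R in H2; try apply FF.
  apply le_epsilon. intros eps He.
  assert (He2 : 0 < eps / 2) by lra.
  destruct (filter_ex _ (filter_and _ _ H (filter_and _ _ (H1 _ He2) (H2 _ He2)))) as [z [Hz [Ha Hb]]].
  apply Rabs_def2 in Ha. apply Rabs_def2 in Hb. lra.
Qed.

Lemma flim_ext (f h : T -> R) l : F (fun z => f z = h z) -> filterlim f F (locally l) -> filterlim h F (locally l).
Proof. intros H. apply filterlim_ext_loc. exact H. Qed.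
End FilterLimits.

(** Index of the time step that contains [t]. [Z.to_nat] sends negative integers to 0, so for
    [t <= 0] the schemes stay at their initial data, which lets later statements range over all [t]
    below a bound. *)
Definition nfl (h t : R) : nat := Z.to_nat (Int_part (t / h)).

Lemma nfl_spec h t : 0 < h -> 0 <= t -> INR (nfl h t) * h <= t < (INR (nfl h t) + 1) * h.
Proof.
  intros Hh Ht. unfold nfl. destruct (base_Int_part (t / h)) as [H1 H2].
  assert (Hp : (0 <= Int_part (t / h))%Z).
  { assert (0 <= t / h) by (apply Rmult_le_pos; auto; left; apply Rinv_0_lt_compat; auto).
    assert (-1 < IZR (Int_part (t / h))) by lra. apply lt_IZR in H0. lia. }
  rewrite INR_IZR_INZ, Z2Nat.id by auto.
  replace t with (t / h * h) at 2 3 by (field; lra). split.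
  - apply Rmult_le_compat_r; lra.
  - apply Rmult_lt_compat_r; lra.
Qed.

Lemma nfl_neg h t : 0 < h -> t <= 0 -> nfl h t = O.
Proof.
  intros Hh Ht. unfold nfl. destruct (base_Int_part (t / h)) as [H1 H2].
  assert (t / h <= 0).
  { assert (0 < / h) by (apply Rinv_0_lt_compat; auto). unfold Rdiv; nra. }
  assert (IZR (Int_part (t / h)) <= 0) by lra. apply le_IZR in H0.
  destruct (Int_part (t / h)); auto. lia.
Qed.

Lemma nfl_le h t n : 0 < h -> 0 <= t -> INR n * h <= t -> (n <= nfl h t)%nat.
Proof.
  intros Hh Ht Hn. destruct (nfl_spec h t Hh Ht).
  assert (INR n < INR (S (nfl h t))).
  { rewrite S_INR. apply Rmult_lt_reg_r with h; lra. }
  apply INR_lt in H1. lia.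
Qed.

Lemma nfl_mono h t t' : 0 < h -> 0 <= t -> t <= t' -> (nfl h t <= nfl h t')%nat.
Proof. intros Hh Ht Htt. apply nfl_le; auto; [lra|]. destruct (nfl_spec h t Hh Ht); lra. Qed.

Section Limit.
Variables (g : R) (m : nat -> R) (c0 : nat -> R) (U : (nat -> Prop) -> Prop).
Hypothesis Hg : 0 < g.
Hypothesis Hm : forall k, Rabs (m k) <= 2.
Hypothesis Hc00 : c0 O = 0.
Hypothesis Hc0 : rapid c0.
Context {UF : ProperFilter U}.
Hypothesis Ufree : forall n, U (fun N => (n <= N)%nat).
Hypothesis Uultra : forall P, U P \/ U (fun N => ~ P N).

(** The limit along [U], as the supremum of the levels that [x] reaches on a set of [U]. The default
    value of [real] occurs only for sequences unbounded along [U]. *)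
Definition Ulim (x : nat -> R) : R := real (Lub_Rbar (fun y => U (fun N => y <= x N))).

Lemma Ulim_correct x M : U (fun N => Rabs (x N) <= M) -> filterlim x U (locally (Ulim x)).
Proof.
  intros HM. unfold Ulim. pose (S := fun y => U (fun N => y <= x N)).
  destruct (Lub_Rbar_correct S) as [Hub Hlub]. fold S.
  assert (HS1 : S (- M)).
  { unfold S. revert HM. apply filter_imp. intros N HN. apply Rabs_le_between in HN. lra. }
  assert (HS2 : forall y, S y -> y <= M).
  { intros y Hy. destruct (filter_ex _ (filter_and _ _ Hy HM)) as [N [H1 H2]].
    apply Rabs_le_between in H2. lra. }
  assert (Hle : Rbar_le (Lub_Rbar S) M).
  { apply Hlub. intros y Hy. apply HS2; auto. }
  specialize (Hub (- M) HS1) as Hge.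
  destruct (Lub_Rbar S) as [l| |]; simpl in *; try contradiction.
  apply filterlim_locally_R; [apply UF|]. intros eps He.
  assert (H1 : U (fun N => l - eps / 2 <= x N)).
  { apply NNPP. intros Hn.
    assert (Hl : Rbar_le l (l - eps / 2)).
    { apply (Hlub (Finite (l - eps / 2))). intros y Hy. simpl. apply Rnot_lt_le. intros Hlt. apply Hn.
      revert Hy. unfold S. apply filter_imp. intros; lra. }
    simpl in Hl. lra. }
  (* The ultra property decides: either this level is reached on a set of [U], against the choice of
     [l], or the complementary set belongs to [U]. *)
  assert (H2 : U (fun N => ~ (l + eps / 2 <= x N))).
  { destruct (Uultra (fun N => l + eps / 2 <= x N)) as [H|H]; auto.
    specialize (Hub (l + eps / 2) H). simpl in Hub. lra. }
  generalize (filter_and _ _ H1 H2). apply filter_imp. intros N [Ha Hb]. apply Rabs_def1; lra.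
Qed.

Definition init (N k : nat) : R := if lt_dec k N then c0 k else 0.

Fixpoint eul (N n : nat) : nat -> R :=
  match n with
  | O => init N
  | S n' => fun k => eul N n' k + hN N * FN g m N (eul N n') (eul N n') k
  end.

Lemma eul_supp N n : supp N (eul N n).
Proof.
  induction n.
  - split; simpl; unfold init.
    + destruct (lt_dec 0 N); auto.
    + intros k Hk. destruct (lt_dec k N); auto; lia.
  - destruct IHn as [H1 H2]. destruct (FN_supp g m N (eul N n) (eul N n)) as [H3 H4].
    split; simpl.
    + rewrite H1, H3; ring.
    + intros k Hk. rewrite H2, H4; auto; ring.
Qed.

Definition good (T : R) : Prop :=
  exists M, U (fun N => forall n, INR n * hN N <= T -> EN N 2 (eul N n) <= M).

Lemma good_mono T T' : T' <= T -> good T -> good T'.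
Proof.
  intros H [M HM]. exists M. revert HM. apply filter_imp. intros N HN n Hn. apply HN; lra.
Qed.

Lemma init_energy s : exists A, forall N, EN N s (init N) <= A.
Proof.
  destruct (Hc0 (s + 1)%nat) as [A HA]. exists (2 * A ^ 2). intros N.
  assert (HA0 := bnd_nonneg _ _ _ HA).
  eapply Rle_trans; [|apply (sm_Aw2 (A ^ 2) N); nra].
  apply sm_le; intros k Hk. unfold init. destruct (lt_dec k N); [|lia].
  specialize (HA k). rewrite pow_add, pow_1 in HA.
  assert (Hq := q_ge1 k). pose proof (inv_q2_le_w2 k).
  assert (Hx : INR k ^ s <= q k ^ s) by (apply pow_incr, INR_le_q).
  assert (Hx0 : 0 <= INR k ^ s) by nn.
  replace (2 * s)%nat with (s * 2)%nat by lia. rewrite pow_mult, <- (pow2_abs (c0 k)), <- Rpow_mult_distr.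
  apply Rle_trans with ((q k ^ s * Rabs (c0 k)) ^ 2).
  - apply pow_incr. split; [nn|]. apply Rmult_le_compat_r; [apply Rabs_pos|auto].
  - assert (0 <= q k ^ s * Rabs (c0 k)) by (apply Rmult_le_pos; [lra|apply Rabs_pos]).
    apply Rle_trans with (A ^ 2 * / q k ^ 2); [|apply Rmult_le_compat_l; nra].
    apply Rmult_le_reg_r with (q k ^ 2); [nra|].
    rewrite Rmult_assoc, Rinv_l by nra.
    rewrite <- Rpow_mult_distr, Rmult_1_r. apply pow_incr. split; [nra|]. nra.
Qed.

(** Discrete Gronwall, through [1 + x <= exp x]. The exponent contains only the [H^2] bound [M], so
    control in [H^2] propagates to every order. *)
Lemma energy_growth N r T M : 0 <= M ->
  (forall n, INR n * hN N <= T -> EN N 2 (eul N n) <= M) ->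
  forall n, INR n * hN N <= T ->
  EN N (S r) (eul N n) <= EN N (S r) (init N) * exp (Kst g r * (1 + M) * (INR n * hN N)).
Proof.
  intros HM0 HM n. induction n; intros Hn.
  - simpl. rewrite Rmult_0_l, Rmult_0_r, exp_0. lra.
  - assert (Hh := hN_pos N). rewrite S_INR in *.
    specialize (IHn ltac:(nra)). specialize (HM n ltac:(nra)).
    pose proof (energy_step g m Hg Hm N r (eul N n) (eul_supp N n)) as Hs.
    change (fun k => eul N n k + hN N * FN g m N (eul N n) (eul N n) k) with (eul N (S n)) in Hs.
    eapply Rle_trans; [exact Hs|].
    assert (HK := Kst_nonneg g Hg r).
    pose proof (EN_nonneg N (eul N n) (S r)) as HE. pose proof (EN_nonneg N (eul N n) 2) as HE2.
    replace (Kst g r * (1 + M) * ((INR n + 1) * hN N)) with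
      (Kst g r * (1 + M) * (INR n * hN N) + hN N * (Kst g r * (1 + M))) by ring.
    rewrite exp_plus, <- (Rmult_assoc (EN N (S r) (init N))). apply Rmult_le_compat; auto.
    + assert (0 <= hN N * (Kst g r * (1 + EN N 2 (eul N n)))) by nn. lra.
    + apply Rle_trans with (1 + hN N * (Kst g r * (1 + M))); [|apply exp_ineq1_le].
      apply Rplus_le_compat_l. apply Rmult_le_compat_l; [lra|]. apply Rmult_le_compat_l; lra.
Qed.

(** Each mode separately: [2 ^ S r] compares [q k] with [k] for [k >= 1], and the zero mode
    vanishes. *)
Lemma energy_bnd N r c E : supp N c -> EN N (S r) c <= E -> bnd (S r) (2 ^ S r * sqrt E) c.
Proof.
  intros Hc HE k. pose proof (EN_nonneg N c (S r)) as HE0.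
  assert (H2 : 0 <= 2 ^ S r * sqrt E) by (apply Rmult_le_pos; [apply pow_le; lra|apply sqrt_pos]).
  destruct (Nat.lt_ge_cases k N) as [Hk|Hk].
  2: { rewrite (proj2 Hc k Hk), Rabs_R0, Rmult_0_r; auto. }
  destruct k as [|k].
  { rewrite (proj1 Hc), Rabs_R0, Rmult_0_r; auto. }
  pose proof (al_term N r c Hc (S k)) as Ha.
  apply Rle_trans with ((2 * INR (S k)) ^ S r * Rabs (c (S k))).
  - apply Rmult_le_compat_r; [apply Rabs_pos|]. apply pow_incr. unfold q. rewrite S_INR.
    pose proof (pos_INR k). lra.
  - rewrite Rpow_mult_distr, Rmult_assoc. apply Rmult_le_compat_l; [apply pow_le; lra|].
    eapply Rle_trans; [exact Ha|]. apply sqrt_le_1_alt; auto.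
Qed.

Lemma uniform_bnd T : good T -> forall s, exists A, U (fun N => forall n, INR n * hN N <= T -> bnd s A (eul N n)).
Proof.
  intros [M HM] s.
  destruct (init_energy (S s)) as [E0 HE0].
  exists (2 ^ S s * sqrt (E0 * exp (Kst g s * (1 + Rmax M 0) * Rmax T 0))).
  revert HM. apply filter_imp. intros N HN n Hn.
  apply bnd_le with (S s) (2 ^ S s * sqrt (E0 * exp (Kst g s * (1 + Rmax M 0) * Rmax T 0))); [lia|lra|].
  apply energy_bnd with N; [apply eul_supp|].
  pose proof (Rmax_r M 0). assert (HK := Kst_nonneg g Hg s).
  eapply Rle_trans.
  - apply (energy_growth N s T (Rmax M 0)); auto.
    intros n' Hn'. eapply Rle_trans; [apply HN; auto|apply Rmax_l].
  - apply Rmult_le_compat; [apply EN_nonneg|left; apply exp_pos|apply HE0|].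
    assert (Kst g s * (1 + Rmax M 0) * (INR n * hN N) <= Kst g s * (1 + Rmax M 0) * Rmax T 0).
    { apply Rmult_le_compat_l; [apply Rmult_le_pos; lra|]. eapply Rle_trans; [exact Hn|apply Rmax_l]. }
    destruct H0 as [H0|H0]; [left; apply exp_increasing; auto|rewrite H0; lra].
Qed.

(** The zero mode carries no information, since [rho] is normalised to vanish at [x = 0]; its rate
    is set to 0, consistently with the factor [cos (0 x) - 1 = 0] in [Bser_mult_cosm1]. *)
Definition Bser (c d : nat -> R) (k : nat) : R :=
  match k with O => 0 | S _ => g / 2 * Series (fun j => INR j * c j * Qm m d k j) end.

(** For [l = j + k] and [l = |j - k|] one has [q k <= q j + q l], so the [s] powers of [q k] move to
    [c] or to [d]. The three extra orders on [c] pay for the factor [j] and for summability in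
    [j]. *)
Lemma conv_term s A A' c d k j : bnd (s + 3) A c -> bnd s A' d ->
  q k ^ s * Rabs (INR j * c j * Qm m d k j) <= 8 * 2 ^ s * (A * A') * w2 j.
Proof.
  intros Hc Hd.
  assert (HA0 := bnd_nonneg _ _ _ Hc). assert (HA0' := bnd_nonneg _ _ _ Hd).
  assert (Hc1 := bnd_kmul (s + 2) A c ltac:(replace (S (s + 2)) with (s + 3)%nat by lia; auto)).
  assert (Hc2 := bnd_w2 s A _ Hc1 j). simpl in Hc2.
  rewrite Rabs_mult. set (b := Rabs (INR j * c j)) in *.
  assert (Hb : 0 <= b) by apply Rabs_pos.
  assert (H2 : 0 <= 2 ^ s) by (apply pow_le; lra).
  assert (Hqs := qpow_ge1 s).
  assert (Hl : forall l, q k <= q j + q l -> q k ^ s * (b * Rabs (d l)) <= 2 ^ s * (2 * (A * A' * w2 j))).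
  { intros l Hl. assert (Hk : q k ^ s <= 2 ^ s * (q j ^ s + q l ^ s)).
    { eapply Rle_trans; [|apply pow_plus_le; pose proof (q_ge1 j); pose proof (q_ge1 l); lra].
      apply pow_incr. pose proof (q_ge1 k); lra. }
    specialize (Hd l) as Hdl. assert (Hd0 := bnd_abs _ _ _ l Hd).
    assert (Hdp := Rabs_pos (d l)).
    apply Rle_trans with (2 ^ s * (q j ^ s + q l ^ s) * (b * Rabs (d l))).
    - apply Rmult_le_compat_r; [apply Rmult_le_pos; auto|auto].
    - rewrite Rmult_assoc. apply Rmult_le_compat_l; auto.
      assert (Hbw : b <= A * w2 j). { specialize (Hqs j). nra. }
      assert (T1 : (q j ^ s * b) * Rabs (d l) <= (A * w2 j) * A').
      { apply Rmult_le_compat; auto. specialize (Hqs j). nra. }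
      assert (T2 : b * (q l ^ s * Rabs (d l)) <= (A * w2 j) * A').
      { apply Rmult_le_compat; auto. specialize (Hqs l). nra. }
      lra. }
  apply Rle_trans with (q k ^ s * (b * (2 * (Rabs (d (j + k)%nat) + Rabs (d (ndist k j)))))).
  - apply Rmult_le_compat_l; [specialize (Hqs k); lra|]. apply Rmult_le_compat_l; auto. apply Qm_bound, Hm.
  - assert (L1 := Hl (j + k)%nat). assert (L2 := Hl (ndist k j)).
    unfold q in L1, L2. rewrite plus_INR in L1. rewrite INR_dist in L2.
    pose proof (pos_INR j). specialize (L1 ltac:(pose proof (pos_INR k); lra)).
    assert (INR k <= INR j + Rabs (INR j - INR k)).
    { destruct (Rle_dec (INR k) (INR j)); [pose proof (Rabs_pos (INR j - INR k)); lra|rewrite Rabs_left; lra]. }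
    specialize (L2 ltac:(lra)). fold (q k) in L1, L2. lra.
Qed.

Lemma conv_ex s A A' c d k : bnd (s + 3) A c -> bnd s A' d ->
  ex_series (fun j => INR j * c j * Qm m d k j).
Proof.
  intros Hc Hd. apply ex_series_dom with (fun j => 8 * 2 ^ s * (A * A') * w2 j).
  - apply ex_series_Aw2.
  - intros j. eapply Rle_trans; [|apply (conv_term s A A' c d k j); auto].
    pose proof (qpow_ge1 s k). pose proof (Rabs_pos (INR j * c j * Qm m d k j)). nra.
Qed.

Lemma FN_bnd N s A A' c d : bnd (s + 3) A c -> bnd s A' d -> bnd s (8 * 2 ^ s * g * (A * A')) (FN g m N c d).
Proof.
  intros Hc Hd k.
  assert (HA0 := bnd_nonneg _ _ _ Hc). assert (HA0' := bnd_nonneg _ _ _ Hd).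
  assert (H2 : 0 <= 2 ^ s) by (apply pow_le; lra).
  destruct (FN_cases g m N c d k) as [H0|H0]; rewrite H0.
  - rewrite Rabs_R0, Rmult_0_r. nn.
  - rewrite Rabs_mult, (Rabs_pos_eq (g / 2)) by lra.
    apply Rle_trans with (g / 2 * sm (fun j => 8 * 2 ^ s * (A * A') * w2 j) N).
    + rewrite <- Rmult_assoc, (Rmult_comm (q k ^ s)), Rmult_assoc. apply Rmult_le_compat_l; [lra|].
      eapply Rle_trans; [apply Rmult_le_compat_l; [pose proof (qpow_ge1 s k); lra|apply sm_abs]|].
      rewrite <- sm_scal. apply sm_le; intros. apply conv_term; auto.
    + pose proof (sm_Aw2 (8 * 2 ^ s * (A * A')) N ltac:(nn)). nra.
Qed.

Lemma Bser_bnd s A A' c d : bnd (s + 3) A c -> bnd s A' d -> bnd s (8 * 2 ^ s * g * (A * A')) (Bser c d).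
Proof.
  intros Hc Hd k.
  assert (HA0 := bnd_nonneg _ _ _ Hc). assert (HA0' := bnd_nonneg _ _ _ Hd).
  assert (H2 : 0 <= 2 ^ s) by (apply pow_le; lra).
  destruct k as [|k]; unfold Bser.
  - rewrite Rabs_R0, Rmult_0_r. nn.
  - rewrite Rabs_mult, (Rabs_pos_eq (g / 2)) by lra.
    assert (H : Rabs (Series (fun j => q (S k) ^ s * (INR j * c j * Qm m d (S k) j))) <= Series (fun j => 8 * 2 ^ s * (A * A') * w2 j)).
    { apply series_abs_le; [apply ex_series_Aw2|]. intros j. rewrite Rabs_mult, Rabs_pos_eq.
      - apply conv_term; auto.
      - pose proof (qpow_ge1 s (S k)); lra. }
    rewrite Series_scal_l, Rabs_mult, Rabs_pos_eq, Series_Aw2 in H by (pose proof (qpow_ge1 s (S k)); lra).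
    nra.
Qed.

Lemma FN_eq_Bser N c k : supp N c -> (1 <= k < N)%nat -> FN g m N c c k = Bser c c k.
Proof.
  intros Hc Hk. rewrite FN_in by auto. destruct k; [lia|]. unfold Bser. f_equal.
  symmetry. apply is_series_unique, sm_is_series.
  apply is_lim_seq_ext_loc with (fun _ => sm (fun j => INR j * c j * Qm m c (S k) j) N); [|apply is_lim_seq_const].
  exists N. intros n Hn. replace n with (N + (n - N))%nat by lia. rewrite sm_split.
  rewrite (sm_ext (fun i => _ ) (fun _ => 0) (n - N)); [rewrite sm_zero; ring|].
  intros i _. rewrite (proj2 Hc) by lia. ring.
Qed.

Lemma Qm_minus c d k j : Qm m (fun i => c i - d i) k j = Qm m c k j - Qm m d k j.
Proof. unfold Qm, Qanti. destruct (le_dec k j); ring. Qed.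

Lemma FN_diff N c c' k : FN g m N c' c' k - FN g m N c c k =
  FN g m N (fun i => c' i - c i) c' k + FN g m N c (fun i => c' i - c i) k.
Proof.
  unfold FN. destruct (andb _ _); [|ring].
  rewrite <- Rmult_minus_distr_l, <- Rmult_plus_distr_l, <- sm_minus, <- sm_plus. f_equal.
  apply sm_ext; intros. rewrite Qm_minus. ring.
Qed.

Lemma bnd_scal s A e c : bnd s A c -> bnd s (Rabs e * A) (fun k => e * c k).
Proof. intros H. apply bnd_mul; auto; [intros; lra|apply Rabs_pos]. Qed.

Lemma bnd_ext s A c d : (forall k, c k = d k) -> bnd s A c -> bnd s A d.
Proof. intros H H' k. rewrite <- H. apply H'. Qed.

Lemma eul_lip N T s A : (forall n, INR n * hN N <= T -> bnd (s + 3) A (eul N n)) ->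
  forall i n, INR (n + i) * hN N <= T ->
  bnd s (8 * 2 ^ s * g * (A * A) * (INR i * hN N)) (fun k => eul N (n + i) k - eul N n k).
Proof.
  intros HA i n. assert (Hh := hN_pos N). induction i; intros Hn.
  - rewrite Nat.add_0_r. apply bnd_ext with (fun _ => 0); [intros; ring|].
    intros k. rewrite Rabs_R0. simpl. lra.
  - rewrite Nat.add_succ_r, S_INR in Hn.
    specialize (IHi ltac:(nra)). specialize (HA (n + i)%nat ltac:(nra)).
    assert (HF := FN_bnd N s A A _ _ HA (bnd_le (s + 3) s A A _ ltac:(lia) (Rle_refl A) HA)).
    apply (bnd_scal _ _ (hN N)) in HF. rewrite Rabs_pos_eq in HF by lra.
    pose proof (bnd_plus _ _ _ _ _ IHi HF) as H.
    replace (8 * 2 ^ s * g * (A * A) * (INR (S i) * hN N)) with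
      (8 * 2 ^ s * g * (A * A) * (INR i * hN N) + hN N * (8 * 2 ^ s * g * (A * A))) by (rewrite S_INR; ring).
    eapply bnd_ext; [|exact H]. intros k. rewrite Nat.add_succ_r. simpl. ring.
Qed.

(** Bilinear expansion. The increment has three orders less than the scheme, by [eul_lip] with
    [s = 3], and in the first slot of [FN] it loses three more: hence the order 6. The constant is
    [8 g * 64 g], twice. *)
Lemma FN_lip N T A : 0 <= A -> (forall n, INR n * hN N <= T -> bnd 6 A (eul N n)) ->
  forall i n k, INR (n + i) * hN N <= T ->
  Rabs (FN g m N (eul N (n + i)) (eul N (n + i)) k - FN g m N (eul N n) (eul N n) k)
   <= 1024 * g ^ 2 * A ^ 3 * (INR i * hN N).
Proof.
  intros HA0 HA i n k Hn. assert (Hh := hN_pos N).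
  assert (Hn' : INR n * hN N <= T).
  { rewrite plus_INR in Hn. pose proof (pos_INR i). nra. }
  pose proof (eul_lip N T 3 A HA i n Hn) as HL.
  rewrite FN_diff. eapply Rle_trans; [apply Rabs_triang|].
  assert (H0 : bnd 0 A (eul N (n + i))) by (eapply bnd_le; [|apply Rle_refl|apply HA; auto]; lia).
  assert (H3 : bnd 3 A (eul N n)) by (eapply bnd_le; [|apply Rle_refl|apply HA; auto]; lia).
  pose proof (FN_bnd N 0 _ _ _ _ HL H0) as B1.
  pose proof (bnd_le 3 0 _ _ _ ltac:(lia) (Rle_refl _) HL) as HL0.
  pose proof (FN_bnd N 0 _ _ _ _ H3 HL0) as B2.
  apply (bnd_abs _ _ _ k) in B1. apply (bnd_abs _ _ _ k) in B2. simpl pow in *.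
  eapply Rle_trans; [apply Rplus_le_compat; [exact B1|exact B2]|]. right; ring.
Qed.

(** By [FN_lip] the right-hand side drifts from its first value by at most a multiple of [i h], and
    the drift accumulates over a time [i h]. *)
Lemma eul_taylor N T A : 0 <= A -> (forall n, INR n * hN N <= T -> bnd 6 A (eul N n)) ->
  forall i n k, INR (n + i) * hN N <= T ->
  Rabs (eul N (n + i) k - eul N n k - INR i * hN N * FN g m N (eul N n) (eul N n) k)
   <= 1024 * g ^ 2 * A ^ 3 * (INR i * hN N) ^ 2.
Proof.
  intros HA0 HA i n k. assert (Hh := hN_pos N). induction i; intros Hn.
  - rewrite Nat.add_0_r. simpl INR.
    replace (eul N n k - eul N n k - 0 * hN N * FN g m N (eul N n) (eul N n) k) with 0 by ring.
    rewrite Rabs_R0. nra.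
  - assert (Hni : INR (n + i) * hN N <= T) by (rewrite Nat.add_succ_r, S_INR in Hn; nra).
    specialize (IHi Hni). pose proof (FN_lip N T A HA0 HA i n k Hni) as HF.
    rewrite Nat.add_succ_r, S_INR. simpl eul.
    set (x := eul N (n + i) k) in *. set (y := eul N n k) in *.
    set (f := FN g m N (eul N n) (eul N n) k) in *.
    set (f' := FN g m N (eul N (n + i)) (eul N (n + i)) k) in *.
    replace (x + hN N * f' - y - (INR i + 1) * hN N * f) with
      ((x - y - INR i * hN N * f) + hN N * (f' - f)) by ring.
    eapply Rle_trans; [apply Rabs_triang|]. rewrite Rabs_mult, (Rabs_pos_eq (hN N)) by lra.
    pose proof (pos_INR i).
    assert (0 <= 1024 * g ^ 2 * A ^ 3) by nn.
    assert (hN N * Rabs (f' - f) <= hN N * (1024 * g ^ 2 * A ^ 3 * (INR i * hN N))) by (apply Rmult_le_compat_l; lra).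
    assert (1024 * g ^ 2 * A ^ 3 * ((INR i * hN N) ^ 2 + hN N * (INR i * hN N)) <= 1024 * g ^ 2 * A ^ 3 * ((INR i + 1) * hN N) ^ 2).
    { apply Rmult_le_compat_l; auto. nra. }
    nra.
Qed.

Definition cN (N : nat) (t : R) : nat -> R := eul N (nfl (hN N) t).
Definition cU (t : R) (k : nat) : R := Ulim (fun N => cN N t k).

Lemma hN_lim : filterlim hN U (locally 0).
Proof.
  apply filterlim_locally_R; [apply UF|]. intros eps He.
  destruct (nfl_spec eps 1 He ltac:(lra)) as [_ H]. set (n := nfl eps 1) in *.
  generalize (Ufree n). apply filter_imp. intros N HN. apply le_INR in HN.
  assert (Hh := hN_pos N). rewrite Rminus_0_r, Rabs_pos_eq by lra. unfold hN in *.
  assert (Hq := q_ge1 N). unfold q in *.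
  assert (INR N + 1 <= (INR N + 1) ^ 5).
  { rewrite <- (pow_1 (INR N + 1)) at 1. apply Rle_pow; [auto|lia]. }
  apply Rmult_lt_reg_r with ((INR N + 1) ^ 5); [lra|]. rewrite Rinv_l by lra. nra.
Qed.

Lemma cN_time N T t : 0 <= T -> t <= T -> INR (nfl (hN N) t) * hN N <= T.
Proof.
  intros HT Ht. assert (Hh := hN_pos N). destruct (Rle_dec t 0).
  - rewrite nfl_neg; auto. simpl. lra.
  - destruct (nfl_spec (hN N) t Hh ltac:(lra)). lra.
Qed.

Section Good.
Variable T : R.
Hypothesis HT : 0 <= T.
Hypothesis HG : good T.

Lemma cU_lim t k : t <= T -> filterlim (fun N => cN N t k) U (locally (cU t k)).
Proof.
  intros Ht. destruct (uniform_bnd T HG 0) as [A HA]. apply Ulim_correct with A.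
  revert HA. apply filter_imp. intros N HN. apply (bnd_abs 0 A). apply HN, cN_time; auto.
Qed.

Lemma cU_bnd s : exists A, forall t, t <= T -> bnd s A (cU t).
Proof.
  destruct (uniform_bnd T HG s) as [A HA]. exists A. intros t Ht k.
  apply (@flim_le _ U UF (fun N => q k ^ s * Rabs (cN N t k)) (fun _ => A)).
  - revert HA. apply filter_imp. intros N HN. apply HN, cN_time; auto.
  - apply (flim_mult U); [apply (flim_const U)|apply (flim_abs U), cU_lim; auto].
  - apply (flim_const U).
Qed.

Lemma cU_0 t : t <= T -> cU t O = 0.
Proof.
  intros Ht. apply Rle_antisym.
  - apply (@flim_le _ U UF (fun N => cN N t O) (fun _ => 0)); [|apply cU_lim; auto|apply (flim_const U)].
    apply filter_forall. intros N. unfold cN. rewrite (proj1 (eul_supp N _)). lra.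
  - apply (@flim_le _ U UF (fun _ => 0) (fun N => cN N t O)); [|apply (flim_const U)|apply cU_lim; auto].
    apply filter_forall. intros N. unfold cN. rewrite (proj1 (eul_supp N _)). lra.
Qed.

(** [FN] and [Bser] agree on the schemes as soon as [N > k]. What remains is Tannery along [U],
    dominated through [conv_term] with a bound common to the schemes and to their limit. *)
Lemma FN_lim t k : (1 <= k)%nat -> t <= T ->
  filterlim (fun N => FN g m N (cN N t) (cN N t) k) U (locally (Bser (cU t) (cU t) k)).
Proof.
  intros Hk Ht. apply (flim_ext U (fun N => Bser (cN N t) (cN N t) k)).
  { generalize (Ufree (S k)). apply filter_imp. intros N HN. symmetry. apply FN_eq_Bser; [apply eul_supp|lia]. }
  destruct k; [lia|]. unfold Bser. apply (flim_mult U); [apply (flim_const U)|].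
  destruct (uniform_bnd T HG 3) as [A HA]. destruct (cU_bnd 3) as [A' HA'].
  assert (Hb : forall A1 c j, bnd 3 A1 c -> A1 <= Rmax A A' -> Rabs (INR j * c j * Qm m c (S k) j) <= 8 * 2 ^ 0 * (Rmax A A' * Rmax A A') * w2 j).
  { intros A1 c j Hc H1. assert (H3 : bnd 3 (Rmax A A') c) by (eapply bnd_le; [|exact H1|exact Hc]; lia).
    pose proof (conv_term 0 _ (Rmax A A') c c (S k) j H3 (bnd_le 3 0 _ _ _ ltac:(lia) (Rle_refl _) H3)).
    simpl pow in *. lra. }
  apply (tannery U _ _ (fun j => 8 * 2 ^ 0 * (Rmax A A' * Rmax A A') * w2 j)).
  - apply ex_series_Aw2.
  - revert HA. apply filter_imp. intros N HN j. apply (Hb A); [|apply Rmax_l]. apply HN, cN_time; auto.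
  - intros j. apply (Hb A'); [|apply Rmax_r]. apply HA'; auto.
  - intros j. apply (flim_mult U); [apply (flim_mult U); [apply (flim_const U)|apply cU_lim; auto]|].
    unfold Qm. apply (flim_plus U).
    + apply (flim_mult U); [apply (flim_const U)|apply cU_lim; auto].
    + unfold Qanti. destruct (le_dec (S k) j).
      * apply (flim_mult U); [apply (flim_const U)|apply cU_lim; auto].
      * eapply filterlim_comp; [|apply (filterlim_opp (m (S k - j) * cU t (S k - j)%nat))].
        apply (flim_mult U); [apply (flim_const U)|apply cU_lim; auto].
Qed.

Lemma time_lim t t' : 0 <= t -> t <= t' ->
  filterlim (fun N => INR (nfl (hN N) t' - nfl (hN N) t) * hN N) U (locally (t' - t)).
Proof.
  intros Ht Htt. apply filterlim_locally_R; [apply UF|]. intros eps He.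
  pose proof hN_lim as HL. rewrite filterlim_locally_R in HL; [|apply UF].
  generalize (HL eps He). apply filter_imp. intros N HN. assert (Hh := hN_pos N).
  rewrite Rminus_0_r, Rabs_pos_eq in HN by lra.
  destruct (nfl_spec (hN N) t Hh Ht). destruct (nfl_spec (hN N) t' Hh ltac:(lra)).
  rewrite minus_INR by (apply nfl_mono; auto). apply Rabs_def1; lra.
Qed.

Lemma cU_lip s : exists A, 0 <= A /\ forall t t', 0 <= t <= T -> t <= t' <= T ->
  bnd s (A * (t' - t)) (fun k => cU t' k - cU t k).
Proof.
  destruct (uniform_bnd T HG (s + 3)) as [A HA].
  exists (8 * 2 ^ s * g * (A * A)). split.
  { assert (0 <= A * A) by nra. assert (0 <= 2 ^ s) by (apply pow_le; lra). nn. }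
  intros t t' Ht Ht' k.
  apply (@flim_le _ U UF (fun N => q k ^ s * Rabs (cN N t' k - cN N t k))
    (fun N => 8 * 2 ^ s * g * (A * A) * (INR (nfl (hN N) t' - nfl (hN N) t) * hN N))).
  - revert HA. apply filter_imp. intros N HN. assert (Hh := hN_pos N).
    pose proof (nfl_mono (hN N) t t' Hh ltac:(lra) ltac:(lra)) as Hmono.
    pose proof (eul_lip N T s A HN (nfl (hN N) t' - nfl (hN N) t) (nfl (hN N) t)) as HL.
    replace (nfl (hN N) t + (nfl (hN N) t' - nfl (hN N) t))%nat with (nfl (hN N) t') in HL by lia.
    apply HL. apply cN_time; lra.
  - apply (flim_mult U); [apply (flim_const U)|]. apply (flim_abs U), (flim_minus U); apply cU_lim; lra.
  - apply (flim_mult U); [apply (flim_const U)|]. apply time_lim; lra.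
Qed.

(** The expansion of the schemes survives the limit, but it is based at the earlier time. The
    Lipschitz bound on [Bser] is there to move the base point. *)
Lemma cU_taylor : exists A, 0 <= A /\ forall t t' k, (1 <= k)%nat -> 0 <= t <= T -> t <= t' <= T ->
  Rabs (cU t' k - cU t k - (t' - t) * Bser (cU t) (cU t) k) <= A * (t' - t) ^ 2 /\
  Rabs (Bser (cU t') (cU t') k - Bser (cU t) (cU t) k) <= A * (t' - t).
Proof.
  destruct (uniform_bnd T HG 6) as [A HA].
  assert (HA0 : 0 <= A).
  { destruct (filter_ex _ HA) as [N HN]. apply (bnd_nonneg 6 A (eul N 0)). apply HN. simpl; lra. }
  exists (1024 * g ^ 2 * A ^ 3). split; [nn|].
  intros t t' k Hk Ht Ht'.
  assert (Hn : forall N, (nfl (hN N) t <= nfl (hN N) t')%nat) by (intros N; apply nfl_mono; [apply hN_pos|lra|lra]).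
  assert (Hn' : forall N, (nfl (hN N) t + (nfl (hN N) t' - nfl (hN N) t))%nat = nfl (hN N) t') by (intros N; specialize (Hn N); lia).
  split.
  - apply (@flim_le _ U UF (fun N => Rabs (cN N t' k - cN N t k - INR (nfl (hN N) t' - nfl (hN N) t) * hN N * FN g m N (cN N t) (cN N t) k))
     (fun N => 1024 * g ^ 2 * A ^ 3 * (INR (nfl (hN N) t' - nfl (hN N) t) * hN N) ^ 2)).
    + revert HA. apply filter_imp. intros N HN.
      pose proof (eul_taylor N T A HA0 HN (nfl (hN N) t' - nfl (hN N) t) (nfl (hN N) t) k) as H.
      rewrite Hn' in H. apply H. apply cN_time; lra.
    + apply (flim_abs U), (flim_minus U).
      * apply (flim_minus U); apply cU_lim; lra.
      * apply (flim_mult U); [apply time_lim; lra|apply FN_lim; auto; lra].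
    + apply (flim_mult U); [apply (flim_const U)|]. simpl.
      apply (flim_mult U); [apply time_lim; lra|]. apply (flim_mult U); [apply time_lim; lra|apply (flim_const U)].
  - apply (@flim_le _ U UF (fun N => Rabs (FN g m N (cN N t') (cN N t') k - FN g m N (cN N t) (cN N t) k))
     (fun N => 1024 * g ^ 2 * A ^ 3 * (INR (nfl (hN N) t' - nfl (hN N) t) * hN N))).
    + revert HA. apply filter_imp. intros N HN.
      pose proof (FN_lip N T A HA0 HN (nfl (hN N) t' - nfl (hN N) t) (nfl (hN N) t) k) as H.
      rewrite Hn' in H. apply H. apply cN_time; lra.
    + apply (flim_abs U), (flim_minus U); apply FN_lim; auto; lra.
    + apply (flim_mult U); [apply (flim_const U)|]. apply time_lim; lra.
Qed.

Lemma cU_derive t k : 0 < t < T -> is_derive (fun s => cU s k) t (Bser (cU t) (cU t) k).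
Proof.
  intros Ht. destruct k as [|k].
  { simpl. apply is_derive_ext_loc with (fun _ => 0).
    - exists (mkposreal (T - t) ltac:(lra)). intros s Hs. symmetry. apply cU_0.
      change (Rabs (s - t) < T - t) in Hs. apply Rabs_def2 in Hs. lra.
    - apply (is_derive_const 0). }
  destruct cU_taylor as [A [HA H]].
  apply is_derive_Reals. intros eps He.
  assert (Hd : 0 < Rmin (Rmin t (T - t)) (eps / (2 * A + 1))).
  { repeat apply Rmin_pos; try lra. apply Rdiv_lt_0_compat; lra. }
  exists (mkposreal _ Hd). intros h Hh0 Hh. simpl in Hh.
  assert (H1 : Rabs h < t). { eapply Rlt_le_trans; [exact Hh|]. eapply Rle_trans; apply Rmin_l. }
  assert (H2 : Rabs h < T - t). { eapply Rlt_le_trans; [exact Hh|]. eapply Rle_trans; [apply Rmin_l|apply Rmin_r]. }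
  assert (H3 : Rabs h < eps / (2 * A + 1)). { eapply Rlt_le_trans; [exact Hh|]. apply Rmin_r. }
  assert (H4 : Rabs h * (2 * A + 1) < eps).
  { apply Rmult_lt_compat_r with (r := 2 * A + 1) in H3; [|lra].
    replace (eps / (2 * A + 1) * (2 * A + 1)) with eps in H3 by (field; lra). exact H3. }
  assert (Hhp : 0 < Rabs h) by (apply Rabs_pos_lt; auto).
  apply Rabs_def2 in H1 as H1'. apply Rabs_def2 in H2 as H2'.
  (* For [h < 0] the expansion is based at [t + h]; replacing the rate there by the rate at [t]
     costs another [A h ^ 2], hence [2 A]. *)
  assert (Hkey : Rabs (cU (t + h) (S k) - cU t (S k) - h * Bser (cU t) (cU t) (S k)) <= 2 * A * Rabs h ^ 2).
  { rewrite pow2_abs. destruct (Rle_dec 0 h).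
    - destruct (H t (t + h) (S k) ltac:(lia) ltac:(lra) ltac:(lra)) as [Ha _].
      replace (t + h - t) with h in Ha by ring. pose proof (pow2_ge_0 h). nra.
    - destruct (H (t + h) t (S k) ltac:(lia) ltac:(lra) ltac:(lra)) as [Ha Hb].
      replace (t - (t + h)) with (- h) in Ha, Hb by ring.
      replace (cU (t + h) (S k) - cU t (S k) - h * Bser (cU t) (cU t) (S k)) with
        (- (cU t (S k) - cU (t + h) (S k) - - h * Bser (cU (t + h)) (cU (t + h)) (S k))
         - h * (Bser (cU t) (cU t) (S k) - Bser (cU (t + h)) (cU (t + h)) (S k))) by ring.
      eapply Rle_trans; [apply Rabs_triang|]. rewrite !Rabs_Ropp, Rabs_mult.
      rewrite (Rabs_left h) by lra.
      assert (- h * Rabs (Bser (cU t) (cU t) (S k) - Bser (cU (t + h)) (cU (t + h)) (S k)) <= - h * (A * - h)) by (apply Rmult_le_compat_l; lra).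
      lra. }
  replace ((cU (t + h) (S k) - cU t (S k)) / h - Bser (cU t) (cU t) (S k)) with
    ((cU (t + h) (S k) - cU t (S k) - h * Bser (cU t) (cU t) (S k)) / h) by (field; auto).
  unfold Rdiv. rewrite Rabs_mult, Rabs_inv.
  apply Rmult_lt_reg_r with (Rabs h); auto. rewrite Rmult_assoc, Rinv_l by lra. rewrite Rmult_1_r.
  eapply Rle_lt_trans; [exact Hkey|]. nra.
Qed.
End Good.

Lemma cU_init t : t <= 0 -> forall k, cU t k = c0 k.
Proof.
  intros Ht k.
  assert (H : filterlim (fun N => cN N t k) U (locally (c0 k))).
  { apply (flim_ext U (fun _ => c0 k)); [|apply (flim_const U)].
    generalize (Ufree (S k)). apply filter_imp. intros N HN. unfold cN.
    rewrite nfl_neg; [|apply hN_pos|auto]. simpl. unfold init. destruct (lt_dec k N); auto; lia. }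
  assert (H' : filterlim (fun N => cN N t k) U (locally (cU t k))).
  { apply Ulim_correct with (Rabs (c0 k) + 1). rewrite filterlim_locally_R in H; [|apply UF].
    generalize (H 1 ltac:(lra)). apply filter_imp. intros N HN.
    replace (cN N t k) with (c0 k + (cN N t k - c0 k)) by ring.
    eapply Rle_trans; [apply Rabs_triang|]. lra. }
  apply Rle_antisym; eapply (@flim_le _ U UF); eauto; apply filter_forall; intros; apply Rle_refl.
Qed.

(** A discrete Riccati inequality: by [energy_step] the reciprocal of one plus the energy drops by
    at most [Kst * hN] per step, so doubling takes a time that does not depend on [N]. *)
Lemma energy_doubling N Y n0 : 1 + EN N 2 (eul N n0) <= Y ->
  forall i, Kst g 1 * Y * (INR i * hN N) <= / 2 -> 1 + EN N 2 (eul N (n0 + i)) <= 2 * Y.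
Proof.
  intros HY. assert (Hh := hN_pos N). assert (HK := Kst_nonneg g Hg 1).
  assert (HE : forall n, 0 <= EN N 2 (eul N n)) by (intros; apply EN_nonneg).
  assert (HYp : 1 <= Y) by (specialize (HE n0); lra).
  assert (Hinv : forall i, / Y - Kst g 1 * (INR i * hN N) <= / (1 + EN N 2 (eul N (n0 + i)))).
  { induction i.
    - rewrite Nat.add_0_r. simpl INR. rewrite Rmult_0_l, Rmult_0_r, Rminus_0_r.
      apply Rinv_le_contravar; auto. specialize (HE n0); lra.
    - rewrite S_INR, Nat.add_succ_r.
      pose proof (energy_step g m Hg Hm N 1 (eul N (n0 + i)) (eul_supp N (n0 + i))) as Hs.
      change (fun k => eul N (n0 + i) k + hN N * FN g m N (eul N (n0 + i)) (eul N (n0 + i)) k) with (eul N (S (n0 + i))) in Hs.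
      pose proof (HE (n0 + i)%nat) as He1. pose proof (HE (S (n0 + i))) as He2.
      set (e := EN N 2 (eul N (n0 + i))) in *. set (e' := EN N 2 (eul N (S (n0 + i)))) in *.
      assert (Hz : 0 <= hN N * Kst g 1) by nn.
      assert (H1 : / (1 + e) - hN N * Kst g 1 <= / (1 + e')); [|lra].
      apply Rle_trans with (/ ((1 + e) * (1 + hN N * (Kst g 1 * (1 + e))))).
      + set (z := hN N * Kst g 1) in *. replace (hN N * (Kst g 1 * (1 + e))) with (z * (1 + e)) by (unfold z; ring).
        assert (0 < 1 + z * (1 + e)) by nra.
        apply Rmult_le_reg_r with ((1 + e) * (1 + z * (1 + e))); [nra|].
        rewrite Rinv_l by nra.
        (* With [x = z (1 + e)] the claim is [(1 - x) (1 + x) <= 1]. *)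
        replace ((/ (1 + e) - z) * ((1 + e) * (1 + z * (1 + e)))) with ((1 - z * (1 + e)) * (1 + z * (1 + e))) by (field; lra).
        pose proof (pow2_ge_0 (z * (1 + e))). nra.
      + apply Rinv_le_contravar; [lra|].
        assert (0 <= hN N * (Kst g 1 * (1 + e))) by nn. nra. }
  intros i Hi. specialize (Hinv i). specialize (HE (n0 + i)%nat).
  assert (H1 : / (2 * Y) <= / (1 + EN N 2 (eul N (n0 + i)))).
  { eapply Rle_trans; [|exact Hinv]. rewrite Rinv_mult.
    assert (Kst g 1 * (INR i * hN N) <= / 2 * / Y); [|lra].
    apply Rmult_le_reg_r with Y; [lra|]. rewrite (Rmult_assoc (/ 2)), Rinv_l by lra. lra. }
  apply Rinv_le_contravar in H1; [|apply Rinv_0_lt_compat; lra].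
  rewrite !Rinv_inv in H1. exact H1.
Qed.

Lemma good_start : exists T, 0 < T /\ good T.
Proof.
  destruct (init_energy 2) as [E0 HE0].
  assert (0 <= E0) by (eapply Rle_trans; [apply (EN_nonneg O (init O) 2)|apply HE0]).
  assert (HK := Kst_nonneg g Hg 1).
  assert (Hp : 0 < 2 * (Kst g 1 * (1 + E0)) + 1) by nra.
  exists (/ (2 * (Kst g 1 * (1 + E0)) + 1)). split; [apply Rinv_0_lt_compat; auto|].
  exists (2 * (1 + E0)). apply filter_forall. intros N n Hn.
  pose proof (energy_doubling N (1 + E0) 0 ltac:(simpl; specialize (HE0 N); lra) n) as H1.
  simpl plus in H1. assert (1 + EN N 2 (eul N n) <= 2 * (1 + E0)); [|lra]. apply H1.
  apply Rle_trans with (Kst g 1 * (1 + E0) * / (2 * (Kst g 1 * (1 + E0)) + 1)).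
  - apply Rmult_le_compat_l; [nra|auto].
  - apply Rmult_le_reg_r with (2 * (Kst g 1 * (1 + E0)) + 1); auto.
    rewrite (Rmult_assoc (Kst g 1 * (1 + E0))), Rinv_l by lra. lra.
Qed.

(** The bound on the limit, uniform up to [Tm], is carried back to the schemes at one time [t1] just
    before [Tm]; from there [energy_doubling] grants a span that does not depend on [t1]. *)
Lemma good_extend Tm K : 0 < Tm -> (forall t, t < Tm -> good t) ->
  (forall t n, 0 <= t < Tm -> sm (fun k => INR k ^ 4 * cU t k ^ 2) n <= K) ->
  exists T, Tm < T /\ good T.
Proof.
  intros HTm HG HKb. assert (HK := Kst_nonneg g Hg 1).
  assert (HK0 : 0 <= K) by (specialize (HKb 0 O ltac:(lra)); simpl in HKb; lra).
  pose (Y := 2 + K). assert (Hp : 0 < 2 * (Kst g 1 * Y) + 1) by (unfold Y; nra).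
  (* A span over which an energy below [Y] at most doubles. It has to cover [de / 2] from [t1] to
     [Tm], [de / 4] beyond, and at most [de / 4] of rounding to the time grid. *)
  pose (de := / (2 * (Kst g 1 * Y) + 1)).
  assert (Hde : 0 < de) by (apply Rinv_0_lt_compat; auto).
  pose (t1 := Rmax 0 (Tm - de / 2)).
  assert (Ht1 : 0 <= t1 < Tm /\ Tm - de / 2 <= t1).
  { unfold t1. split; [split; [apply Rmax_l|apply Rmax_lub_lt; lra]|apply Rmax_r]. }
  assert (Hg1 := HG t1 ltac:(lra)).
  exists (Tm + de / 4). split; [lra|].
  destruct Hg1 as [M1 HM1]. exists (Rmax M1 (2 * Y)).
  (* The modes below [n0] converge, which costs [/ 2]; those above are small uniformly in [N] by the
     decay of order 4, another [/ 2]. *)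
  assert (Hst : U (fun N => EN N 2 (cN N t1) <= K + 1)).
  { destruct (uniform_bnd t1 (HG t1 ltac:(lra)) 4) as [A HA].
    destruct (series_tail_small (fun k => A ^ 2 * w2 k) (/ 2) (ex_series_Aw2 _)) as [n0 Hn0]; [lra|].
    specialize (Hn0 n0 (le_n n0)).
    assert (HL : filterlim (fun N => sm (fun k => INR k ^ 4 * cN N t1 k ^ 2) n0) U (locally (sm (fun k => INR k ^ 4 * cU t1 k ^ 2) n0))).
    { apply (filterlim_sm U). intros k. apply (flim_mult U); [apply (flim_const U)|]. simpl.
      apply (flim_mult U); [|apply (flim_mult U); [|apply (flim_const U)]]; apply cU_lim with t1; try lra; apply HG; lra. }
    rewrite filterlim_locally_R in HL; [|apply UF].
    assert (Hhalf : 0 < / 2) by lra.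
    generalize (filter_and _ _ (HL (/ 2) Hhalf) (filter_and _ _ HA (Ufree n0))).
    apply filter_imp. intros N [H1 [H2 H3]].
    specialize (HKb t1 n0 ltac:(lra)). apply Rabs_def2 in H1.
    pose (f := fun k => INR k ^ (2 * 2) * cN N t1 k ^ 2).
    change (EN N 2 (cN N t1)) with (sm f N).
    replace (sm f N) with (sm f n0 + sm (fun k => f (n0 + k)%nat) (N - n0))
      by (rewrite <- sm_split; f_equal; lia).
    unfold f.
    assert (Hrest : sm (fun k => INR (n0 + k) ^ (2 * 2) * cN N t1 (n0 + k)%nat ^ 2) (N - n0) <= / 2).
    { apply Rle_trans with (sm (fun k => A ^ 2 * w2 (n0 + k)) (N - n0)).
      - apply sm_le; intros k _.
        assert (Hb : bnd 4 A (cN N t1)) by (apply H2, cN_time; lra).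
        specialize (Hb (n0 + k)%nat). set (i := (n0 + k)%nat) in *.
        pose proof (inv_q2_le_w2 i). pose proof (q_ge1 i). pose proof (INR_le_q i).
        rewrite <- (pow2_abs (cN N t1 i)). set (y := Rabs (cN N t1 i)) in *.
        assert (Hy : 0 <= y) by apply Rabs_pos.
        replace (2 * 2)%nat with 4%nat by lia.
        apply Rle_trans with (A ^ 2 * / q i ^ 2); [|apply Rmult_le_compat_l; [apply pow2_ge_0|auto]].
        apply Rmult_le_reg_r with (q i ^ 2); [nra|]. rewrite (Rmult_assoc (A ^ 2)), Rinv_l, Rmult_1_r by nra.
        apply Rle_trans with ((q i ^ 4 * y) ^ 2).
        + assert (INR i ^ 4 <= q i ^ 4) by (apply pow_incr; lra).
          assert (0 <= INR i ^ 4) by nn.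
          apply Rle_trans with (q i ^ 4 * y ^ 2 * q i ^ 2).
          * apply Rmult_le_compat_r; [nra|]. apply Rmult_le_compat_r; [nra|auto].
          * replace ((q i ^ 4 * y) ^ 2) with (q i ^ 4 * y ^ 2 * q i ^ 4) by ring.
            apply Rmult_le_compat_l; [nra|]. apply Rle_pow; [auto|lia].
        + apply pow_incr. split; [|auto]. apply Rmult_le_pos; [|auto]. apply pow_le; lra.
      - rewrite (series_split (fun k => A ^ 2 * w2 k) n0) in Hn0 by apply ex_series_Aw2.
        pose proof (series_sm_le (fun k => A ^ 2 * w2 (n0 + k)) (N - n0)) as Hs.
        assert (Hex : ex_series (fun k => A ^ 2 * w2 (n0 + k))).
        { apply (ex_series_incr_n (fun k => A ^ 2 * w2 k) n0). apply ex_series_Aw2. }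
        specialize (Hs Hex).
        assert (forall k, 0 <= A ^ 2 * w2 (n0 + k)) by (intros k; pose proof (w2_pos (n0 + k)); pose proof (pow2_ge_0 A); nra).
        specialize (Hs H). lra. }
    replace (2 * 2)%nat with 4%nat in * by lia. lra. }
  pose proof hN_lim as HLh. rewrite filterlim_locally_R in HLh; [|apply UF].
  assert (Hq4 : 0 < de / 4) by lra.
  generalize (filter_and _ _ HM1 (filter_and _ _ Hst (HLh (de / 4) Hq4))).
  apply filter_imp. intros N [H1 [H2 H3]] n Hn. assert (Hh := hN_pos N).
  rewrite Rminus_0_r, Rabs_pos_eq in H3 by lra.
  destruct (Rle_dec (INR n * hN N) t1) as [Hle|Hgt].
  { eapply Rle_trans; [apply H1; auto|apply Rmax_l]. }
  assert (Hn0 : (nfl (hN N) t1 <= n)%nat).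
  { destruct (nfl_spec (hN N) t1 Hh ltac:(lra)).
    apply INR_le. apply Rmult_le_reg_r with (hN N); auto. lra. }
  destruct (nfl_spec (hN N) t1 Hh ltac:(lra)) as [Hs1 Hs2].
  pose proof (energy_doubling N Y (nfl (hN N) t1)) as HD. unfold cN in H2.
  specialize (HD ltac:(unfold Y; lra) (n - nfl (hN N) t1)%nat).
  replace (nfl (hN N) t1 + (n - nfl (hN N) t1))%nat with n in HD by lia.
  assert (1 + EN N 2 (eul N n) <= 2 * Y).
  { apply HD. rewrite minus_INR by auto.
    apply Rle_trans with (Kst g 1 * Y * de).
    - apply Rmult_le_compat_l; [unfold Y; nra|]. lra.
    - unfold de. apply Rmult_le_reg_r with (2 * (Kst g 1 * Y) + 1); auto.
      rewrite (Rmult_assoc (Kst g 1 * Y)), Rinv_l by lra. lra. }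
  eapply Rle_trans; [|apply Rmax_r]. lra.
Qed.
End Limit.

(** * Cosine series and the transport identity *)

(** With the phase as a parameter one family contains sines, cosines and all their derivatives:
    differentiation multiplies the coefficients by [k] and adds [PI / 2] to [phi]. *)
Definition cosS (phi : R) (a : nat -> R) (x : R) : R :=
  Series (fun k => a k * cos (INR k * x + phi)).

Lemma Rabs_cos_le z : Rabs (cos z) <= 1.
Proof. apply Rabs_le. pose proof (COS_bound z). lra. Qed.

Lemma cosS_term phi a A x k : bnd 2 A a -> Rabs (a k * cos (INR k * x + phi)) <= A * w2 k.
Proof.
  intros H. pose proof (bnd_w2 0 A a H k) as Hk. simpl in Hk. rewrite Rabs_mult.
  pose proof (Rabs_cos_le (INR k * x + phi)). pose proof (Rabs_pos (a k)). nra.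
Qed.

Lemma cosS_ex phi a A x : bnd 2 A a -> ex_series (fun k => a k * cos (INR k * x + phi)).
Proof.
  intros H. apply ex_series_dom with (fun k => A * w2 k); [apply ex_series_Aw2|].
  intros; apply cosS_term; auto.
Qed.

Lemma cosS_bound phi a A x : bnd 2 A a -> Rabs (cosS phi a x) <= 2 * A.
Proof.
  intros H. rewrite <- Series_Aw2. apply series_abs_le; [apply ex_series_Aw2|].
  intros; apply cosS_term; auto.
Qed.

Lemma cosS_plus phi a b x : rapid a -> rapid b ->
  cosS phi (fun k => a k + b k) x = cosS phi a x + cosS phi b x.
Proof.
  intros Ha Hb. destruct (Ha 2%nat) as [A HA]. destruct (Hb 2%nat) as [B HB].
  unfold cosS. rewrite <- Series_plus; [|eapply cosS_ex; eauto|eapply cosS_ex; eauto].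
  apply Series_ext; intros; ring.
Qed.

Lemma cosS_scal phi e a x : cosS phi (fun k => e * a k) x = e * cosS phi a x.
Proof. unfold cosS. rewrite <- Series_scal_l. apply Series_ext; intros; ring. Qed.

Lemma cosS_ext phi a b x : (forall k, a k = b k) -> cosS phi a x = cosS phi b x.
Proof. intros H. apply Series_ext; intros; rewrite H; auto. Qed.

Lemma cosS_derive phi a x : rapid a ->
  is_derive (cosS phi a) x (cosS (phi + PI / 2) (fun k => INR k * a k) x).
Proof.
  intros Ha. destruct (Ha 2%nat) as [A HA]. destruct (rapid_kmul a Ha 2%nat) as [B HB].
  unfold cosS.
  apply (is_derive_Series (fun x k => a k * cos (INR k * x + phi))
    (fun x k => INR k * a k * cos (INR k * x + (phi + PI / 2))) (fun k => B * w2 k) x 1).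
  - lra.
  - apply ex_series_Aw2.
  - intros s k _. replace (cos (INR k * s + (phi + PI / 2))) with (- sin (INR k * s + phi)).
    + auto_derive; auto. ring.
    + replace (INR k * s + (phi + PI / 2)) with (PI / 2 + (INR k * s + phi)) by ring.
      rewrite sin_cos. ring.
  - intros s k _. apply (cosS_term (phi + PI / 2) (fun k => INR k * a k)). auto.
  - intros s _. apply (cosS_ex phi a A); auto.
Qed.

Lemma cosS_period phi a x : cosS phi a (x + 2 * PI) = cosS phi a x.
Proof.
  apply Series_ext. intros k. f_equal.
  replace (INR k * (x + 2 * PI) + phi) with (INR k * x + phi + 2 * INR k * PI) by ring.
  apply cos_period.
Qed.

Lemma rapid_kpow n a : rapid a -> rapid (fun k => INR k ^ n * a k).
Proof.
  intros Ha. induction n.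
  - intros s. destruct (Ha s) as [A HA]. exists A. eapply bnd_ext; [|exact HA]. intros; simpl; ring.
  - apply rapid_kmul in IHn. intros s. destruct (IHn s) as [A HA]. exists A.
    eapply bnd_ext; [|exact HA]. intros; simpl; ring.
Qed.

Lemma rapid_scal e a : rapid a -> rapid (fun k => e * a k).
Proof. intros Ha s. destruct (Ha s) as [A HA]. exists (Rabs e * A). apply bnd_scal; auto. Qed.

Lemma is_derive_cosS_pow phi n a x : rapid a ->
  is_derive (cosS (phi + INR n * (PI / 2)) (fun k => INR k ^ n * a k)) x
            (cosS (phi + INR (S n) * (PI / 2)) (fun k => INR k ^ S n * a k) x).
Proof.
  intros Ha.
  pose proof (cosS_derive (phi + INR n * (PI / 2)) (fun k => INR k ^ n * a k) x (rapid_kpow n a Ha)) as H.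
  rewrite S_INR. replace (phi + (INR n + 1) * (PI / 2)) with (phi + INR n * (PI / 2) + PI / 2) by ring.
  rewrite (cosS_ext _ (fun k => INR k ^ S n * a k) (fun k => INR k * (INR k ^ n * a k))); auto.
  intros; simpl; ring.
Qed.

Lemma is_derive_minus_const (f : R -> R) x l b : is_derive f x l -> is_derive (fun y => f y - b) x l.
Proof.
  intros H. replace l with (l - 0) by ring. apply (is_derive_minus f (fun _ => b)); auto.
  apply (is_derive_const b).
Qed.

Lemma cosS_iter_derive phi a b n x : rapid a ->
  ex_derive_n (fun y => cosS phi a y - b) n x /\
  Derive_n (fun y => cosS phi a y - b) n x =
    cosS (phi + INR n * (PI / 2)) (fun k => INR k ^ n * a k) x - (if Nat.eqb n 0 then b else 0).
Proof.
  intros Ha. revert x. induction n; intros x.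
  - split; [exact I|]. simpl. f_equal. rewrite Rmult_0_l, Rplus_0_r. apply cosS_ext; intros; ring.
  - assert (Hd : is_derive (Derive_n (fun y => cosS phi a y - b) n) x
       (cosS (phi + INR (S n) * (PI / 2)) (fun k => INR k ^ S n * a k) x)).
    { apply is_derive_ext with (fun x => cosS (phi + INR n * (PI / 2)) (fun k => INR k ^ n * a k) x - (if Nat.eqb n 0 then b else 0)).
      - intros y. symmetry. apply IHn.
      - apply is_derive_minus_const, is_derive_cosS_pow; auto. }
    split.
    + exists (cosS (phi + INR (S n) * (PI / 2)) (fun k => INR k ^ S n * a k) x). exact Hd.
    + change (Derive_n (fun y => cosS phi a y - b) (S n) x) with (Derive (Derive_n (fun y => cosS phi a y - b) n) x).
      rewrite (is_derive_unique _ _ _ Hd). change (if Nat.eqb (S n) 0 then b else 0) with 0. ring.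
Qed.

Lemma cosS_smooth phi a b : rapid a -> smooth_per (fun y => cosS phi a y - b).
Proof.
  intros Ha. split; [|split].
  - intros x. rewrite cosS_period; reflexivity.
  - intros n x. apply cosS_iter_derive; auto.
  - intros n. destruct (rapid_kpow n a Ha 2%nat) as [A HA].
    exists (2 * A + Rabs b). intros x.
    rewrite (proj2 (cosS_iter_derive phi a b n x Ha)).
    eapply Rle_trans; [apply Rabs_triang|]. rewrite Rabs_Ropp.
    apply Rplus_le_compat; [apply cosS_bound; auto|].
    destruct (Nat.eqb n 0); [lra|rewrite Rabs_R0; apply Rabs_pos].
Qed.

(** Tannery along the neighbourhood filter of [(t, x)]. *)
Lemma cosS_cont2 phi (a : R -> nat -> R) t x d A : 0 < d ->
  (forall s, Rabs (s - t) < d -> bnd 2 A (a s)) ->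
  (forall k, continuous (fun s => a s k) t) ->
  continuous (fun p : R * R => cosS phi (a (fst p)) (snd p)) (t, x).
Proof.
  intros Hd HA Hc. unfold continuous, cosS. simpl fst; simpl snd.
  apply (tannery (locally (t, x)) (fun p k => a (fst p) k * cos (INR k * snd p + phi)) _ (fun k => A * w2 k)).
  - apply ex_series_Aw2.
  - exists (mkposreal _ Hd). intros [s y] [Hs Hy] k. apply cosS_term. apply HA. exact Hs.
  - intros k. apply cosS_term. apply HA. rewrite Rminus_diag, Rabs_R0; auto.
  - intros k.
    apply (continuous_mult (fun p : R * R => a (fst p) k) (fun p : R * R => cos (INR k * snd p + phi)) (t, x)).
    + apply (continuous_comp fst (fun s => a s k)); [apply continuous_fst|apply Hc].
    + apply (continuous_comp snd (fun y => cos (INR k * y + phi))); [apply continuous_snd|].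
      apply (ex_derive_continuous (fun y => cos (INR k * y + phi)) x). auto_derive; auto.
Qed.

(** * Joint smoothness in time and space *)

Section Time.
Variables (g : R) (m : nat -> R).
Hypothesis Hg : 0 < g.
Hypothesis Hm : forall k, Rabs (m k) <= 2.
Variable Tm : R.

(** Half-lines [t <= T1] rather than compact intervals: the solution is extended by its initial
    value to negative times, so that [t = 0] is an interior point as far as continuity is
    concerned. *)
Definition ubnd (a : R -> nat -> R) : Prop :=
  forall T1, T1 < Tm -> forall s, exists A, forall t, t <= T1 -> bnd s A (a t).

(** [n] derivatives in time on [(0, Tm)], each with every order of decay. The number is finite so
    that the equation can be bootstrapped by induction on [n]. *)
Fixpoint RD (n : nat) (a : R -> nat -> R) : Prop :=
  ubnd a /\ match n with
            | O => True
            | S n' => exists a', (forall t k, 0 < t < Tm -> is_derive (fun s => a s k) t (a' t k)) /\ RD n' a'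
            end.

Lemma RD_ubnd n a : RD n a -> ubnd a.
Proof. destruct n; intros [H _]; auto. Qed.

Lemma RD_S n a : RD (S n) a -> RD n a.
Proof.
  revert a. induction n; intros a [H1 [a' [H2 H3]]]; split; auto.
  exists a'; auto.
Qed.

Lemma ubnd_plus a b : ubnd a -> ubnd b -> ubnd (fun t k => a t k + b t k).
Proof.
  intros Ha Hb T1 HT s. destruct (Ha T1 HT s) as [A HA]. destruct (Hb T1 HT s) as [B HB].
  exists (A + B). intros t Ht. apply bnd_plus; auto.
Qed.

Lemma RD_plus n a b : RD n a -> RD n b -> RD n (fun t k => a t k + b t k).
Proof.
  revert a b. induction n; intros a b [Ha Ha'] [Hb Hb']; split; try apply ubnd_plus; auto.
  destruct Ha' as [a' [Ha1 Ha2]]. destruct Hb' as [b' [Hb1 Hb2]].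
  exists (fun t k => a' t k + b' t k). split; auto.
  intros t k Ht. apply (is_derive_plus (fun s => a s k) (fun s => b s k)); auto.
Qed.

Lemma RD_kmul n a : RD n a -> RD n (fun t k => INR k * a t k).
Proof.
  revert a. induction n; intros a [Ha Ha']; split.
  1, 3: intros T1 HT s; destruct (Ha T1 HT (S s)) as [A HA]; exists A; intros t Ht; apply bnd_kmul; auto.
  - auto.
  - destruct Ha' as [a' [Ha1 Ha2]]. exists (fun t k => INR k * a' t k). split; auto.
    intros t k Ht. apply (is_derive_scal (fun s => a s k)); auto.
Qed.

Lemma ubnd_rapid a t : ubnd a -> t < Tm -> rapid (a t).
Proof. intros Ha Ht s. destruct (Ha t Ht s) as [A HA]. exists A. apply HA; lra. Qed.

Lemma ubnd_near a t s : ubnd a -> t < Tm -> exists d A, 0 < d /\ forall t', Rabs (t' - t) < d -> bnd s A (a t').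
Proof.
  intros Ha Ht. destruct (Ha ((t + Tm) / 2) ltac:(lra) s) as [A HA].
  exists ((Tm - t) / 2), A. split; [lra|]. intros t' Ht'. apply HA. apply Rabs_def2 in Ht'. lra.
Qed.

Lemma near_interior t d : 0 < t < Tm -> 0 < d -> exists d', 0 < d' <= d /\ forall s, Rabs (s - t) < d' -> 0 < s < Tm.
Proof.
  intros Ht Hd. exists (Rmin d (Rmin t (Tm - t))). split.
  - split; [repeat apply Rmin_pos; lra|apply Rmin_l].
  - intros s Hs. pose proof (Rmin_r d (Rmin t (Tm - t))). pose proof (Rmin_l t (Tm - t)).
    pose proof (Rmin_r t (Tm - t)). apply Rabs_def2 in Hs. lra.
Qed.

Lemma cosS_derive_t phi a a' t x : ubnd a -> ubnd a' ->
  (forall t k, 0 < t < Tm -> is_derive (fun s => a s k) t (a' t k)) -> 0 < t < Tm ->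
  is_derive (fun s => cosS phi (a s) x) t (cosS phi (a' t) x).
Proof.
  intros Ha Ha' Hd Ht.
  destruct (ubnd_near a' t 2 Ha' ltac:(lra)) as [d [A [Hd0 HA]]].
  destruct (near_interior t d Ht Hd0) as [d' [Hd1 Hd2]].
  apply (is_derive_Series (fun s k => a s k * cos (INR k * x + phi)) (fun s k => a' s k * cos (INR k * x + phi)) (fun k => A * w2 k) t d').
  - lra.
  - apply ex_series_Aw2.
  - intros s k Hs.
    apply is_derive_ext with (fun s => scal (cos (INR k * x + phi)) (a s k)).
    { intros u. apply Rmult_comm. }
    rewrite (Rmult_comm (a' s k)). apply (is_derive_scal (fun s => a s k)). auto.
  - intros s k Hs. apply cosS_term. apply HA. lra.
  - intros s Hs. destruct (ubnd_rapid a s Ha ltac:(apply Hd2 in Hs; lra) 2%nat) as [B HB].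
    eapply cosS_ex; eauto.
Qed.

Lemma is_derive_Qm (b b' : R -> nat -> R) k j t :
  (forall i, is_derive (fun s => b s i) t (b' t i)) ->
  is_derive (fun s => Qm m (b s) k j) t (Qm m (b' t) k j).
Proof.
  intros H. unfold Qm, Qanti.
  apply (is_derive_plus (fun s => m (j + k) * b s (j + k)%nat) (fun s => if le_dec k j then m (j - k) * b s (j - k)%nat else - (m (k - j) * b s (k - j)%nat))).
  - apply (is_derive_scal (fun s => b s (j + k)%nat)), H.
  - destruct (le_dec k j).
    + apply (is_derive_scal (fun s => b s (j - k)%nat)), H.
    + apply (is_derive_opp (fun s => m (k - j) * b s (k - j)%nat)).
      apply (is_derive_scal (fun s => b s (k - j)%nat)), H.
Qed.

Lemma is_derive_Bser a a' b b' t k :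
  ubnd a -> ubnd a' -> ubnd b -> ubnd b' ->
  (forall t k, 0 < t < Tm -> is_derive (fun s => a s k) t (a' t k)) ->
  (forall t k, 0 < t < Tm -> is_derive (fun s => b s k) t (b' t k)) -> 0 < t < Tm ->
  is_derive (fun s => Bser g m (a s) (b s) k) t (Bser g m (a' t) (b t) k + Bser g m (a t) (b' t) k).
Proof.
  intros Ha Ha' Hb Hb' Hda Hdb Ht. destruct k as [|k]; unfold Bser.
  { rewrite Rplus_0_r. apply (is_derive_const 0). }
  assert (HT : (t + Tm) / 2 < Tm) by lra.
  destruct (Ha _ HT 3%nat) as [A HA]. destruct (Ha' _ HT 3%nat) as [A' HA'].
  destruct (Hb _ HT 0%nat) as [B HB]. destruct (Hb' _ HT 0%nat) as [B' HB'].
  destruct (near_interior t ((Tm - t) / 2) Ht ltac:(lra)) as [d [Hd1 Hd2]].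
  assert (Hn : forall s, Rabs (s - t) < d -> s <= (t + Tm) / 2).
  { intros s Hs. apply Rabs_def2 in Hs. lra. }
  assert (Hterm : forall A B c d k j, bnd 3 A c -> bnd 0 B d -> Rabs (INR j * c j * Qm m d k j) <= 8 * (A * B) * w2 j).
  { intros A1 B1 c1 d1 k1 j1 H1 H2. pose proof (conv_term m Hm 0 A1 B1 c1 d1 k1 j1 H1 H2). simpl pow in H. lra. }
  rewrite <- Rmult_plus_distr_l.
  apply (is_derive_scal (fun s => Series (fun j => INR j * a s j * Qm m (b s) (S k) j))).
  rewrite <- Series_plus.
  2: { apply (conv_ex m Hm 0 A' B); [apply HA'|apply HB]; lra. }
  2: { apply (conv_ex m Hm 0 A B'); [apply HA|apply HB']; lra. }
  apply (is_derive_Series (fun s j => INR j * a s j * Qm m (b s) (S k) j)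
    (fun s j => INR j * a' s j * Qm m (b s) (S k) j + INR j * a s j * Qm m (b' s) (S k) j)
    (fun j => (8 * (A' * B) + 8 * (A * B')) * w2 j) t d).
  - lra.
  - apply ex_series_Aw2.
  - intros s j Hs.
    apply (is_derive_mult (fun s => INR j * a s j) (fun s => Qm m (b s) (S k) j)).
    + apply (is_derive_scal (fun s => a s j)). auto.
    + apply (is_derive_Qm b b'). auto.
    + intros; apply Rmult_comm.
  - intros s j Hs. eapply Rle_trans; [apply Rabs_triang|]. rewrite Rmult_plus_distr_r.
    apply Rplus_le_compat; apply Hterm; auto.
  - intros s Hs. apply (conv_ex m Hm 0 A B); auto.
Qed.

Lemma ubnd_Bser a b : ubnd a -> ubnd b -> ubnd (fun t => Bser g m (a t) (b t)).
Proof.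
  intros Ha Hb T1 HT s. destruct (Ha T1 HT (s + 3)%nat) as [A HA]. destruct (Hb T1 HT s) as [B HB].
  exists (8 * 2 ^ s * g * (A * B)). intros t Ht. apply Bser_bnd; auto.
Qed.

Lemma RD_Bser n a b : RD n a -> RD n b -> RD n (fun t => Bser g m (a t) (b t)).
Proof.
  revert a b. induction n; intros a b Ha Hb.
  - split; auto. apply ubnd_Bser; [apply Ha|apply Hb].
  - pose proof (RD_S _ _ Ha) as Ha0. pose proof (RD_S _ _ Hb) as Hb0.
    destruct Ha as [Ha [a' [Ha1 Ha2]]]. destruct Hb as [Hb [b' [Hb1 Hb2]]].
    split; [apply ubnd_Bser; auto|].
    exists (fun t k => Bser g m (a' t) (b t) k + Bser g m (a t) (b' t) k). split.
    + intros t k Ht. apply is_derive_Bser; auto; apply RD_ubnd with n; auto.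
    + apply RD_plus; apply IHn; auto.
Qed.

Section Sol.
Variable c : R -> nat -> R.
Hypothesis Hub : ubnd c.
Hypothesis Hder : forall t k, 0 < t < Tm -> is_derive (fun s => c s k) t (Bser g m (c t) (c t) k).
Hypothesis Hlip : forall T1, T1 < Tm -> forall s, exists A, 0 <= A /\
  forall t t', t <= T1 -> t' <= T1 -> bnd s (A * Rabs (t' - t)) (fun k => c t' k - c t k).

(** The equation provides the next derivative: if [c] has [n] of them, so has [Bser c c], which is
    the derivative of [c]. *)
Lemma RD_c n : RD n c.
Proof.
  induction n; split; auto. exists (fun t => Bser g m (c t) (c t)). split; auto.
  apply RD_Bser; auto.
Qed.

Definition rho (t x : R) : R := cosS 0 (c t) x - cosS 0 (c t) 0.

Lemma c_rapid t : t < Tm -> rapid (c t).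
Proof. apply ubnd_rapid; auto. Qed.

Lemma c_cont t k : t < Tm -> continuous (fun s => c s k) t.
Proof.
  intros Ht. destruct (Hlip ((t + Tm) / 2) ltac:(lra) O) as [A [HA0 HA]].
  apply filterlim_locally_R; [apply locally_filter|]. intros eps He.
  assert (Hd : 0 < Rmin ((Tm - t) / 2) (eps / (A + 1))).
  { apply Rmin_pos; [lra|apply Rdiv_lt_0_compat; lra]. }
  exists (mkposreal _ Hd). intros s Hs. change (Rabs (s - t) < Rmin ((Tm - t) / 2) (eps / (A + 1))) in Hs.
  assert (H1 : Rabs (s - t) < (Tm - t) / 2) by (eapply Rlt_le_trans; [exact Hs|apply Rmin_l]).
  assert (H2 : Rabs (s - t) < eps / (A + 1)) by (eapply Rlt_le_trans; [exact Hs|apply Rmin_r]).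
  apply Rmult_lt_compat_r with (r := A + 1) in H2; [|lra].
  replace (eps / (A + 1) * (A + 1)) with eps in H2 by (field; lra).
  apply Rabs_def2 in H1.
  pose proof (bnd_abs _ _ _ k (HA t s ltac:(lra) ltac:(lra))) as Hb. simpl in Hb.
  eapply Rle_lt_trans; [exact Hb|]. pose proof (Rabs_pos (s - t)). nra.
Qed.

(** A form stable under both partial derivatives. One in [x] removes the correction at 0 ([be]
    becomes 0); one in [t] keeps it and uses up one order of [RD], which is why [n] is quantified
    inside the induction on [w]. *)
Lemma pd_form w : forall n, exists phi be a, RD n a /\
  forall t x, 0 < t < Tm -> pd w rho t x = cosS phi (a t) x - be * cosS phi (a t) 0.
Proof.
  induction w as [|b w IH]; intros n.
  - exists 0, 1, c. split; [apply RD_c|]. intros t x _. simpl. unfold rho. ring.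
  - destruct (IH (S n)) as [phi [be [a [Ha Hf]]]]. destruct b.
    + pose proof (RD_ubnd _ _ Ha) as Hua. destruct Ha as [_ [a' [Hd Ha']]].
      exists phi, be, a'. split; auto. intros t x Ht. simpl. unfold pdt.
      apply is_derive_unique.
      apply is_derive_ext_loc with (fun s => cosS phi (a s) x - be * cosS phi (a s) 0).
      { destruct (near_interior t 1 Ht ltac:(lra)) as [d [[Hd1 _] Hd2]].
        exists (mkposreal d Hd1). intros s Hs. symmetry. apply Hf. apply Hd2. exact Hs. }
      pose proof (RD_ubnd _ _ Ha') as Hua'.
      apply (is_derive_minus (fun s => cosS phi (a s) x) (fun s => be * cosS phi (a s) 0)).
      * apply cosS_derive_t; auto.
      * apply (is_derive_scal (fun s => cosS phi (a s) 0)). apply cosS_derive_t; auto.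
    + exists (phi + PI / 2), 0, (fun t k => INR k * a t k). split; [apply RD_kmul, RD_S; auto|].
      intros t x Ht. simpl. unfold pdx.
      apply is_derive_unique.
      apply is_derive_ext with (fun y => cosS phi (a t) y - be * cosS phi (a t) 0).
      { intros y. symmetry. apply Hf; auto. }
      rewrite Rmult_0_l, Rminus_0_r. apply is_derive_minus_const, cosS_derive.
      apply ubnd_rapid; [eapply RD_ubnd; eauto|lra].
Qed.

Lemma pd_regular w t x : 0 < t < Tm ->
  ex_derive (fun s => pd w rho s x) t /\ ex_derive (fun y => pd w rho t y) x /\
  continuous (uncurry2 (pd w rho)) (t, x).
Proof.
  intros Ht. destruct (pd_form w 1) as [phi [be [a [Ha Hf]]]].
  pose proof (RD_ubnd _ _ Ha) as Hua. destruct Ha as [_ [a' [Hd [Hua' _]]]].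
  destruct (near_interior t 1 Ht ltac:(lra)) as [d [[Hd1 _] Hd2]].
  split; [|split].
  - exists (cosS phi (a' t) x - be * cosS phi (a' t) 0).
    apply is_derive_ext_loc with (fun s => cosS phi (a s) x - be * cosS phi (a s) 0).
    + exists (mkposreal d Hd1). intros s Hs. symmetry. apply Hf. apply Hd2. exact Hs.
    + apply (is_derive_minus (fun s => cosS phi (a s) x) (fun s => be * cosS phi (a s) 0)).
      * apply cosS_derive_t; auto.
      * apply (is_derive_scal (fun s => cosS phi (a s) 0)). apply cosS_derive_t; auto.
  - exists (cosS (phi + PI / 2) (fun k => INR k * a t k) x).
    apply is_derive_ext with (fun y => cosS phi (a t) y - be * cosS phi (a t) 0).
    { intros y. symmetry. apply Hf; auto. }
    apply is_derive_minus_const, cosS_derive. apply ubnd_rapid; auto; lra.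
  - apply continuous_ext_loc with (fun p : R * R => cosS phi (a (fst p)) (snd p) - be * cosS phi (a (fst p)) 0).
    { exists (mkposreal d Hd1). intros [s y] [Hs Hy]. symmetry. apply Hf. apply Hd2. exact Hs. }
    destruct (ubnd_near a t 2 Hua ltac:(lra)) as [d' [A [Hd' HA]]].
    assert (Hck : forall k, continuous (fun s => a s k) t).
    { intros k. apply (ex_derive_continuous (fun s => a s k) t). exists (a' t k). auto. }
    apply (continuous_minus (fun p : R * R => cosS phi (a (fst p)) (snd p)) (fun p : R * R => be * cosS phi (a (fst p)) 0) (t, x)).
    + apply cosS_cont2 with d' A; auto.
    + apply (continuous_scal_r be (fun p : R * R => cosS phi (a (fst p)) 0) (t, x)).
      apply (continuous_comp fst (fun s => cosS phi (a s) 0)); [apply continuous_fst|].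
      apply (continuous_comp (fun s : R => (s, 0)) (fun p : R * R => cosS phi (a (fst p)) (snd p))).
      * apply (continuous_comp_2 (fun s : R => s) (fun s : R => 0) (fun a b : R => (a, b))); [apply continuous_id|apply continuous_const|].
        apply continuous_ext with (fun p : R * R => p); [intros []; auto|apply continuous_id].
      * apply cosS_cont2 with d' A; auto.
Qed.

Lemma iter_pdx n t x : t < Tm ->
  Nat.iter n pdx rho t x = cosS (INR n * (PI / 2)) (fun k => INR k ^ n * c t k) x - (if Nat.eqb n 0 then cosS 0 (c t) 0 else 0).
Proof.
  intros Ht. pose proof (proj2 (cosS_iter_derive 0 (c t) (cosS 0 (c t) 0) n x (c_rapid t Ht))) as H.
  rewrite Rplus_0_l in H. rewrite <- H.
  clear H. revert x. induction n; intros x; [reflexivity|].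
  change (Nat.iter (S n) pdx rho t x) with (Derive (fun y => Nat.iter n pdx rho t y) x).
  change (Derive_n (fun y => cosS 0 (c t) y - cosS 0 (c t) 0) (S n) x) with
    (Derive (Derive_n (fun y => cosS 0 (c t) y - cosS 0 (c t) 0) n) x).
  apply Derive_ext. auto.
Qed.

(** At [t = 0] the modes are continuous by the Lipschitz hypothesis, the equation being available
    for [t > 0]. *)
Lemma iter_pdx_cont n t x : t < Tm -> continuous (uncurry2 (Nat.iter n pdx rho)) (t, x).
Proof.
  intros Ht.
  apply continuous_ext_loc with (fun p : R * R => cosS (INR n * (PI / 2)) (fun k => INR k ^ n * c (fst p) k) (snd p)
     - (if Nat.eqb n 0 then cosS 0 (c (fst p)) 0 else 0)).
  { assert (Hp : 0 < Tm - t) by lra. exists (mkposreal (Tm - t) Hp). intros [s y] [Hs Hy]. symmetry. apply iter_pdx.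
    change (Rabs (s - t) < Tm - t) in Hs. apply Rabs_def2 in Hs. simpl; lra. }
  assert (Hu : forall j, ubnd (fun t k => INR k ^ j * c t k)).
  { intros j. induction j.
    - intros T1 HT1 s. destruct (Hub T1 HT1 s) as [A HA]. exists A. intros t' Ht'.
      apply bnd_ext with (c t'); [intros k; simpl; ring|apply HA; auto].
    - intros T1 HT1 s. destruct (IHj T1 HT1 (S s)) as [A HA]. exists A. intros t' Ht'.
      apply bnd_ext with (fun k => INR k * (INR k ^ j * c t' k)); [intros k; simpl; ring|].
      apply (bnd_kmul s A (fun k => INR k ^ j * c t' k)), HA; auto. }
  assert (Hk : forall j k, continuous (fun s => INR k ^ j * c s k) t).
  { intros j k. apply (continuous_scal_r (INR k ^ j) (fun s => c s k)). apply c_cont; auto. }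
  destruct (ubnd_near _ t 2 (Hu n) Ht) as [d [A [Hd HA]]].
  destruct (ubnd_near _ t 2 Hub Ht) as [d0 [A0 [Hd0 HA0]]].
  apply (continuous_minus (fun p : R * R => cosS (INR n * (PI / 2)) (fun k => INR k ^ n * c (fst p) k) (snd p))
     (fun p : R * R => if Nat.eqb n 0 then cosS 0 (c (fst p)) 0 else 0) (t, x)).
  - apply (cosS_cont2 (INR n * (PI / 2)) (fun s k => INR k ^ n * c s k) t x d A); auto.
  - destruct (Nat.eqb n 0); [|apply continuous_const].
    apply (continuous_comp fst (fun s => cosS 0 (c s) 0)); [apply continuous_fst|].
    apply (continuous_comp (fun s : R => (s, 0)) (fun p : R * R => cosS 0 (c (fst p)) (snd p))).
    * apply (continuous_comp_2 (fun s : R => s) (fun s : R => 0) (fun a b : R => (a, b))); [apply continuous_id|apply continuous_const|].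
      apply continuous_ext with (fun p : R * R => p); [intros []; auto|apply continuous_id].
    * apply cosS_cont2 with d0 A0; auto. intros; apply c_cont; auto.
Qed.

Lemma pdt_rho t x : 0 < t < Tm ->
  is_derive (fun s => rho s x) t (cosS 0 (Bser g m (c t) (c t)) x - cosS 0 (Bser g m (c t) (c t)) 0).
Proof.
  intros Ht. pose proof (RD_c 1) as [_ _].
  assert (Hb : ubnd (fun t => Bser g m (c t) (c t))) by (apply ubnd_Bser; auto).
  apply (is_derive_minus (fun s => cosS 0 (c s) x) (fun s => cosS 0 (c s) 0));
    apply (cosS_derive_t 0 c (fun t => Bser g m (c t) (c t))); auto.
Qed.
End Sol.
End Time.

(** * From the coefficients back to the transport equation *)

Section Product.
Variables (g : R) (m : nat -> R).
Hypothesis Hg : 0 < g.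
Hypothesis Hm : forall k, Rabs (m k) <= 2.
Variable c : nat -> R.
Hypothesis Hc : rapid c.
Hypothesis Hc0 : c O = 0.

(** Complementary to [conv_term]: summability in [k] at fixed [j], from [q k <= q j * q l], at the
    price of [q j ^ 2]. *)
Lemma Qm_summable A k j : bnd 2 A c -> Rabs (Qm m c k j) <= 4 * A * q j ^ 2 * w2 k.
Proof.
  intros HA. eapply Rle_trans; [apply Qm_bound, Hm|].
  assert (Hl : forall l, q k <= q j * q l -> Rabs (c l) <= A * q j ^ 2 * w2 k).
  { intros l Hl. specialize (HA l). assert (HA0 := Rabs_pos (c l)).
    pose proof (q_ge1 j). pose proof (q_ge1 l). pose proof (q_ge1 k). pose proof (inv_q2_le_w2 k).
    apply Rle_trans with ((q j ^ 2 * (q l ^ 2 * Rabs (c l))) * / q k ^ 2).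
    - apply Rmult_le_reg_r with (q k ^ 2); [nra|].
      rewrite (Rmult_assoc (q j ^ 2 * (q l ^ 2 * Rabs (c l)))), Rinv_l, Rmult_1_r by nra.
      assert (q k ^ 2 <= (q j * q l) ^ 2) by (apply pow_incr; lra). nra.
    - assert (0 <= q l ^ 2 * Rabs (c l)) by nra.
      assert (0 <= / q k ^ 2) by (left; apply Rinv_0_lt_compat; nra).
      replace (A * q j ^ 2 * w2 k) with ((q j ^ 2 * A) * w2 k) by ring.
      apply Rmult_le_compat; auto; [nra|]. apply Rmult_le_compat_l; [nra|auto]. }
  assert (H1 := Hl (j + k)%nat). assert (H2 := Hl (ndist k j)).
  unfold q in H1, H2. rewrite plus_INR in H1. rewrite INR_dist in H2.
  pose proof (pos_INR j). pose proof (pos_INR k).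
  specialize (H1 ltac:(nra)).
  assert (INR k <= INR j + Rabs (INR j - INR k)).
  { destruct (Rle_dec (INR k) (INR j)); [pose proof (Rabs_pos (INR j - INR k)); lra|rewrite Rabs_left; lra]. }
  pose proof (Rabs_pos (INR j - INR k)).
  specialize (H2 ltac:(nra)). fold (q j) in H1, H2. fold (q k) in *. lra.
Qed.

Lemma cosm1_bound z : Rabs (cos z - 1) <= 2.
Proof. apply Rabs_le. pose proof (COS_bound z). lra. Qed.

Lemma ex_series_mc (e : nat -> R) B : (forall k, Rabs (e k) <= B) -> ex_series (fun i => m i * c i * e i).
Proof.
  intros He. destruct (rapid_mul m c 2 Hm Hc 2%nat) as [A HA].
  apply ex_series_dom with (fun k => A * B * w2 k); [apply ex_series_Aw2|].
  intros k. pose proof (bnd_w2 0 A _ HA k) as Hk. simpl in Hk. rewrite Rabs_mult.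
  specialize (He k). pose proof (Rabs_pos (e k)). pose proof (Rabs_pos (m k * c k)).
  replace (A * B * w2 k) with ((A * w2 k) * B) by ring. apply Rmult_le_compat; auto. lra.
Qed.

(** The formula [cos (i - j) x - cos (i + j) x = 2 sin ix sin jx], summed over [i]. The series in
    [j + k] and the two halves of [Qanti], below and above [j], are reindexed by [i]; the constants
    [- 1] cancel in the difference. *)
Lemma conv_column j x :
  Series (fun k => Qm m c k j * (cos (INR k * x) - 1)) =
  2 * sin (INR j * x) * Series (fun i => m i * c i * sin (INR i * x)).
Proof.
  pose (p i := m i * c i).
  assert (Hp0 : p O = 0) by (unfold p; rewrite Hc0; ring).
  destruct (Hc 2%nat) as [A HA].
  assert (E0 : forall e, (forall k, Rabs (e k) <= 2) -> ex_series (fun i => p i * e i)) by (intros; eapply ex_series_mc; eauto).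
  assert (E1 : ex_series (fun k => p (j + k)%nat * (cos (INR k * x) - 1))).
  { pose proof (E0 (fun i => cos (INR (i - j) * x) - 1) ltac:(intros; apply cosm1_bound)) as H.
    apply (ex_series_incr_n _ j) in H. eapply ex_series_ext; [|exact H].
    intros n; simpl. replace (j + n - j)%nat with n by lia. reflexivity. }
  assert (EQ : ex_series (fun k => Qm m c k j * (cos (INR k * x) - 1))).
  { apply ex_series_dom with (fun k => 8 * A * q j ^ 2 * w2 k); [apply ex_series_Aw2|].
    intros k. rewrite Rabs_mult. pose proof (Qm_summable A k j HA). pose proof (cosm1_bound (INR k * x)).
    pose proof (Rabs_pos (Qm m c k j)). pose proof (Rabs_pos (cos (INR k * x) - 1)). nra. }
  assert (E2 : ex_series (fun k => Qanti m c k j * (cos (INR k * x) - 1))).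
  { eapply ex_series_ext; [|apply (ex_series_minus _ _ EQ E1)]. intros k. unfold Qm, p, plus, opp; simpl. ring. }
  rewrite (Series_ext _ (fun k => p (j + k)%nat * (cos (INR k * x) - 1) + Qanti m c k j * (cos (INR k * x) - 1))).
  2: { intros k. unfold Qm, p. ring. }
  rewrite Series_plus; auto.
  rewrite (series_split (fun k => Qanti m c k j * (cos (INR k * x) - 1)) j E2).
  assert (S1 : Series (fun i => p i * (cos (INR i * x - INR j * x) - 1)) =
     sm (fun i => p i * (cos (INR i * x - INR j * x) - 1)) j + Series (fun k => p (j + k)%nat * (cos (INR k * x) - 1))).
  { rewrite (series_split _ j); [|apply E0; intros; apply cosm1_bound]. f_equal. apply Series_ext. intros k.
    rewrite plus_INR. do 3 f_equal. ring. }
  assert (S2 : sm (fun k => Qanti m c k j * (cos (INR k * x) - 1)) j = sm (fun i => p i * (cos (INR i * x - INR j * x) - 1)) j).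
  { pose (F i := p i * (cos (INR i * x - INR j * x) - 1)).
    rewrite (sm_ext _ (fun k => F (j - k)%nat)).
    - rewrite sm_rev.
      assert (F O + sm (fun k => F (S k)) j = sm F j + F j) by (rewrite <- sm_head; reflexivity).
      assert (F O = 0) by (unfold F; rewrite Hp0; ring).
      assert (F j = 0) by (unfold F; rewrite Rminus_diag, cos_0; ring). fold F. lra.
    - intros k Hk. unfold Qanti, F. destruct (le_dec k j); [|lia]. fold (p (j - k)%nat). f_equal. f_equal.
      rewrite minus_INR by lia. replace ((INR j - INR k) * x - INR j * x) with (- (INR k * x)) by ring.
      rewrite cos_neg; auto. }
  assert (S3 : Series (fun k => Qanti m c (j + k) j * (cos (INR (j + k) * x) - 1)) = - Series (fun i => p i * (cos (INR i * x + INR j * x) - 1))).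
  { rewrite <- Series_opp. apply Series_ext. intros k.
    replace (INR (j + k) * x) with (INR k * x + INR j * x) by (rewrite plus_INR; ring).
    assert (Qanti m c (j + k) j = - p k); [|rewrite H; ring].
    unfold Qanti. destruct (le_dec (j + k) j).
    - assert (k = O) by lia. subst. rewrite Hp0. replace (j - (j + 0))%nat with O by lia. fold (p O). rewrite Hp0. ring.
    - unfold p. do 2 f_equal; f_equal; lia. }
  rewrite S2, S3.
  assert (S4 : Series (fun i => p i * (cos (INR i * x - INR j * x) - 1)) - Series (fun i => p i * (cos (INR i * x + INR j * x) - 1))
     = 2 * sin (INR j * x) * Series (fun i => p i * sin (INR i * x))).
  { rewrite <- Series_minus; try (apply E0; intros; apply cosm1_bound).
    rewrite <- Series_scal_l. apply Series_ext. intros i. rewrite cos_minus, cos_plus. ring. }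
  fold p. unfold p in *. lra.
Qed.

Lemma Bser_mult_cosm1 k x : Bser g m c c k * (cos (INR k * x) - 1) =
  g / 2 * Series (fun j => INR j * c j * (Qm m c k j * (cos (INR k * x) - 1))).
Proof.
  destruct k.
  - assert (H : cos (INR 0 * x) - 1 = 0) by (simpl; rewrite Rmult_0_l, cos_0; ring).
    rewrite (Series_ext _ (fun j => 0 * 0)) by (intros; rewrite H; ring).
    rewrite Series_scal_l, H. ring.
  - unfold Bser. rewrite Rmult_assoc, <- Series_scal_r. f_equal. apply Series_ext; intros; ring.
Qed.

Lemma Series_sm_swap (f : nat -> nat -> R) n : (forall j, ex_series (f j)) ->
  ex_series (fun k => sm (fun j => f j k) n) /\
  Series (fun k => sm (fun j => f j k) n) = sm (fun j => Series (f j)) n.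
Proof.
  intros H. induction n; simpl.
  - split.
    + exists 0. apply sm_is_series. apply is_lim_seq_ext with (fun _ => 0); [intros; rewrite sm_zero; auto|apply is_lim_seq_const].
    + rewrite (Series_ext _ (fun _ => 0 * 0)) by (intros; ring). rewrite Series_scal_l; ring.
  - destruct IHn as [H1 H2]. split; [apply (ex_series_plus _ _ H1 (H n))|].
    rewrite Series_plus, H2; auto.
Qed.

(** As the slope is [- sum j c_j sin jx], the right-hand side is [- g] times velocity times slope.
    The two summations are exchanged by means of partial sums in [j]: these converge to the double
    series by Tannery, and to the product by [conv_column]. *)
Lemma transport_identity x :
  cosS 0 (Bser g m c c) x - cosS 0 (Bser g m c c) 0 =
  g * Series (fun i => m i * c i * sin (INR i * x)) * Series (fun j => INR j * c j * sin (INR j * x)).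
Proof.
  destruct (Hc 5%nat) as [A HA].
  assert (HB : bnd 2 (8 * 2 ^ 2 * g * (A * A)) (Bser g m c c)).
  { apply Bser_bnd; auto. eapply bnd_le; [|apply Rle_refl|exact HA]. lia. }
  unfold cosS. rewrite <- Series_minus; try (eapply cosS_ex; eauto).
  pose (f j k := INR j * c j * (Qm m c k j * (cos (INR k * x) - 1))).
  rewrite (Series_ext _ (fun k => g / 2 * Series (fun j => f j k))).
  2: { intros k. unfold f. rewrite <- Bser_mult_cosm1. rewrite Rmult_0_r, Rplus_0_l, cos_0, Rplus_0_r. ring. }
  rewrite Series_scal_l.
  set (V := Series (fun i => m i * c i * sin (INR i * x))).
  assert (HQ : forall j, ex_series (f j)).
  { intros j. destruct (Hc 2%nat) as [A2 HA2].
    apply (ex_series_scal_l (INR j * c j) (fun k => Qm m c k j * (cos (INR k * x) - 1))).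
    apply ex_series_dom with (fun k => 8 * A2 * q j ^ 2 * w2 k); [apply ex_series_Aw2|].
    intros k. rewrite Rabs_mult. pose proof (Qm_summable A2 k j HA2). pose proof (cosm1_bound (INR k * x)).
    pose proof (Rabs_pos (Qm m c k j)). pose proof (Rabs_pos (cos (INR k * x) - 1)). nra. }
  assert (Hfb : forall j k, Rabs (f j k) <= 64 * (A * A) * w2 k * w2 j).
  { intros j k. unfold f. rewrite <- Rmult_assoc, Rabs_mult.
    pose proof (conv_term m Hm 2 A A c c k j HA (bnd_le 5 2 A A c ltac:(lia) (Rle_refl A) HA)) as Ht.
    pose proof (cosm1_bound (INR k * x)). set (y := Rabs (INR j * c j * Qm m c k j)) in *.
    assert (0 <= y) by apply Rabs_pos. pose proof (q_ge1 k). pose proof (inv_q2_le_w2 k).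
    assert (Hy : y <= 32 * (A * A) * w2 j * / q k ^ 2).
    { apply Rmult_le_reg_r with (q k ^ 2); [nra|].
      rewrite (Rmult_assoc (32 * (A * A) * w2 j)), Rinv_l, Rmult_1_r by nra. simpl pow in *. lra. }
    assert (0 <= 32 * (A * A) * w2 j) by (pose proof (w2_pos j); assert (0 <= A * A) by nra; nra).
    assert (y <= 32 * (A * A) * w2 j * w2 k).
    { eapply Rle_trans; [exact Hy|]. apply Rmult_le_compat_l; auto. }
    pose proof (Rabs_pos (cos (INR k * x) - 1)). nra. }
  assert (HL : is_lim_seq (fun n => Series (fun k => sm (fun j => f j k) n)) (Series (fun k => Series (fun j => f j k)))).
  { assert (HA2 : 0 <= A * A) by nra.
    apply (tannery eventually (fun n k => sm (fun j => f j k) n) (fun k => Series (fun j => f j k)) (fun k => 128 * (A * A) * w2 k)).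
    - apply ex_series_Aw2.
    - exists O. intros n _ k. eapply Rle_trans; [apply sm_abs|].
      apply Rle_trans with (sm (fun j => 64 * (A * A) * w2 k * w2 j) n); [apply sm_le; auto|].
      pose proof (sm_Aw2 (64 * (A * A) * w2 k) n). pose proof (w2_pos k).
      assert (0 <= 64 * (A * A) * w2 k) by (apply Rmult_le_pos; lra). lra.
    - intros k. eapply Rle_trans; [apply (series_abs_le _ (fun j => 64 * (A * A) * w2 k * w2 j)); auto; apply ex_series_Aw2|].
      rewrite Series_Aw2. lra.
    - intros k. apply is_series_sm. apply Series_correct.
      apply ex_series_dom with (fun j => 64 * (A * A) * w2 k * w2 j); [apply ex_series_Aw2|auto]. }
  assert (HR : is_lim_seq (fun n => Series (fun k => sm (fun j => f j k) n)) (2 * V * Series (fun j => INR j * c j * sin (INR j * x)))).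
  { apply is_lim_seq_ext with (fun n => 2 * V * sm (fun j => INR j * c j * sin (INR j * x)) n).
    - intros n. rewrite (proj2 (Series_sm_swap f n HQ)). rewrite <- sm_scal. apply sm_ext. intros j _.
      unfold f. rewrite Series_scal_l, conv_column. fold V. ring.
    - apply is_lim_seq_mult'; [apply is_lim_seq_const|]. apply is_series_sm, Series_correct.
      destruct (rapid_kmul c Hc 2%nat) as [B HB'].
      apply ex_series_dom with (fun k => B * w2 k); [apply ex_series_Aw2|].
      intros k. pose proof (bnd_w2 0 B _ HB' k) as Hk. simpl in Hk. rewrite Rabs_mult.
      assert (Rabs (sin (INR k * x)) <= 1) by (apply Rabs_le; pose proof (SIN_bound (INR k * x)); lra).
      pose proof (Rabs_pos (INR k * c k)). nra. }
  apply is_lim_seq_unique in HL. apply is_lim_seq_unique in HR.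
  rewrite HL in HR. injection HR as HR. rewrite HR. field.
Qed.
End Product.

(** * The Fourier symbol of the kernel *)

Lemma PI_gt_3 : 3 < PI.
Proof. pose proof PI2_3_2. lra. Qed.

Lemma incr_of_deriv (F f : R -> R) al be : al <= be ->
  (forall x, al <= x <= be -> is_derive F x (f x)) ->
  (forall x, al <= x <= be -> 0 <= f x) -> F al <= F be.
Proof.
  intros Hab Hd Hf.
  destruct (MVT_gen F al be f) as [c [Hc1 Hc2]].
  - intros x Hx. rewrite Rmin_left, Rmax_right in Hx by lra. apply Hd; lra.
  - intros x Hx. rewrite Rmin_left, Rmax_right in Hx by lra.
    apply continuity_pt_filterlim, (ex_derive_continuous F x). exists (f x). apply Hd; lra.
  - rewrite Rmin_left, Rmax_right in Hc1 by lra. specialize (Hf c Hc1). nra.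
Qed.

(** Many estimates of integrals are reduced to this comparison: a primitive of the majorant is
    exhibited instead of integrating an inequality. *)
Lemma deriv_dom (F1 F2 f1 f2 : R -> R) al be : al <= be ->
  (forall x, al <= x <= be -> is_derive F1 x (f1 x)) ->
  (forall x, al <= x <= be -> is_derive F2 x (f2 x)) ->
  (forall x, al <= x <= be -> Rabs (f1 x) <= f2 x) ->
  Rabs (F1 be - F1 al) <= F2 be - F2 al.
Proof.
  intros Hab H1 H2 H. apply Rabs_le. split.
  - assert (F2 al + F1 al <= F2 be + F1 be); [|lra].
    apply (incr_of_deriv (fun x => F2 x + F1 x) (fun x => f2 x + f1 x)); auto.
    + intros x Hx. apply (is_derive_plus F2 F1); auto.
    + intros x Hx. specialize (H x Hx). apply Rabs_le_between in H. lra.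
  - assert (F2 al - F1 al <= F2 be - F1 be); [|lra].
    apply (incr_of_deriv (fun x => F2 x - F1 x) (fun x => f2 x - f1 x)); auto.
    + intros x Hx. apply (is_derive_minus F2 F1); auto.
    + intros x Hx. specialize (H x Hx). apply Rabs_le_between in H. lra.
Qed.

Lemma Rabs_sin_le x : 0 <= x -> Rabs (sin x) <= x.
Proof.
  intros Hx. pose proof (deriv_dom sin (fun y => y) cos (fun _ => 1) 0 x Hx) as H.
  rewrite sin_0, !Rminus_0_r in H. apply H.
  - intros; apply is_derive_sin.
  - intros; apply (is_derive_id x0).
  - intros; apply Rabs_cos_le.
Qed.

Lemma RInt_Chasles_R (f : R -> R) (al be ga : R) : ex_RInt f al be -> ex_RInt f be ga ->
  RInt f al ga - RInt f al be = RInt f be ga.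
Proof.
  intros H1 H2. pose proof (RInt_Chasles f al be ga H1 H2) as H. rewrite <- H.
  change (plus (RInt f al be) (RInt f be ga)) with (RInt f al be + RInt f be ga). lra.
Qed.

Definition contpos (f : R -> R) : Prop := forall y, 0 < y -> continuous f y.

Lemma ex_RInt_pos f al be : contpos f -> 0 < al -> 0 < be -> ex_RInt f al be.
Proof.
  intros Hf Ha Hb. apply (@ex_RInt_continuous R_CompleteNormedModule). intros z Hz. apply Hf.
  apply Rlt_le_trans with (Rmin al be); [apply Rmin_pos; auto|apply Hz].
Qed.

Lemma is_derive_RInt_pos f al y : contpos f -> 0 < al -> 0 < y -> is_derive (fun z => RInt f al z) y (f y).
Proof.
  intros Hf Ha Hy. apply (is_derive_RInt f (fun z => RInt f al z) al y); [|apply Hf; auto].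
  exists (mkposreal _ Hy). intros z Hz. apply (RInt_correct f), ex_RInt_pos; auto.
  change (Rabs (z - y) < y) in Hz. apply Rabs_def2 in Hz. lra.
Qed.

Lemma RInt_dom f F2 f2 al be : contpos f -> 0 < al <= be ->
  (forall y, 0 < y -> is_derive F2 y (f2 y)) ->
  (forall y, al <= y <= be -> Rabs (f y) <= f2 y) -> Rabs (RInt f al be) <= F2 be - F2 al.
Proof.
  intros Hf Hab H2 H.
  pose proof (deriv_dom (fun z => RInt f al z) F2 f f2 al be ltac:(lra)) as HD.
  rewrite RInt_point in HD. change (zero : R) with 0 in HD. rewrite Rminus_0_r in HD. apply HD.
  - intros; apply is_derive_RInt_pos; auto; lra.
  - intros; apply H2; lra.
  - auto.
Qed.

Lemma cauchy_seq (u e : nat -> R) : (forall n n', (n <= n')%nat -> Rabs (u n' - u n) <= e n) ->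
  is_lim_seq e 0 -> exists l : R, is_lim_seq u l /\ forall n, Rabs (l - u n) <= e n.
Proof.
  intros Hu He.
  assert (Hc : ex_finite_lim_seq u).
  { apply ex_lim_seq_cauchy_corr. intros eps.
    apply is_lim_seq_spec in He. destruct (He (pos_div_2 eps)) as [N HN].
    exists N. intros n n' Hn Hn'. specialize (HN N (le_n N)). simpl in HN. rewrite Rminus_0_r in HN.
    apply Rabs_def2 in HN. pose proof (Hu N n Hn). pose proof (Hu N n' Hn').
    replace (u n - u n') with ((u n - u N) - (u n' - u N)) by ring.
    eapply Rle_lt_trans; [apply Rabs_triang|]. rewrite Rabs_Ropp. lra. }
  destruct Hc as [l Hl]. exists l. split; auto. intros n.
  assert (H : Rbar_le (Rabs (l - u n)) (e n)); [|exact H].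
  apply (is_lim_seq_le_loc (fun n' => Rabs (u n' - u n)) (fun _ => e n)).
  - exists n. intros n' Hn'. auto.
  - apply (is_lim_seq_abs (fun n' => u n' - u n) (l - u n)).
    apply is_lim_seq_minus'; auto. apply is_lim_seq_const.
  - apply is_lim_seq_const.
Qed.

Lemma is_lim_seq_inv_q : is_lim_seq (fun n => / q n) 0.
Proof.
  unfold q. apply (is_lim_seq_inv (fun n => INR n + 1) p_infty); [|discriminate].
  apply is_lim_seq_ext with (fun n => INR (S n)); [intros; apply S_INR|].
  apply (is_lim_seq_incr_1 INR). apply is_lim_seq_INR.
Qed.

Lemma cauchy_tail (J : R -> R) (D b0 : R) : 0 < b0 -> 0 <= D ->
  (forall b b', b0 <= b <= b' -> Rabs (J b' - J b) <= D / b ^ 2) ->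
  exists l, forall b, b0 <= b -> Rabs (J b - l) <= D / b ^ 2.
Proof.
  intros Hb0 HD HJ.
  destruct (cauchy_seq (fun n => J (b0 + q n)) (fun n => D * / q n)) as [l [Hl _]].
  - intros n n' Hn. pose proof (q_ge1 n). eapply Rle_trans.
    + apply HJ. unfold q. apply le_INR in Hn. pose proof (pos_INR n). lra.
    + unfold Rdiv. apply Rmult_le_compat_l; auto. apply Rinv_le_contravar; [lra|]. nra.
  - replace (Finite 0) with (Finite (D * 0)) by (f_equal; ring).
    apply is_lim_seq_mult'; [apply is_lim_seq_const|apply is_lim_seq_inv_q].
  - exists l. intros b Hb. rewrite Rabs_minus_sym.
    assert (H : Rbar_le (Rabs (l - J b)) (D / b ^ 2)); [|exact H].
    apply (is_lim_seq_le_loc (fun n => Rabs (J (b0 + q n) - J b)) (fun _ => D / b ^ 2)).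
    + destruct (nfl_spec 1 (b) ltac:(lra) ltac:(lra)) as [_ Hn]. exists (nfl 1 b). intros n Hn'.
      apply HJ. unfold q. apply le_INR in Hn'. lra.
    + apply (is_lim_seq_abs (fun n => J (b0 + q n) - J b) (l - J b)).
      apply is_lim_seq_minus'; auto. apply is_lim_seq_const.
    + apply is_lim_seq_const.
Qed.

Section Kernel.
Variable a : R.
Hypothesis Ha : 0 < a.

Lemma Ka_den y : 0 < y -> 0 < PI * y * (y ^ 2 + a ^ 2).
Proof. intros Hy. pose proof PI_gt_3. apply Rmult_lt_0_compat; [nra|nra]. Qed.

Lemma Ka_pos y : 0 < y -> 0 < Ka a y.
Proof. intros Hy. unfold Ka. apply Rdiv_lt_0_compat; [nra|apply Ka_den; auto]. Qed.

Lemma Ka_odd y : Ka a (- y) = - Ka a y.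
Proof.
  unfold Ka. replace (PI * - y * ((- y) ^ 2 + a ^ 2)) with (- (PI * y * (y ^ 2 + a ^ 2))) by ring.
  rewrite Rdiv_opp_r. reflexivity.
Qed.

Lemma Ka_cont : contpos (Ka a).
Proof.
  intros y Hy. apply (ex_derive_continuous (Ka a) y). unfold Ka.
  pose proof (Ka_den y Hy). auto_derive. lra.
Qed.

Lemma Ka_mul y : 0 < y -> y * Ka a y = a ^ 2 / (PI * (y ^ 2 + a ^ 2)).
Proof. intros Hy. unfold Ka. pose proof PI_gt_3. field. repeat split; nra. Qed.

(** [y Ka y] is a multiple of [/ (y ^ 2 + a ^ 2)]. This is stronger than monotonicity of the kernel
    and yields the constant in the lower bound on the velocity. *)
Lemma yKa_decr y z : 0 < y <= z -> z * Ka a z <= y * Ka a y.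
Proof.
  intros H. rewrite !Ka_mul by lra. pose proof PI_gt_3.
  unfold Rdiv. apply Rmult_le_compat_l; [nra|]. apply Rinv_le_contravar.
  - apply Rmult_lt_0_compat; [lra|nra].
  - apply Rmult_le_compat_l; [lra|]. nra.
Qed.

Lemma Ka_decr y z : 0 < y <= z -> Ka a z <= Ka a y.
Proof.
  intros H. pose proof (yKa_decr y z H). pose proof (Ka_pos z ltac:(lra)).
  apply Rmult_le_reg_l with y; [lra|]. nra.
Qed.

Lemma yKa_le y : 0 < y -> y * Ka a y <= / PI.
Proof.
  intros Hy. rewrite Ka_mul by auto. pose proof PI_gt_3.
  apply Rmult_le_reg_r with (PI * (y ^ 2 + a ^ 2)); [apply Rmult_lt_0_compat; nra|].
  unfold Rdiv. rewrite Rmult_assoc, Rinv_l by nra. rewrite <- Rmult_assoc, Rinv_l by lra. nra.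
Qed.

(** Source of all the tails in [/ b ^ 2]: against a bounded function the integral beyond [b]
    converges absolutely at this rate. *)
Lemma Ka_le_cube y : 0 < y -> Ka a y <= a ^ 2 / y ^ 3.
Proof.
  intros Hy. unfold Ka, Rdiv. apply Rmult_le_compat_l; [nra|].
  assert (0 < y ^ 3) by (apply pow_lt; auto). apply Rinv_le_contravar; auto.
  pose proof PI_gt_3.
  assert (y * y ^ 2 <= PI * y * (y ^ 2 + a ^ 2)); [|simpl in *; lra].
  assert (0 < y ^ 2) by nra. assert (0 < a ^ 2) by nra.
  apply Rle_trans with (y * (y ^ 2 + a ^ 2)); [nra|].
  apply Rmult_le_compat_r; [nra|]. nra.
Qed.

Lemma RInt_tail f M al be : contpos f -> (forall y, 0 < y -> Rabs (f y) <= M) -> 0 < al <= be ->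
  Rabs (RInt (fun y => f y * Ka a y) al be) <= M * a ^ 2 / 2 / al ^ 2.
Proof.
  intros Hf HM Hab.
  assert (HM0 : 0 <= M) by (eapply Rle_trans; [apply Rabs_pos|apply (HM 1); lra]).
  assert (0 < al ^ 2) by nra. assert (0 < be ^ 2) by nra.
  eapply Rle_trans.
  - apply (RInt_dom _ (fun y => - (M * a ^ 2 / 2) * / y ^ 2) (fun y => M * (a ^ 2 / y ^ 3))); auto.
    + intros y Hy. apply (continuous_mult f (Ka a)); [apply Hf; auto|apply Ka_cont; auto].
    + intros y Hy. auto_derive; [nra|]. field. lra.
    + intros y Hy. rewrite Rabs_mult. pose proof (Ka_pos y ltac:(lra)).
      rewrite (Rabs_pos_eq (Ka a y)) by lra. apply Rmult_le_compat; [apply Rabs_pos|lra|apply HM; lra|apply Ka_le_cube; lra].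
  - assert (0 <= M * a ^ 2 / 2) by nra. assert (0 < / be ^ 2) by (apply Rinv_0_lt_compat; auto).
    unfold Rdiv at 3. nra.
Qed.

Definition Gk (k : nat) (al be : R) : R := RInt (fun y => sin (INR k * y) * Ka a y) al be.

Lemma sin_contpos k : contpos (fun y => sin (INR k * y)).
Proof. intros y Hy. apply (ex_derive_continuous (fun y => sin (INR k * y)) y). auto_derive; auto. Qed.

Lemma sinKa_contpos k : contpos (fun y => sin (INR k * y) * Ka a y).
Proof.
  intros y Hy. apply (continuous_mult (fun y => sin (INR k * y)) (Ka a)); [apply sin_contpos; auto|apply Ka_cont; auto].
Qed.

Lemma Gk_small k al be : 0 < al <= be -> Rabs (Gk k al be) <= INR k * be.
Proof.
  intros H. pose proof (pos_INR k) as Hk. pose proof PI_gt_3.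
  assert (Hp : / PI <= 1). { rewrite <- Rinv_1. apply Rinv_le_contravar; lra. }
  eapply Rle_trans.
  - apply (RInt_dom _ (fun y => INR k * y) (fun y => INR k)); [apply sinKa_contpos|auto| |].
    + intros y Hy. auto_derive; auto. ring.
    + intros y Hy. rewrite Rabs_mult. pose proof (Ka_pos y ltac:(lra)) as Hp1.
      rewrite (Rabs_pos_eq (Ka a y)) by lra.
      pose proof (Rabs_sin_le (INR k * y) ltac:(nra)). pose proof (yKa_le y ltac:(lra)).
      apply Rle_trans with (INR k * y * Ka a y); [apply Rmult_le_compat_r; lra|].
      rewrite Rmult_assoc. nra.
  - nra.
Qed.

Lemma Gk_tail k al be : 0 < al <= be -> Rabs (Gk k al be) <= a ^ 2 / 2 / al ^ 2.
Proof.
  intros H. pose proof (RInt_tail (fun y => sin (INR k * y)) 1 al be) as HT.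
  rewrite Rmult_1_l in HT. apply HT; auto; [apply sin_contpos|].
  intros; apply Rabs_le; pose proof (SIN_bound (INR k * y)); lra.
Qed.

Definition Ka' (y : R) : R := - (a ^ 2 * (PI * (3 * y ^ 2 + a ^ 2))) / (PI * y * (y ^ 2 + a ^ 2)) ^ 2.

Lemma Ka_derive y : 0 < y -> is_derive (Ka a) y (Ka' y).
Proof.
  intros Hy. pose proof (Ka_den y Hy). unfold Ka, Ka'. auto_derive; [lra|]. field.
  pose proof PI_gt_3. repeat split; nra.
Qed.

Lemma Ka'_neg y : 0 < y -> Ka' y <= 0.
Proof.
  intros Hy. pose proof (Ka_den y Hy). pose proof PI_gt_3. unfold Ka'.
  assert (0 < (PI * y * (y ^ 2 + a ^ 2)) ^ 2) by nra.
  assert (0 <= a ^ 2 * (PI * (3 * y ^ 2 + a ^ 2))) by (apply Rmult_le_pos; [nra|apply Rmult_le_pos; nra]).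
  unfold Rdiv. assert (0 < / (PI * y * (y ^ 2 + a ^ 2)) ^ 2) by (apply Rinv_0_lt_compat; auto). nra.
Qed.

(* Integration by parts against the decreasing kernel. *)
Lemma Gk_osc k al be : (1 <= k)%nat -> 0 < al <= be -> Rabs (Gk k al be) <= 2 * Ka a al / INR k.
Proof.
  intros Hk H. assert (Hk1 : 1 <= INR k) by (change 1 with (INR 1); apply le_INR; auto).
  assert (Hik : 0 < / INR k) by (apply Rinv_0_lt_compat; lra).
  pose proof (deriv_dom (fun z => RInt (fun y => sin (INR k * y) * Ka a y) al z + cos (INR k * z) * Ka a z * / INR k)
     (fun z => - Ka a z * / INR k) (fun z => cos (INR k * z) * Ka' z * / INR k) (fun z => - Ka' z * / INR k) al be ltac:(lra)) as HD.
  cbv beta in HD. rewrite (RInt_point al (fun y => sin (INR k * y) * Ka a y)) in HD. change (zero : R) with 0 in HD. fold (Gk k al be) in HD.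
  assert (HB : Rabs (Gk k al be + cos (INR k * be) * Ka a be * / INR k - (0 + cos (INR k * al) * Ka a al * / INR k)) <=
     - Ka a be * / INR k - - Ka a al * / INR k).
  { apply HD.
    - intros x Hx.
      replace (cos (INR k * x) * Ka' x * / INR k) with
        (sin (INR k * x) * Ka a x + (- sin (INR k * x) * Ka a x + cos (INR k * x) * Ka' x * / INR k)) by ring.
      apply (is_derive_plus (fun z => RInt (fun y => sin (INR k * y) * Ka a y) al z) (fun z => cos (INR k * z) * Ka a z * / INR k)).
      + apply (is_derive_RInt_pos (fun y => sin (INR k * y) * Ka a y)); [apply sinKa_contpos|lra|lra].
      + pose proof (Ka_derive x ltac:(lra)) as HK.
        auto_derive; [exists (Ka' x); exact HK|]. change (Derive (fun x0 : R => Ka a x0) x) with (Derive (Ka a) x). rewrite (is_derive_unique (Ka a) _ _ HK). field. lra.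
    - intros x Hx. pose proof (Ka_derive x ltac:(lra)) as HK.
      auto_derive; [exists (Ka' x); exact HK|]. change (Derive (fun x0 : R => Ka a x0) x) with (Derive (Ka a) x). rewrite (is_derive_unique (Ka a) _ _ HK). field. lra.
    - intros x Hx. pose proof (Ka'_neg x ltac:(lra)). rewrite !Rabs_mult.
      rewrite (Rabs_left1 (Ka' x)) by lra. rewrite (Rabs_pos_eq (/ INR k)) by lra.
      pose proof (Rabs_cos_le (INR k * x)). pose proof (Rabs_pos (cos (INR k * x))).
      apply Rmult_le_compat_r; [lra|]. nra. }
  pose proof (Ka_pos al ltac:(lra)) as P1. pose proof (Ka_pos be ltac:(lra)) as P2.
  assert (Hc : forall z P, 0 < P -> - (P * / INR k) <= cos z * P * / INR k <= P * / INR k).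
  { intros z P HP. pose proof (COS_bound z). split.
    - assert (0 <= (cos z + 1) * (P * / INR k)) by (apply Rmult_le_pos; [lra|nra]). lra.
    - assert (0 <= (1 - cos z) * (P * / INR k)) by (apply Rmult_le_pos; [lra|nra]). lra. }
  pose proof (Hc (INR k * al) _ P1). pose proof (Hc (INR k * be) _ P2).
  apply Rabs_le_between in HB. apply Rabs_le. unfold Rdiv. lra.
Qed.

Lemma Gk_chasles k al be ga : 0 < al -> 0 < be -> 0 < ga -> Gk k al ga = Gk k al be + Gk k be ga.
Proof.
  intros. unfold Gk. symmetry. apply (RInt_Chasles (fun y => sin (INR k * y) * Ka a y));
    apply ex_RInt_pos; auto; apply sinKa_contpos.
Qed.

(** Cut at [y = / k]. Below, [|sin ky| <= ky] and [y Ka y <= / PI] give at most [/ 3]; above,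
    [Gk_osc] gives at most [2 / 3]. *)
Lemma Gk_bound k al be : 0 < al <= be -> Rabs (Gk k al be) <= 1.
Proof.
  intros H. pose proof PI_gt_3 as HP.
  destruct k as [|k].
  { eapply Rle_trans; [apply Gk_small; auto|]. simpl. lra. }
  assert (Hip : / PI <= / 3) by (apply Rinv_le_contravar; lra).
  set (x := INR (S k)). assert (Hx : 1 <= x) by (unfold x; rewrite S_INR; pose proof (pos_INR k); lra).
  assert (Hsm : forall al be, 0 < al <= be -> be <= / x -> Rabs (Gk (S k) al be) <= / 3).
  { intros al' be' H' Hb. eapply Rle_trans.
    - apply (RInt_dom _ (fun y => x * / PI * y) (fun y => x * / PI)); [apply sinKa_contpos|auto| |].
      + intros y Hy. auto_derive; auto. ring.
      + intros y Hy. rewrite Rabs_mult. pose proof (Ka_pos y ltac:(lra)) as Hp1.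
        rewrite (Rabs_pos_eq (Ka a y)) by lra.
        pose proof (Rabs_sin_le (x * y) ltac:(nra)). pose proof (yKa_le y ltac:(lra)). fold x.
        apply Rle_trans with (x * y * Ka a y); [apply Rmult_le_compat_r; lra|].
        rewrite Rmult_assoc. nra.
    - assert (x * be' <= 1). { apply Rmult_le_reg_r with (/ x); [apply Rinv_0_lt_compat; lra|].
        replace (x * be' * / x) with be' by (field; lra). lra. }
      assert (HiP : 0 < / PI) by (apply Rinv_0_lt_compat; lra).
      assert (/ PI * (x * be') <= / PI * 1) by (apply Rmult_le_compat_l; lra).
      assert (0 <= / PI * (x * al')) by (apply Rmult_le_pos; [lra|nra]). lra. }
  assert (Hlg : forall al be, 0 < al <= be -> / x <= al -> Rabs (Gk (S k) al be) <= 2 / 3).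
  { intros al' be' H' Hb. eapply Rle_trans; [apply Gk_osc; [lia|auto]|]. fold x.
    pose proof (yKa_le al' ltac:(lra)). pose proof (Ka_pos al' ltac:(lra)).
    assert (/ x * Ka a al' <= / PI) by nra. unfold Rdiv. lra. }
  assert (Hix : 0 < / x) by (apply Rinv_0_lt_compat; lra).
  destruct (Rle_dec be (/ x)); [pose proof (Hsm al be H r); lra|].
  destruct (Rle_dec (/ x) al); [pose proof (Hlg al be H r); lra|].
  rewrite (Gk_chasles _ al (/ x) be) by lra.
  pose proof (Hsm al (/ x) ltac:(lra) ltac:(lra)). pose proof (Hlg (/ x) be ltac:(lra) ltac:(lra)).
  eapply Rle_trans; [apply Rabs_triang|]. lra.
Qed.

Lemma Gk_cauchy k al be al' be' : 0 < al' <= al -> al <= be -> be <= be' ->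
  Rabs (Gk k al' be' - Gk k al be) <= INR k * al + a ^ 2 / 2 / be ^ 2.
Proof.
  intros H1 H2 H3. rewrite (Gk_chasles k al' al be') by lra. rewrite (Gk_chasles k al be be') by lra.
  replace (Gk k al' al + (Gk k al be + Gk k be be') - Gk k al be) with (Gk k al' al + Gk k be be') by ring.
  eapply Rle_trans; [apply Rabs_triang|]. apply Rplus_le_compat.
  - apply Gk_small; lra.
  - apply Gk_tail; lra.
Qed.

(** The symbol of [H_a], with closed form [1 - exp (- a k)]. The factor 2 is there because both
    half-lines contribute equally by oddness. The limit follows one sequence of truncations;
    [mk_close] compares it with all others. *)
Definition mk (k : nat) : R := 2 * real (Lim_seq (fun n => Gk k (/ q n) (q n))).

Lemma mk_lim k : is_lim_seq (fun n => Gk k (/ q n) (q n)) (mk k / 2).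
Proof.
  destruct (cauchy_seq (fun n => Gk k (/ q n) (q n)) (fun n => INR k * / q n + a ^ 2 / 2 * (/ q n * / q n))) as [l [Hl _]].
  - intros n n' Hn. pose proof (q_ge1 n).
    assert (q n <= q n') by (unfold q; apply le_INR in Hn; lra).
    replace (a ^ 2 / 2 * (/ q n * / q n)) with (a ^ 2 / 2 / q n ^ 2) by (field; lra).
    apply Gk_cauchy; auto.
    + split; [apply Rinv_0_lt_compat; lra|apply Rinv_le_contravar; lra].
    + apply Rle_trans with 1; auto. rewrite <- Rinv_1. apply Rinv_le_contravar; lra.
  - replace (Finite 0) with (Finite (INR k * 0 + a ^ 2 / 2 * (0 * 0))) by (f_equal; ring).
    apply is_lim_seq_plus'; apply is_lim_seq_mult'; try apply is_lim_seq_const; try apply is_lim_seq_inv_q.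
    apply is_lim_seq_mult'; apply is_lim_seq_inv_q.
  - unfold mk. rewrite (is_lim_seq_unique _ _ Hl). simpl.
    replace (2 * l / 2) with l by field. exact Hl.
Qed.

Lemma mk_close k al be : 0 < al <= be ->
  Rabs (2 * Gk k al be - mk k) <= 2 * (INR k * al + a ^ 2 / 2 / be ^ 2).
Proof.
  intros H.
  assert (HB : Rbar_le (Rabs (mk k / 2 - Gk k al be)) (INR k * al + a ^ 2 / 2 / be ^ 2)).
  { apply (is_lim_seq_le_loc (fun n => Rabs (Gk k (/ q n) (q n) - Gk k al be)) (fun _ => INR k * al + a ^ 2 / 2 / be ^ 2)).
    - destruct (nfl_spec 1 (be + / al) ltac:(lra)) as [_ Hn]; [assert (0 < / al) by (apply Rinv_0_lt_compat; lra); lra|].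
      exists (nfl 1 (be + / al)). intros n Hn'.
      assert (Hia : 0 < / al) by (apply Rinv_0_lt_compat; lra).
      assert (Hq : be + / al < q n) by (unfold q; apply le_INR in Hn'; lra).
      apply Gk_cauchy; try lra. split; [apply Rinv_0_lt_compat; lra|].
      rewrite <- (Rinv_inv al). apply Rinv_le_contravar; lra.
    - apply (is_lim_seq_abs (fun n => Gk k (/ q n) (q n) - Gk k al be) (mk k / 2 - Gk k al be)).
      apply is_lim_seq_minus'; [apply mk_lim|apply is_lim_seq_const].
    - apply is_lim_seq_const. }
  unfold Rbar_le in HB. replace (2 * Gk k al be - mk k) with (-2 * (mk k / 2 - Gk k al be)) by field.
  rewrite Rabs_mult. replace (Rabs (-2)) with 2 by (rewrite Rabs_left; lra). lra.
Qed.

Lemma mk_bound k : Rabs (mk k) <= 2.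
Proof.
  assert (HB : Rbar_le (Rabs (mk k / 2)) 1).
  { apply (is_lim_seq_le (fun n => Rabs (Gk k (/ q n) (q n))) (fun _ => 1)).
    - intros n. pose proof (q_ge1 n). apply Gk_bound. split; [apply Rinv_0_lt_compat; lra|].
      apply Rle_trans with 1; auto. rewrite <- Rinv_1. apply Rinv_le_contravar; lra.
    - apply (is_lim_seq_abs (fun n => Gk k (/ q n) (q n)) (mk k / 2)), mk_lim.
    - apply is_lim_seq_const. }
  simpl in HB. replace (mk k) with (2 * (mk k / 2)) by field. rewrite Rabs_mult, Rabs_pos_eq by lra. lra.
Qed.

Section OddSeries.
Variables (A : nat -> R) (M : R).
Hypothesis HM : bnd 3 M A.

(** The shape of [f (x - y) - f (x + y)] for a cosine series [f], with [sin kx] absorbed in [A k];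
    see [prof_antisym]. *)
Definition oddS (y : R) : R := Series (fun k => 2 * A k * sin (INR k * y)).

Lemma A_w2 k : q k * Rabs (A k) <= M * w2 k.
Proof. pose proof (bnd_w2 1 M A HM k). simpl in H. lra. Qed.

Lemma oddS_term k y : Rabs (2 * A k * sin (INR k * y)) <= 2 * M * w2 k.
Proof.
  pose proof (A_w2 k). pose proof (q_ge1 k). pose proof (Rabs_pos (A k)).
  assert (Rabs (sin (INR k * y)) <= 1) by (apply Rabs_le; pose proof (SIN_bound (INR k * y)); lra).
  rewrite !Rabs_mult, (Rabs_pos_eq 2) by lra. pose proof (Rabs_pos (sin (INR k * y))). nra.
Qed.

Lemma RInt_oddS al be : 0 < al <= be ->
  is_RInt (fun y => oddS y * Ka a y) al be (Series (fun k => A k * (2 * Gk k al be))).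
Proof.
  intros H. pose proof (Ka_pos al ltac:(lra)) as HK.
  pose proof (is_RInt_Series (fun k y => 2 * A k * (sin (INR k * y) * Ka a y)) (fun k => 2 * M * Ka a al * w2 k) al be ltac:(lra) (ex_series_Aw2 _)) as HS.
  rewrite (Series_ext (fun k => A k * (2 * Gk k al be)) (fun k => RInt (fun y => 2 * A k * (sin (INR k * y) * Ka a y)) al be)).
  - apply is_RInt_ext with (fun y => Series (fun k => 2 * A k * (sin (INR k * y) * Ka a y))).
    { intros y _. unfold oddS. rewrite <- Series_scal_r. apply Series_ext; intros; ring. }
    apply HS.
    + intros k. apply (ex_RInt_scal (fun y => sin (INR k * y) * Ka a y)). apply ex_RInt_pos; try lra. apply sinKa_contpos.
    + intros k y Hy. rewrite <- Rmult_assoc, Rabs_mult. pose proof (Ka_pos y ltac:(lra)).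
      rewrite (Rabs_pos_eq (Ka a y)) by lra. pose proof (oddS_term k y).
      pose proof (Ka_decr al y ltac:(lra)).
      replace (2 * M * Ka a al * w2 k) with (2 * M * w2 k * Ka a al) by ring.
      apply Rmult_le_compat; auto; [apply Rabs_pos|lra].
  - intros k. symmetry.
    apply is_RInt_unique.
    replace (A k * (2 * Gk k al be)) with (scal (2 * A k) (Gk k al be)).
    + apply (is_RInt_scal (fun y => sin (INR k * y) * Ka a y)).
      apply (RInt_correct (fun y => sin (INR k * y) * Ka a y)), ex_RInt_pos; try lra. apply sinKa_contpos.
    + change (2 * A k * Gk k al be = A k * (2 * Gk k al be)). ring.
Qed.

(** The error in [mk_close] grows like [k]: one of the three orders of decay absorbs it, the other
    two make the sum converge. *)
Lemma oddS_close al be : 0 < al <= be ->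
  Rabs (RInt (fun y => oddS y * Ka a y) al be - Series (fun k => A k * mk k)) <= 4 * M * (al + a ^ 2 / 2 / be ^ 2).
Proof.
  intros H. rewrite (is_RInt_unique _ _ _ _ (RInt_oddS al be H)).
  assert (Hb : 0 <= a ^ 2 / 2 / be ^ 2).
  { apply Rmult_le_pos; [nra|left; apply Rinv_0_lt_compat; nra]. }
  assert (HM0 := bnd_nonneg _ _ _ HM).
  assert (Hex : forall e, (forall k, Rabs (e k) <= 2) -> ex_series (fun k => A k * e k)).
  { intros e He. apply ex_series_dom with (fun k => 2 * M * w2 k); [apply ex_series_Aw2|].
    intros k. rewrite Rabs_mult. pose proof (A_w2 k). pose proof (q_ge1 k). pose proof (Rabs_pos (A k)).
    specialize (He k). pose proof (Rabs_pos (e k)). nra. }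
  rewrite <- Series_minus; [| |apply Hex; apply mk_bound].
  2: { apply Hex. intros k. rewrite Rabs_mult, Rabs_pos_eq by lra. pose proof (Gk_bound k al be H). lra. }
  replace (4 * M * (al + a ^ 2 / 2 / be ^ 2)) with (2 * (2 * M * (al + a ^ 2 / 2 / be ^ 2))) by ring.
  rewrite <- Series_Aw2. apply series_abs_le; [apply ex_series_Aw2|].
  intros k. rewrite <- Rmult_minus_distr_l, Rabs_mult. pose proof (mk_close k al be H) as Hm.
  pose proof (A_w2 k) as HA. pose proof (INR_le_q k). pose proof (q_ge1 k). pose proof (Rabs_pos (A k)).
  set (t := a ^ 2 / 2 / be ^ 2) in *.
  apply Rle_trans with (Rabs (A k) * (2 * (q k * (al + t)))).
  - apply Rmult_le_compat_l; auto. eapply Rle_trans; [exact Hm|]. nra.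
  - replace (Rabs (A k) * (2 * (q k * (al + t)))) with (2 * (al + t) * (q k * Rabs (A k))) by ring.
    replace (2 * M * (al + t) * w2 k) with (2 * (al + t) * (M * w2 k)) by ring.
    apply Rmult_le_compat_l; auto. nra.
Qed.
End OddSeries.

Lemma tail_integral f M ep : contpos f -> (forall y, 0 < y -> Rabs (f y) <= M) -> 0 < ep ->
  exists l, (forall b, ep <= b -> Rabs (RInt (fun y => f y * Ka a y) ep b - l) <= M * a ^ 2 / 2 / b ^ 2) /\
  is_RInt_gen (fun y => f y * Ka a y) (at_point ep) (Rbar_locally p_infty) l.
Proof.
  intros Hf HM He.
  assert (HM0 : 0 <= M) by (eapply Rle_trans; [apply Rabs_pos|apply (HM 1); lra]).
  assert (Hc : contpos (fun y => f y * Ka a y)).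
  { intros y Hy. apply (continuous_mult f (Ka a)); [apply Hf; auto|apply Ka_cont; auto]. }
  assert (HD : 0 <= M * a ^ 2 / 2) by nra.
  destruct (cauchy_tail (fun b => RInt (fun y => f y * Ka a y) ep b) (M * a ^ 2 / 2) ep He HD) as [l Hl].
  - intros b b' Hb. rewrite RInt_Chasles_R by (apply ex_RInt_pos; auto; lra).
    apply RInt_tail; auto. lra.
  - exists l. split; auto.
    apply filterlimi_locally. intros eps.
    set (D := M * a ^ 2 / 2) in *.
    apply (Filter_prod _ _ _ (fun z => z = ep) (fun b => ep + 1 + D / eps < b)).
    + reflexivity.
    + exists (ep + 1 + D / eps). auto.
    + intros x b -> Hb. simpl.
      exists (RInt (fun y => f y * Ka a y) ep b).
      assert (He' := cond_pos eps). assert (HDe : 0 <= D / eps) by (apply Rmult_le_pos; [auto|left; apply Rinv_0_lt_compat; auto]).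
      split.
      * apply (RInt_correct (fun y => f y * Ka a y)), ex_RInt_pos; auto. lra.
      * change (Rabs (RInt (fun y => f y * Ka a y) ep b - l) < eps).
        eapply Rle_lt_trans; [apply Hl; lra|].
        assert (1 < b) by lra.
        apply Rmult_lt_reg_r with (b ^ 2); [nra|]. unfold Rdiv. rewrite Rmult_assoc, Rinv_l by nra.
        assert (D < eps * b).
        { assert (D / eps < b) by lra. apply Rmult_lt_compat_l with (r := eps) in H0; auto.
          replace (eps * (D / eps)) with D in H0 by (field; lra). auto. }
        nra.
Qed.

(** As the kernel is odd, the left half-line contributes like the right one with [f (x + y)] and a
    minus sign, so the symmetrised integral decides. The rate in [be] lets the outer truncation go
    to infinity first; the rate in [al] then gives the principal value. *)
Lemma Ha_limit (f : R -> R) x v M C : (forall y, continuous f y) -> (forall y, Rabs (f y) <= M) ->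
  (forall al be, 0 < al <= be ->
    Rabs (RInt (fun y => (f (x - y) - f (x + y)) * Ka a y) al be - v) <= C * (al + a ^ 2 / 2 / be ^ 2)) ->
  is_Ha a f x v.
Proof.
  intros Hf HM Hv.
  assert (Hc1 : contpos (fun y => f (x - y))).
  { intros y Hy. apply (continuous_comp (fun y => x - y) f); [|apply Hf].
    apply (ex_derive_continuous (fun y => x - y) y). auto_derive; auto. }
  assert (Hc2 : contpos (fun y => f (x + y))).
  { intros y Hy. apply (continuous_comp (fun y => x + y) f); [|apply Hf].
    apply (ex_derive_continuous (fun y => x + y) y). auto_derive; auto. }
  assert (Hmain : forall ep, 0 < ep -> exists l1 l2,
    is_RInt_gen (fun y => f (x - y) * Ka a y) (Rbar_locally m_infty) (at_point (- ep)) (- l2) /\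
    is_RInt_gen (fun y => f (x - y) * Ka a y) (at_point ep) (Rbar_locally p_infty) l1 /\
    Rabs (l1 - l2 - v) <= C * ep).
  { intros ep He.
    destruct (tail_integral (fun y => f (x - y)) M ep Hc1 ltac:(intros; apply HM) He) as [l1 [Hl1 Hg1]].
    destruct (tail_integral (fun y => f (x + y)) M ep Hc2 ltac:(intros; apply HM) He) as [l2 [Hl2 Hg2]].
    exists l1, l2. split; [|split; auto].
    - apply filterlimi_locally. intros eps.
      pose proof (proj1 (filterlimi_locally _ l2) Hg2) as Hg3.
      destruct (Hg3 eps) as [P Q HP HQ HPQ].
      destruct HQ as [B HB].
      apply (Filter_prod _ _ _ (fun b => b < - B) (fun z => z = - ep)).
      + exists (- B). auto.
      + reflexivity.
      + intros b z Hb ->. simpl. destruct (HPQ ep (- b) HP (HB (- b) ltac:(lra))) as [z [Hz1 Hz2]]. simpl in Hz1.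
        exists (- z). split.
        * apply (is_RInt_swap (fun y => f (x - y) * Ka a y) b (- ep) z).
          assert (Hz3 : is_RInt (fun y => f (x + y) * Ka a y) (- (- ep)) (- b) z) by (rewrite Ropp_involutive; exact Hz1).
          apply (is_RInt_comp_opp (fun y => f (x + y) * Ka a y) (- ep) b z) in Hz3.
          eapply is_RInt_ext; [|exact Hz3]. intros y _. simpl. rewrite Ka_odd.
          unfold opp; simpl. replace (x + - y) with (x - y) by ring. ring.
        * change (Rabs (- z - - l2) < eps). change (Rabs (z - l2) < eps) in Hz2.
          replace (- z - - l2) with (- (z - l2)) by ring. rewrite Rabs_Ropp; auto.
    - apply le_epsilon. intros eta Het.
      assert (HM0 : 0 <= M) by (eapply Rle_trans; [apply Rabs_pos|apply (HM 1)]).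
      pose (D := M * a ^ 2 / 2 + M * a ^ 2 / 2 + Rabs C * (a ^ 2 / 2)).
      assert (HD : 0 <= D).
      { unfold D. pose proof (Rabs_pos C). assert (0 <= M * a ^ 2 / 2) by nra. assert (0 <= Rabs C * (a ^ 2 / 2)) by nra. lra. }
      (* Far enough for the two tails and the truncation error, together [D / b ^ 2], to be at most
         [eta]. *)
      pose (b := ep + 1 + D / eta).
      assert (HDe : 0 <= D / eta) by (apply Rmult_le_pos; [auto|left; apply Rinv_0_lt_compat; auto]).
      assert (Hb : ep <= b /\ 1 <= b) by (unfold b; lra).
      specialize (Hl1 b ltac:(lra)). specialize (Hl2 b ltac:(lra)). specialize (Hv ep b ltac:(lra)).
      assert (Hi : RInt (fun y => (f (x - y) - f (x + y)) * Ka a y) ep b =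
        RInt (fun y => f (x - y) * Ka a y) ep b - RInt (fun y => f (x + y) * Ka a y) ep b).
      { rewrite <- (RInt_minus (fun y => f (x - y) * Ka a y) (fun y => f (x + y) * Ka a y)).
        - apply RInt_ext. intros y _. unfold minus, plus, opp; simpl. ring.
        - apply ex_RInt_pos; try lra. intros y Hy. apply (continuous_mult (fun y => f (x - y)) (Ka a)); [apply Hc1; auto|apply Ka_cont; auto].
        - apply ex_RInt_pos; try lra. intros y Hy. apply (continuous_mult (fun y => f (x + y)) (Ka a)); [apply Hc2; auto|apply Ka_cont; auto]. }
      rewrite Hi in Hv.
      set (I1 := RInt (fun y => f (x - y) * Ka a y) ep b) in *. set (I2 := RInt (fun y => f (x + y) * Ka a y) ep b) in *.
      assert (Hib : 0 < / b ^ 2) by (apply Rinv_0_lt_compat; nra).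
      assert (HDb : D * / b ^ 2 <= eta).
      { apply Rmult_le_reg_r with (b ^ 2); [nra|]. rewrite (Rmult_assoc D), Rinv_l by nra.
        assert (D <= eta * b).
        { assert (D / eta <= b) by (unfold b; lra). apply Rmult_le_compat_l with (r := eta) in H; [|lra].
          replace (eta * (D / eta)) with D in H by (field; lra). auto. }
        nra. }
      assert (C * (a ^ 2 / 2 / b ^ 2) <= Rabs C * (a ^ 2 / 2) * / b ^ 2).
      { unfold Rdiv. rewrite <- !Rmult_assoc. pose proof (Rle_abs C). apply Rmult_le_compat_r; [lra|]. nra. }
      replace (l1 - l2 - v) with ((I1 - I2 - v) - (I1 - l1) + (I2 - l2)) by ring.
      eapply Rle_trans; [apply Rabs_triang|].
      assert (Rabs (I1 - I2 - v - (I1 - l1)) <= Rabs (I1 - I2 - v) + Rabs (I1 - l1)).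
      { eapply Rle_trans; [apply Rabs_triang|]. rewrite Rabs_Ropp; lra. }
      unfold D in HDb. unfold Rdiv in *. lra. }
  split.
  - intros eps He. destruct (Hmain eps He) as [l1 [l2 [H1 [H2 _]]]]. split; [exists (- l2); auto|exists l1; auto].
  - apply filterlim_locally_R; [apply within_filter, locally_filter|]. intros eps He.
    assert (Hd : 0 < eps / (Rabs C + 1)) by (apply Rdiv_lt_0_compat; [auto|pose proof (Rabs_pos C); lra]).
    exists (mkposreal _ Hd). intros ep Hep Hep0.
    change (Rabs (ep - 0) < eps / (Rabs C + 1)) in Hep. rewrite Rminus_0_r, Rabs_pos_eq in Hep by lra.
    destruct (Hmain ep Hep0) as [l1 [l2 [H1 [H2 H3]]]].
    unfold Ha_trunc.
    rewrite (is_RInt_gen_unique _ _ H1), (is_RInt_gen_unique _ _ H2).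
    replace (- l2 + l1 - v) with (l1 - l2 - v) by ring.
    eapply Rle_lt_trans; [exact H3|].
    pose proof (Rle_abs C). pose proof (Rabs_pos C).
    apply Rmult_lt_compat_r with (r := Rabs C + 1) in Hep; [|lra].
    replace (eps / (Rabs C + 1) * (Rabs C + 1)) with eps in Hep by (field; lra). nra.
Qed.
End Kernel.

(** * Fourier inversion *)

(** [sin z >= z - z ^ 3 / 6], and [z ^ 2 <= 4] on this interval. *)
Lemma sin_ge_third z : 0 <= z <= 2 -> z / 3 <= sin z.
Proof.
  intros Hz.
  assert (Hc : forall y, 0 <= y -> 1 - y ^ 2 / 2 <= cos y).
  { intros y Hy.
    pose proof (incr_of_deriv (fun t => cos t - 1 + t ^ 2 / 2) (fun t => - sin t + t) 0 y Hy) as H.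
    cbv beta in H. rewrite cos_0 in H. assert (1 - 1 + 0 ^ 2 / 2 <= cos y - 1 + y ^ 2 / 2); [|lra]. apply H.
    - intros x Hx. auto_derive; auto. field.
    - intros x Hx. pose proof (Rabs_sin_le x ltac:(lra)) as Hs. apply Rabs_le_between in Hs. lra. }
  pose proof (incr_of_deriv (fun t => sin t - t + t ^ 3 / 6) (fun t => cos t - 1 + t ^ 2 / 2) 0 z ltac:(lra)) as H.
  cbv beta in H. rewrite sin_0 in H.
  assert (0 - 0 + 0 ^ 3 / 6 <= sin z - z + z ^ 3 / 6).
  { apply H.
    - intros x Hx. auto_derive; auto. field.
    - intros x Hx. specialize (Hc x ltac:(lra)). lra. }
  assert (z ^ 3 <= 4 * z) by (simpl; nra). lra.
Qed.

(** [1 - cos y = 2 sin (y / 2) ^ 2], which is at least [2 (y / 6) ^ 2] by [sin_ge_third]. *)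
Lemma cos_quadratic y : - PI <= y <= PI -> y ^ 2 <= 18 * (1 - cos y).
Proof.
  intros Hy. pose proof PI_4.
  assert (Hp : forall y, 0 <= y <= PI -> y ^ 2 <= 18 * (1 - cos y)).
  { clear y Hy. intros y Hy. pose proof (sin_ge_third (y / 2) ltac:(lra)) as Hs.
    replace y with (2 * (y / 2)) at 2 by field. rewrite cos_2a_sin. nra. }
  destruct (Rle_dec 0 y); [apply Hp; lra|].
  pose proof (Hp (- y) ltac:(lra)). rewrite cos_neg in H0. lra.
Qed.

(** A nonzero limit would make the partial sums grow linearly. *)
Lemma cesaro_zero (u : nat -> R) (L B : R) : is_lim_seq u L -> (forall n, Rabs (sm u n) <= B) -> L = 0.
Proof.
  assert (Hp : forall (u : nat -> R) (L : R), is_lim_seq u L -> (forall n, Rabs (sm u n) <= B) -> L <= 0).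
  { clear u L. intros u L Hu HB. apply Rnot_lt_le. intros HL.
    apply is_lim_seq_spec in Hu. assert (H2 : 0 < L / 2) by lra.
    destruct (Hu (mkposreal _ H2)) as [N HN]. simpl in HN.
    assert (HB0 : 0 <= B) by (eapply Rle_trans; [apply Rabs_pos|apply (HB O)]).
    destruct (nfl_spec (L / 2) (2 * B + 1) H2 ltac:(lra)) as [_ Hi].
    set (i := S (nfl (L / 2) (2 * B + 1))).
    assert (Hs : INR i * (L / 2) <= sm (fun k => u (N + k)%nat) i).
    { rewrite <- sm_const. apply sm_le. intros k _. specialize (HN (N + k)%nat ltac:(lia)).
      apply Rabs_def2 in HN. lra. }
    pose proof (sm_split u N i). pose proof (HB N) as H1. pose proof (HB (N + i)%nat) as H3.
    apply Rabs_le_between in H1. apply Rabs_le_between in H3.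
    unfold i in Hs. rewrite S_INR in Hs. fold i in Hs. lra. }
  intros Hu HB. apply Rle_antisym; [eapply Hp; eauto|].
  assert (- L <= 0); [|lra].
  apply (Hp (fun n => -1 * u n)).
  - replace (Finite (- L)) with (Finite (-1 * L)) by (f_equal; ring).
    apply is_lim_seq_mult'; [apply is_lim_seq_const|auto].
  - intros n. rewrite sm_scal, Rabs_mult. replace (Rabs (-1)) with 1 by (rewrite Rabs_left; lra). rewrite Rmult_1_l; auto.
Qed.

Definition dirichlet (n : nat) (y : R) : R := 2 * sm (fun k => cos (INR k * y)) (S n) - 1.

Lemma dirichlet_telescope n y : (1 - cos y) * dirichlet n y = cos (INR n * y) - cos ((INR n + 1) * y).
Proof.
  unfold dirichlet. induction n.
  - simpl. rewrite !Rmult_0_l, Rplus_0_l, cos_0. replace ((0 + 1) * y) with y by ring. ring.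
  - rewrite sm_S.
    replace ((1 - cos y) * (2 * (sm (fun k => cos (INR k * y)) (S n) + cos (INR (S n) * y)) - 1)) with
      ((1 - cos y) * (2 * sm (fun k => cos (INR k * y)) (S n) - 1) + (1 - cos y) * (2 * cos (INR (S n) * y))) by ring.
    rewrite IHn. rewrite S_INR.
    replace (INR n * y) with ((INR n + 1) * y - y) by ring.
    replace ((INR n + 1 + 1) * y) with ((INR n + 1) * y + y) by ring.
    rewrite cos_minus, cos_plus. ring.
Qed.

Lemma fejer_identity M y : (1 - cos y) * sm (fun n => dirichlet n y) M = 1 - cos (INR M * y).
Proof.
  induction M.
  - simpl. rewrite Rmult_0_l, cos_0. ring.
  - rewrite sm_S, Rmult_plus_distr_l, IHM, dirichlet_telescope, S_INR. ring.
Qed.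

Lemma cont_ex_RInt (f : R -> R) al be : (forall y, continuous f y) -> ex_RInt f al be.
Proof. intros H. apply (@ex_RInt_continuous R_CompleteNormedModule). auto. Qed.

Lemma RInt_bound (f : R -> R) al be B : al <= be -> (forall y, continuous f y) ->
  (forall y, al <= y <= be -> Rabs (f y) <= B) -> Rabs (RInt f al be) <= (be - al) * B.
Proof.
  intros Hab Hf HB. apply (norm_RInt_le_const f al be); auto.
  apply (RInt_correct f), cont_ex_RInt; auto.
Qed.

(** The integral over a moving period has derivative [h (PI + z) - h (- PI + z) = 0]. *)
Lemma periodic_shift (h : R -> R) x : (forall y, continuous h y) -> periodic2pi h ->
  RInt (fun y => h (x + y)) (- PI) PI = RInt h (- PI) PI.
Proof.
  intros Hc Hp.
  assert (E1 : RInt (fun y => h (x + y)) (- PI) PI = RInt h (- PI + x) (PI + x)).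
  { pose proof (RInt_comp_lin h 1 x (- PI) PI) as H.
    rewrite !Rmult_1_l in H. rewrite <- H.
    - apply RInt_ext. intros y _. change (h (x + y) = 1 * h (1 * y + x)). rewrite !Rmult_1_l. f_equal. ring.
    - apply cont_ex_RInt; auto. }
  rewrite E1.
  pose (G := fun z => RInt h 0 (PI + z) - RInt h 0 (- PI + z)).
  assert (HG : forall z, RInt h (- PI + z) (PI + z) = G z).
  { intros z. unfold G. symmetry. apply RInt_Chasles_R; apply cont_ex_RInt; auto. }
  assert (Hd : forall z, is_derive G z 0).
  { intros z. replace 0 with (1 * h (PI + z) - 1 * h (- PI + z)).
    2: { replace (PI + z) with (- PI + z + 2 * PI) by ring. rewrite Hp. ring. }
    assert (HI : forall w, is_derive (fun b => RInt h 0 b) w (h w)).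
    { intros w. apply (is_derive_RInt h (fun b => RInt h 0 b) 0 w); auto.
      apply filter_forall. intros b. apply (RInt_correct h), cont_ex_RInt; auto. }
    apply (is_derive_minus (fun z => RInt h 0 (PI + z)) (fun z => RInt h 0 (- PI + z))).
    - apply (is_derive_comp (fun b => RInt h 0 b) (fun z => PI + z)); [apply HI|]. auto_derive; auto.
    - apply (is_derive_comp (fun b => RInt h 0 b) (fun z => - PI + z)); [apply HI|]. auto_derive; auto. }
  assert (Hz : forall x y, x <= y -> G x = G y).
  { intros u v Huv. apply Rle_antisym.
    - apply (incr_of_deriv G (fun _ => 0)); auto. intros; lra.
    - assert (- G u <= - G v); [|lra].
      apply (incr_of_deriv (fun z => - G z) (fun _ => 0)); auto; [|intros; lra].
      intros w _. replace 0 with (- 0) by ring. apply (is_derive_opp G); auto. }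
  rewrite HG. transitivity (G 0).
  - destruct (Rle_dec x 0); [apply Hz; auto|symmetry; apply Hz; lra].
  - rewrite <- HG, !Rplus_0_r. reflexivity.
Qed.

Lemma RInt_reflect (h : R -> R) : (forall y, continuous h y) ->
  RInt (fun y => h (- y)) (- PI) PI = RInt h (- PI) PI.
Proof.
  intros Hc. apply is_RInt_unique.
  assert (H : is_RInt h (- PI) PI (RInt h (- PI) PI)) by (apply (RInt_correct h), cont_ex_RInt; auto).
  apply (is_RInt_swap h PI (- PI)) in H.
  replace (is_RInt h PI (- PI)) with (is_RInt h (- - PI) (- PI)) in H by (rewrite Ropp_involutive; auto).
  apply is_RInt_comp_opp in H.
  apply (is_RInt_opp (fun y => opp (h (- y)))) in H.
  rewrite opp_opp in H.
  eapply is_RInt_ext; [|exact H]. intros y _. apply opp_opp.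
Qed.

Section Inversion.
Variable f : R -> R.
Hypothesis Hf : smooth_per f.

Lemma f_derive n x : is_derive (Derive_n f n) x (Derive_n f (S n) x).
Proof. apply Derive_correct. apply (proj1 (proj2 Hf) (S n) x). Qed.

Lemma f_cont n x : continuous (Derive_n f n) x.
Proof. apply (ex_derive_continuous (Derive_n f n) x). exists (Derive_n f (S n) x). apply f_derive. Qed.

Lemma f_per n x : Derive_n f n (x + 2 * PI) = Derive_n f n x.
Proof.
  rewrite <- Derive_n_comp_trans. apply Derive_n_ext. apply (proj1 Hf).
Qed.

Definition FC (h : R -> R) (phi : R) (k : nat) : R := RInt (fun x => h x * cos (INR k * x + phi)) (- PI) PI.

Lemma hcos_cont (h : R -> R) phi k x : (forall y, continuous h y) -> continuous (fun x => h x * cos (INR k * x + phi)) x.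
Proof.
  intros Hh. apply (continuous_mult h (fun x => cos (INR k * x + phi))); auto.
  apply (ex_derive_continuous (fun x => cos (INR k * x + phi)) x). auto_derive; auto.
Qed.

(** Integration by parts, with boundary terms cancelling by periodicity. The phase joins sine and
    cosine coefficients into one family, so that the step can be iterated. *)
Lemma FC_parts n phi k : INR k * FC (Derive_n f n) phi k = FC (Derive_n f (S n)) (phi + PI / 2) k.
Proof.
  assert (H : is_RInt (fun x => Derive_n f (S n) x * sin (INR k * x + phi) + Derive_n f n x * (INR k * cos (INR k * x + phi))) (- PI) PI
    (minus (Derive_n f n PI * sin (INR k * PI + phi)) (Derive_n f n (- PI) * sin (INR k * (- PI) + phi)))).
  { apply (is_RInt_derive (fun x => Derive_n f n x * sin (INR k * x + phi))).
    - intros x _.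
      apply (is_derive_mult (Derive_n f n) (fun x => sin (INR k * x + phi)) x (Derive_n f (S n) x) (INR k * cos (INR k * x + phi))).
      + apply f_derive.
      + auto_derive; auto. ring.
      + intros; apply Rmult_comm.
    - intros x _. apply (continuous_plus (fun x => Derive_n f (S n) x * sin (INR k * x + phi)) (fun x => Derive_n f n x * (INR k * cos (INR k * x + phi)))).
      + apply (continuous_mult (Derive_n f (S n)) (fun x => sin (INR k * x + phi))); [apply f_cont|].
        apply (ex_derive_continuous (fun x => sin (INR k * x + phi)) x). auto_derive; auto.
      + apply (continuous_mult (Derive_n f n) (fun x => INR k * cos (INR k * x + phi))); [apply f_cont|].
        apply (ex_derive_continuous (fun x => INR k * cos (INR k * x + phi)) x). auto_derive; auto. }
  assert (Hz : minus (Derive_n f n PI * sin (INR k * PI + phi)) (Derive_n f n (- PI) * sin (INR k * (- PI) + phi)) = 0).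
  { change (Derive_n f n PI * sin (INR k * PI + phi) - Derive_n f n (- PI) * sin (INR k * (- PI) + phi) = 0).
    replace (INR k * PI + phi) with (INR k * - PI + phi + 2 * INR k * PI) by ring. rewrite sin_period.
    replace PI with (- PI + 2 * PI) at 1 by ring. rewrite f_per. ring. }
  rewrite Hz in H. clear Hz.
  assert (E1 : is_RInt (fun x => Derive_n f n x * cos (INR k * x + phi)) (- PI) PI (FC (Derive_n f n) phi k)).
  { apply (RInt_correct (fun x => Derive_n f n x * cos (INR k * x + phi))), cont_ex_RInt. intros y. apply hcos_cont. apply f_cont. }
  apply (is_RInt_scal _ _ _ (INR k)) in E1.
  pose proof (is_RInt_minus _ _ _ _ _ _ E1 H) as E2.
  unfold FC at 2. symmetry. apply is_RInt_unique.
  replace (INR k * FC (Derive_n f n) phi k) with (minus (scal (INR k) (FC (Derive_n f n) phi k)) 0).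
  2: { change (INR k * FC (Derive_n f n) phi k - 0 = INR k * FC (Derive_n f n) phi k). ring. }
  eapply is_RInt_ext; [|exact E2]. intros x _.
  change (INR k * (Derive_n f n x * cos (INR k * x + phi)) - (Derive_n f (S n) x * sin (INR k * x + phi) + Derive_n f n x * (INR k * cos (INR k * x + phi))) = Derive_n f (S n) x * cos (INR k * x + (phi + PI / 2))).
  replace (INR k * x + (phi + PI / 2)) with (PI / 2 + (INR k * x + phi)) by ring.
  pose proof (sin_cos (INR k * x + phi)) as Hs. rewrite Hs. ring.
Qed.

Lemma FC_decay s : exists A, forall phi k, q k ^ s * Rabs (FC f phi k) <= A.
Proof.
  assert (Hk : forall s phi k, INR k ^ s * FC f phi k = FC (Derive_n f s) (phi + INR s * (PI / 2)) k).
  { induction s0; intros phi k.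
    - simpl. rewrite Rmult_0_l, Rplus_0_r, Rmult_1_l. reflexivity.
    - simpl pow. rewrite Rmult_assoc, IHs0, FC_parts. f_equal. rewrite S_INR. ring. }
  assert (HB : forall s, exists B, forall phi k, INR k ^ s * Rabs (FC f phi k) <= B).
  { intros s0. destruct (proj2 (proj2 Hf) s0) as [M HM]. exists ((PI - - PI) * M). intros phi k.
    assert (Hp : 0 <= INR k ^ s0) by nn.
    rewrite <- (Rabs_pos_eq _ Hp), <- Rabs_mult, Hk.
    apply RInt_bound; [pose proof PI_gt_3; lra|intros y; apply hcos_cont, f_cont|].
    intros y _. rewrite Rabs_mult. specialize (HM y). pose proof (Rabs_cos_le (INR k * y + (phi + INR s0 * (PI / 2)))).
    pose proof (Rabs_pos (Derive_n f s0 y)). nra. }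
  destruct (HB s) as [B HBs]. destruct (HB O) as [B0 HB0].
  exists (2 ^ s * (B + B0)). intros phi k.
  assert (H1 : q k ^ s <= 2 ^ s * (INR k ^ s + 1 ^ s)) by (apply pow_plus_le; [apply pos_INR|lra]).
  rewrite pow1 in H1. specialize (HBs phi k). specialize (HB0 phi k). simpl in HB0. rewrite Rmult_1_l in HB0.
  apply Rle_trans with (2 ^ s * (INR k ^ s + 1) * Rabs (FC f phi k)).
  - apply Rmult_le_compat_r; [apply Rabs_pos|auto].
  - rewrite Rmult_assoc. apply Rmult_le_compat_l; [apply pow_le; lra|]. lra.
Qed.

Hypothesis Heven : forall x, f (- x) = f x.

Lemma RInt_cos_k k : (1 <= k)%nat -> RInt (fun y => cos (INR k * y)) (- PI) PI = 0.
Proof.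
  intros Hk. assert (Hk1 : 1 <= INR k) by (change 1 with (INR 1); apply le_INR; auto).
  apply is_RInt_unique.
  replace 0 with (minus (sin (INR k * PI) / INR k) (sin (INR k * (- PI)) / INR k)).
  - apply (is_RInt_derive (fun y => sin (INR k * y) / INR k)).
    + intros x _. auto_derive; auto. field. lra.
    + intros x _. apply (ex_derive_continuous (fun y => cos (INR k * y)) x). auto_derive; auto.
  - change (sin (INR k * PI) / INR k - sin (INR k * (- PI)) / INR k = 0).
    replace (INR k * PI) with (INR k * - PI + 2 * INR k * PI) by ring. rewrite sin_period. ring.
Qed.

Lemma fcont x : continuous f x.
Proof. apply (f_cont 0). Qed.

(** Translate by periodicity and expand [cos (kz - kx)]; the sine coefficient of an even function
    vanishes. *)
Lemma FC_shift k x : RInt (fun y => f (x + y) * cos (INR k * y)) (- PI) PI = cos (INR k * x) * FC f 0 k.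
Proof.
  assert (E1 : RInt (fun y => f (x + y) * cos (INR k * y)) (- PI) PI = RInt (fun z => f z * cos (INR k * z + (- (INR k * x)))) (- PI) PI).
  { rewrite <- (periodic_shift (fun z => f z * cos (INR k * z + - (INR k * x))) x).
    - apply RInt_ext. intros y _. do 2 f_equal. ring.
    - intros y. apply hcos_cont. apply fcont.
    - intros y. rewrite (proj1 Hf). f_equal.
      replace (INR k * (y + 2 * PI) + - (INR k * x)) with (INR k * y + - (INR k * x) + 2 * INR k * PI) by ring.
      apply cos_period. }
  rewrite E1.
  assert (Hs : RInt (fun z => f z * sin (INR k * z)) (- PI) PI = 0).
  { assert (Hc : forall y, continuous (fun z => f z * sin (INR k * z)) y).
    { intros y. apply (continuous_mult f (fun z => sin (INR k * z))); [apply fcont|].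
      apply (ex_derive_continuous (fun z => sin (INR k * z)) y). auto_derive; auto. }
    pose proof (RInt_reflect _ Hc) as HR.
    assert (HR2 : RInt (fun y => f (- y) * sin (INR k * - y)) (- PI) PI = - RInt (fun z => f z * sin (INR k * z)) (- PI) PI).
    { rewrite <- (RInt_opp (fun z => f z * sin (INR k * z))) by (apply cont_ex_RInt; auto).
      apply RInt_ext. intros y _. change (f (- y) * sin (INR k * - y) = - (f y * sin (INR k * y))).
      rewrite Heven. replace (INR k * - y) with (- (INR k * y)) by ring. rewrite sin_neg. ring. }
    assert (Hz : forall z : R, z = - z -> z = 0) by (intros; lra).
    apply Hz. rewrite <- HR2. symmetry. exact HR. }
  apply is_RInt_unique.
  assert (Ic : is_RInt (fun z => f z * cos (INR k * z + 0)) (- PI) PI (FC f 0 k)).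
  { apply (RInt_correct (fun z => f z * cos (INR k * z + 0))), cont_ex_RInt. intros; apply hcos_cont, fcont. }
  assert (Is : is_RInt (fun z => f z * sin (INR k * z)) (- PI) PI 0).
  { rewrite <- Hs. apply (RInt_correct (fun z => f z * sin (INR k * z))), cont_ex_RInt.
    intros y. apply (continuous_mult f (fun z => sin (INR k * z))); [apply fcont|].
    apply (ex_derive_continuous (fun z => sin (INR k * z)) y). auto_derive; auto. }
  apply (is_RInt_scal _ _ _ (cos (INR k * x))) in Ic. apply (is_RInt_scal _ _ _ (sin (INR k * x))) in Is.
  pose proof (is_RInt_plus _ _ _ _ _ _ Ic Is) as H.
  replace (cos (INR k * x) * FC f 0 k) with (plus (scal (cos (INR k * x)) (FC f 0 k)) (scal (sin (INR k * x)) 0)).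
  2: { change (cos (INR k * x) * FC f 0 k + sin (INR k * x) * 0 = cos (INR k * x) * FC f 0 k). ring. }
  eapply is_RInt_ext; [|exact H]. intros z _.
  change (cos (INR k * x) * (f z * cos (INR k * z + 0)) + sin (INR k * x) * (f z * sin (INR k * z)) = f z * cos (INR k * z + - (INR k * x))).
  rewrite Rplus_0_r. replace (INR k * z + - (INR k * x)) with (INR k * z - INR k * x) by ring. rewrite cos_minus. ring.
Qed.

Definition symdiff (x y : R) : R := (f (x + y) + f (x - y)) / 2 - f x.

Lemma comp_cont (u : R -> R) y : ex_derive u y -> continuous (fun y => f (u y)) y.
Proof. intros H. apply (continuous_comp u f); [apply (ex_derive_continuous u y H)|apply fcont]. Qed.

Lemma symdiff_cont x y : continuous (symdiff x) y.
Proof.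
  unfold symdiff.
  apply (continuous_minus (fun y => (f (x + y) + f (x - y)) / 2) (fun _ => f x)); [|apply continuous_const].
  apply (continuous_mult (fun y => f (x + y) + f (x - y)) (fun _ => / 2)); [|apply continuous_const].
  apply (continuous_plus (fun y => f (x + y)) (fun y => f (x - y))); apply comp_cont; auto_derive; auto.
Qed.

(** A symmetric second difference is [O (y ^ 2)] by two uses of the mean value inequality. It thus
    compensates the double zero of [1 - cos y] in [fejer_identity]. *)
Lemma symdiff_bound x : exists C, forall y, - PI <= y <= PI -> Rabs (symdiff x y) <= C * (1 - cos y).
Proof.
  destruct (proj2 (proj2 Hf) 2%nat) as [M HM]. exists (18 * M). intros y Hy.
  assert (HM0 : 0 <= M) by (eapply Rle_trans; [apply Rabs_pos|apply (HM 0)]).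
  assert (Hfd : forall z, is_derive f z (Derive_n f 1 z)) by (intros z; apply (f_derive 0)).
  assert (Hp : forall y, 0 <= y -> Rabs (symdiff x y) <= M * y ^ 2).
  { clear y Hy. intros y Hy.
    pose proof (deriv_dom (symdiff x) (fun y => M * y ^ 2) (fun y => (Derive_n f 1 (x + y) - Derive_n f 1 (x - y)) / 2) (fun y => M * (2 * y)) 0 y Hy) as H.
    cbv beta in H. replace (symdiff x 0) with 0 in H.
    2: { unfold symdiff. rewrite Rplus_0_r, Rminus_0_r. field. }
    rewrite Rminus_0_r in H. replace (M * y ^ 2 - M * 0 ^ 2) with (M * y ^ 2) in H by ring. apply H.
    - intros z Hz. unfold symdiff. auto_derive.
      + split; [exists (Derive_n f 1 (x + z)); apply Hfd|split; [exists (Derive_n f 1 (x - z)); apply Hfd|auto]].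
      + change (fun x0 : R => f x0) with f. replace (x + - z) with (x - z) by ring.
        rewrite (is_derive_unique f _ _ (Hfd (x + z))), (is_derive_unique f _ _ (Hfd (x - z))). field.
    - intros z Hz. auto_derive; auto. ring.
    - intros z Hz.
      assert (HL : Rabs (Derive_n f 1 (x + z) - Derive_n f 1 (x - z)) <= M * (x + z) - M * (x - z)).
      { apply (deriv_dom (Derive_n f 1) (fun t => M * t) (Derive_n f 2) (fun _ => M)); [lra| | |].
        - intros; apply (f_derive 1).
        - intros; auto_derive; auto; ring.
        - intros; apply HM. }
      unfold Rdiv. rewrite Rabs_mult, (Rabs_pos_eq (/ 2)) by lra.
      assert (0 <= M * z) by (apply Rmult_le_pos; lra). lra. }
  pose proof (cos_quadratic y Hy) as Hq.
  assert (Rabs (symdiff x y) <= M * y ^ 2); [|nra].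
  destruct (Rle_dec 0 y); [apply Hp; auto|].
  replace (symdiff x y) with (symdiff x (- y)).
  - replace (y ^ 2) with ((- y) ^ 2) by ring. apply Hp; lra.
  - unfold symdiff. replace (x + - y) with (x - y) by ring. replace (x - - y) with (x + y) by ring. field.
Qed.

Lemma symdiff_coef k x : RInt (fun y => symdiff x y * cos (INR k * y)) (- PI) PI =
  cos (INR k * x) * FC f 0 k - f x * RInt (fun y => cos (INR k * y)) (- PI) PI.
Proof.
  assert (Hcc : forall y, continuous (fun y => cos (INR k * y)) y).
  { intros y. apply (ex_derive_continuous (fun y => cos (INR k * y)) y). auto_derive; auto. }
  assert (Hc1 : forall y, continuous (fun y => f (x + y) * cos (INR k * y)) y).
  { intros y. apply (continuous_mult (fun y => f (x + y)) (fun y => cos (INR k * y))); auto. apply comp_cont; auto_derive; auto. }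
  assert (Hc2 : forall y, continuous (fun y => f (x - y) * cos (INR k * y)) y).
  { intros y. apply (continuous_mult (fun y => f (x - y)) (fun y => cos (INR k * y))); auto. apply comp_cont; auto_derive; auto. }
  assert (I1 : is_RInt (fun y => f (x + y) * cos (INR k * y)) (- PI) PI (cos (INR k * x) * FC f 0 k)).
  { rewrite <- FC_shift. apply (RInt_correct (fun y => f (x + y) * cos (INR k * y))), cont_ex_RInt; auto. }
  assert (I2 : is_RInt (fun y => f (x - y) * cos (INR k * y)) (- PI) PI (cos (INR k * x) * FC f 0 k)).
  { rewrite <- FC_shift. rewrite <- (RInt_reflect (fun y : R => f (x + y) * cos (INR k * y)) Hc1).
    eapply is_RInt_ext; [|apply (RInt_correct (fun y => f (x + - y) * cos (INR k * - y))), cont_ex_RInt].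
    - intros y _. simpl. replace (INR k * - y) with (- (INR k * y)) by ring. rewrite cos_neg. reflexivity.
    - intros y. apply (continuous_comp (fun y => - y) (fun y => f (x + y) * cos (INR k * y))); auto.
      apply (ex_derive_continuous (fun y => - y) y). auto_derive; auto. }
  assert (I3 : is_RInt (fun y => cos (INR k * y)) (- PI) PI (RInt (fun y => cos (INR k * y)) (- PI) PI)).
  { apply (RInt_correct (fun y => cos (INR k * y))), cont_ex_RInt; auto. }
  set (c := RInt (fun y => cos (INR k * y)) (- PI) PI) in *. set (v := cos (INR k * x) * FC f 0 k) in *.
  apply is_RInt_unique.
  pose proof (is_RInt_plus _ _ _ _ _ _ I1 I2) as I12. apply (is_RInt_scal _ _ _ (/ 2)) in I12.
  apply (is_RInt_scal _ _ _ (f x)) in I3. pose proof (is_RInt_minus _ _ _ _ _ _ I12 I3) as H.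
  replace (v - f x * c) with (minus (scal (/ 2) (plus v v)) (scal (f x) c)).
  2: { change (/ 2 * (v + v) - f x * c = v - f x * c). field. }
  eapply is_RInt_ext; [|exact H]. intros y _.
  change (/ 2 * (f (x + y) * cos (INR k * y) + f (x - y) * cos (INR k * y)) - f x * cos (INR k * y) = symdiff x y * cos (INR k * y)).
  unfold symdiff. field.
Qed.

Lemma RInt_dirichlet n x : is_RInt (fun y => symdiff x y * dirichlet n y) (- PI) PI
  (2 * sm (fun k => cos (INR k * x) * FC f 0 k) (S n) - FC f 0 0 - 2 * PI * f x).
Proof.
  assert (Hc : forall k y, continuous (fun y => symdiff x y * cos (INR k * y)) y).
  { intros k y. apply (continuous_mult (symdiff x) (fun y => cos (INR k * y))); [apply symdiff_cont|].
    apply (ex_derive_continuous (fun y => cos (INR k * y)) y). auto_derive; auto. }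
  pose proof (is_RInt_sm (fun k y => symdiff x y * cos (INR k * y)) (- PI) PI (S n) ltac:(intros; apply cont_ex_RInt; auto)) as H1.
  pose proof (is_RInt_sm (fun k y => symdiff x y * cos (INR k * y)) (- PI) PI 1 ltac:(intros; apply cont_ex_RInt; auto)) as H2.
  apply (is_RInt_scal _ _ _ 2) in H1. pose proof (is_RInt_minus _ _ _ _ _ _ H1 H2) as H.
  assert (E0 : RInt (fun y => cos (INR 0 * y)) (- PI) PI = 2 * PI).
  { rewrite (RInt_ext _ (fun _ => 1)) by (intros; simpl; rewrite Rmult_0_l, cos_0; auto).
    rewrite RInt_const. change ((PI - - PI) * 1 = 2 * PI). ring. }
  assert (Es : forall n, sm (fun k => RInt (fun y => symdiff x y * cos (INR k * y)) (- PI) PI) (S n) =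
     sm (fun k => cos (INR k * x) * FC f 0 k) (S n) - f x * (2 * PI)).
  { intros i. rewrite (sm_ext _ (fun k => cos (INR k * x) * FC f 0 k - f x * RInt (fun y => cos (INR k * y)) (- PI) PI)) by (intros; apply symdiff_coef).
    rewrite sm_minus. f_equal. rewrite sm_scal. f_equal. rewrite sm_head, E0.
    rewrite (sm_ext _ (fun _ => 0)) by (intros; apply RInt_cos_k; lia). rewrite sm_zero; ring. }
  replace (2 * sm (fun k => cos (INR k * x) * FC f 0 k) (S n) - FC f 0 0 - 2 * PI * f x) with
    (minus (scal 2 (sm (fun k => RInt (fun y => symdiff x y * cos (INR k * y)) (- PI) PI) (S n)))
       (sm (fun k => RInt (fun y => symdiff x y * cos (INR k * y)) (- PI) PI) 1)).
  2: { rewrite !Es. change (2 * (sm (fun k => cos (INR k * x) * FC f 0 k) (S n) - f x * (2 * PI)) - (sm (fun k => cos (INR k * x) * FC f 0 k) 1 - f x * (2 * PI)) = 2 * sm (fun k => cos (INR k * x) * FC f 0 k) (S n) - FC f 0 0 - 2 * PI * f x).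
       rewrite (sm_S _ 0). simpl (sm _ 0). simpl (INR 0). rewrite Rmult_0_l, cos_0. ring. }
  eapply is_RInt_ext; [|exact H]. intros y _.
  change (2 * sm (fun k => symdiff x y * cos (INR k * y)) (S n) - sm (fun k => symdiff x y * cos (INR k * y)) 1 = symdiff x y * dirichlet n y).
  unfold dirichlet. rewrite !sm_scal. rewrite (sm_S _ 0). simpl (sm _ 0). simpl (INR 0). rewrite Rmult_0_l, cos_0. ring.
Qed.

(* Fejer means of [symdiff x] stay bounded since [symdiff x y = O(1 - cos y)]; hence their
   Dirichlet means, which converge, converge to [0]. *)
Lemma fourier_inversion_value x :
  2 * Series (fun k => cos (INR k * x) * FC f 0 k) - FC f 0 0 - 2 * PI * f x = 0.
Proof.
  destruct (symdiff_bound x) as [C HC].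
  assert (HP := PI_gt_3).
  pose (S n := 2 * sm (fun k => cos (INR k * x) * FC f 0 k) (Datatypes.S n) - FC f 0 0 - 2 * PI * f x).
  apply (cesaro_zero S _ (2 * PI * (2 * Rabs C))).
  - unfold S. apply is_lim_seq_minus'; [|apply is_lim_seq_const].
    apply is_lim_seq_minus'; [|apply is_lim_seq_const].
    apply is_lim_seq_mult'; [apply is_lim_seq_const|].
    apply (is_lim_seq_incr_1 (sm (fun k => cos (INR k * x) * FC f 0 k))).
    apply is_series_sm, Series_correct.
    destruct (FC_decay 2) as [A HA].
    apply ex_series_dom with (fun k => A * w2 k); [apply ex_series_Aw2|].
    intros k. pose proof (bnd_w2 0 A (FC f 0) (HA 0) k) as Hk. simpl in Hk.
    rewrite Rabs_mult. pose proof (Rabs_cos_le (INR k * x)). pose proof (Rabs_pos (FC f 0 k)). nra.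
  - intros M.
    assert (HI : is_RInt (fun y => symdiff x y * sm (fun n => dirichlet n y) M) (- PI) PI (sm S M)).
    { pose proof (is_RInt_sm (fun n y => symdiff x y * dirichlet n y) (- PI) PI M) as H.
      rewrite (sm_ext _ S) in H.
      - eapply is_RInt_ext; [|apply H]; [intros y _; cbv beta; rewrite sm_scal; reflexivity|].
        intros k. eexists. apply RInt_dirichlet.
      - intros k _. apply is_RInt_unique, RInt_dirichlet. }
    replace (2 * PI * (2 * Rabs C)) with ((PI - - PI) * (2 * Rabs C)) by ring.
    apply (norm_RInt_le_const (fun y => symdiff x y * sm (fun n => dirichlet n y) M) (- PI) PI (sm S M)); auto; [lra|].
    intros y Hy. change (Rabs (symdiff x y * sm (fun n => dirichlet n y) M) <= 2 * Rabs C).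
    rewrite Rabs_mult. specialize (HC y Hy).
    pose proof (COS_bound y). pose proof (COS_bound (INR M * y)). pose proof (fejer_identity M y) as HF.
    set (P := sm (fun n => dirichlet n y) M) in *.
    apply Rle_trans with (Rabs C * ((1 - cos y) * Rabs P)).
    + rewrite <- Rmult_assoc. apply Rmult_le_compat_r; [apply Rabs_pos|]. eapply Rle_trans; [exact HC|].
      apply Rmult_le_compat_r; [lra|apply Rle_abs].
    + replace ((1 - cos y) * Rabs P) with (Rabs ((1 - cos y) * P)) by (rewrite Rabs_mult, (Rabs_pos_eq (1 - cos y)); lra).
      rewrite HF, (Rabs_pos_eq (1 - cos (INR M * y))) by lra. pose proof (Rabs_pos C). nra.
Qed.

(** Subtracting the inversion formula at 0 removes the mean, so the zero coefficient can be set to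
    0. *)
Lemma fourier_cos_series : exists c0, c0 O = 0 /\ rapid c0 /\
  forall x, f x - f 0 = cosS 0 c0 x - cosS 0 c0 0.
Proof.
  pose (c0 := fun k => match k with O => 0 | S _ => / PI * FC f 0 k end).
  assert (HP := PI_gt_3). assert (HiP : 0 < / PI) by (apply Rinv_0_lt_compat; lra).
  assert (Hr : rapid c0).
  { intros s. destruct (FC_decay s) as [A HA]. exists (/ PI * A). intros k. specialize (HA 0 k).
    destruct k; unfold c0.
    - rewrite Rabs_R0, Rmult_0_r. apply Rmult_le_pos; [lra|]. eapply Rle_trans; [|exact HA].
      apply Rmult_le_pos; [pose proof (qpow_ge1 s 0); lra|apply Rabs_pos].
    - rewrite Rabs_mult, (Rabs_pos_eq (/ PI)) by lra.
      rewrite <- Rmult_assoc, (Rmult_comm (q (S k) ^ s)), Rmult_assoc. apply Rmult_le_compat_l; lra. }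
  exists c0. split; [reflexivity|split; auto]. intros x.
  assert (Hex : forall z, ex_series (fun k => cos (INR k * z) * FC f 0 k)).
  { intros z. destruct (FC_decay 2) as [A HA].
    apply ex_series_dom with (fun k => A * w2 k); [apply ex_series_Aw2|].
    intros k. pose proof (bnd_w2 0 A (FC f 0) (HA 0) k) as Hk. simpl in Hk.
    rewrite Rabs_mult. pose proof (Rabs_cos_le (INR k * z)). pose proof (Rabs_pos (FC f 0 k)). nra. }
  assert (Hs : forall z, Series (fun k => cos (INR k * z) * FC f 0 k) = FC f 0 0 + PI * cosS 0 c0 z).
  { intros z. rewrite Series_incr_1 by apply Hex. simpl (INR 0). rewrite Rmult_0_l, cos_0, Rmult_1_l. f_equal.
    unfold cosS. destruct (Hr 2%nat) as [A HA]. rewrite (Series_incr_1 (fun k => c0 k * cos (INR k * z + 0))) by (eapply cosS_ex; eauto).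
    replace (c0 O) with 0 by reflexivity. rewrite Rmult_0_l, Rplus_0_l. rewrite <- Series_scal_l.
    apply Series_ext. intros k. unfold c0. rewrite Rplus_0_r. field. lra. }
  pose proof (fourier_inversion_value x) as H1. pose proof (fourier_inversion_value 0) as H2.
  rewrite Hs in H1, H2.
  assert (2 * PI * (f x - f 0) = 2 * PI * (cosS 0 c0 x - cosS 0 c0 0)) by lra.
  apply Rmult_eq_reg_l with (2 * PI); lra.
Qed.
End Inversion.

(** * Monotone profiles *)

Definition sinS (a : nat -> R) (x : R) : R := Series (fun k => a k * sin (INR k * x)).

Lemma cosS_sinS a x : cosS (PI / 2) a x = - sinS a x.
Proof.
  unfold cosS, sinS. rewrite <- Series_opp. apply Series_ext. intros k.
  replace (INR k * x + PI / 2) with (PI / 2 + INR k * x) by ring.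
  rewrite (sin_cos (INR k * x)). ring.
Qed.

Lemma sinS_cosS a x : sinS a x = cosS (- (PI / 2)) a x.
Proof.
  unfold cosS, sinS. apply Series_ext. intros k. f_equal.
  rewrite <- cos_shift. rewrite <- (cos_neg (PI / 2 - INR k * x)). f_equal. ring.
Qed.

Lemma sinS_derive a x : rapid a -> is_derive (sinS a) x (cosS 0 (fun k => INR k * a k) x).
Proof.
  intros Ha. apply is_derive_ext with (cosS (- (PI / 2)) a); [intros; symmetry; apply sinS_cosS|].
  replace 0 with (- (PI / 2) + PI / 2) by ring. apply cosS_derive; auto.
Qed.

Lemma cos0S_derive a x : rapid a -> is_derive (cosS 0 a) x (- sinS (fun k => INR k * a k) x).
Proof.
  intros Ha. rewrite <- cosS_sinS. replace (PI / 2) with (0 + PI / 2) by ring. apply cosS_derive; auto.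
Qed.

Lemma sinS_bound a A x : bnd 2 A a -> Rabs (sinS a x) <= 2 * A.
Proof. rewrite sinS_cosS. apply cosS_bound. Qed.

Lemma sin_k_PI k : sin (INR k * PI) = 0.
Proof. apply sin_eq_0_1. exists (Z.of_nat k). rewrite <- INR_IZR_INZ. reflexivity. Qed.

Lemma sinS_0 a : sinS a 0 = 0.
Proof.
  unfold sinS. rewrite (Series_ext _ (fun k => 0 * 0)); [rewrite Series_scal_l; ring|].
  intros k. rewrite Rmult_0_r, sin_0. ring.
Qed.

Lemma sinS_PI a : sinS a PI = 0.
Proof.
  unfold sinS. rewrite (Series_ext _ (fun k => 0 * 0)); [rewrite Series_scal_l; ring|].
  intros k. rewrite sin_k_PI. ring.
Qed.

Lemma cosS_even a x : cosS 0 a (- x) = cosS 0 a x.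
Proof.
  apply Series_ext. intros k. rewrite !Rplus_0_r.
  replace (INR k * - x) with (- (INR k * x)) by ring. rewrite cos_neg; reflexivity.
Qed.

Lemma periodic_nat f n x : periodic2pi f -> f (x + 2 * PI * INR n) = f x.
Proof.
  intros H. induction n.
  - simpl. f_equal; ring.
  - rewrite S_INR. replace (x + 2 * PI * (INR n + 1)) with (x + 2 * PI * INR n + 2 * PI) by ring. rewrite H; auto.
Qed.

Lemma even_periodic_reduce f x : periodic2pi f -> (forall y, f (- y) = f y) -> exists y, 0 <= y <= PI /\ f x = f y.
Proof.
  intros Hp He. pose proof PI_gt_3.
  assert (Hpos : forall x, 0 <= x -> exists y, 0 <= y <= PI /\ f x = f y).
  { clear x. intros x Hx. destruct (nfl_spec (2 * PI) x ltac:(lra) Hx) as [H1 H2].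
    set (n := nfl (2 * PI) x) in *. set (z := x - 2 * PI * INR n).
    assert (Hz : f x = f z).
    { rewrite <- (periodic_nat f n z Hp). f_equal. unfold z; ring. }
    assert (0 <= z < 2 * PI) by (unfold z; lra).
    destruct (Rle_dec z PI); [exists z; split; auto; lra|].
    exists (2 * PI - z). split; [lra|]. rewrite Hz, <- He, <- Hp. f_equal. ring. }
  destruct (Rle_dec 0 x); [auto|]. rewrite <- He. apply Hpos. lra.
Qed.

(** For a bounded function the supremum is finite, so [real] does not return its default. *)
Lemma Linf_spec f M : (forall x, Rabs (f x) <= M) -> (forall x, Rabs (f x) <= Linf f) /\ Linf f <= M.
Proof.
  intros HM. unfold Linf. destruct (Lub_Rbar_correct (fun y => exists x, y = Rabs (f x))) as [H1 H2].
  assert (Hle : Rbar_le (Lub_Rbar (fun y => exists x, y = Rabs (f x))) M).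
  { apply H2. intros y [x ->]. apply HM. }
  pose proof (H1 (Rabs (f 0)) (ex_intro _ 0 eq_refl)) as Hge.
  destruct (Lub_Rbar _) as [l| |]; simpl in *; try contradiction.
  split; auto. intros x. apply (H1 (Rabs (f x)) (ex_intro _ x eq_refl)).
Qed.

Lemma Linf_lip f h M d : (forall x, Rabs (f x) <= M) -> (forall x, Rabs (h x) <= M) ->
  (forall x, Rabs (f x - h x) <= d) -> Rabs (Linf f - Linf h) <= d.
Proof.
  assert (Hone : forall f h M d, (forall x, Rabs (f x) <= M) -> (forall x, Rabs (h x) <= M) ->
    (forall x, Rabs (f x - h x) <= d) -> Linf f <= Linf h + d).
  { clear. intros f h M d Hf Hh Hd. apply (proj2 (Linf_spec f (Linf h + d) ltac:(
      intros x; pose proof (proj1 (Linf_spec h M Hh) x); specialize (Hd x);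
      replace (f x) with (h x + (f x - h x)) by ring; eapply Rle_trans; [apply Rabs_triang|]; lra))). }
  intros Hf Hh Hd. apply Rabs_le. split.
  - pose proof (Hone h f M d Hh Hf ltac:(intros x; rewrite Rabs_minus_sym; auto)). lra.
  - pose proof (Hone f h M d Hf Hh Hd). lra.
Qed.

(** * Profiles with rapidly decaying coefficients *)

Section Profile.
Variables (a g : R) (c : nat -> R).
Hypothesis Ha : 0 < a.
Hypothesis Hg : 0 < g.
Hypothesis Hc : rapid c.
Hypothesis Hc0 : c O = 0.

Definition prof (x : R) : R := cosS 0 c x - cosS 0 c 0.
(** [H_a] of the profile on the Fourier side; [Ha_prof] identifies it with the principal value. *)
Definition vel (x : R) : R := sinS (fun k => mk a k * c k) x.
Definition slope (x : R) : R := - sinS (fun k => INR k * c k) x.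
(** Time derivative of the profile when its coefficients follow [Bser]. *)
Definition rate (x : R) : R := cosS 0 (Bser g (mk a) c c) x - cosS 0 (Bser g (mk a) c c) 0.

Lemma prof_derive x : is_derive prof x (slope x).
Proof. apply is_derive_minus_const. apply cos0S_derive; auto. Qed.

Lemma prof_even x : prof (- x) = prof x.
Proof. unfold prof. rewrite cosS_even; auto. Qed.

Lemma prof_per : periodic2pi prof.
Proof. intros x. unfold prof. rewrite cosS_period; auto. Qed.

Lemma prof_0 : prof 0 = 0.
Proof. unfold prof; ring. Qed.

Lemma mc_rapid : rapid (fun k => mk a k * c k).
Proof. apply rapid_mul with 2; auto. intros k. apply mk_bound; auto. Qed.

Lemma rate_eq x : rate x = - (g * vel x * slope x).
Proof.
  unfold rate. rewrite (transport_identity g (mk a) Hg (mk_bound a Ha) c Hc Hc0 x).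
  unfold vel, slope, sinS. ring.
Qed.

Lemma Bser_rapid : rapid (Bser g (mk a) c c).
Proof.
  intros s. destruct (Hc (s + 3)%nat) as [A HA]. exists (8 * 2 ^ s * g * (A * A)).
  apply Bser_bnd; auto. apply mk_bound; auto. apply bnd_le with (s + 3)%nat A; auto; [lia|lra].
Qed.

Lemma prof_antisym x y : prof (x - y) - prof (x + y) = oddS (fun k => c k * sin (INR k * x)) y.
Proof.
  unfold prof, oddS, cosS. destruct (Hc 2%nat) as [A HA].
  replace (Series (fun k => c k * cos (INR k * (x - y) + 0)) - Series (fun k => c k * cos (INR k * 0 + 0)) -
    (Series (fun k => c k * cos (INR k * (x + y) + 0)) - Series (fun k => c k * cos (INR k * 0 + 0)))) with
    (Series (fun k => c k * cos (INR k * (x - y) + 0)) - Series (fun k => c k * cos (INR k * (x + y) + 0))) by ring.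
  rewrite <- Series_minus; try (eapply cosS_ex; eauto).
  apply Series_ext. intros k. rewrite !Rplus_0_r, Rmult_minus_distr_l, Rmult_plus_distr_l, cos_minus, cos_plus. ring.
Qed.

(** Expresses the derivative of the velocity as a singular integral of the slope, the form in which
    [velx_log] can use a bound on the slope. *)
Lemma slope_antisym x y : slope (x - y) - slope (x + y) = oddS (fun k => INR k * c k * cos (INR k * x)) y.
Proof.
  unfold slope, oddS, sinS. destruct (rapid_kmul c Hc 2%nat) as [A HA].
  assert (Hex : forall z, ex_series (fun k => INR k * c k * sin (INR k * z))).
  { intros z. pose proof (cosS_ex (- (PI / 2)) _ A z HA) as H. eapply ex_series_ext; [|exact H].
    intros k. simpl. f_equal. rewrite <- cos_shift, <- (cos_neg (PI / 2 - INR k * z)). f_equal; ring. }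
  replace (- Series (fun k => INR k * c k * sin (INR k * (x - y))) - - Series (fun k => INR k * c k * sin (INR k * (x + y)))) with
    (Series (fun k => INR k * c k * sin (INR k * (x + y))) - Series (fun k => INR k * c k * sin (INR k * (x - y)))) by ring.
  rewrite <- Series_minus by auto.
  apply Series_ext. intros k. rewrite Rmult_minus_distr_l, Rmult_plus_distr_l, sin_minus, sin_plus. ring.
Qed.

Lemma bnd_trig s A (d e : nat -> R) : (forall k, Rabs (e k) <= 1) -> bnd s A d -> bnd s A (fun k => d k * e k).
Proof.
  intros He Hd. apply bnd_ext with (fun k => e k * d k); [intros; ring|].
  replace A with (1 * A) by ring. apply bnd_mul; auto. lra.
Qed.

Lemma Rabs_sin_1 z : Rabs (sin z) <= 1.
Proof. apply Rabs_le. pose proof (SIN_bound z). lra. Qed.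

Lemma prof_bounded : exists M, forall x, Rabs (prof x) <= M.
Proof.
  destruct (Hc 2%nat) as [A HA]. exists (4 * A). intros x. unfold prof.
  eapply Rle_trans; [apply Rabs_triang|]. rewrite Rabs_Ropp.
  pose proof (cosS_bound 0 c A x HA). pose proof (cosS_bound 0 c A 0 HA). lra.
Qed.

Lemma prof_cont x : continuous prof x.
Proof. apply (ex_derive_continuous prof x). exists (slope x). apply prof_derive. Qed.

Lemma vel_close A x al be : bnd 3 A c -> 0 < al <= be ->
  Rabs (RInt (fun y => (prof (x - y) - prof (x + y)) * Ka a y) al be - vel x) <= 4 * A * (al + a ^ 2 / 2 / be ^ 2).
Proof.
  intros HA Hab.
  rewrite (RInt_ext _ (fun y => oddS (fun k => c k * sin (INR k * x)) y * Ka a y)) by (intros; rewrite prof_antisym; auto).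
  unfold vel, sinS. rewrite (Series_ext _ (fun k => c k * sin (INR k * x) * mk a k)) by (intros; ring).
  apply oddS_close; auto. apply bnd_trig; auto. intros; apply Rabs_sin_1.
Qed.

Lemma Ha_prof x : is_Ha a prof x (vel x).
Proof.
  destruct (Hc 3%nat) as [A HA]. destruct prof_bounded as [M HM].
  apply (Ha_limit a Ha prof x (vel x) M (4 * A)); auto.
  - intros; apply prof_cont.
  - intros al be Hab. apply vel_close; auto.
Qed.
End Profile.

(** * Evolution of the slope and propagation of monotonicity *)

Section Evolution.
Variables (a g : R).
Hypothesis Ha : 0 < a.
Hypothesis Hg : 0 < g.
Variable Tm : R.
Variable c : R -> nat -> R.
Hypothesis Hub : ubnd Tm c.
Hypothesis Hc0 : forall t, t < Tm -> c t O = 0.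
Hypothesis Hder : forall t k, 0 < t < Tm -> is_derive (fun s => c s k) t (Bser g (mk a) (c t) (c t) k).
Hypothesis Hlip : forall T1, T1 < Tm -> forall s, exists A, 0 <= A /\
  forall t t', t <= T1 -> t' <= T1 -> bnd s (A * Rabs (t' - t)) (fun k => c t' k - c t k).

Lemma crapid t : t < Tm -> rapid (c t).
Proof. intros; eapply ubnd_rapid; eauto. Qed.

Lemma slope_pdx t x : t < Tm -> pdx (rho c) t x = slope (c t) x.
Proof. intros Ht. apply is_derive_unique, prof_derive, crapid; auto. Qed.

Lemma rho_t t x : 0 < t < Tm -> is_derive (fun s => rho c s x) t (- (g * vel a (c t) x * slope (c t) x)).
Proof.
  intros Ht. rewrite <- (rate_eq a g (c t) Ha Hg (crapid t ltac:(lra)) (Hc0 t ltac:(lra)) x).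
  apply (pdt_rho g (mk a) Hg (mk_bound a Ha) Tm c Hub Hder t x Ht).
Qed.

Lemma slope_lip T1 : T1 < Tm -> exists A, 0 <= A /\ forall t t' x, t <= T1 -> t' <= T1 ->
  Rabs (slope (c t') x - slope (c t) x) <= A * Rabs (t' - t).
Proof.
  intros HT. destruct (Hlip T1 HT 3%nat) as [A [HA0 HA]]. exists (2 * A). split; [lra|].
  intros t t' x Ht Ht'. specialize (HA t t' Ht Ht'). apply bnd_kmul in HA.
  pose proof (sinS_bound _ _ x HA) as HB.
  replace (slope (c t') x - slope (c t) x) with (- sinS (fun k => INR k * (c t' k - c t k)) x).
  - rewrite Rabs_Ropp. lra.
  - unfold slope. rewrite !sinS_cosS.
    rewrite (cosS_ext _ (fun k => INR k * (c t' k - c t k)) (fun k => INR k * c t' k + -1 * (INR k * c t k))) by (intros; ring).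
    rewrite cosS_plus.
    + rewrite cosS_scal. ring.
    + apply rapid_kmul, crapid; lra.
    + apply rapid_scal, rapid_kmul, crapid; lra.
Qed.

Lemma slope_bound T1 : T1 < Tm -> exists M, forall t x, t <= T1 -> Rabs (slope (c t) x) <= M.
Proof.
  intros HT. destruct (Hub T1 HT 3%nat) as [A HA]. exists (2 * A). intros t x Ht.
  unfold slope. rewrite Rabs_Ropp. apply sinS_bound, bnd_kmul. auto.
Qed.

(** The slope is Lipschitz in time uniformly in [x], and this passes to its supremum; it makes the
    norm integrable in time. *)
Lemma Linf_cont t : t < Tm -> continuous (fun s => Linf (pdx (rho c) s)) t.
Proof.
  intros Ht. assert (HT : (t + Tm) / 2 < Tm) by lra.
  destruct (slope_lip _ HT) as [A [HA0 HA]]. destruct (slope_bound _ HT) as [M HM].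
  apply filterlim_locally_R; [apply locally_filter|]. intros eps He.
  assert (Hd : 0 < Rmin ((Tm - t) / 2) (eps / (A + 1))).
  { apply Rmin_pos; [lra|apply Rdiv_lt_0_compat; lra]. }
  exists (mkposreal _ Hd). intros s Hs. change (Rabs (s - t) < Rmin ((Tm - t) / 2) (eps / (A + 1))) in Hs.
  assert (H1 : Rabs (s - t) < (Tm - t) / 2) by (eapply Rlt_le_trans; [exact Hs|apply Rmin_l]).
  assert (H2 : Rabs (s - t) < eps / (A + 1)) by (eapply Rlt_le_trans; [exact Hs|apply Rmin_r]).
  apply Rmult_lt_compat_r with (r := A + 1) in H2; [|lra].
  replace (eps / (A + 1) * (A + 1)) with eps in H2 by (field; lra).
  apply Rabs_def2 in H1.
  assert (Hs' : s < Tm) by lra.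
  eapply Rle_lt_trans.
  - apply (Linf_lip _ _ M (A * Rabs (s - t))).
    + intros x. rewrite slope_pdx by auto. apply HM; lra.
    + intros x. rewrite slope_pdx by auto. apply HM; lra.
    + intros x. rewrite !slope_pdx by auto. apply HA; lra.
  - pose proof (Rabs_pos (s - t)). nra.
Qed.

Lemma Linf_slope t x : t < Tm -> Rabs (slope (c t) x) <= Linf (pdx (rho c) t).
Proof.
  intros Ht. destruct (slope_bound t Ht) as [M HM]. rewrite <- slope_pdx by auto.
  apply (proj1 (Linf_spec (pdx (rho c) t) M ltac:(intros y; rewrite slope_pdx by auto; apply HM; lra))).
Qed.

Lemma ex_RInt_Linf t : 0 <= t < Tm -> ex_RInt (fun s => Linf (pdx (rho c) s)) 0 t.
Proof.
  intros Ht. apply (@ex_RInt_continuous R_CompleteNormedModule). intros z Hz.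
  rewrite Rmin_left, Rmax_right in Hz by lra. apply Linf_cont. lra.
Qed.

Definition velx (t x : R) : R := cosS 0 (fun k => INR k * (mk a k * c t k)) x.
Definition curv (t x : R) : R := - cosS 0 (fun k => INR k * (INR k * c t k)) x.

Lemma vel_derive t x : t < Tm -> is_derive (vel a (c t)) x (velx t x).
Proof. intros Ht. apply sinS_derive. apply mc_rapid; auto. apply crapid; auto. Qed.

Lemma slope_derive t x : t < Tm -> is_derive (slope (c t)) x (curv t x).
Proof.
  intros Ht. apply (is_derive_opp (sinS (fun k => INR k * c t k))). apply sinS_derive. apply rapid_kmul, crapid; auto.
Qed.

(** Both sides are the derivative of [rate] in [x], computed once from its series and once from
    [rate_eq] by the product rule. *)
Lemma rate_x t x : t < Tm ->
  - sinS (fun k => INR k * Bser g (mk a) (c t) (c t) k) x =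
  - (g * (velx t x * slope (c t) x + vel a (c t) x * curv t x)).
Proof.
  intros Ht. pose proof (crapid t Ht) as Hr. pose proof (Bser_rapid a g (c t) Ha Hg Hr) as HBr.
  assert (H1 : is_derive (rate a g (c t)) x (- sinS (fun k => INR k * Bser g (mk a) (c t) (c t) k) x)).
  { apply is_derive_minus_const, cos0S_derive; auto. }
  assert (H2 : is_derive (rate a g (c t)) x (- (g * (velx t x * slope (c t) x + vel a (c t) x * curv t x)))).
  { apply is_derive_ext with (fun y => - (g * (vel a (c t) y * slope (c t) y))).
    - intros y. rewrite <- Rmult_assoc. symmetry. apply (rate_eq a g (c t) Ha Hg Hr (Hc0 t Ht)).
    - apply (is_derive_opp (fun y => g * (vel a (c t) y * slope (c t) y))).
      apply (is_derive_scal (fun y => vel a (c t) y * slope (c t) y)).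
      apply (is_derive_mult (vel a (c t)) (slope (c t))); [apply vel_derive; lra|apply slope_derive; lra|intros; apply Rmult_comm]. }
  rewrite <- (is_derive_unique _ _ _ H1). apply is_derive_unique; auto.
Qed.

Lemma slope_t t x : 0 < t < Tm ->
  is_derive (fun s => slope (c s) x) t (- (g * (velx t x * slope (c t) x + vel a (c t) x * curv t x))).
Proof.
  intros Ht. rewrite <- rate_x by lra.
  apply (is_derive_opp (fun s => sinS (fun k => INR k * c s k) x)).
  apply is_derive_ext with (fun s => cosS (- (PI / 2)) (fun k => INR k * c s k) x); [intros; symmetry; apply sinS_cosS|].
  rewrite sinS_cosS.
  assert (HuB : ubnd Tm (fun t => Bser g (mk a) (c t) (c t))) by (apply ubnd_Bser; auto; apply mk_bound; auto).
  assert (Hk : forall b, ubnd Tm b -> ubnd Tm (fun t k => INR k * b t k)).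
  { intros b Hb T1 HT s. destruct (Hb T1 HT (S s)) as [A HA]. exists A. intros u Hu. apply bnd_kmul; auto. }
  apply (cosS_derive_t Tm (- (PI / 2)) (fun s k => INR k * c s k) (fun t k => INR k * Bser g (mk a) (c t) (c t) k) t x); auto.
  intros s k Hs. apply (is_derive_scal (fun s => c s k)). auto.
Qed.

Lemma velx_bound T1 : T1 < Tm -> exists L, forall t x, t <= T1 -> Rabs (velx t x) <= L.
Proof.
  intros HT. destruct (Hub T1 HT 3%nat) as [A HA]. exists (2 * (2 * A)). intros t x Ht.
  apply cosS_bound, bnd_kmul, bnd_mul; auto; [|lra]. intros; apply mk_bound; auto.
Qed.

Lemma derive_pos_left (f : R -> R) t d : is_derive f t d -> 0 < d -> 0 < t -> exists s, 0 < s < t /\ f s < f t.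
Proof.
  intros Hd Hp Ht. apply is_derive_Reals in Hd.
  destruct (Hd (d / 2) ltac:(lra)) as [de Hde]. pose proof (cond_pos de).
  pose (h := - (Rmin (de / 2) (t / 2))).
  assert (Hh : 0 < - h /\ - h <= de / 2 /\ - h <= t / 2).
  { unfold h. rewrite Ropp_involutive. split; [apply Rmin_pos; lra|split; [apply Rmin_l|apply Rmin_r]]. }
  specialize (Hde h ltac:(lra) ltac:(rewrite Rabs_left; lra)). apply Rabs_def2 in Hde.
  exists (t + h). split; [lra|].
  assert (Hq : 0 < (f (t + h) - f t) / h) by lra.
  assert ((f (t + h) - f t) / h * h < 0) by nra.
  replace ((f (t + h) - f t) / h * h) with (f (t + h) - f t) in H0 by (field; lra). lra.
Qed.

Hypothesis Hinit : forall x, 0 <= x <= PI -> 0 <= slope (c 0) x.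

(* Minimum principle for the slope: at a negative minimum of [exp (- la t) * slope] over
   space and past times the transport term vanishes and the time derivative is positive. *)
Lemma slope_nonneg t x : 0 <= t < Tm -> 0 <= x <= PI -> 0 <= slope (c t) x.
Proof.
  intros Ht Hx. apply Rnot_lt_le. intros Hneg. pose proof PI_gt_3 as HPI.
  destruct (velx_bound t ltac:(lra)) as [L HL].
  (* Larger than [g |velx|] up to time [t], so that after weighting the zeroth-order coefficient
     [- g velx - la] is negative. *)
  pose (la := g * Rabs L + 1).
  assert (Hmin : forall s, exists y, s < Tm -> 0 <= y <= PI /\ forall z, 0 <= z <= PI -> slope (c s) y <= slope (c s) z).
  { intros s. destruct (Rlt_dec s Tm) as [Hs|Hs]; [|exists 0; intros; lra].
    destruct (continuity_ab_min (slope (c s)) 0 PI ltac:(lra)) as [y [Hy1 Hy2]].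
    - intros z _. apply continuity_pt_filterlim, (ex_derive_continuous (slope (c s)) z).
      exists (curv s z). apply slope_derive; auto.
    - exists y. intros _. split; auto. }
  assert (HX : exists X, forall s, s < Tm -> 0 <= X s <= PI /\ forall z, 0 <= z <= PI -> slope (c s) (X s) <= slope (c s) z).
  { exists (fun s => proj1_sig (constructive_indefinite_description _ (Hmin s))).
    intros s. exact (proj2_sig (constructive_indefinite_description _ (Hmin s))). }
  destruct HX as [X HX]. clear Hmin.
  pose (mn s := slope (c s) (X s)).
  (* The minimiser [X] may jump, but a minimum of functions Lipschitz in time, uniformly in [x], is
     continuous. *)
  assert (Hmc : forall s, s < Tm -> continuous mn s).
  { intros s Hs. assert (HT : (s + Tm) / 2 < Tm) by lra.
    destruct (slope_lip _ HT) as [A [HA0 HA]].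
    apply filterlim_locally_R; [apply locally_filter|]. intros eps He.
    assert (Hd : 0 < Rmin ((Tm - s) / 2) (eps / (A + 1))).
    { apply Rmin_pos; [lra|apply Rdiv_lt_0_compat; lra]. }
    exists (mkposreal _ Hd). intros r Hr. change (Rabs (r - s) < Rmin ((Tm - s) / 2) (eps / (A + 1))) in Hr.
    assert (H1 : Rabs (r - s) < (Tm - s) / 2) by (eapply Rlt_le_trans; [exact Hr|apply Rmin_l]).
    assert (H2 : Rabs (r - s) < eps / (A + 1)) by (eapply Rlt_le_trans; [exact Hr|apply Rmin_r]).
    apply Rmult_lt_compat_r with (r := A + 1) in H2; [|lra].
    replace (eps / (A + 1) * (A + 1)) with eps in H2 by (field; lra).
    apply Rabs_def2 in H1.
    destruct (HX s Hs) as [Xs1 Xs2]. destruct (HX r ltac:(lra)) as [Xr1 Xr2].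
    pose proof (HA s r (X s) ltac:(lra) ltac:(lra)) as B1. pose proof (HA s r (X r) ltac:(lra) ltac:(lra)) as B2.
    specialize (Xs2 (X r) Xr1). specialize (Xr2 (X s) Xs1).
    apply Rabs_le_between in B1. apply Rabs_le_between in B2. pose proof (Rabs_pos (r - s)).
    unfold mn. apply Rabs_def1; nra. }
  pose (ph s := exp (- la * s) * mn s).
  destruct (continuity_ab_min ph 0 t ltac:(lra)) as [t0 [Ht01 Ht02]].
  { intros s Hs. apply continuity_pt_filterlim.
    apply (continuous_mult (fun s => exp (- la * s)) mn); [|apply Hmc; lra].
    apply (ex_derive_continuous (fun s => exp (- la * s)) s). auto_derive; auto. }
  assert (Hpt : ph t0 < 0).
  { eapply Rle_lt_trans; [apply (Ht01 t); lra|]. unfold ph, mn.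
    pose proof (exp_pos (- la * t)). destruct (HX t ltac:(lra)) as [_ H2]. specialize (H2 x Hx). nra. }
  destruct (HX t0 ltac:(lra)) as [X1 X2].
  assert (Hm0 : slope (c t0) (X t0) < 0).
  { unfold ph, mn in Hpt. pose proof (exp_pos (- la * t0)). nra. }
  assert (Ht0 : 0 < t0).
  { destruct (Req_dec t0 0) as [E|E]; [|lra]. rewrite E in Hm0, X1. pose proof (Hinit (X 0) X1). lra. }
  (* The slope vanishes at 0 and at [PI], so a negative minimum is interior and its [x]-derivative
     is 0. *)
  assert (Hint : 0 < X t0 < PI).
  { split.
    - destruct (Req_dec (X t0) 0) as [E|E]; [|lra]. rewrite E in Hm0. unfold slope in Hm0. rewrite sinS_0 in Hm0. lra.
    - destruct (Req_dec (X t0) PI) as [E|E]; [|lra]. rewrite E in Hm0. unfold slope in Hm0. rewrite sinS_PI in Hm0. lra. }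
  assert (Hcurv : curv t0 (X t0) = 0).
  { pose proof (slope_derive t0 (X t0) ltac:(lra)) as Hd. apply is_derive_Reals in Hd.
    pose (pr := exist (fun l => derivable_pt_abs (slope (c t0)) (X t0) l) _ Hd : derivable_pt (slope (c t0)) (X t0)).
    rewrite <- (deriv_minimum (slope (c t0)) 0 PI (X t0) pr); [reflexivity|lra|lra|].
    intros z Hz1 Hz2. apply X2. lra. }
  set (x0 := X t0) in *.
  pose proof (slope_t t0 x0 ltac:(lra)) as Hst. rewrite Hcurv in Hst.
  assert (Hd : is_derive (fun s => exp (- la * s) * slope (c s) x0) t0
     (exp (- la * t0) * (- (g * velx t0 x0) - la) * slope (c t0) x0)).
  { replace (exp (- la * t0) * (- (g * velx t0 x0) - la) * slope (c t0) x0) with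
      (- la * exp (- la * t0) * slope (c t0) x0 + exp (- la * t0) * - (g * (velx t0 x0 * slope (c t0) x0 + vel a (c t0) x0 * 0))) by ring.
    apply (is_derive_mult (fun s => exp (- la * s)) (fun s => slope (c s) x0)); [|exact Hst|intros; apply Rmult_comm].
    auto_derive; auto. ring. }
  apply derive_pos_left in Hd; auto.
  - destruct Hd as [s [Hs1 Hs2]].
    specialize (Ht01 s ltac:(lra)). unfold ph, mn in Ht01. fold x0 in Ht01.
    destruct (HX s ltac:(lra)) as [_ H2]. specialize (H2 x0 ltac:(lra)).
    pose proof (exp_pos (- la * s)). nra.
  - specialize (HL t0 x0 ltac:(lra)). pose proof (Rle_abs L). pose proof (Rle_abs (- velx t0 x0)) as Hv. rewrite Rabs_Ropp in Hv.
    pose proof (exp_pos (- la * t0)).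
    assert (Hq : - (g * velx t0 x0) - la < 0) by (unfold la; nra).
    assert (0 < (- (g * velx t0 x0) - la) * slope (c t0) x0) by nra.
    rewrite Rmult_assoc. apply Rmult_lt_0_compat; auto.
Qed.

Lemma prof_mono t x y : 0 <= t < Tm -> 0 <= x <= y -> y <= PI -> prof (c t) x <= prof (c t) y.
Proof.
  intros Ht Hxy Hy. apply (incr_of_deriv (prof (c t)) (slope (c t))); [lra| |].
  - intros z Hz. apply prof_derive, crapid; lra.
  - intros z Hz. apply slope_nonneg; auto; lra.
Qed.

Lemma prof_nonneg t x : 0 <= t < Tm -> 0 <= prof (c t) x.
Proof.
  intros Ht. destruct (even_periodic_reduce (prof (c t)) x (prof_per (c t)) (prof_even (c t))) as [y [Hy ->]].
  rewrite <- (prof_0 (c t)). apply prof_mono; auto; lra.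
Qed.
End Evolution.

Lemma RInt_nonneg (f : R -> R) al be : al <= be -> ex_RInt f al be ->
  (forall x, al <= x <= be -> 0 <= f x) -> 0 <= RInt f al be.
Proof. intros H1 H2 H3. apply RInt_ge_0; auto. intros x Hx. apply H3; lra. Qed.

Lemma RInt_ge_const (f : R -> R) al be m : al <= be -> ex_RInt f al be ->
  (forall x, al <= x <= be -> m <= f x) -> (be - al) * m <= RInt f al be.
Proof.
  intros H1 H2 H3. pose proof (RInt_le (fun _ => m) f al be H1) as H.
  rewrite RInt_const in H. change (scal (be - al) m) with ((be - al) * m) in H. apply H; auto.
  - apply ex_RInt_const.
  - intros x Hx. apply H3; lra.
Qed.

Lemma RInt_ge_sub (f : R -> R) al be s1 s2 m : al <= s1 -> s1 <= s2 -> s2 <= be ->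
  (forall x, al <= x <= be -> continuous f x) -> (forall x, al <= x <= be -> 0 <= f x) ->
  (forall x, s1 <= x <= s2 -> m <= f x) -> (s2 - s1) * m <= RInt f al be.
Proof.
  intros H1 H2 H3 Hc Hp Hm.
  assert (Hex : forall u v, al <= u -> u <= v -> v <= be -> ex_RInt f u v).
  { intros u v Hu Huv Hv. apply (@ex_RInt_continuous R_CompleteNormedModule). intros z Hz.
    rewrite Rmin_left, Rmax_right in Hz by lra. apply Hc; lra. }
  pose proof (RInt_Chasles_R f al s1 be ltac:(apply Hex; lra) ltac:(apply Hex; lra)) as E1.
  pose proof (RInt_Chasles_R f s1 s2 be ltac:(apply Hex; lra) ltac:(apply Hex; lra)) as E2.
  pose proof (RInt_nonneg f al s1 H1 ltac:(apply Hex; lra) ltac:(intros; apply Hp; lra)).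
  pose proof (RInt_nonneg f s2 be H3 ltac:(apply Hex; lra) ltac:(intros; apply Hp; lra)).
  pose proof (RInt_ge_const f s1 s2 m H2 ltac:(apply Hex; lra) Hm). lra.
Qed.

(** * Finite time blow-up *)

(** In [block0_lower] an interval of length [mu x] meets a folded kernel of at least
    [2/3 Ka (2 mu x)]. The product is a third of [y Ka y] at [y = 2 mu x <= PI / 2], and [y Ka y]
    decreases. *)
Definition kap0 (a : R) : R := / 3 * (PI / 2 * Ka a (PI / 2)).

Lemma kap0_pos a : 0 < a -> 0 < kap0 a.
Proof.
  intros Ha. unfold kap0. pose proof PI_gt_3. pose proof (Ka_pos a Ha (PI / 2) ltac:(lra)).
  apply Rmult_lt_0_compat; [lra|]. apply Rmult_lt_0_compat; lra.
Qed.

(** * Lower bound on the velocity of a monotone even profile *)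

Section VelocityBound.
Variables (a : R) (c : nat -> R).
Hypothesis Ha : 0 < a.
Hypothesis Hc : rapid c.
Hypothesis Hmono : forall x y, 0 <= x <= y -> y <= PI -> prof c x <= prof c y.

Variable x : R.
Hypothesis Hx : 0 < x < PI.

(** [- H_a rho x] is the integral of [Dx y * Ka a y] over [y > 0]. *)
Definition Dx (y : R) : R := prof c (x + y) - prof c (x - y).

(** Fold both points into [[0, PI]] by evenness and periodicity: [|x - y|] lies to the left of the
    image of [x + y]. *)
Lemma Dx_nonneg y : 0 <= y <= PI -> 0 <= Dx y.
Proof.
  intros Hy. unfold Dx.
  assert (H1 : prof c (x - y) = prof c (Rabs (x - y))).
  { destruct (Rle_dec 0 (x - y)); [rewrite Rabs_pos_eq by lra; auto|].
    rewrite Rabs_left by lra. symmetry; apply prof_even. }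
  assert (Ha1 : 0 <= Rabs (x - y) <= x + y /\ Rabs (x - y) <= 2 * PI - (x + y) /\ Rabs (x - y) <= PI).
  { split; [split; [apply Rabs_pos|]|split]; unfold Rabs; destruct (Rcase_abs (x - y)); lra. }
  rewrite H1. destruct (Rle_dec (x + y) PI).
  - pose proof (Hmono (Rabs (x - y)) (x + y) ltac:(lra) ltac:(lra)). lra.
  - replace (prof c (x + y)) with (prof c (2 * PI - (x + y))).
    + pose proof (Hmono (Rabs (x - y)) (2 * PI - (x + y)) ltac:(lra) ltac:(lra)). lra.
    + rewrite <- (prof_even c (x + y)). rewrite <- (prof_per c (- (x + y))). f_equal. ring.
Qed.

Lemma Dx_shift n y : Dx (y + 2 * PI * INR n) = Dx y.
Proof.
  unfold Dx. replace (x + (y + 2 * PI * INR n)) with (x + y + 2 * PI * INR n) by ring.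
  rewrite (periodic_nat _ n (x + y) (prof_per c)). f_equal.
  rewrite <- (periodic_nat _ n (x - (y + 2 * PI * INR n)) (prof_per c)). f_equal. ring.
Qed.

Lemma Dx_reflect n y : Dx (2 * PI * INR n - y) = - Dx y.
Proof.
  replace (2 * PI * INR n - y) with (- y + 2 * PI * INR n) by ring. rewrite Dx_shift.
  unfold Dx. replace (x + - y) with (x - y) by ring. replace (x - - y) with (x + y) by ring. ring.
Qed.

Lemma Dx_cont y : continuous Dx y.
Proof.
  unfold Dx. apply (continuous_minus (fun y => prof c (x + y)) (fun y => prof c (x - y))).
  - apply (continuous_comp (fun y => x + y) (prof c)); [|apply prof_cont; auto].
    apply (ex_derive_continuous (fun y => x + y) y). auto_derive; auto.
  - apply (continuous_comp (fun y => x - y) (prof c)); [|apply prof_cont; auto].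
    apply (ex_derive_continuous (fun y => x - y) y). auto_derive; auto.
Qed.

Lemma DK_cont : contpos (fun y => Dx y * Ka a y).
Proof. intros y Hy. apply (continuous_mult Dx (Ka a)); [apply Dx_cont|apply Ka_cont; auto]. Qed.

Lemma DKr_cont p y : y < p -> continuous (fun y => Dx y * Ka a (p - y)) y.
Proof.
  intros Hy. apply (continuous_mult Dx (fun y => Ka a (p - y))); [apply Dx_cont|].
  apply (continuous_comp (fun y => p - y) (Ka a)); [|apply Ka_cont; auto; lra].
  apply (ex_derive_continuous (fun y => p - y) y). auto_derive; auto.
Qed.

(** [Dx] is antisymmetric about the odd multiple [p] of [PI], so the right half of the block is the
    left half with a minus sign and the kernel taken at the mirror point. The kernel decreases,
    which makes the folded integrand nonnegative ([fold_nonneg]). *)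
Lemma block_fold i al : 0 < al <= PI * (2 * INR i + 1) ->
  RInt (fun y => Dx y * Ka a y) al (2 * (PI * (2 * INR i + 1)) - al) =
  RInt (fun y => Dx y * (Ka a y - Ka a (2 * (PI * (2 * INR i + 1)) - y))) al (PI * (2 * INR i + 1)).
Proof.
  set (p := PI * (2 * INR i + 1)). intros Hal.
  assert (Hp : 0 < p) by lra.
  pose proof (RInt_Chasles_R (fun y => Dx y * Ka a y) al p (2 * p - al)
    ltac:(apply ex_RInt_pos; [apply DK_cont|lra|lra]) ltac:(apply ex_RInt_pos; [apply DK_cont|lra|lra])) as E1.
  assert (E2 : is_RInt (fun y => Dx y * Ka a (2 * p - y)) al p (- RInt (fun y => Dx y * Ka a y) p (2 * p - al))).
  { assert (H : is_RInt (fun y => Dx y * Ka a y) (-1 * al + 2 * p) (-1 * p + 2 * p) (opp (RInt (fun y => Dx y * Ka a y) p (2 * p - al)))).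
    { replace (-1 * al + 2 * p) with (2 * p - al) by ring. replace (-1 * p + 2 * p) with p by ring.
      apply (is_RInt_swap (fun y => Dx y * Ka a y)). apply (RInt_correct (fun y => Dx y * Ka a y)).
      apply ex_RInt_pos; [apply DK_cont|lra|lra]. }
    apply is_RInt_comp_lin in H. eapply is_RInt_ext; [|exact H].
    intros y _. change (-1 * (Dx (-1 * y + 2 * p) * Ka a (-1 * y + 2 * p)) = Dx y * Ka a (2 * p - y)).
    replace (-1 * y + 2 * p) with (2 * p - y) by ring.
    replace (2 * p - y) with (2 * PI * INR (2 * i + 1) - y) at 1.
    - rewrite Dx_reflect. ring.
    - unfold p. rewrite plus_INR, mult_INR. simpl. ring. }
  assert (E3 : is_RInt (fun y => Dx y * Ka a y) al p (RInt (fun y => Dx y * Ka a y) al p)).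
  { apply (RInt_correct (fun y => Dx y * Ka a y)), ex_RInt_pos; [apply DK_cont|lra|lra]. }
  symmetry. apply is_RInt_unique.
  pose proof (is_RInt_minus _ _ _ _ _ _ E3 E2) as E4.
  replace (RInt (fun y => Dx y * Ka a y) al (2 * p - al)) with
    (minus (RInt (fun y => Dx y * Ka a y) al p) (- RInt (fun y => Dx y * Ka a y) p (2 * p - al))).
  - eapply is_RInt_ext; [|exact E4]. intros y _.
    change (Dx y * Ka a y - Dx y * Ka a (2 * p - y) = Dx y * (Ka a y - Ka a (2 * p - y))). ring.
  - change (RInt (fun y => Dx y * Ka a y) al p - - RInt (fun y => Dx y * Ka a y) p (2 * p - al) = RInt (fun y => Dx y * Ka a y) al (2 * p - al)). lra.
Qed.

Lemma fold_cont p y : 0 < y <= p -> continuous (fun y => Dx y * (Ka a y - Ka a (2 * p - y))) y.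
Proof.
  intros Hy. apply (continuous_ext (fun y => Dx y * Ka a y - Dx y * Ka a (2 * p - y))); [intros; symmetry; apply Rmult_minus_distr_l|].
  apply (continuous_minus (fun y => Dx y * Ka a y) (fun y => Dx y * Ka a (2 * p - y))).
  - apply DK_cont; lra.
  - apply DKr_cont; lra.
Qed.

Lemma fold_nonneg i y : 2 * PI * INR i <= y -> 0 < y <= PI * (2 * INR i + 1) ->
  0 <= Dx y * (Ka a y - Ka a (2 * (PI * (2 * INR i + 1)) - y)).
Proof.
  intros H1 H2. apply Rmult_le_pos.
  - replace y with ((y - 2 * PI * INR i) + 2 * PI * INR i) by ring. rewrite Dx_shift. apply Dx_nonneg. lra.
  - pose proof (Ka_decr a Ha y (2 * (PI * (2 * INR i + 1)) - y) ltac:(lra)). lra.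
Qed.

Lemma blocks_nonneg n : 0 <= RInt (fun y => Dx y * Ka a y) (2 * PI) (2 * PI * (INR n + 1)).
Proof.
  pose proof PI_gt_3 as HP. induction n.
  - simpl INR. replace (2 * PI * (0 + 1)) with (2 * PI) by ring. rewrite RInt_point. apply Rle_refl.
  - pose proof (pos_INR n) as Hn. rewrite S_INR.
    pose proof (RInt_Chasles_R (fun y => Dx y * Ka a y) (2 * PI) (2 * PI * (INR n + 1)) (2 * PI * (INR n + 1 + 1))
      ltac:(apply ex_RInt_pos; [apply DK_cont|lra|nra]) ltac:(apply ex_RInt_pos; [apply DK_cont|nra|nra])) as E1.
    pose proof (block_fold (S n) (2 * PI * (INR n + 1))) as E2. rewrite S_INR in E2.
    specialize (E2 ltac:(nra)).
    replace (2 * (PI * (2 * (INR n + 1) + 1)) - 2 * PI * (INR n + 1)) with (2 * PI * (INR n + 1 + 1)) in E2 by ring.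
    assert (0 <= RInt (fun y => Dx y * (Ka a y - Ka a (2 * (PI * (2 * (INR n + 1) + 1)) - y))) (2 * PI * (INR n + 1)) (PI * (2 * (INR n + 1) + 1))).
    { apply RInt_nonneg; [nra| |].
      - apply (@ex_RInt_continuous R_CompleteNormedModule). intros z Hz.
        rewrite Rmin_left, Rmax_right in Hz by nra. apply fold_cont. nra.
      - intros y Hy. pose proof (fold_nonneg (S n) y) as HF. rewrite S_INR in HF. apply HF; nra. }
    rewrite <- E2 in H. lra.
Qed.

Variable mu : R.
Hypothesis Hmu : 0 < mu <= / 2.
Hypothesis Hmu1 : 2 * mu * x <= 2 * PI - 2 * x.
Hypothesis Hmu2 : 2 * mu * x <= PI / 2.

(** Only [mu x <= y <= 2 mu x] of the folded integrand is kept. There [x - y <= (1 - mu) x], while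
    [x + y], folded at [PI] if necessary, stays to the right of [x]: this is what [Hmu1] ensures. *)
Lemma block0_lower ep : 0 < ep < mu * x ->
  kap0 a * (prof c x - prof c ((1 - mu) * x)) <= RInt (fun y => Dx y * Ka a y) ep (2 * PI - ep).
Proof.
  intros Hep. pose proof PI_gt_3 as HP. assert (Hmx : 0 < mu * x) by nra.
  pose proof (block_fold 0 ep) as E. simpl INR in E. replace (PI * (2 * 0 + 1)) with PI in E by ring.
  rewrite E by nra. clear E.
  set (h := prof c x - prof c ((1 - mu) * x)).
  assert (Hh : 0 <= h).
  { unfold h. pose proof (Hmono ((1 - mu) * x) x ltac:(nra) ltac:(lra)). lra. }
  pose proof (Ka_pos a Ha (2 * (mu * x)) ltac:(lra)) as HK.
  apply Rle_trans with ((2 * (mu * x) - mu * x) * (h * (2 / 3 * Ka a (2 * (mu * x))))).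
  - pose proof (yKa_decr a (2 * (mu * x)) (PI / 2) ltac:(lra)) as Hd. unfold kap0. nra.
  - apply RInt_ge_sub; try lra.
    + intros y Hy. apply fold_cont. lra.
    + intros y Hy. pose proof (fold_nonneg 0 y) as HF. simpl INR in HF.
      replace (PI * (2 * 0 + 1)) with PI in HF by ring. apply HF; lra.
    + intros y Hy.
      assert (HD : h <= Dx y).
      { unfold h, Dx.
        assert (prof c x <= prof c (x + y)).
        { destruct (Rle_dec (x + y) PI); [apply Hmono; lra|].
          replace (prof c (x + y)) with (prof c (2 * PI - (x + y))).
          - apply Hmono; lra.
          - rewrite <- (prof_even c (x + y)). rewrite <- (prof_per c (- (x + y))). f_equal. ring. }
        assert (prof c (x - y) <= prof c ((1 - mu) * x)).
        { apply Hmono; nra. }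
        lra. }
      apply Rmult_le_compat; auto; [lra|].
      (* [2 PI - y >= 3 y] because [y <= PI / 2], and [3 Ka (3 y) <= Ka y]: the mirror term takes
         away at most a third of the kernel. *)
      pose proof (Ka_decr a Ha y (2 * (mu * x)) ltac:(lra)) as K1.
      pose proof (Ka_decr a Ha (3 * y) (2 * PI - y) ltac:(lra)) as K2.
      pose proof (yKa_decr a y (3 * y) ltac:(lra)) as K3.
      assert (3 * Ka a (3 * y) <= Ka a y) by (apply Rmult_le_reg_l with y; lra).
      lra.
Qed.

(** Three pieces: [block0_lower] on the first period; the gap [[2 PI - ep, 2 PI]] left out by
    folding, of size [O (ep)]; the later periods, by [blocks_nonneg]. Truncation costs the error of
    [vel_close], also [O (ep)] once [b >= / ep]. *)
Lemma vel_lower : kap0 a * (prof c x - prof c ((1 - mu) * x)) <= - vel a c x.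
Proof.
  pose proof PI_gt_3 as HP. assert (Hmx : 0 < mu * x) by nra.
  destruct (Hc 3%nat) as [A HA]. assert (HA0 := bnd_nonneg _ _ _ HA).
  destruct (prof_bounded c Hc) as [M HM]. assert (HM0 : 0 <= M) by (eapply Rle_trans; [apply Rabs_pos|apply (HM 0)]).
  pose proof (Ka_pos a Ha PI ltac:(lra)) as HKP.
  pose (C := 2 * M * Ka a PI + 4 * A * (1 + a ^ 2 / 2)).
  assert (HC : 0 <= C). { unfold C. assert (0 <= a ^ 2) by nra. assert (0 <= M * Ka a PI) by nra. nra. }
  apply le_epsilon. intros eta Het.
  pose (ep := Rmin (mu * x / 2) (eta / (C + 1))).
  assert (Hep : 0 < ep /\ ep <= mu * x / 2 /\ ep <= eta / (C + 1)).
  { unfold ep. split; [apply Rmin_pos; [lra|apply Rdiv_lt_0_compat; lra]|split; [apply Rmin_l|apply Rmin_r]]. }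
  assert (HCe : C * ep <= eta).
  { destruct Hep as [_ [_ H]]. apply Rmult_le_compat_l with (r := C + 1) in H; [|lra].
    replace ((C + 1) * (eta / (C + 1))) with eta in H by (field; lra). nra. }
  assert (Hep1 : ep < PI) by lra.
  destruct (nfl_spec ep 1 ltac:(lra) ltac:(lra)) as [_ Hn]. set (n := nfl ep 1) in *.
  set (b := 2 * PI * (INR n + 1)). pose proof (pos_INR n).
  assert (Hb1 : INR n + 1 <= b) by (unfold b; nra).
  assert (Hb : a ^ 2 / 2 / b ^ 2 <= a ^ 2 / 2 * ep).
  { unfold Rdiv at 1. apply Rmult_le_compat_l; [nra|].
    apply Rmult_le_reg_r with (b ^ 2); [nra|]. rewrite Rinv_l by nra.
    assert (1 <= ep * b) by nra. nra. }
  assert (Hbe : ep <= b) by (unfold b; nra).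
  pose proof (vel_close a c Ha Hc A x ep b HA ltac:(lra)) as HV.
  assert (Hneg : RInt (fun y => (prof c (x - y) - prof c (x + y)) * Ka a y) ep b = - RInt (fun y => Dx y * Ka a y) ep b).
  { rewrite <- (RInt_opp (fun y => Dx y * Ka a y)) by (apply ex_RInt_pos; [apply DK_cont|lra|nra]).
    apply RInt_ext. intros y _. change ((prof c (x - y) - prof c (x + y)) * Ka a y = - (Dx y * Ka a y)). unfold Dx. ring. }
  rewrite Hneg in HV. apply Rabs_le_between in HV.
  pose proof (block0_lower ep ltac:(lra)) as HB.
  pose proof (blocks_nonneg n) as HN. fold b in HN.
  pose proof (RInt_Chasles_R (fun y => Dx y * Ka a y) ep (2 * PI - ep) b
      ltac:(apply ex_RInt_pos; [apply DK_cont|lra|lra]) ltac:(apply ex_RInt_pos; [apply DK_cont|lra|lra])) as E1.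
  pose proof (RInt_Chasles_R (fun y => Dx y * Ka a y) (2 * PI - ep) (2 * PI) b
      ltac:(apply ex_RInt_pos; [apply DK_cont|lra|lra]) ltac:(apply ex_RInt_pos; [apply DK_cont|lra|lra])) as E2.
  assert (HS : (2 * PI - (2 * PI - ep)) * (- (2 * M * Ka a PI)) <= RInt (fun y => Dx y * Ka a y) (2 * PI - ep) (2 * PI)).
  { apply RInt_ge_const; [lra|apply ex_RInt_pos; [apply DK_cont|lra|lra]|].
    intros y Hy. pose proof (Ka_pos a Ha y ltac:(lra)). pose proof (Ka_decr a Ha PI y ltac:(lra)).
    assert (HD : - (2 * M) <= Dx y).
    { unfold Dx. pose proof (HM (x + y)) as B1. pose proof (HM (x - y)) as B2.
      apply Rabs_le_between in B1. apply Rabs_le_between in B2. lra. }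
    apply Rle_trans with (- (2 * M) * Ka a y); [nra|]. apply Rmult_le_compat_r; lra. }
  assert (HCE : C * ep = 2 * M * Ka a PI * ep + 4 * A * (ep + a ^ 2 / 2 * ep)) by (unfold C; ring).
  assert (4 * A * (ep + a ^ 2 / 2 / b ^ 2) <= 4 * A * (ep + a ^ 2 / 2 * ep)) by (apply Rmult_le_compat_l; lra).
  lra.
Qed.
End VelocityBound.

Lemma prof_series b x : rapid b -> prof b x = Series (fun k => b k * (cos (INR k * x) - 1)).
Proof.
  intros Hb. destruct (Hb 2%nat) as [A HA]. unfold prof, cosS.
  rewrite <- Series_minus by (eapply cosS_ex; eauto). apply Series_ext. intros k.
  rewrite Rmult_0_r, !Rplus_0_r, cos_0. ring.
Qed.

(** * Growth of the weighted mass *)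

Section WeightedMass.
Variables (de s0 : R).
Hypothesis Hde : 0 < de < s0.

Definition wk (k : nat) : R := RInt (fun s => (cos (INR k * s ^ 2) - 1) / s ^ 2) de s0.
(** The variable [s] avoids fractional powers of [x = s ^ 2]. The cut-off [de] keeps the weight
    bounded, and with it the coefficients [wk] of this linear functional. *)
Definition Jf (b : nat -> R) : R := RInt (fun s => prof b (s ^ 2) / s ^ 2) de s0.

Lemma wk_contpos k : contpos (fun s => (cos (INR k * s ^ 2) - 1) / s ^ 2).
Proof.
  intros s Hs. apply (ex_derive_continuous (fun s => (cos (INR k * s ^ 2) - 1) / s ^ 2) s).
  auto_derive. nra.
Qed.

Lemma wk_term k s : de <= s <= s0 -> Rabs ((cos (INR k * s ^ 2) - 1) / s ^ 2) <= 2 / de ^ 2.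
Proof.
  intros Hs. unfold Rdiv. rewrite Rabs_mult.
  assert (0 < / s ^ 2) by (apply Rinv_0_lt_compat; nra). rewrite (Rabs_pos_eq (/ s ^ 2)) by lra.
  apply Rmult_le_compat; [apply Rabs_pos|lra|apply cosm1_bound|]. apply Rinv_le_contravar; nra.
Qed.

Lemma wk_bound k : Rabs (wk k) <= (s0 - de) * (2 / de ^ 2).
Proof.
  apply (norm_RInt_le_const (fun s => (cos (INR k * s ^ 2) - 1) / s ^ 2) de s0); [lra| |].
  - intros s Hs. apply wk_term; auto.
  - apply (RInt_correct (fun s => (cos (INR k * s ^ 2) - 1) / s ^ 2)), ex_RInt_pos; [apply wk_contpos|lra|lra].
Qed.

Lemma Jf_series b : rapid b -> Jf b = Series (fun k => b k * wk k).
Proof.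
  intros Hb. destruct (Hb 2%nat) as [A HA]. unfold Jf. apply is_RInt_unique.
  assert (HA0 := bnd_nonneg _ _ _ HA).
  assert (Hd2 : 0 < 2 / de ^ 2) by (apply Rdiv_lt_0_compat; nra).
  pose proof (is_RInt_Series (fun k s => b k * ((cos (INR k * s ^ 2) - 1) / s ^ 2)) (fun k => A * (2 / de ^ 2) * w2 k) de s0 ltac:(lra) (ex_series_Aw2 _)) as H.
  rewrite (Series_ext (fun k => b k * wk k) (fun k => RInt (fun s => b k * ((cos (INR k * s ^ 2) - 1) / s ^ 2)) de s0)).
  - eapply is_RInt_ext; [|apply H].
    + intros s Hs. rewrite Rmin_left, Rmax_right in Hs by lra. rewrite (prof_series b) by auto.
      unfold Rdiv. rewrite <- Series_scal_r. apply Series_ext; intros; ring.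
    + intros k. apply (ex_RInt_scal (fun s => (cos (INR k * s ^ 2) - 1) / s ^ 2)), ex_RInt_pos; [apply wk_contpos|lra|lra].
    + intros k s Hs. rewrite Rabs_mult. pose proof (bnd_w2 0 A b HA k) as Hk. simpl in Hk.
      pose proof (wk_term k s Hs). replace (A * (2 / de ^ 2) * w2 k) with (A * w2 k * (2 / de ^ 2)) by ring.
      apply Rmult_le_compat; auto; try apply Rabs_pos. lra.
  - intros k. symmetry. apply is_RInt_unique. unfold wk.
    apply (is_RInt_scal (fun s => (cos (INR k * s ^ 2) - 1) / s ^ 2) de s0 (b k)).
    apply (RInt_correct (fun s => (cos (INR k * s ^ 2) - 1) / s ^ 2)), ex_RInt_pos; [apply wk_contpos|lra|lra].
Qed.

Lemma Jf_derive Tm (c c' : R -> nat -> R) t : ubnd Tm c -> ubnd Tm c' ->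
  (forall t k, 0 < t < Tm -> is_derive (fun s => c s k) t (c' t k)) -> 0 < t < Tm ->
  is_derive (fun s => Jf (c s)) t (Jf (c' t)).
Proof.
  intros Hc Hc' Hd Ht.
  destruct (ubnd_near Tm c' t 2 Hc' ltac:(lra)) as [d [A [Hd0 HA]]].
  destruct (near_interior Tm t d Ht Hd0) as [d' [Hd1 Hd2]].
  apply is_derive_ext_loc with (fun s => Series (fun k => c s k * wk k)).
  { exists (mkposreal d' (proj1 Hd1)). intros s Hs. symmetry. apply Jf_series. eapply ubnd_rapid; eauto.
    specialize (Hd2 s Hs). lra. }
  rewrite Jf_series by (eapply ubnd_rapid; eauto; lra).
  set (B := (s0 - de) * (2 / de ^ 2)).
  assert (Hw := wk_bound). fold B in Hw.
  apply (is_derive_Series (fun s k => c s k * wk k) (fun s k => c' s k * wk k) (fun k => A * B * w2 k) t d').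
  - lra.
  - apply ex_series_Aw2.
  - intros s k Hs. apply is_derive_ext with (fun s => scal (wk k) (c s k)); [intros; apply Rmult_comm|].
    rewrite (Rmult_comm (c' s k)). apply (is_derive_scal (fun s => c s k)). auto.
  - intros s k Hs. rewrite Rabs_mult. pose proof (bnd_w2 0 A _ (HA s ltac:(lra)) k) as Hk. simpl in Hk.
    replace (A * B * w2 k) with (A * w2 k * B) by ring. apply Rmult_le_compat; auto; try apply Rabs_pos. lra.
  - intros s Hs. destruct (ubnd_rapid Tm c s Hc ltac:(specialize (Hd2 s Hs); lra) 2%nat) as [A2 HA2].
    apply ex_series_dom with (fun k => A2 * B * w2 k); [apply ex_series_Aw2|].
    intros k. rewrite Rabs_mult. pose proof (bnd_w2 0 A2 _ HA2 k) as Hk. simpl in Hk.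
    replace (A2 * B * w2 k) with (A2 * w2 k * B) by ring. apply Rmult_le_compat; auto; try apply Rabs_pos. lra.
Qed.

Section Static.
Variables (a g : R) (c : nat -> R) (M lam : R).
Hypothesis Ha : 0 < a.
Hypothesis Hg : 0 < g.
Hypothesis Hc : rapid c.
Hypothesis Hc0 : c O = 0.
Hypothesis HM : forall x, Rabs (slope c x) <= M.
Hypothesis Hsl : forall x, 0 <= x <= PI -> 0 <= slope c x.
Hypothesis Hs0 : s0 ^ 2 < PI.
Hypothesis Hlam : 0 < lam < 1.
Hypothesis Hmu1 : 1 - lam ^ 2 <= / 4.
Hypothesis Hmu2 : (1 - lam ^ 2) * PI <= PI - s0 ^ 2.

Lemma mono_of_slope x y : 0 <= x <= y -> y <= PI -> prof c x <= prof c y.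
Proof.
  intros Hxy Hy. apply (incr_of_deriv (prof c) (slope c)); [lra| |].
  - intros z Hz. apply prof_derive; auto.
  - intros z Hz. apply Hsl; lra.
Qed.

Lemma prof_linear x : 0 <= x -> prof c x <= M * x.
Proof.
  intros Hx. pose proof (deriv_dom (prof c) (fun y => M * y) (slope c) (fun _ => M) 0 x Hx) as H.
  rewrite prof_0 in H. rewrite Rmult_0_r, !Rminus_0_r in H.
  eapply Rle_trans; [apply Rle_abs|]. apply H.
  - intros; apply prof_derive; auto.
  - intros; auto_derive; auto; ring.
  - auto.
Qed.

(** The difference in [vel_lower] at [x = s ^ 2] with [mu = 1 - lam ^ 2]; in the variable [s] it
    compares the profile with its dilation by [lam]. *)
Definition hh (s : R) : R := prof c (s ^ 2) - prof c (lam ^ 2 * s ^ 2).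
Definition hh' (s : R) : R := 2 * s * slope c (s ^ 2) - 2 * lam ^ 2 * s * slope c (lam ^ 2 * s ^ 2).
Definition kap : R := g * kap0 a.

Lemma hh_derive s : is_derive hh s (hh' s).
Proof.
  assert (H : forall z, is_derive (prof c) z (slope c z)) by (intros; apply prof_derive; auto).
  apply (is_derive_minus (fun s => prof c (s ^ 2)) (fun s => prof c (lam ^ 2 * s ^ 2))).
  - apply (is_derive_comp (prof c) (fun s => s ^ 2) s (slope c (s ^ 2)) (2 * s)); [apply H|].
    auto_derive; auto. ring.
  - apply (is_derive_comp (prof c) (fun s => lam ^ 2 * s ^ 2) s (slope c (lam ^ 2 * s ^ 2)) (2 * lam ^ 2 * s)); [apply H|].
    auto_derive; auto. ring.
Qed.

Lemma sq_range s : de <= s <= s0 -> 0 < s ^ 2 /\ s ^ 2 <= s0 ^ 2 /\ lam ^ 2 * s ^ 2 <= s ^ 2 /\ 0 < lam ^ 2 < 1.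
Proof.
  intros Hs. assert (0 < s ^ 2) by nra. assert (s ^ 2 <= s0 ^ 2) by (apply pow_incr; lra).
  assert (0 < lam ^ 2 < 1) by nra. repeat split; try lra. nra.
Qed.

Lemma hh_nonneg s : de <= s <= s0 -> 0 <= hh s.
Proof.
  intros Hs. destruct (sq_range s Hs) as [H1 [H2 [H3 H4]]]. unfold hh.
  pose proof (mono_of_slope (lam ^ 2 * s ^ 2) (s ^ 2) ltac:(nra) ltac:(lra)). lra.
Qed.

Lemma kap_pos : 0 < kap.
Proof. apply Rmult_lt_0_compat; auto. apply kap0_pos; auto. Qed.

Lemma rate_lower s : de <= s <= s0 -> kap * hh s * slope c (s ^ 2) <= rate a g c (s ^ 2).
Proof.
  intros Hs. destruct (sq_range s Hs) as [H1 [H2 [H3 H4]]]. pose proof PI_gt_3.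
  pose proof (vel_lower a c Ha Hc mono_of_slope (s ^ 2) ltac:(lra) (1 - lam ^ 2) ltac:(lra)) as HV.
  specialize (HV ltac:(nra) ltac:(nra)).
  replace ((1 - (1 - lam ^ 2)) * s ^ 2) with (lam ^ 2 * s ^ 2) in HV by ring. fold (hh s) in HV.
  rewrite rate_eq by auto. pose proof (Hsl (s ^ 2) ltac:(lra)). unfold kap.
  replace (- (g * vel a c (s ^ 2) * slope c (s ^ 2))) with (g * slope c (s ^ 2) * - vel a c (s ^ 2)) by ring.
  replace (g * kap0 a * hh s * slope c (s ^ 2)) with (g * slope c (s ^ 2) * (kap0 a * hh s)) by ring.
  apply Rmult_le_compat_l; auto. nra.
Qed.

Lemma pow2_ex_derive (F : R -> R) (G : R -> R) s : (forall z, ex_derive F z) -> ex_derive G s -> ex_derive (fun s => F (G s)) s.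
Proof. intros H1 H2. apply (ex_derive_comp F G s); auto. Qed.

Lemma div_contpos (F : R -> R) : (forall s, ex_derive F s) -> contpos (fun s => F s / s ^ 2).
Proof.
  intros H s Hs. apply (ex_derive_continuous (fun s => F s / s ^ 2) s).
  apply (ex_derive_div F (fun s => s ^ 2)); auto; [auto_derive; auto|nra].
Qed.

Lemma prof_ex b s : rapid b -> ex_derive (fun s => prof b (s ^ 2)) s.
Proof.
  intros Hb. apply pow2_ex_derive; [|auto_derive; auto]. intros z. exists (slope b z). apply prof_derive; auto.
Qed.

Lemma Jrate_nonneg : 0 <= Jf (Bser g (mk a) c c).
Proof.
  pose proof (Bser_rapid a g c Ha Hg Hc) as HB.
  apply RInt_nonneg; [lra| |].
  - apply ex_RInt_pos; [|lra|lra]. apply (div_contpos (fun s => prof (Bser g (mk a) c c) (s ^ 2))). intros; apply prof_ex; auto.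
  - intros s Hs. change (0 <= rate a g c (s ^ 2) / s ^ 2). destruct (sq_range s Hs) as [H1 [H2 _]].
    apply Rmult_le_pos; [|left; apply Rinv_0_lt_compat; auto].
    eapply Rle_trans; [|apply rate_lower; auto]. pose proof (hh_nonneg s Hs). pose proof kap_pos.
    pose proof (Hsl (s ^ 2) ltac:(lra)). apply Rmult_le_pos; auto. nra.
Qed.

Definition Xf : R := RInt (fun s => hh s / s ^ 2) de s0.

Lemma hh_contpos : contpos (fun s => hh s / s ^ 2).
Proof. apply div_contpos. intros s. exists (hh' s). apply hh_derive. Qed.

(** By [rate_lower] the integrand is at least [kap hh rho_x(s^2) / s^2], and [2 s rho_x(s^2) >= hh']
    since the other term of [hh'] has a sign; this leaves [kap / 2] times [hh hh' / s^3].
    Integration by parts gives [3 kap / 4] times the integral of [(hh / s^2)^2], plus a boundary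
    term that is nonnegative at [s0] and, as [hh <= M s^2], small at [de]. Cauchy-Schwarz
    concludes. *)
Lemma Jrate_lower : 3 * kap / 4 * (Xf ^ 2 / s0) - kap / 4 * (M ^ 2 * de) <= Jf (Bser g (mk a) c c).
Proof.
  pose proof (Bser_rapid a g c Ha Hg Hc) as HB. pose proof kap_pos as Hk.
  (* Cauchy-Schwarz in tangent form: [v ^ 2 >= 2 z v - z ^ 2] pointwise, with the optimal [z] for an
     interval of length [s0]. *)
  pose (z := Xf / s0).
  assert (Hcr : contpos (fun s => prof (Bser g (mk a) c c) (s ^ 2) / s ^ 2)).
  { apply (div_contpos (fun s => prof (Bser g (mk a) c c) (s ^ 2))). intros; apply prof_ex; auto. }
  (* The difference of the two sides over [[de, s]], boundary term included; the inequality becomes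
     monotonicity of [P]. *)
  pose (P s := RInt (fun s => prof (Bser g (mk a) c c) (s ^ 2) / s ^ 2) de s
     - (3 * kap / 4 * (2 * z * RInt (fun s => hh s / s ^ 2) de s - z ^ 2 * (s - de)) + kap / 4 * (hh s ^ 2 / s ^ 3))).
  pose (P' s := prof (Bser g (mk a) c c) (s ^ 2) / s ^ 2
     - (3 * kap / 4 * (2 * z * (hh s / s ^ 2) - z ^ 2) + kap / 4 * (2 * hh s * hh' s / s ^ 3 - 3 * hh s ^ 2 / s ^ 4))).
  assert (HP : P de <= P s0).
  { apply (incr_of_deriv P P'); [lra| |].
    - intros s Hs. unfold P, P'.
      apply (is_derive_minus (fun s => RInt (fun s => prof (Bser g (mk a) c c) (s ^ 2) / s ^ 2) de s)
        (fun s => 3 * kap / 4 * (2 * z * RInt (fun s => hh s / s ^ 2) de s - z ^ 2 * (s - de)) + kap / 4 * (hh s ^ 2 / s ^ 3))).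
      { apply (is_derive_RInt_pos (fun s => prof (Bser g (mk a) c c) (s ^ 2) / s ^ 2)); auto; lra. }
      apply (is_derive_plus (fun s => 3 * kap / 4 * (2 * z * RInt (fun s => hh s / s ^ 2) de s - z ^ 2 * (s - de))) (fun s => kap / 4 * (hh s ^ 2 / s ^ 3))).
      + apply (is_derive_scal (fun s => 2 * z * RInt (fun s => hh s / s ^ 2) de s - z ^ 2 * (s - de))).
        apply (is_derive_minus (fun s => 2 * z * RInt (fun s => hh s / s ^ 2) de s) (fun s => z ^ 2 * (s - de))).
        * apply (is_derive_scal (fun s => RInt (fun s => hh s / s ^ 2) de s)).
          apply (is_derive_RInt_pos (fun s => hh s / s ^ 2)); [apply hh_contpos|lra|lra].
        * auto_derive; auto. ring.
      + apply (is_derive_scal (fun s => hh s ^ 2 / s ^ 3)).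
        pose proof (hh_derive s) as Hd.
        replace (2 * hh s * hh' s / s ^ 3 - 3 * hh s ^ 2 / s ^ 4) with
          ((2 * hh s * hh' s * s ^ 3 - hh s ^ 2 * (3 * s ^ 2)) / (s ^ 3) ^ 2) by (field; lra).
        apply (is_derive_div (fun s => hh s ^ 2) (fun s => s ^ 3)).
        * apply is_derive_ext with (fun s => hh s * hh s); [intros; simpl; ring|].
          replace (2 * hh s * hh' s) with (hh' s * hh s + hh s * hh' s) by ring.
          apply (is_derive_mult hh hh); auto. intros; apply Rmult_comm.
        * auto_derive; auto. ring.
        * assert (0 < s ^ 3) by (apply pow_lt; lra). lra.
    - intros s Hs. unfold P'. change (prof (Bser g (mk a) c c) (s ^ 2)) with (rate a g c (s ^ 2)).
      pose proof (rate_lower s Hs) as HR. destruct (sq_range s Hs) as [H1 [H2 [H3 H4]]].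
      pose proof (hh_nonneg s Hs) as Hh0.
      assert (Hsp : 0 < s) by lra.
      assert (Hi2 : 0 < / s ^ 2) by (apply Rinv_0_lt_compat; auto).
      assert (Hi3 : 0 < / s ^ 3) by (apply Rinv_0_lt_compat, pow_lt; auto).
      assert (A1 : kap * hh s * slope c (s ^ 2) * / s ^ 2 <= rate a g c (s ^ 2) / s ^ 2) by (apply Rmult_le_compat_r; lra).
      assert (A2 : kap / 2 * (hh s * hh' s * / s ^ 3) <= kap * hh s * slope c (s ^ 2) * / s ^ 2).
      { replace (kap * hh s * slope c (s ^ 2) * / s ^ 2) with (kap / 2 * (hh s * (2 * s * slope c (s ^ 2)) * / s ^ 3)) by (field; lra).
        apply Rmult_le_compat_l; [lra|]. apply Rmult_le_compat_r; [lra|]. apply Rmult_le_compat_l; auto.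
        unfold hh'. pose proof (Hsl (lam ^ 2 * s ^ 2) ltac:(nra)).
        assert (0 <= 2 * lam ^ 2 * s * slope c (lam ^ 2 * s ^ 2)) by (apply Rmult_le_pos; [nra|auto]). lra. }
      assert (A3 : 2 * z * (hh s / s ^ 2) - z ^ 2 <= (hh s / s ^ 2) ^ 2) by (pose proof (pow2_ge_0 (hh s / s ^ 2 - z)); lra).
      assert (A4 : 3 * kap / 4 * (2 * z * (hh s / s ^ 2) - z ^ 2) <= 3 * kap / 4 * (hh s / s ^ 2) ^ 2) by (apply Rmult_le_compat_l; lra).
      assert (A5 : kap / 4 * (2 * hh s * hh' s / s ^ 3 - 3 * hh s ^ 2 / s ^ 4) = kap / 2 * (hh s * hh' s * / s ^ 3) - 3 * kap / 4 * (hh s / s ^ 2) ^ 2) by (field; lra).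
      lra. }
  unfold P in HP. rewrite !(RInt_point de) in HP. change (zero : R) with 0 in HP.
  fold (Jf (Bser g (mk a) c c)) in HP. fold Xf in HP.
  assert (E1 : 2 * z * Xf - z ^ 2 * (s0 - de) >= Xf ^ 2 / s0).
  { unfold z. replace (Xf ^ 2 / s0) with (2 * (Xf / s0) * Xf - (Xf / s0) ^ 2 * s0) by (field; lra).
    pose proof (pow2_ge_0 (Xf / s0)). nra. }
  assert (E2 : 0 <= hh s0 ^ 2 / s0 ^ 3).
  { apply Rmult_le_pos; [apply pow2_ge_0|left; apply Rinv_0_lt_compat, pow_lt; lra]. }
  assert (E3 : hh de ^ 2 / de ^ 3 <= M ^ 2 * de).
  { destruct (sq_range de ltac:(lra)) as [H1 [H2 [H3 H4]]].
    assert (Hd3 : 0 < de ^ 3) by (apply pow_lt; lra).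
    assert (Hh : 0 <= hh de <= M * de ^ 2).
    { split; [apply hh_nonneg; lra|]. unfold hh. pose proof (prof_linear (de ^ 2) ltac:(lra)).
      pose proof (mono_of_slope 0 (lam ^ 2 * de ^ 2) ltac:(nra) ltac:(lra)) as Hz. rewrite prof_0 in Hz. lra. }
    apply Rmult_le_reg_r with (de ^ 3); auto. unfold Rdiv. rewrite Rmult_assoc, Rinv_l by lra. rewrite Rmult_1_r.
    replace (M ^ 2 * de * de ^ 3) with ((M * de ^ 2) ^ 2) by ring. apply pow_incr; auto. }
  assert (3 * kap / 4 * (Xf ^ 2 / s0) <= 3 * kap / 4 * (2 * z * Xf - z ^ 2 * (s0 - de))) by (apply Rmult_le_compat_l; lra).
  assert (0 <= kap / 4 * (hh s0 ^ 2 / s0 ^ 3)) by (apply Rmult_le_pos; lra).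
  assert (kap / 4 * (hh de ^ 2 / de ^ 3) <= kap / 4 * (M ^ 2 * de)) by (apply Rmult_le_compat_l; lra).
  lra.
Qed.

(** A dilation turns the second term of [hh] into [lam] times the mass on [[lam de, lam s0]]. This
    exceeds the mass on [[de, s0]] by at most the piece [[lam de, de]], where the integrand is below
    [M]. *)
Lemma Xf_lower : (1 - lam) * Jf c - M * de <= Xf.
Proof.
  assert (Hex1 : forall s, ex_derive (fun s => prof c (s ^ 2)) s) by (intros; apply prof_ex; auto).
  assert (Hcf : contpos (fun s => prof c (s ^ 2) / s ^ 2)) by (apply (div_contpos (fun s => prof c (s ^ 2))); auto).
  assert (Hcl : contpos (fun s => prof c (lam ^ 2 * s ^ 2) / s ^ 2)).
  { apply (div_contpos (fun s => prof c (lam ^ 2 * s ^ 2))). intros s.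
    apply (pow2_ex_derive (prof c) (fun s => lam ^ 2 * s ^ 2)); [|auto_derive; auto].
    intros z. exists (slope c z). apply prof_derive; auto. }
  assert (HM0 : 0 <= M) by (eapply Rle_trans; [apply Rabs_pos|apply (HM 0)]).
  set (F := fun s => prof c (s ^ 2) / s ^ 2) in *.
  assert (E1 : Xf = Jf c - RInt (fun s => prof c (lam ^ 2 * s ^ 2) / s ^ 2) de s0).
  { unfold Xf, Jf.
    rewrite <- (RInt_minus (fun s => prof c (s ^ 2) / s ^ 2) (fun s => prof c (lam ^ 2 * s ^ 2) / s ^ 2)) by (apply ex_RInt_pos; auto; lra).
    apply RInt_ext. intros s _. change (hh s / s ^ 2 = prof c (s ^ 2) / s ^ 2 - prof c (lam ^ 2 * s ^ 2) / s ^ 2).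
    unfold hh, Rdiv. ring. }
  assert (E2 : RInt (fun s => prof c (lam ^ 2 * s ^ 2) / s ^ 2) de s0 = lam * RInt F (lam * de) (lam * s0)).
  { apply is_RInt_unique.
    assert (H : is_RInt F (lam * de + 0) (lam * s0 + 0) (RInt F (lam * de) (lam * s0))).
    { rewrite !Rplus_0_r. apply (RInt_correct F), ex_RInt_pos; auto; nra. }
    apply is_RInt_comp_lin in H. apply (is_RInt_scal _ _ _ lam) in H.
    eapply is_RInt_ext; [|exact H]. intros s Hs. rewrite Rmin_left, Rmax_right in Hs by lra.
    change (lam * (lam * F (lam * s + 0)) = prof c (lam ^ 2 * s ^ 2) / s ^ 2). unfold F.
    rewrite Rplus_0_r. replace ((lam * s) ^ 2) with (lam ^ 2 * s ^ 2) by ring. field. lra. }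
  assert (HFb : forall s, 0 < s -> s <= s0 -> 0 <= F s <= M).
  { intros s Hs Hss. unfold F. assert (Hs2 : 0 < s ^ 2) by nra. assert (s ^ 2 <= s0 ^ 2) by (apply pow_incr; lra).
    pose proof (prof_linear (s ^ 2) ltac:(lra)). pose proof (mono_of_slope 0 (s ^ 2) ltac:(lra) ltac:(lra)) as Hz. rewrite prof_0 in Hz.
    assert (0 < / s ^ 2) by (apply Rinv_0_lt_compat; auto). split; [apply Rmult_le_pos; lra|].
    apply Rmult_le_reg_r with (s ^ 2); auto. unfold Rdiv. rewrite Rmult_assoc, Rinv_l by lra. lra. }
  pose proof (RInt_Chasles_R F (lam * de) (lam * s0) s0 ltac:(apply ex_RInt_pos; auto; nra) ltac:(apply ex_RInt_pos; auto; nra)) as C1.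
  pose proof (RInt_Chasles_R F (lam * de) de s0 ltac:(apply ex_RInt_pos; auto; nra) ltac:(apply ex_RInt_pos; auto; nra)) as C2.
  assert (N1 : 0 <= RInt F (lam * s0) s0).
  { apply RInt_nonneg; [nra|apply ex_RInt_pos; auto; nra|]. intros s Hs. apply HFb; nra. }
  assert (N2 : RInt F (lam * de) de <= (de - lam * de) * M).
  { eapply Rle_trans; [apply Rle_abs|].
    apply (norm_RInt_le_const F (lam * de) de); [nra| |apply (RInt_correct F), ex_RInt_pos; auto; nra].
    intros s Hs. change (Rabs (F s) <= M). destruct (HFb s ltac:(nra) ltac:(nra)). rewrite Rabs_pos_eq; auto. }
  change (RInt F de s0) with (Jf c) in C2.
  assert (lam * RInt F (lam * de) (lam * s0) <= lam * (Jf c + (de - lam * de) * M)) by (apply Rmult_le_compat_l; lra).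
  assert (lam * ((de - lam * de) * M) <= M * de).
  { assert (0 <= M * de) by nra. replace (lam * ((de - lam * de) * M)) with (lam * (1 - lam) * (M * de)) by ring.
    assert (lam * (1 - lam) <= 1) by nra. nra. }
  lra.
Qed.
End Static.
End WeightedMass.

(** * The Riccati inequality for the weighted mass *)

Section Blowup.
Variables (a g : R).
Hypothesis Ha : 0 < a.
Hypothesis Hg : 0 < g.
Variable Tm : R.
Variable c : R -> nat -> R.
Hypothesis Hub : ubnd Tm c.
Hypothesis Hc0 : forall t, t < Tm -> c t O = 0.
Hypothesis Hder : forall t k, 0 < t < Tm -> is_derive (fun s => c s k) t (Bser g (mk a) (c t) (c t) k).
Hypothesis Hlip : forall T1, T1 < Tm -> forall s, exists A, 0 <= A /\
  forall t t', t <= T1 -> t' <= T1 -> bnd s (A * Rabs (t' - t)) (fun k => c t' k - c t k).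
Hypothesis Hinit : forall x, 0 <= x <= PI -> 0 <= slope (c 0) x.

(** [1 - lam0 ^ 2] is at most the minimum inside, which makes [mu = 1 - lam ^ 2] admissible in
    [vel_lower] for every [x <= s0 ^ 2]. *)
Definition lam0 (s0 : R) : R := 1 - Rmin ((PI - s0 ^ 2) / PI) (/ 4) / 2.
(** Half of the leading coefficient [3 kap / 4 * ((1 - lam) / 2) ^ 2 / s0]; the other half absorbs
    the error of the cut-off. *)
Definition rate0 (s0 : R) : R := 3 * kap a g * (1 - lam0 s0) ^ 2 / (32 * s0).
Definition mass0 (s1 s0 p : R) : R := (s0 - s1) * (p / s0 ^ 2).

Lemma lam0_spec s0 : 0 < s0 -> s0 ^ 2 < PI ->
  0 < lam0 s0 < 1 /\ 1 - lam0 s0 ^ 2 <= / 4 /\ (1 - lam0 s0 ^ 2) * PI <= PI - s0 ^ 2.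
Proof.
  intros H1 H2. unfold lam0. set (mu := Rmin ((PI - s0 ^ 2) / PI) (/ 4)). pose proof PI_gt_3.
  assert (Hmu : 0 < mu /\ mu <= / 4 /\ mu <= (PI - s0 ^ 2) / PI).
  { unfold mu. split; [apply Rmin_pos; [apply Rdiv_lt_0_compat; lra|lra]|split; [apply Rmin_r|apply Rmin_l]]. }
  assert (mu * PI <= PI - s0 ^ 2).
  { destruct Hmu as [_ [_ Hm]]. apply Rmult_le_compat_r with (r := PI) in Hm; [|lra].
    replace ((PI - s0 ^ 2) / PI * PI) with (PI - s0 ^ 2) in Hm by (field; lra). auto. }
  assert (1 - (1 - mu / 2) ^ 2 <= mu) by nra.
  repeat split; nra.
Qed.

(** If the solution lasted longer, [J' >= rate0 * J ^ 2] from [J >= mass0] would hold beyond the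
    explosion time of that inequality. The slope bound [M] up to [T1] enters only through the
    cut-off [de], so the final bound is free of it. *)
Lemma blowup_bound t0 s1 s0 p : 0 < s1 < s0 -> s0 ^ 2 < PI -> 0 < p -> 0 < t0 < Tm -> p <= prof (c t0) (s1 ^ 2) ->
  Tm <= t0 + / (rate0 s0 * mass0 s1 s0 p).
Proof.
  intros Hs Hs0 Hp Ht0 Hpp. apply Rnot_lt_le. intros Hlong.
  destruct (lam0_spec s0 ltac:(lra) Hs0) as [L1 [L2 L3]].
  set (lam := lam0 s0) in *. set (j0 := mass0 s1 s0 p) in *. set (ka := rate0 s0) in *.
  assert (Hk := kap_pos a g Ha Hg).
  assert (Hj0 : 0 < j0) by (unfold j0, mass0; apply Rmult_lt_0_compat; [lra|apply Rdiv_lt_0_compat; nra]).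
  assert (Hka : 0 < ka).
  { unfold ka, rate0. fold lam. apply Rdiv_lt_0_compat; [|lra]. apply Rmult_lt_0_compat; [lra|nra]. }
  pose (T1 := (t0 + / (ka * j0) + Tm) / 2).
  assert (Hkj : 0 < / (ka * j0)) by (apply Rinv_0_lt_compat; nra).
  assert (HT1 : t0 + / (ka * j0) < T1 < Tm) by (unfold T1; lra).
  destruct (slope_bound Tm c Hub T1 ltac:(lra)) as [M0 HM0].
  set (M := Rabs M0 + 1).
  assert (HM1 : 1 <= M) by (unfold M; pose proof (Rabs_pos M0); lra).
  assert (HMb : forall t x, t <= T1 -> Rabs (slope (c t) x) <= M).
  { intros t x Ht. eapply Rle_trans; [apply HM0; auto|]. unfold M. pose proof (Rle_abs M0). lra. }
  (* [e1] keeps the error of [Xf_lower] below half of its main term, [e2] the boundary term of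
     [Jrate_lower] below half of the quadratic one, for every mass at least [j0]. *)
  set (e1 := (1 - lam) * j0 / (2 * M)). set (e2 := 3 * (1 - lam) ^ 2 * j0 ^ 2 / (8 * s0 * M ^ 2)).
  assert (He1 : 0 < e1) by (apply Rdiv_lt_0_compat; [apply Rmult_lt_0_compat; lra|lra]).
  assert (He2 : 0 < e2).
  { apply Rdiv_lt_0_compat; [apply Rmult_lt_0_compat; nra|]. apply Rmult_lt_0_compat; [lra|nra]. }
  set (de := Rmin (s1 / 2) (Rmin e1 e2)).
  assert (Hde : 0 < de /\ de <= s1 / 2 /\ de <= e1 /\ de <= e2).
  { unfold de. pose proof (Rmin_r (s1 / 2) (Rmin e1 e2)). pose proof (Rmin_l e1 e2). pose proof (Rmin_r e1 e2).
    split; [repeat apply Rmin_pos; lra|split; [apply Rmin_l|lra]]. }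
  assert (Hd1 : M * de <= (1 - lam) * j0 / 2).
  { apply Rle_trans with (M * e1); [apply Rmult_le_compat_l; lra|]. right. unfold e1. field. lra. }
  assert (Hd2 : M ^ 2 * de <= 3 * (1 - lam) ^ 2 * j0 ^ 2 / (8 * s0)).
  { apply Rle_trans with (M ^ 2 * e2); [apply Rmult_le_compat_l; [nra|lra]|]. right. unfold e2. field. lra. }
  assert (Hdes : 0 < de < s0) by lra.
  pose (J t := Jf de s0 (c t)). pose (J' t := Jf de s0 (Bser g (mk a) (c t) (c t))).
  assert (HJd : forall t, 0 < t < Tm -> is_derive J t (J' t)).
  { intros t Ht. apply (Jf_derive de s0 Hdes Tm c (fun t => Bser g (mk a) (c t) (c t))); auto.
    apply ubnd_Bser; auto. apply mk_bound; auto. }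
  assert (Hsl : forall t x, 0 <= t < Tm -> 0 <= x <= PI -> 0 <= slope (c t) x).
  { intros t x Ht Hx. apply (slope_nonneg a g Ha Hg Tm c Hub Hc0 Hder Hlip Hinit t x Ht Hx). }
  assert (Hr : forall t, t < Tm -> rapid (c t)) by (intros; eapply ubnd_rapid; eauto).
  assert (HJ0 : forall t, 0 < t < Tm -> 0 <= J' t).
  { intros t Ht. apply (Jrate_nonneg de s0 Hdes a g (c t) lam Ha Hg (Hr t ltac:(lra)) (Hc0 t ltac:(lra))); auto.
    intros x Hx. apply Hsl; lra. }
  assert (HJt0 : j0 <= J t0).
  { unfold j0, mass0, J, Jf. apply RInt_ge_sub; try lra.
    - intros s Hss. apply (div_contpos (fun s => prof (c t0) (s ^ 2))); [|lra]. intros; apply prof_ex; apply Hr; lra.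
    - intros s Hss. apply Rmult_le_pos; [|left; apply Rinv_0_lt_compat; nra].
      rewrite <- (prof_0 (c t0)). assert (s ^ 2 <= s0 ^ 2) by (apply pow_incr; lra).
      apply (mono_of_slope (c t0)); [apply Hr; lra|intros; apply Hsl; lra|nra|lra].
    - intros s Hss. assert (s ^ 2 <= s0 ^ 2) by (apply pow_incr; lra). assert (s1 ^ 2 <= s ^ 2) by (apply pow_incr; lra).
      assert (0 < s1 ^ 2) by nra.
      pose proof (mono_of_slope (c t0) (Hr t0 ltac:(lra)) ltac:(intros; apply Hsl; lra) (s1 ^ 2) (s ^ 2) ltac:(nra) ltac:(lra)).
      apply Rmult_le_compat; try lra; [left; apply Rinv_0_lt_compat; lra|]. apply Rinv_le_contravar; lra. }
  assert (HJm : forall t, t0 <= t <= T1 -> j0 <= J t).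
  { intros t Ht. eapply Rle_trans; [exact HJt0|]. apply (incr_of_deriv J J'); [lra| |].
    - intros s Hss. apply HJd; lra.
    - intros s Hss. apply HJ0; lra. }
  assert (HJq : forall t, t0 <= t <= T1 -> ka * J t ^ 2 <= J' t).
  { intros t Ht. specialize (HJm t Ht).
    pose proof (Jrate_lower de s0 Hdes a g (c t) M lam Ha Hg (Hr t ltac:(lra)) (Hc0 t ltac:(lra)) ltac:(intros; apply HMb; lra) ltac:(intros; apply Hsl; lra) Hs0 L1 L2 L3) as HL.
    pose proof (Xf_lower de s0 Hdes (c t) M lam (Hr t ltac:(lra)) ltac:(intros; apply HMb; lra) ltac:(intros; apply Hsl; lra) Hs0 L1 L2) as HX.
    fold (J' t) in HL. fold (J t) in HX. set (X := Xf de s0 (c t) lam) in *.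
    assert (HX1 : (1 - lam) * J t / 2 <= X) by nra.
    assert (HX2 : ((1 - lam) * J t / 2) ^ 2 <= X ^ 2) by (apply pow_incr; nra).
    assert (His0 : 0 < / s0) by (apply Rinv_0_lt_compat; lra).
    assert (B1 : 3 * kap a g / 4 * (((1 - lam) * J t / 2) ^ 2 / s0) <= 3 * kap a g / 4 * (X ^ 2 / s0)).
    { apply Rmult_le_compat_l; [lra|]. apply Rmult_le_compat_r; lra. }
    assert (B2 : kap a g / 4 * (M ^ 2 * de) <= kap a g / 4 * (3 * (1 - lam) ^ 2 * j0 ^ 2 / (8 * s0))) by (apply Rmult_le_compat_l; lra).
    assert (B3 : kap a g / 4 * (3 * (1 - lam) ^ 2 * j0 ^ 2 / (8 * s0)) <= kap a g / 4 * (3 * (1 - lam) ^ 2 * J t ^ 2 / (8 * s0))).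
    { apply Rmult_le_compat_l; [lra|]. unfold Rdiv. apply Rmult_le_compat_r; [left; apply Rinv_0_lt_compat; lra|].
      apply Rmult_le_compat_l; [nra|]. apply pow_incr; lra. }
    assert (B4 : 3 * kap a g / 4 * (((1 - lam) * J t / 2) ^ 2 / s0) - kap a g / 4 * (3 * (1 - lam) ^ 2 * J t ^ 2 / (8 * s0)) = ka * J t ^ 2).
    { unfold ka, rate0. fold lam. field. lra. }
    lra. }
  assert (HF : - / J t0 - ka * t0 <= - / J T1 - ka * T1).
  { apply (incr_of_deriv (fun t => - / J t - ka * t) (fun t => J' t / J t ^ 2 - ka)); [lra| |].
    - intros t Ht. pose proof (HJm t Ht). pose proof (HJd t ltac:(lra)) as Hd.
      apply (is_derive_minus (fun t => - / J t) (fun t => ka * t)); [|auto_derive; auto; ring].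
      replace (J' t / J t ^ 2) with (- (- J' t / J t ^ 2)) by (field; lra).
      apply (is_derive_opp (fun t => / J t)). apply (is_derive_inv J); auto. lra.
    - intros t Ht. pose proof (HJm t Ht). pose proof (HJq t Ht).
      assert (0 < J t ^ 2) by nra. assert (ka <= J' t / J t ^ 2); [|lra].
      apply Rmult_le_reg_r with (J t ^ 2); auto. unfold Rdiv. rewrite Rmult_assoc, Rinv_l by lra. lra. }
  assert (H1 : 0 < / J T1) by (apply Rinv_0_lt_compat; pose proof (HJm T1 ltac:(lra)); lra).
  assert (H2 : / J t0 <= / j0) by (apply Rinv_le_contravar; lra).
  assert (H3 : ka * (T1 - t0) < / j0) by lra.
  assert (H4 : T1 - t0 < / (ka * j0)).
  { rewrite Rinv_mult. apply Rmult_lt_reg_l with ka; auto. rewrite <- Rmult_assoc, Rinv_r, Rmult_1_l by lra. auto. }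
  lra.
Qed.
End Blowup.

(** * Continuation criterion *)

Lemma cosS_cont phi a x : rapid a -> continuous (cosS phi a) x.
Proof. intros Ha. apply (ex_derive_continuous (cosS phi a) x). eexists. apply cosS_derive; auto. Qed.

Lemma cos_phase_cont k phi x : continuous (fun x => cos (INR k * x + phi)) x.
Proof. apply (ex_derive_continuous (fun x => cos (INR k * x + phi)) x). auto_derive; auto. Qed.

(** The condition on [phi] admits pure cosines ([phi = 0]) and pure sines ([phi = - PI / 2]), for
    which the boundary terms vanish on a half period. *)
Lemma cos_orthogonal phi k j : sin (2 * phi) = 0 -> (1 <= k)%nat ->
  is_RInt (fun x => cos (INR k * x + phi) * cos (INR j * x + phi)) 0 PI (if Nat.eq_dec k j then PI / 2 else 0).
Proof.
  intros Hphi Hk. assert (Hk1 : 1 <= INR k) by (change 1 with (INR 1); apply le_INR; auto).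
  pose proof (pos_INR j) as Hj.
  assert (Hc : forall x, continuous (fun x => cos (INR k * x + phi) * cos (INR j * x + phi)) x).
  { intros x. apply (continuous_mult (fun x => cos (INR k * x + phi)) (fun x => cos (INR j * x + phi))); apply cos_phase_cont. }
  assert (Hs : sin (INR k * PI + INR j * PI + 2 * phi) = 0).
  { rewrite sin_plus, Hphi, sin_plus, !sin_k_PI. ring. }
  destruct (Nat.eq_dec k j) as [<-|Hne].
  - replace (PI / 2) with (minus (PI / 2 + sin (INR k * PI + INR k * PI + 2 * phi) / (4 * INR k)) (0 / 2 + sin (INR k * 0 + INR k * 0 + 2 * phi) / (4 * INR k))).
    + apply (is_RInt_derive (fun x => x / 2 + sin (INR k * x + INR k * x + 2 * phi) / (4 * INR k))); [|intros; apply Hc].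
      intros x _. auto_derive; auto.
      replace (INR k * x + INR k * x + 2 * phi) with ((INR k * x + phi) + (INR k * x + phi)) by ring.
      rewrite cos_plus. pose proof (sin2_cos2 (INR k * x + phi)) as H2. unfold Rsqr in H2.
      replace (sin (INR k * x + phi) * sin (INR k * x + phi)) with
        (1 - cos (INR k * x + phi) * cos (INR k * x + phi)) by lra.
      field. lra.
    + change (PI / 2 + sin (INR k * PI + INR k * PI + 2 * phi) / (4 * INR k) - (0 / 2 + sin (INR k * 0 + INR k * 0 + 2 * phi) / (4 * INR k)) = PI / 2).
      rewrite Hs. replace (INR k * 0 + INR k * 0 + 2 * phi) with (2 * phi) by ring. rewrite Hphi. field. lra.
  - assert (Hkj : INR k - INR j <> 0) by (intros E; apply Hne, INR_eq; lra).
    replace 0 with (minus (sin (INR k * PI - INR j * PI) / (2 * (INR k - INR j)) + sin (INR k * PI + INR j * PI + 2 * phi) / (2 * (INR k + INR j)))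
      (sin (INR k * 0 - INR j * 0) / (2 * (INR k - INR j)) + sin (INR k * 0 + INR j * 0 + 2 * phi) / (2 * (INR k + INR j)))) at 2.
    + apply (is_RInt_derive (fun x => sin (INR k * x - INR j * x) / (2 * (INR k - INR j)) + sin (INR k * x + INR j * x + 2 * phi) / (2 * (INR k + INR j)))); [|intros; apply Hc].
      intros x _. auto_derive; auto.
      replace (INR k * x + - (INR j * x)) with ((INR k * x + phi) - (INR j * x + phi)) by ring.
      replace (INR k * x + INR j * x + 2 * phi) with ((INR k * x + phi) + (INR j * x + phi)) by ring.
      rewrite cos_plus, cos_minus. field. split; lra.
    + change (sin (INR k * PI - INR j * PI) / (2 * (INR k - INR j)) + sin (INR k * PI + INR j * PI + 2 * phi) / (2 * (INR k + INR j)) -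
        (sin (INR k * 0 - INR j * 0) / (2 * (INR k - INR j)) + sin (INR k * 0 + INR j * 0 + 2 * phi) / (2 * (INR k + INR j))) = 0).
      rewrite Hs, sin_minus, !sin_k_PI.
      replace (INR k * 0 - INR j * 0) with 0 by ring. replace (INR k * 0 + INR j * 0 + 2 * phi) with (2 * phi) by ring.
      rewrite Hphi, sin_0. field. split; lra.
Qed.

(** Integrate term by term twice, first against one mode and then against the second series. The
    zero mode is excluded because constants have another norm on [[0, PI]]. *)
Lemma parseval phi a b : sin (2 * phi) = 0 -> rapid a -> rapid b -> a O = 0 ->
  is_RInt (fun x => cosS phi a x * cosS phi b x) 0 PI (PI / 2 * Series (fun k => a k * b k)).
Proof.
  intros Hphi Ha Hb Ha0. pose proof PI_gt_3.
  destruct (Ha 2%nat) as [A HA]. destruct (Hb 2%nat) as [B HB].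
  assert (H1 : forall j, is_RInt (fun x => cosS phi a x * cos (INR j * x + phi)) 0 PI (PI / 2 * a j)).
  { intros j.
    pose proof (is_RInt_Series (fun k x => a k * (cos (INR k * x + phi) * cos (INR j * x + phi))) (fun k => A * w2 k) 0 PI ltac:(lra) (ex_series_Aw2 _)) as HS.
    assert (Hex : forall k, is_RInt (fun x => a k * (cos (INR k * x + phi) * cos (INR j * x + phi))) 0 PI (if Nat.eq_dec k j then PI / 2 * a j else 0)).
    { intros k. destruct k as [|k].
      - rewrite Ha0. apply is_RInt_ext with (fun _ => 0); [intros; symmetry; apply Rmult_0_l|].
        assert (Hz : is_RInt (fun _ : R => 0) 0 PI 0).
        { pose proof (is_RInt_const 0 PI (0 : R)) as Hz. change (scal (PI - 0) (0 : R)) with ((PI - 0) * 0) in Hz.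
          rewrite Rmult_0_r in Hz. exact Hz. }
        destruct (Nat.eq_dec 0 j) as [<-|]; [rewrite Ha0, Rmult_0_r|]; exact Hz.
      - pose proof (is_RInt_scal _ _ _ (a (S k)) _ (cos_orthogonal phi (S k) j Hphi ltac:(lia))) as HO.
        destruct (Nat.eq_dec (S k) j) as [<-|].
        + rewrite Rmult_comm. exact HO.
        + change (scal (a (S k)) 0) with (a (S k) * 0) in HO. rewrite Rmult_0_r in HO. exact HO. }
    assert (HSe : Series (fun k => RInt (fun x => a k * (cos (INR k * x + phi) * cos (INR j * x + phi))) 0 PI) = PI / 2 * a j).
    { rewrite (Series_ext _ (fun k => if Nat.eq_dec k j then PI / 2 * a j else 0)) by (intros k; apply is_RInt_unique, Hex).
      apply is_series_unique, sm_is_series.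
      apply is_lim_seq_ext_loc with (fun _ => PI / 2 * a j); [|apply is_lim_seq_const].
      exists (S j). intros n Hn. induction Hn as [|n Hn IH]; rewrite sm_S.
      - rewrite (sm_ext _ (fun _ => 0)); [rewrite sm_zero|]; [destruct (Nat.eq_dec j j); [ring|lia]|].
        intros k Hk. destruct (Nat.eq_dec k j); [lia|auto].
      - rewrite <- IH. destruct (Nat.eq_dec n j); [lia|ring]. }
    rewrite <- HSe. eapply is_RInt_ext; [|apply HS].
    - intros x _. cbv beta. unfold cosS. rewrite <- Series_scal_r. apply Series_ext; intros; ring.
    - intros k. eexists. apply Hex.
    - intros k x _. rewrite <- Rmult_assoc, Rabs_mult. pose proof (cosS_term phi a A x k HA).
      pose proof (Rabs_cos_le (INR j * x + phi)). pose proof (Rabs_pos (a k * cos (INR k * x + phi))). nra. }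
  pose proof (is_RInt_Series (fun j x => b j * (cosS phi a x * cos (INR j * x + phi))) (fun k => 2 * A * B * w2 k) 0 PI ltac:(lra) (ex_series_Aw2 _)) as HS.
  rewrite <- Series_scal_l.
  rewrite (Series_ext (fun n => PI / 2 * (a n * b n)) (fun j => RInt (fun x => b j * (cosS phi a x * cos (INR j * x + phi))) 0 PI)).
  - eapply is_RInt_ext; [|apply HS].
    + intros x _. cbv beta. unfold cosS at 3. rewrite <- Series_scal_l. apply Series_ext; intros; ring.
    + intros j. eexists. apply (is_RInt_scal _ _ _ (b j) _ (H1 j)).
    + intros j x _. rewrite Rabs_mult. pose proof (cosS_term phi b B x j HB) as Hbj. rewrite Rabs_mult in Hbj.
      rewrite Rabs_mult. pose proof (cosS_bound phi a A x HA).
      replace (Rabs (b j) * (Rabs (cosS phi a x) * Rabs (cos (INR j * x + phi)))) with (Rabs (cosS phi a x) * (Rabs (b j) * Rabs (cos (INR j * x + phi)))) by ring.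
      replace (2 * A * B * w2 j) with (2 * A * (B * w2 j)) by ring.
      apply Rmult_le_compat; auto; [apply Rabs_pos|apply Rmult_le_pos; apply Rabs_pos].
  - intros j. symmetry. apply is_RInt_unique.
    replace (PI / 2 * (a j * b j)) with (scal (b j) (PI / 2 * a j)).
    + apply (is_RInt_scal _ _ _ (b j) _ (H1 j)).
    + change (b j * (PI / 2 * a j) = PI / 2 * (a j * b j)). ring.
Qed.

Lemma is_derive_RInt_all (f : R -> R) x : (forall y, continuous f y) -> is_derive (fun z => RInt f 0 z) x (f x).
Proof.
  intros Hf. apply (is_derive_RInt f (fun b => RInt f 0 b) 0 x); auto.
  apply filter_forall. intros b. apply (RInt_correct f), cont_ex_RInt; auto.
Qed.

Section LogBound.
Variables (a : R) (c : nat -> R).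
Hypothesis Ha : 0 < a.
Hypothesis Hc : rapid c.
Variables (Th E : R).
Hypothesis HTh : forall x, Rabs (slope c x) <= Th.
Hypothesis HE0 : 0 <= E.
Hypothesis HEs : ex_series (fun k => INR k ^ 4 * c k ^ 2).
Hypothesis HE : Series (fun k => INR k ^ 4 * c k ^ 2) <= E.

(** Large enough for both bounds in [mk_close_min]: [2 k + a ^ 2 <= Ca k] for [k >= 1], and
    [4 <= Ca]. *)
Definition Ca : R := 4 + a ^ 2.

(** For [k <= nu] the truncation error is [O (k / nu)] by [mk_close]; for [k > nu] it is at most 4.
    The quotient [k / (nu + k)] is comparable to the smaller of the two. *)
Lemma mk_close_min nu k : 1 <= nu ->
  Rabs (2 * Gk a k (/ nu) nu - mk a k) * INR k <= 2 * Ca * (INR k ^ 2 * / (nu + INR k)).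
Proof.
  intros Hnu. destruct k as [|k]; [simpl; rewrite Rmult_0_r, Rmult_0_l, Rmult_0_l, Rmult_0_r; lra|].
  set (x := INR (S k)). assert (Hx : 1 <= x) by (unfold x; rewrite S_INR; pose proof (pos_INR k); lra).
  assert (Hin : 0 < / nu <= nu).
  { split; [apply Rinv_0_lt_compat; lra|]. apply Rle_trans with 1; auto. rewrite <- Rinv_1. apply Rinv_le_contravar; lra. }
  pose proof (mk_close a Ha (S k) (/ nu) nu Hin) as H1. fold x in H1.
  assert (H2 : Rabs (2 * Gk a (S k) (/ nu) nu - mk a (S k)) <= 4).
  { eapply Rle_trans; [apply Rabs_triang|]. rewrite Rabs_Ropp, Rabs_mult, (Rabs_pos_eq 2) by lra.
    pose proof (Gk_bound a Ha (S k) (/ nu) nu Hin). pose proof (mk_bound a Ha (S k)). lra. }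
  set (d := Rabs (2 * Gk a (S k) (/ nu) nu - mk a (S k))) in *.
  assert (Ha2 : 0 < a ^ 2) by nra.
  assert (Hd : d <= 2 * Ca * (x * / (nu + x))).
  { apply Rmult_le_reg_r with (nu + x); [lra|].
    replace (2 * Ca * (x * / (nu + x)) * (nu + x)) with (2 * Ca * x) by (field; lra).
    destruct (Rle_dec x nu).
    - assert (H3 : d * nu <= Ca * x).
      { apply Rle_trans with (2 * (x * / nu + a ^ 2 / 2 / nu ^ 2) * nu); [apply Rmult_le_compat_r; lra|].
        replace (2 * (x * / nu + a ^ 2 / 2 / nu ^ 2) * nu) with (2 * x + a ^ 2 * / nu) by (field; lra).
        assert (/ nu <= 1) by (rewrite <- Rinv_1; apply Rinv_le_contravar; lra). unfold Ca. nra. }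
      assert (0 <= d) by apply Rabs_pos. nra.
    - assert (d <= Ca) by (unfold Ca; lra). assert (0 <= d) by apply Rabs_pos. nra. }
  replace (2 * Ca * (x ^ 2 * / (nu + x))) with (2 * Ca * (x * / (nu + x)) * x) by ring.
  apply Rmult_le_compat_r; lra.
Qed.

Lemma telescope_series nu : 1 <= nu -> is_series (fun k => / ((nu + INR k) * (nu + INR k + 1))) (/ nu).
Proof.
  intros Hnu. apply sm_is_series.
  assert (Hsm : forall n, sm (fun k => / ((nu + INR k) * (nu + INR k + 1))) n = / nu - / (nu + INR n)).
  { induction n.
    - simpl. rewrite Rplus_0_r. ring.
    - rewrite sm_S, IHn, S_INR. pose proof (pos_INR n). field. lra. }
  apply is_lim_seq_ext with (fun n => / nu - / (nu + INR n)); [intros; rewrite Hsm; auto|].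
  replace (Finite (/ nu)) with (Finite (/ nu - 0)) by (f_equal; ring).
  apply is_lim_seq_minus'; [apply is_lim_seq_const|].
  apply (is_lim_seq_inv (fun n => nu + INR n) p_infty); [|discriminate].
  apply (is_lim_seq_plus (fun _ => nu) INR nu p_infty); [apply is_lim_seq_const|apply is_lim_seq_INR|reflexivity].
Qed.

(* Split the singular integral at distance [1 / (1 + E)]: beyond it only the sup norm of the
   slope enters, with a logarithmic constant; below it the [L^2] norm of the curvature suffices. *)
Lemma velx_log x :
  Rabs (cosS 0 (fun k => INR k * (mk a k * c k)) x) <= 4 * Th * ln (1 + E) + 3 * Ca.
Proof.
  set (nu := 1 + E). assert (Hnu : 1 <= nu) by (unfold nu; lra).
  assert (Hin : 0 < / nu <= nu).
  { split; [apply Rinv_0_lt_compat; lra|]. apply Rle_trans with 1; auto. rewrite <- Rinv_1. apply Rinv_le_contravar; lra. }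
  assert (HTh0 : 0 <= Th) by (eapply Rle_trans; [apply Rabs_pos|apply (HTh 0)]).
  pose (A k := INR k * c k * cos (INR k * x)).
  destruct (Hc 4%nat) as [M HM].
  assert (HA : bnd 3 M A).
  { apply bnd_trig; [intros; apply Rabs_cos_le|]. apply bnd_kmul; auto. }
  pose proof (RInt_oddS a Ha A M HA (/ nu) nu Hin) as HI.
  assert (HM0 := bnd_nonneg _ _ _ HA).
  assert (Hex : forall e, (forall k, Rabs (e k) <= 2) -> ex_series (fun k => A k * e k)).
  { intros e He. apply ex_series_dom with (fun k => 2 * M * w2 k); [apply ex_series_Aw2|].
    intros k. rewrite Rabs_mult. pose proof (bnd_w2 1 M A HA k) as Hw. pose proof (q_ge1 k). pose proof (Rabs_pos (A k)).
    specialize (He k). pose proof (Rabs_pos (e k)). simpl in Hw. nra. }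
  assert (E1 : cosS 0 (fun k => INR k * (mk a k * c k)) x = Series (fun k => A k * mk a k)).
  { unfold cosS. apply Series_ext. intros k. unfold A. rewrite Rplus_0_r. ring. }
  assert (HG2 : forall k, Rabs (2 * Gk a k (/ nu) nu) <= 2).
  { intros k. rewrite Rabs_mult, Rabs_pos_eq by lra. pose proof (Gk_bound a Ha k _ _ Hin). lra. }
  (* [Ka a y <= / y], whose integral over [[/ nu, nu]] is [2 ln nu]. *)
  assert (B1 : Rabs (Series (fun k => A k * (2 * Gk a k (/ nu) nu))) <= 4 * Th * ln nu).
  { rewrite <- (is_RInt_unique _ _ _ _ HI).
    assert (Hcp : contpos (fun y => (slope c (x - y) - slope c (x + y)) * Ka a y)).
    { assert (Hsc : forall z, continuous (slope c) z).
      { intros z. apply (ex_derive_continuous (slope c) z). eexists.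
        apply (is_derive_opp (sinS (fun k => INR k * c k))). apply sinS_derive. apply rapid_kmul; auto. }
      intros y Hy. apply (continuous_mult (fun y => slope c (x - y) - slope c (x + y)) (Ka a)); [|apply Ka_cont; auto].
      apply (continuous_minus (fun y => slope c (x - y)) (fun y => slope c (x + y))).
      - apply (continuous_comp (fun y => x - y) (slope c)); auto. apply (ex_derive_continuous (fun y => x - y) y). auto_derive; auto.
      - apply (continuous_comp (fun y => x + y) (slope c)); auto. apply (ex_derive_continuous (fun y => x + y) y). auto_derive; auto. }
    rewrite (RInt_ext _ (fun y => (slope c (x - y) - slope c (x + y)) * Ka a y)) by (intros; rewrite slope_antisym; auto).
    eapply Rle_trans.
    - apply (RInt_dom _ (fun y => 2 * Th * ln y) (fun y => 2 * Th * / y)); auto.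
      + intros y Hy. auto_derive; auto. ring.
      + intros y Hy. rewrite Rabs_mult. pose proof (Ka_pos a Ha y ltac:(lra)). rewrite (Rabs_pos_eq (Ka a y)) by lra.
        apply Rmult_le_compat; [apply Rabs_pos|lra| |].
        * eapply Rle_trans; [apply Rabs_triang|]. rewrite Rabs_Ropp. pose proof (HTh (x - y)). pose proof (HTh (x + y)). lra.
        * pose proof (yKa_le a Ha y ltac:(lra)). pose proof PI_gt_3.
          assert (/ PI <= 1) by (rewrite <- Rinv_1; apply Rinv_le_contravar; lra).
          apply Rmult_le_reg_l with y; [lra|]. rewrite Rinv_r by lra. lra.
    - rewrite ln_Rinv by lra. right; ring. }
  (* AM-GM with weight [nu]: [2 y w <= y ^ 2 / nu + nu w ^ 2]. The [y ^ 2 = k ^ 4 c_k ^ 2] sum to at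
     most [E <= nu], the [w ^ 2 = / (nu + k) ^ 2] to at most [2 / nu] by telescoping: in all
     [1 + 2]. *)
  assert (B2 : Rabs (Series (fun k => A k * (2 * Gk a k (/ nu) nu)) - Series (fun k => A k * mk a k)) <= 3 * Ca).
  { rewrite <- Series_minus; [|apply Hex; auto|apply Hex; apply mk_bound; auto].
    pose proof (telescope_series nu Hnu) as HTe.
    assert (Hi : 0 < / nu) by lra.
    assert (Hex2 : ex_series (fun k => Ca * (/ nu * (INR k ^ 4 * c k ^ 2) + 2 * nu * / ((nu + INR k) * (nu + INR k + 1))))).
    { apply (ex_series_scal_l Ca (fun k => / nu * (INR k ^ 4 * c k ^ 2) + 2 * nu * / ((nu + INR k) * (nu + INR k + 1)))).
      apply (ex_series_plus (fun k => / nu * (INR k ^ 4 * c k ^ 2)) (fun k => 2 * nu * / ((nu + INR k) * (nu + INR k + 1)))).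
      - apply (ex_series_scal_l (/ nu) (fun k => INR k ^ 4 * c k ^ 2)); auto.
      - apply (ex_series_scal_l (2 * nu) (fun k => / ((nu + INR k) * (nu + INR k + 1)))). exists (/ nu); auto. }
    eapply Rle_trans.
    - apply (series_abs_le _ (fun k => Ca * (/ nu * (INR k ^ 4 * c k ^ 2) + 2 * nu * / ((nu + INR k) * (nu + INR k + 1))))); auto.
      intros k. rewrite <- Rmult_minus_distr_l, Rabs_mult. unfold A.
      pose proof (mk_close_min nu k Hnu) as HK. set (d := Rabs (2 * Gk a k (/ nu) nu - mk a k)) in *.
      assert (Hd0 : 0 <= d) by apply Rabs_pos.
      rewrite !Rabs_mult, (Rabs_pos_eq (INR k)) by apply pos_INR.
      pose proof (Rabs_cos_le (INR k * x)). pose proof (pos_INR k) as Hk0. pose proof (Rabs_pos (c k)) as Hc0.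
      apply Rle_trans with (Rabs (c k) * (d * INR k)).
      { replace (INR k * Rabs (c k) * Rabs (cos (INR k * x)) * d) with (Rabs (c k) * (d * INR k) * Rabs (cos (INR k * x))) by ring.
        rewrite <- (Rmult_1_r (Rabs (c k) * (d * INR k))) at 2. apply Rmult_le_compat_l; auto. apply Rmult_le_pos; nra. }
      apply Rle_trans with (Rabs (c k) * (2 * Ca * (INR k ^ 2 * / (nu + INR k)))); [apply Rmult_le_compat_l; auto|].
      rewrite <- (pow2_abs (c k)). set (y := INR k ^ 2 * Rabs (c k)).
      set (w := / (nu + INR k)).
      replace (Rabs (c k) * (2 * Ca * (INR k ^ 2 * w))) with (Ca * (2 * (y * w))) by (unfold y; ring).
      replace (INR k ^ 4 * Rabs (c k) ^ 2) with (y ^ 2) by (unfold y; ring).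
      apply Rmult_le_compat_l; [unfold Ca; nra|].
      assert (Hw : w ^ 2 <= 2 * / ((nu + INR k) * (nu + INR k + 1))).
      { unfold w. apply Rmult_le_reg_r with ((nu + INR k) ^ 2 * (nu + INR k + 1)); [apply Rmult_lt_0_compat; nra|].
        replace ((/ (nu + INR k)) ^ 2 * ((nu + INR k) ^ 2 * (nu + INR k + 1))) with (nu + INR k + 1) by (field; lra).
        replace (2 * / ((nu + INR k) * (nu + INR k + 1)) * ((nu + INR k) ^ 2 * (nu + INR k + 1))) with (2 * (nu + INR k)) by (field; lra). lra. }
      apply Rle_trans with (/ nu * y ^ 2 + nu * w ^ 2).
      + assert (0 <= nu * (/ nu * y - w) ^ 2) by (apply Rmult_le_pos; [lra|apply pow2_ge_0]).
        replace (nu * (/ nu * y - w) ^ 2) with (/ nu * y ^ 2 - 2 * (y * w) + nu * w ^ 2) in H0 by (field; lra). lra.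
      + assert (nu * w ^ 2 <= nu * (2 * / ((nu + INR k) * (nu + INR k + 1)))) by (apply Rmult_le_compat_l; lra). lra.
    - rewrite Series_scal_l, Series_plus, !Series_scal_l.
      + rewrite (is_series_unique _ _ HTe).
        assert (/ nu * Series (fun k => INR k ^ 4 * c k ^ 2) <= 1).
        { apply Rmult_le_reg_l with nu; [lra|]. rewrite <- Rmult_assoc, Rinv_r by lra. unfold nu. lra. }
        replace (2 * nu * / nu) with 2 by (field; lra).
        assert (0 < Ca) by (unfold Ca; nra). nra.
      + apply (ex_series_scal_l (/ nu) (fun k => INR k ^ 4 * c k ^ 2)); auto.
      + apply (ex_series_scal_l (2 * nu) (fun k => / ((nu + INR k) * (nu + INR k + 1)))). exists (/ nu); auto. }
  rewrite E1. replace (Series (fun k => A k * mk a k)) with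
    (Series (fun k => A k * (2 * Gk a k (/ nu) nu)) - (Series (fun k => A k * (2 * Gk a k (/ nu) nu)) - Series (fun k => A k * mk a k))) by ring.
  eapply Rle_trans; [apply Rabs_triang|]. rewrite Rabs_Ropp. fold nu. lra.
Qed.
End LogBound.

(** * The [H^2] energy against the time integral of the slope *)

Section Continuation.
Variables (a g : R).
Hypothesis Ha : 0 < a.
Hypothesis Hg : 0 < g.
Variable Tm : R.
Variable c : R -> nat -> R.
Hypothesis HTm : 0 < Tm.
Hypothesis Hub : ubnd Tm c.
Hypothesis Hc0 : forall t, t < Tm -> c t O = 0.
Hypothesis Hder : forall t k, 0 < t < Tm -> is_derive (fun s => c s k) t (Bser g (mk a) (c t) (c t) k).
Hypothesis Hlip : forall T1, T1 < Tm -> forall s, exists A, 0 <= A /\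
  forall t t', t <= T1 -> t' <= T1 -> bnd s (A * Rabs (t' - t)) (fun k => c t' k - c t k).

Definition E2 (t : R) : R := Series (fun k => INR k ^ 4 * c t k ^ 2).
Definition E2' (t : R) : R := Series (fun k => 2 * (INR k * (INR k * c t k) * (INR k * (INR k * Bser g (mk a) (c t) (c t) k)))).

Lemma E2_term_bound A B (b d : nat -> R) k : bnd 3 A b -> bnd 3 B d ->
  Rabs (INR k * (INR k * b k) * (INR k * (INR k * d k))) <= A * B * w2 k.
Proof.
  intros Hb Hd. specialize (Hb k). specialize (Hd k). pose proof (INR_le_q k) as Hk. pose proof (q_ge1 k) as Hq.
  rewrite !Rabs_mult, (Rabs_pos_eq (INR k)) by lra.
  set (x := Rabs (b k)) in *. set (y := Rabs (d k)) in *.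
  assert (Hx : 0 <= x) by apply Rabs_pos. assert (Hy : 0 <= y) by apply Rabs_pos.
  pose proof (inv_q2_le_w2 k) as Hw.
  assert (Hxy : (q k ^ 3 * x) * (q k ^ 3 * y) <= A * B).
  { apply Rmult_le_compat; auto; apply Rmult_le_pos; auto; apply pow_le; lra. }
  assert (HAB : 0 <= A * B).
  { eapply Rle_trans; [|exact Hxy]. apply Rmult_le_pos; apply Rmult_le_pos; auto; apply pow_le; lra. }
  apply Rle_trans with (A * B * / q k ^ 2); [|apply Rmult_le_compat_l; auto].
  apply Rmult_le_reg_r with (q k ^ 2); [nra|]. rewrite (Rmult_assoc (A * B)), Rinv_l, Rmult_1_r by nra.
  eapply Rle_trans; [|exact Hxy].
  replace (INR k * (INR k * x) * (INR k * (INR k * y)) * q k ^ 2) with (INR k ^ 4 * (q k ^ 2 * (x * y))) by ring.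
  replace (q k ^ 3 * x * (q k ^ 3 * y)) with (q k ^ 4 * (q k ^ 2 * (x * y))) by ring.
  apply Rmult_le_compat_r; [apply Rmult_le_pos; nra|]. apply pow_incr; lra.
Qed.

Lemma E2_bound_term A (b : nat -> R) k : bnd 3 A b -> Rabs (INR k ^ 4 * b k ^ 2) <= A * A * w2 k.
Proof.
  intros Hb. pose proof (E2_term_bound A A b b k Hb Hb) as H.
  replace (INR k ^ 4 * b k ^ 2) with (INR k * (INR k * b k) * (INR k * (INR k * b k))) by ring. auto.
Qed.

Lemma E2_ex t : t < Tm -> ex_series (fun k => INR k ^ 4 * c t k ^ 2).
Proof.
  intros Ht. destruct (ubnd_rapid Tm c t Hub Ht 3%nat) as [A HA].
  apply ex_series_dom with (fun k => A * A * w2 k); [apply ex_series_Aw2|]. intros; apply E2_bound_term; auto.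
Qed.

Lemma E2_nonneg t : t < Tm -> 0 <= E2 t.
Proof.
  intros Ht. pose proof (series_sm_le (fun k => INR k ^ 4 * c t k ^ 2) 0 (E2_ex t Ht)) as H. simpl sm in H. apply H.
  intros k. apply Rmult_le_pos; [apply pow_le, pos_INR|apply pow2_ge_0].
Qed.

Lemma E2_derive t : 0 < t < Tm -> is_derive E2 t (E2' t).
Proof.
  intros Ht. assert (HuB : ubnd Tm (fun t => Bser g (mk a) (c t) (c t))) by (apply ubnd_Bser; auto; apply mk_bound; auto).
  assert (HT : (t + Tm) / 2 < Tm) by lra.
  destruct (Hub _ HT 3%nat) as [A HA]. destruct (HuB _ HT 3%nat) as [B HB].
  destruct (near_interior Tm t ((Tm - t) / 2) Ht ltac:(lra)) as [d [Hd1 Hd2]].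
  assert (Hn : forall s, Rabs (s - t) < d -> s <= (t + Tm) / 2).
  { intros s Hs. apply Rabs_def2 in Hs. lra. }
  apply (is_derive_Series (fun s k => INR k ^ 4 * c s k ^ 2) (fun s k => 2 * (INR k * (INR k * c s k) * (INR k * (INR k * Bser g (mk a) (c s) (c s) k)))) (fun k => 2 * (A * B) * w2 k) t d).
  - lra.
  - apply ex_series_Aw2.
  - intros s k Hs. specialize (Hder s k (Hd2 s Hs)).
    apply is_derive_ext with (fun s => INR k ^ 4 * (c s k * c s k)); [intros; simpl; ring|].
    replace (2 * (INR k * (INR k * c s k) * (INR k * (INR k * Bser g (mk a) (c s) (c s) k)))) with
      (INR k ^ 4 * (Bser g (mk a) (c s) (c s) k * c s k + c s k * Bser g (mk a) (c s) (c s) k)) by ring.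
    apply (is_derive_scal (fun s => c s k * c s k)).
    apply (is_derive_mult (fun s => c s k) (fun s => c s k)); auto. intros; apply Rmult_comm.
  - intros s k Hs. rewrite Rabs_mult, (Rabs_pos_eq 2) by lra.
    pose proof (E2_term_bound A B (c s) (Bser g (mk a) (c s) (c s)) k (HA s (Hn s Hs)) (HB s (Hn s Hs))). lra.
  - intros s Hs. apply E2_ex. specialize (Hd2 s Hs). lra.
Qed.

Section FixedTime.
Variable t : R.
Hypothesis Ht : t < Tm.
Variable Th : R.
Hypothesis HTh : forall x, Rabs (slope (c t) x) <= Th.

Let Hr : rapid (c t) := ubnd_rapid Tm c t Hub Ht.
Let B := Bser g (mk a) (c t) (c t).
Let HB : rapid B := Bser_rapid a g (c t) Ha Hg Hr.
Let Hmc : rapid (fun k => mk a k * c t k) := mc_rapid a (c t) Ha Hr.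

Definition velxx (x : R) : R := - sinS (fun k => INR k * (INR k * (mk a k * c t k))) x.
Definition curvx (x : R) : R := sinS (fun k => INR k * (INR k * (INR k * c t k))) x.
Definition ratexx (x : R) : R := - cosS 0 (fun k => INR k * (INR k * Bser g (mk a) (c t) (c t) k)) x.

Lemma velx_derive x : is_derive (velx a c t) x (velxx x).
Proof. apply cos0S_derive. apply rapid_kmul; auto. Qed.

Lemma curv_derive x : is_derive (curv c t) x (curvx x).
Proof.
  unfold curvx. rewrite <- (Ropp_involutive (sinS _ x)).
  apply (is_derive_opp (cosS 0 (fun k => INR k * (INR k * c t k)))). apply cos0S_derive. apply rapid_kmul, rapid_kmul; auto.
Qed.

Lemma ratexx_eq x : ratexx x =
  - (g * (velxx x * slope (c t) x + 2 * velx a c t x * curv c t x + vel a (c t) x * curvx x)).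
Proof.
  assert (H1 : is_derive (fun y => - sinS (fun k => INR k * B k) y) x (ratexx x)).
  { apply (is_derive_opp (sinS (fun k => INR k * B k))). apply sinS_derive. apply rapid_kmul; auto. }
  assert (H2 : is_derive (fun y => - sinS (fun k => INR k * B k) y) x
     (- (g * ((velxx x * slope (c t) x + velx a c t x * curv c t x) + (velx a c t x * curv c t x + vel a (c t) x * curvx x))))).
  { apply is_derive_ext with (fun y => - (g * (velx a c t y * slope (c t) y + vel a (c t) y * curv c t y))).
    { intros y. symmetry. apply (rate_x a g Ha Hg Tm c Hub Hc0 t y Ht). }
    apply (is_derive_opp (fun y => g * (velx a c t y * slope (c t) y + vel a (c t) y * curv c t y))).
    apply (is_derive_scal (fun y => velx a c t y * slope (c t) y + vel a (c t) y * curv c t y)).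
    pose proof (slope_derive Tm c Hub t x Ht). pose proof (vel_derive a Ha Tm c Hub t x Ht).
    apply (is_derive_plus (fun y => velx a c t y * slope (c t) y) (fun y => vel a (c t) y * curv c t y)).
    - apply (is_derive_mult (velx a c t) (slope (c t))); auto; [apply velx_derive|intros; apply Rmult_comm].
    - apply (is_derive_mult (vel a (c t)) (curv c t)); auto; [apply curv_derive|intros; apply Rmult_comm]. }
  apply is_derive_unique in H1. apply is_derive_unique in H2. rewrite H1 in H2. rewrite H2. ring.
Qed.

Lemma cont_of_derive (f f' : R -> R) : (forall x, is_derive f x (f' x)) -> forall x, continuous f x.
Proof. intros H x. apply (ex_derive_continuous f x). exists (f' x); auto. Qed.

Lemma curv_int : is_RInt (fun x => curv c t x * curv c t x) 0 PI (PI / 2 * E2 t).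
Proof.
  pose proof (parseval 0 (fun k => INR k * (INR k * c t k)) (fun k => INR k * (INR k * c t k))) as H.
  specialize (H ltac:(rewrite Rmult_0_r; apply sin_0) ltac:(apply rapid_kmul, rapid_kmul; auto) ltac:(apply rapid_kmul, rapid_kmul; auto) ltac:(simpl; ring)).
  unfold E2. rewrite (Series_ext _ (fun k => INR k * (INR k * c t k) * (INR k * (INR k * c t k)))) by (intros; ring).
  eapply is_RInt_ext; [|exact H]. intros x _. unfold curv. simpl. ring.
Qed.

(** The symbol is bounded by 2, hence the 4. *)
Lemma velxx_int : exists I, is_RInt (fun x => velxx x * velxx x) 0 PI I /\ I <= 4 * (PI / 2 * E2 t).
Proof.
  pose proof (parseval (- (PI / 2)) (fun k => INR k * (INR k * (mk a k * c t k))) (fun k => INR k * (INR k * (mk a k * c t k)))) as H.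
  specialize (H ltac:(replace (2 * - (PI / 2)) with (- PI) by field; rewrite sin_neg, sin_PI; ring) ltac:(apply rapid_kmul, rapid_kmul; auto) ltac:(apply rapid_kmul, rapid_kmul; auto) ltac:(simpl; ring)).
  eexists. split.
  - eapply is_RInt_ext; [|exact H]. intros x _. unfold velxx. rewrite sinS_cosS. simpl. ring.
  - pose proof PI_gt_3.
    assert (Series (fun k => INR k * (INR k * (mk a k * c t k)) * (INR k * (INR k * (mk a k * c t k)))) <= 4 * E2 t); [|nra].
    unfold E2. rewrite <- Series_scal_l. eapply Rle_trans; [apply Rle_abs|].
    apply series_abs_le; [apply (ex_series_scal_l 4 (fun k => INR k ^ 4 * c t k ^ 2)), E2_ex; auto|].
    intros k. pose proof (mk_bound a Ha k) as Hm.
    replace (INR k * (INR k * (mk a k * c t k)) * (INR k * (INR k * (mk a k * c t k)))) with (mk a k ^ 2 * (INR k ^ 4 * c t k ^ 2)) by ring.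
    assert (0 <= INR k ^ 4 * c t k ^ 2) by (apply Rmult_le_pos; [apply pow_le, pos_INR|apply pow2_ge_0]).
    rewrite Rabs_pos_eq by (apply Rmult_le_pos; [apply pow2_ge_0|auto]).
    apply Rmult_le_compat_r; auto. rewrite <- pow2_abs. pose proof (Rabs_pos (mk a k)). nra.
Qed.

Lemma E2'_int : is_RInt (fun x => curv c t x * ratexx x) 0 PI (PI / 4 * E2' t).
Proof.
  pose proof (parseval 0 (fun k => INR k * (INR k * c t k)) (fun k => INR k * (INR k * B k))) as H.
  specialize (H ltac:(rewrite Rmult_0_r; apply sin_0) ltac:(apply rapid_kmul, rapid_kmul; auto) ltac:(apply rapid_kmul, rapid_kmul; auto) ltac:(simpl; ring)).
  unfold E2'. rewrite Series_scal_l.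
  replace (PI / 4 * (2 * Series (fun k => INR k * (INR k * c t k) * (INR k * (INR k * Bser g (mk a) (c t) (c t) k))))) with
    (PI / 2 * Series (fun k => INR k * (INR k * c t k) * (INR k * (INR k * B k)))) by (unfold B; field).
  eapply is_RInt_ext; [|exact H]. intros x _. unfold curv, ratexx, B. simpl. ring.
Qed.

(** The dangerous term [vel * curvx * curv] contains a third derivative. It equals
    [/ 2 vel (curv ^ 2)'], and integration by parts leaves [- / 2 velx curv ^ 2], with no boundary
    term since [vel] vanishes at 0 and at [PI]. The remaining terms cost [Th] and [L] times [L^2]
    norms of [velxx] and [curv]. *)
Lemma energy_ineq L : 0 <= L -> (forall x, Rabs (velx a c t x) <= L) -> E2' t <= g * (5 * Th + 3 * L) * E2 t.
Proof.
  intros HL0 HL. pose proof PI_gt_3 as HPI.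
  assert (HTh0 : 0 <= Th) by (eapply Rle_trans; [apply Rabs_pos|apply (HTh 0)]).
  destruct velxx_int as [I [HI1 HI2]]. pose proof curv_int as HC. pose proof E2'_int as HR.
  assert (Cc : forall x, continuous (curv c t) x) by (apply (cont_of_derive _ curvx); apply curv_derive).
  assert (Cv : forall x, continuous velxx x).
  { intros x. apply (continuous_opp (sinS (fun k => INR k * (INR k * (mk a k * c t k))))).
    apply (cont_of_derive _ (cosS 0 (fun k => INR k * (INR k * (INR k * (mk a k * c t k)))))). intros; apply sinS_derive.
    apply rapid_kmul, rapid_kmul; auto. }
  assert (Cr : forall x, continuous ratexx x).
  { intros x. apply (continuous_opp (cosS 0 (fun k => INR k * (INR k * B k)))). apply cosS_cont. apply rapid_kmul, rapid_kmul; auto. }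
  (* Right side minus left side over [[0, x]], with the boundary term of the integration by parts
     built in. *)
  pose (P x := g * (/ 2 * Th * (RInt (fun x => velxx x * velxx x) 0 x + RInt (fun x => curv c t x * curv c t x) 0 x)
      + 3 / 2 * L * RInt (fun x => curv c t x * curv c t x) 0 x)
      - g / 2 * (vel a (c t) x * (curv c t x * curv c t x)) - RInt (fun x => curv c t x * ratexx x) 0 x).
  pose (P' x := g * (/ 2 * Th * (velxx x * velxx x + curv c t x * curv c t x) + 3 / 2 * L * (curv c t x * curv c t x))
      - g / 2 * (velx a c t x * (curv c t x * curv c t x) + vel a (c t) x * (curvx x * curv c t x + curv c t x * curvx x)) - curv c t x * ratexx x).
  assert (HP : P 0 <= P PI).
  { apply (incr_of_deriv P P'); [lra| |].
    - intros x _. unfold P, P'.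
      assert (D1 : is_derive (fun z => RInt (fun x => velxx x * velxx x) 0 z) x (velxx x * velxx x)).
      { apply (is_derive_RInt_all (fun x => velxx x * velxx x)). intros; apply (continuous_mult velxx velxx); auto. }
      assert (D2 : is_derive (fun z => RInt (fun x => curv c t x * curv c t x) 0 z) x (curv c t x * curv c t x)).
      { apply (is_derive_RInt_all (fun x => curv c t x * curv c t x)). intros; apply (continuous_mult (curv c t) (curv c t)); auto. }
      assert (D3 : is_derive (fun z => RInt (fun x => curv c t x * ratexx x) 0 z) x (curv c t x * ratexx x)).
      { apply (is_derive_RInt_all (fun x => curv c t x * ratexx x)). intros; apply (continuous_mult (curv c t) ratexx); auto. }
      apply (is_derive_minus (fun x => g * (/ 2 * Th * (RInt (fun x => velxx x * velxx x) 0 x + RInt (fun x => curv c t x * curv c t x) 0 x)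
      + 3 / 2 * L * RInt (fun x => curv c t x * curv c t x) 0 x) - g / 2 * (vel a (c t) x * (curv c t x * curv c t x))) (fun x => RInt (fun x => curv c t x * ratexx x) 0 x)); auto.
      apply (is_derive_minus (fun x => g * (/ 2 * Th * (RInt (fun x => velxx x * velxx x) 0 x + RInt (fun x => curv c t x * curv c t x) 0 x)
      + 3 / 2 * L * RInt (fun x => curv c t x * curv c t x) 0 x)) (fun x => g / 2 * (vel a (c t) x * (curv c t x * curv c t x)))).
      + apply (is_derive_scal (fun x => / 2 * Th * (RInt (fun x => velxx x * velxx x) 0 x + RInt (fun x => curv c t x * curv c t x) 0 x) + 3 / 2 * L * RInt (fun x => curv c t x * curv c t x) 0 x)).
        apply (is_derive_plus (fun x => / 2 * Th * (RInt (fun x => velxx x * velxx x) 0 x + RInt (fun x => curv c t x * curv c t x) 0 x)) (fun x => 3 / 2 * L * RInt (fun x => curv c t x * curv c t x) 0 x)).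
        * apply (is_derive_scal (fun x => RInt (fun x => velxx x * velxx x) 0 x + RInt (fun x => curv c t x * curv c t x) 0 x)).
          apply (is_derive_plus (fun x => RInt (fun x => velxx x * velxx x) 0 x) (fun x => RInt (fun x => curv c t x * curv c t x) 0 x)); auto.
        * apply (is_derive_scal (fun x => RInt (fun x => curv c t x * curv c t x) 0 x)); auto.
      + apply (is_derive_scal (fun x => vel a (c t) x * (curv c t x * curv c t x))).
        apply (is_derive_mult (vel a (c t)) (fun x => curv c t x * curv c t x)).
        * apply (vel_derive a Ha Tm c Hub t x Ht).
        * apply (is_derive_mult (curv c t) (curv c t)); try apply curv_derive. intros; apply Rmult_comm.
        * intros; apply Rmult_comm.
    - intros x _. unfold P'. rewrite ratexx_eq.
      pose proof (HTh x) as T1. pose proof (HL x) as T2.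
      apply Rabs_le_between in T1. apply Rabs_le_between in T2.
      set (v2 := velxx x). set (k := curv c t x). set (th := slope (c t) x) in *. set (v1 := velx a c t x) in *.
      set (v := vel a (c t) x). set (k1 := curvx x).
      assert (A1 : - (Th * (/ 2 * (v2 * v2 + k * k))) <= v2 * th * k).
      { assert (B1 : Rabs (v2 * k) <= / 2 * (v2 * v2 + k * k)).
        { apply Rabs_le. pose proof (pow2_ge_0 (v2 - k)). pose proof (pow2_ge_0 (v2 + k)). split; lra. }
        assert (B2 : Rabs (th * (v2 * k)) <= Th * (/ 2 * (v2 * v2 + k * k))).
        { rewrite Rabs_mult. apply Rmult_le_compat; auto; try apply Rabs_pos. apply HTh. }
        apply Rabs_le_between in B2. lra. }
      assert (A2 : - (L * (k * k)) <= v1 * (k * k)) by (assert (0 <= k * k) by nra; nra).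
      replace (g * (/ 2 * Th * (v2 * v2 + k * k) + 3 / 2 * L * (k * k)) - g / 2 * (v1 * (k * k) + v * (k1 * k + k * k1)) - k * - (g * (v2 * th + 2 * v1 * k + v * k1)))
        with (g * ((Th * (/ 2 * (v2 * v2 + k * k)) + v2 * th * k) + 3 / 2 * (L * (k * k) + v1 * (k * k)))) by field.
      apply Rmult_le_pos; lra. }
  unfold P in HP.
  rewrite (is_RInt_unique _ _ _ _ HI1), (is_RInt_unique _ _ _ _ HC), (is_RInt_unique _ _ _ _ HR) in HP.
  rewrite !(RInt_point 0) in HP. change (zero : R) with 0 in HP.
  replace (vel a (c t) PI) with 0 in HP by (symmetry; apply sinS_PI).
  replace (vel a (c t) 0) with 0 in HP by (symmetry; apply sinS_0).
  pose proof (E2_nonneg t Ht) as HE.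
  assert (HF : PI / 4 * E2' t <= g * (/ 2 * Th * (4 * (PI / 2 * E2 t) + PI / 2 * E2 t) + 3 / 2 * L * (PI / 2 * E2 t))).
  { assert (g * (/ 2 * Th * (I + PI / 2 * E2 t) + 3 / 2 * L * (PI / 2 * E2 t)) <= g * (/ 2 * Th * (4 * (PI / 2 * E2 t) + PI / 2 * E2 t) + 3 / 2 * L * (PI / 2 * E2 t))); [|lra].
    apply Rmult_le_compat_l; [lra|]. apply Rplus_le_compat_r. apply Rmult_le_compat_l; lra. }
  apply Rmult_le_reg_l with (PI / 4); [lra|]. eapply Rle_trans; [exact HF|]. right; field.
Qed.
End FixedTime.

(** [17 = 5 + 3 * 4] and [9 = 3 * 3]: [energy_ineq] with the [L] supplied by [velx_log]. *)
Definition C1 : R := g * (17 + 9 * Ca a).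

Lemma E2_growth t : 0 < t < Tm ->
  E2' t <= C1 * (1 + Linf (pdx (rho c) t)) * ((1 + E2 t) * (1 + ln (1 + E2 t))).
Proof.
  intros Ht. pose proof (E2_nonneg t ltac:(lra)) as HE. set (Th := Linf (pdx (rho c) t)).
  assert (HTh : forall x, Rabs (slope (c t) x) <= Th) by (intros x; apply (Linf_slope Tm c Hub); lra).
  assert (HTh0 : 0 <= Th) by (eapply Rle_trans; [apply Rabs_pos|apply (HTh 0)]).
  assert (HCa : 0 < Ca a) by (unfold Ca; nra).
  assert (Hln : 0 <= ln (1 + E2 t)) by (rewrite <- ln_1; destruct (Req_dec (E2 t) 0) as [E|E]; [rewrite E, Rplus_0_r; lra|left; apply ln_increasing; lra]).
  assert (HL : forall x, Rabs (velx a c t x) <= 4 * Th * ln (1 + E2 t) + 3 * Ca a).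
  { intros x. apply (velx_log a (c t) Ha (ubnd_rapid Tm c t Hub ltac:(lra)) Th (E2 t) HTh HE (E2_ex t ltac:(lra)) (Rle_refl _)). }
  assert (HL0 : 0 <= 4 * Th * ln (1 + E2 t) + 3 * Ca a) by (assert (0 <= Th * ln (1 + E2 t)) by nra; lra).
  pose proof (energy_ineq t ltac:(lra) Th HTh _ HL0 HL) as HI.
  eapply Rle_trans; [exact HI|]. unfold C1. set (l := ln (1 + E2 t)) in *.
  assert (B1 : 5 * Th + 3 * (4 * Th * l + 3 * Ca a) <= (17 + 9 * Ca a) * ((1 + Th) * (1 + l))).
  { assert (0 <= Th * l) by nra. assert (0 <= Ca a * (Th + l + Th * l)) by nra. nra. }
  assert (B2 : (5 * Th + 3 * (4 * Th * l + 3 * Ca a)) * E2 t <= (17 + 9 * Ca a) * ((1 + Th) * (1 + l)) * (1 + E2 t)).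
  { assert (0 <= Th * l) by nra. apply Rmult_le_compat; lra. }
  apply Rmult_le_compat_l with (r := g) in B2; [|lra]. lra.
Qed.

(** By [E2_growth] the derivative of [ln (1 + ln (1 + E2))] is at most [C1 (1 + |rho_x|_oo)], so the
    energy stays below a double exponential. Before [Tm / 2], thus near time 0 where no derivative
    is at hand, the decay of the coefficients is enough. *)
Lemma E2_bounded K : (forall t, 0 <= t < Tm -> RInt (fun s => Linf (pdx (rho c) s)) 0 t <= K) ->
  exists B, forall t n, 0 <= t < Tm -> sm (fun k => INR k ^ 4 * c t k ^ 2) n <= B.
Proof.
  intros HK.
  assert (HCa : 0 < Ca a) by (unfold Ca; nra).
  assert (HC1 : 0 < C1) by (unfold C1; nra).
  pose (t0 := Tm / 2).
  pose (Z t := ln (1 + ln (1 + E2 t))).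
  pose (Rf t := RInt (fun s => Linf (pdx (rho c) s)) 0 t).
  assert (Hln : forall t, t < Tm -> 0 <= ln (1 + E2 t)).
  { intros t Ht. pose proof (E2_nonneg t Ht). rewrite <- ln_1. destruct (Req_dec (E2 t) 0) as [E|E]; [rewrite E, Rplus_0_r; lra|left; apply ln_increasing; lra]. }
  assert (HRd : forall t, 0 < t < Tm -> is_derive Rf t (Linf (pdx (rho c) t))).
  { intros t Ht. apply (is_derive_RInt (fun s => Linf (pdx (rho c) s)) Rf 0 t).
    - destruct (near_interior Tm t 1 Ht ltac:(lra)) as [d [[Hd1 _] Hd2]].
      exists (mkposreal d Hd1). intros s Hs. apply (RInt_correct (fun s => Linf (pdx (rho c) s))).
      apply (ex_RInt_Linf Tm c Hub Hlip). specialize (Hd2 s Hs). lra.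
    - apply (Linf_cont Tm c Hub Hlip). lra. }
  assert (HRp : forall t, 0 <= t < Tm -> 0 <= Rf t).
  { intros t Ht. apply RInt_nonneg; [lra|apply (ex_RInt_Linf Tm c Hub Hlip); lra|].
    intros s Hs. eapply Rle_trans; [apply Rabs_pos|apply (Linf_slope Tm c Hub s 0); lra]. }
  assert (HZ : forall t, t0 <= t < Tm -> Z t <= Z t0 + C1 * (Tm + K)).
  { intros t Ht.
    assert (HW : C1 * (t0 + Rf t0) - Z t0 <= C1 * (t + Rf t) - Z t).
    { apply (incr_of_deriv (fun t => C1 * (t + Rf t) - Z t)
        (fun t => C1 * (1 + Linf (pdx (rho c) t)) - E2' t / (1 + E2 t) / (1 + ln (1 + E2 t)))); [lra| |].
      - intros s Hs. assert (Hs' : 0 < s < Tm) by (unfold t0 in *; lra).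
        apply (is_derive_minus (fun t => C1 * (t + Rf t)) Z).
        + apply (is_derive_scal (fun t => t + Rf t)). apply (is_derive_plus (fun t => t) Rf); [apply (is_derive_id s)|auto].
        + pose proof (E2_nonneg s ltac:(lra)). pose proof (Hln s ltac:(lra)).
          assert (HE1 : is_derive (fun t => 1 + E2 t) s (E2' s)).
          { replace (E2' s) with (0 + E2' s) by ring. apply (is_derive_plus (fun _ => 1) E2); [apply (is_derive_const 1)|apply E2_derive; auto]. }
          assert (HL1 : is_derive (fun t => ln (1 + E2 t)) s (E2' s * / (1 + E2 s))).
          { apply (is_derive_comp ln (fun t => 1 + E2 t) s); [apply is_derive_ln; lra|auto]. }
          assert (HL2 : is_derive (fun t => 1 + ln (1 + E2 t)) s (E2' s * / (1 + E2 s))).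
          { replace (E2' s * / (1 + E2 s)) with (0 + E2' s * / (1 + E2 s)) by ring.
            apply (is_derive_plus (fun _ => 1) (fun t => ln (1 + E2 t))); [apply (is_derive_const 1)|auto]. }
          apply (is_derive_comp ln (fun t => 1 + ln (1 + E2 t)) s); [apply is_derive_ln; lra|auto].
      - intros s Hs. assert (Hs' : 0 < s < Tm) by (unfold t0 in *; lra).
        pose proof (E2_nonneg s ltac:(lra)). pose proof (Hln s ltac:(lra)). pose proof (E2_growth s Hs') as HG.
        assert (E2' s / (1 + E2 s) / (1 + ln (1 + E2 s)) <= C1 * (1 + Linf (pdx (rho c) s))); [|lra].
        apply Rmult_le_reg_r with ((1 + E2 s) * (1 + ln (1 + E2 s))); [nra|].
        replace (E2' s / (1 + E2 s) / (1 + ln (1 + E2 s)) * ((1 + E2 s) * (1 + ln (1 + E2 s)))) with (E2' s) by (field; lra). auto. }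
    pose proof (HK t ltac:(unfold t0 in *; lra)) as HKt. fold (Rf t) in HKt.
    pose proof (HRp t0 ltac:(unfold t0; lra)).
    assert (C1 * (t + Rf t) <= C1 * (Tm + K)) by (apply Rmult_le_compat_l; lra).
    assert (0 <= C1 * (t0 + Rf t0)) by (apply Rmult_le_pos; unfold t0 in *; lra). lra. }
  assert (HEb : forall t, t0 <= t < Tm -> E2 t <= exp (exp (Z t0 + C1 * (Tm + K)))).
  { intros t Ht. specialize (HZ t Ht). pose proof (E2_nonneg t ltac:(lra)). pose proof (Hln t ltac:(lra)).
    assert (H1 : 1 + ln (1 + E2 t) <= exp (Z t0 + C1 * (Tm + K))).
    { rewrite <- (exp_ln (1 + ln (1 + E2 t))) by lra. fold (Z t). destruct HZ as [HZ|HZ]; [left; apply exp_increasing; auto|rewrite HZ; lra]. }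
    assert (H2 : 1 + E2 t <= exp (exp (Z t0 + C1 * (Tm + K)))); [|lra].
    rewrite <- (exp_ln (1 + E2 t)) by lra.
    assert (H3 : ln (1 + E2 t) < exp (Z t0 + C1 * (Tm + K))) by lra. left; apply exp_increasing; auto. }
  assert (Ht0 : t0 < Tm) by (unfold t0; lra).
  destruct (Hub t0 Ht0 3%nat) as [A HA].
  exists (exp (exp (Z t0 + C1 * (Tm + K))) + 2 * (A * A)). intros t n Ht.
  pose proof (exp_pos (exp (Z t0 + C1 * (Tm + K)))).
  assert (HAA : 0 <= A * A) by nra.
  apply Rle_trans with (E2 t).
  - apply series_sm_le; [apply E2_ex; lra|]. intros k. apply Rmult_le_pos; [apply pow_le, pos_INR|apply pow2_ge_0].
  - destruct (Rle_dec t0 t) as [Hl|Hl]; [specialize (HEb t ltac:(lra)); lra|].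
    assert (E2 t <= 2 * (A * A)); [|lra].
    unfold E2. rewrite <- Series_Aw2. eapply Rle_trans; [apply Rle_abs|]. apply series_abs_le; [apply ex_series_Aw2|].
    intros k. apply E2_bound_term. apply HA. lra.
Qed.
End Continuation.

(** * The maximal solution *)

Section Maximal.
Variables (g : R) (m c0 : nat -> R) (U : (nat -> Prop) -> Prop).
Hypothesis Hg : 0 < g.
Hypothesis Hm : forall k, Rabs (m k) <= 2.
Hypothesis Hc00 : c0 O = 0.
Hypothesis Hc0r : rapid c0.
Hypothesis HU : ProperFilter U.
Hypothesis HUn : forall n, U (fun N => (n <= N)%nat).
Hypothesis HUu : forall P, U P \/ U (fun N => ~ P N).
Variable Tm : R.
Hypothesis HTm : 0 < Tm.
Hypothesis Hgood : forall t, t < Tm -> good g m c0 U t.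

Local Notation c := (cU g m c0 U).

Lemma cU_ubnd : ubnd Tm c.
Proof.
  intros T1 HT1 s.
  destruct (cU_bnd g m c0 U Hg Hm Hc00 Hc0r HUu (Rmax 0 T1) (Rmax_l _ _)
    (Hgood _ (Rmax_lub_lt _ _ _ HTm HT1)) s) as [A HA].
  exists A. intros t Ht. apply HA. pose proof (Rmax_r 0 T1). lra.
Qed.

Lemma cU_zero_mode t : t < Tm -> c t O = 0.
Proof.
  intros Ht. apply (cU_0 g m c0 U Hg Hm Hc00 Hc0r HUu (Rmax 0 t) (Rmax_l _ _)
    (Hgood _ (Rmax_lub_lt _ _ _ HTm Ht))). apply Rmax_r.
Qed.

Lemma cU_ode t k : 0 < t < Tm -> is_derive (fun s => c s k) t (Bser g m (c t) (c t) k).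
Proof.
  intros Ht. apply (cU_derive g m c0 U Hg Hm Hc00 Hc0r HUn HUu ((t + Tm) / 2)); [lra|apply Hgood; lra|lra].
Qed.

(** The schemes are frozen for [t <= 0]; this reduces to the nonnegative times for which [cU_lip] is
    stated. *)
Lemma cU_Rmax t k : c t k = c (Rmax 0 t) k.
Proof.
  destruct (Rle_dec 0 t); [rewrite Rmax_right; auto|].
  rewrite Rmax_left by lra. rewrite !cU_init; auto; lra.
Qed.

Lemma Rmax_0_contract t t' : t <= t' -> Rmax 0 t' - Rmax 0 t <= t' - t.
Proof. intros H. unfold Rmax. destruct (Rle_dec 0 t), (Rle_dec 0 t'); lra. Qed.

Lemma cU_lipschitz T1 : T1 < Tm -> forall s, exists A, 0 <= A /\
  forall t t', t <= T1 -> t' <= T1 -> bnd s (A * Rabs (t' - t)) (fun k => c t' k - c t k).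
Proof.
  intros HT1 s.
  destruct (cU_lip g m c0 U Hg Hm Hc00 Hc0r HUn HUu (Rmax 0 T1) (Rmax_l _ _)
    (Hgood _ (Rmax_lub_lt _ _ _ HTm HT1)) s) as [A [HA0 HA]].
  exists A. split; auto.
  assert (H1 : forall t t', t <= t' -> t' <= T1 -> bnd s (A * (t' - t)) (fun k => c t' k - c t k)).
  { intros t t' Htt Ht' k. rewrite (cU_Rmax t'), (cU_Rmax t).
    assert (Hm1 : Rmax 0 t <= Rmax 0 t') by (apply Rle_max_compat_l; auto).
    assert (Hm2 : Rmax 0 t' <= Rmax 0 T1) by (apply Rle_max_compat_l; auto).
    pose proof (Rmax_l 0 t).
    eapply Rle_trans; [apply (HA (Rmax 0 t) (Rmax 0 t')); lra|].
    apply Rmult_le_compat_l; auto. apply Rmax_0_contract; auto. }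
  intros t t' Ht Ht'. destruct (Rle_dec t t').
  - rewrite Rabs_pos_eq by lra. apply H1; auto.
  - rewrite Rabs_minus_sym, Rabs_pos_eq by lra. intros k. rewrite Rabs_minus_sym. apply H1; auto; lra.
Qed.
End Maximal.

Lemma filterlim_at_left_p_infty (f : R -> R) a b : a < b ->
  (forall x y, a <= x <= y -> y < b -> f x <= f y) ->
  (forall K, exists x, a <= x < b /\ K < f x) ->
  filterlim f (at_left b) (Rbar_locally p_infty).
Proof.
  intros Hab Hmono Hunb P [K HK]. destruct (Hunb K) as [x [Hx HKx]].
  assert (Hd : 0 < b - x) by lra. exists (mkposreal _ Hd). intros y Hy Hyb.
  change (Rabs (y - b) < b - x) in Hy. apply Rabs_def2 in Hy.
  apply HK. apply Rlt_le_trans with (f x); auto. apply Hmono; lra.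
Qed.

(** If the point found is [PI] itself, continuity moves it inside: the blow-up argument needs room
    for [s0 ^ 2] between [x1] and [PI]. *)
Lemma positive_inside (f : R -> R) : periodic2pi f -> (forall x, f (- x) = f x) ->
  (forall x, continuous f x) -> (forall x, 0 <= f x) -> f 0 = 0 -> (exists x, f x <> 0) ->
  exists x, 0 < x < PI /\ 0 < f x.
Proof.
  intros Hp He Hc Hn H0 [x0 Hx0]. pose proof PI_gt_3.
  destruct (even_periodic_reduce f x0 Hp He) as [y [Hy Exy]].
  rewrite Exy in Hx0. pose proof (Hn y).
  assert (Hy0 : y <> 0) by (intros E; rewrite E in Hx0; auto).
  assert (Hfy : 0 < f y) by lra.
  destruct (Rlt_dec y PI); [exists y; split; auto; lra|].
  assert (y = PI) by lra; subst y.
  destruct (Hc PI (fun z => 0 < z)) as [d Hd].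
  { exists (mkposreal _ Hfy). intros z Hz. change (Rabs (z - f PI) < f PI) in Hz. apply Rabs_def2 in Hz. lra. }
  pose proof (cond_pos d). pose (e := Rmin (d / 2) 1).
  assert (He1 : 0 < e) by (apply Rmin_pos; lra).
  assert (He2 : e <= d / 2) by apply Rmin_l. assert (He3 : e <= 1) by apply Rmin_r.
  exists (PI - e). split; [lra|]. apply Hd. change (Rabs (PI - e - PI) < d).
  rewrite Rabs_left; lra.
Qed.

Theorem theorem1p2 (a g : R) (rho0 : R -> R) :
  0 < a -> 0 < g ->
  smooth_per rho0 -> bounded_fun rho0 ->
  (forall x, 0 <= rho0 x) ->
  (forall x, rho0 (- x) = rho0 x) ->
  rho0 0 = 0 ->
  (forall x, 0 <= x < PI -> 0 <= Derive rho0 x) ->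
  (exists x, rho0 x <> 0) ->
  exists (Tstar : R) (rho : R -> R -> R),
    0 < Tstar /\
    classical_solution a g rho0 Tstar rho /\
    (forall t, 0 <= t < Tstar ->
       smooth_per (rho t) /\ bounded_fun (rho t) /\ (forall x, 0 <= rho t x)) /\
    (forall t, 0 <= t < Tstar -> ex_RInt (fun s => Linf (pdx rho s)) 0 t) /\
    filterlim (fun t => RInt (fun s => Linf (pdx rho s)) 0 t)
      (at_left Tstar) (Rbar_locally p_infty).
Proof.
  intros Ha Hg Hsm _ Hpos Heven Hz Hmon Hnz.
  destruct (fourier_cos_series rho0 Hsm Heven) as [c0 [Hc00 [Hc0r Hc0]]].
  assert (Hprof : forall x, rho0 x = prof c0 x) by (intros x; unfold prof; rewrite <- Hc0; lra).
  destruct free_ultrafilter as [U [HU [HUn HUu]]].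
  pose (m := mk a). pose proof (mk_bound a Ha : forall k, Rabs (m k) <= 2) as Hm.
  pose (c := cU g m c0 U).
  assert (Hub := cU_ubnd g m c0 U Hg Hm Hc00 Hc0r HU HUu).
  assert (Hzm := cU_zero_mode g m c0 U Hg Hm Hc00 Hc0r HU HUu).
  assert (Hder := cU_ode g m c0 U Hg Hm Hc00 Hc0r HU HUn HUu).
  assert (Hlip := cU_lipschitz g m c0 U Hg Hm Hc00 Hc0r HU HUn HUu).
  fold c in Hub, Hzm, Hder, Hlip. unfold m in Hder.
  assert (Hci : forall k, c 0 k = c0 k) by (intros k; apply cU_init; auto; lra).
  assert (Hp0 : forall x, prof (c 0) x = rho0 x).
  { intros x. rewrite Hprof. unfold prof. rewrite !(cosS_ext _ (c 0) c0); auto. }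
  assert (Hinit : forall x, 0 <= x <= PI -> 0 <= slope (c 0) x).
  { intros x Hx. assert (Es : slope (c 0) x = slope c0 x).
    { unfold slope. f_equal. apply Series_ext. intros k. rewrite Hci; auto. }
    rewrite Es. destruct (Req_dec x PI) as [->|Hne]; [unfold slope; rewrite sinS_PI; lra|].
    rewrite <- (is_derive_unique _ _ _ (prof_derive c0 Hc0r x)).
    rewrite <- (Derive_ext rho0 (prof c0) x Hprof). apply Hmon. lra. }
  assert (Hrc : forall x, continuous rho0 x).
  { intros x. apply (ex_derive_continuous rho0 x). exact (proj1 (proj2 Hsm) 1%nat x). }
  destruct (positive_inside rho0 (proj1 Hsm) Heven Hrc Hpos Hz Hnz) as [x1 [Hx1 Hrx1]].
  destruct (good_start g m c0 U Hg Hm Hc00 Hc0r) as [Ts [HTs Hgs]].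
  assert (Hgood_lt : forall T, good g m c0 U T -> forall t, t < T -> good g m c0 U t).
  { intros T HT t Ht. apply good_mono with T; auto; lra. }
  (* The differential inequality for the mass concerns positive times, so half of the value at [x1]
     is kept at some small [t0 > 0], by continuity up to time 0. *)
  assert (Ht0 : exists t0, 0 < t0 < Ts /\ rho0 x1 / 2 <= prof (c t0) x1).
  { pose proof (iter_pdx_cont Ts c (Hub Ts HTs (Hgood_lt _ Hgs)) (Hlip Ts HTs (Hgood_lt _ Hgs)) 0%nat 0 x1 HTs) as Hcont.
    destruct (Hcont (fun z => rho0 x1 / 2 <= z)) as [d Hd].
    { assert (He : 0 < rho0 x1 / 2) by lra. exists (mkposreal _ He). intros z Hz'.
      change (Rabs (z - prof (c 0) x1) < rho0 x1 / 2) in Hz'. rewrite Hp0 in Hz'. apply Rabs_def2 in Hz'. lra. }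
    pose proof (cond_pos d). exists (Rmin (d / 2) (Ts / 2)).
    assert (0 < Rmin (d / 2) (Ts / 2)) by (apply Rmin_pos; lra).
    pose proof (Rmin_l (d / 2) (Ts / 2)). pose proof (Rmin_r (d / 2) (Ts / 2)).
    split; [lra|]. apply (Hd (Rmin (d / 2) (Ts / 2), x1)). split; [|apply ball_center].
    change (Rabs (Rmin (d / 2) (Ts / 2) - 0) < d). rewrite Rabs_pos_eq; lra. }
  destruct Ht0 as [t0 [Ht0 Hpt0]].
  (* In the variable [s], [s1] marks [x1] and [s0] the midpoint of [x1] and [PI], so that
     [s0 ^ 2 < PI]. *)
  pose (s1 := sqrt x1). pose (s0 := sqrt ((x1 + PI) / 2)).
  assert (Hs1 : s1 ^ 2 = x1) by (apply pow2_sqrt; lra).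
  assert (Hs0 : s0 ^ 2 = (x1 + PI) / 2) by (apply pow2_sqrt; lra).
  assert (Hs10 : 0 < s1 < s0) by (split; [apply sqrt_lt_R0; lra|apply sqrt_lt_1; lra]).
  (* [blowup_bound] is applied with a good time [T] in the role of [Tm], which bounds the good times
     before their supremum is known. *)
  destruct (completeness (good g m c0 U)) as [Tst [Hub1 Hlub]].
  { exists (Rmax Ts (t0 + / (rate0 a g s0 * mass0 s1 s0 (rho0 x1 / 2)))). intros T HT.
    destruct (Rle_dec T Ts) as [Hle|Hgt]; [eapply Rle_trans; [exact Hle|apply Rmax_l]|].
    eapply Rle_trans; [|apply Rmax_r]. assert (HT0 : 0 < T) by lra.
    apply (blowup_bound a g Ha Hg T c (Hub T HT0 (Hgood_lt T HT)) (Hzm T HT0 (Hgood_lt T HT))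
      (Hder T HT0 (Hgood_lt T HT)) (Hlip T HT0 (Hgood_lt T HT)) Hinit); try lra.
    rewrite Hs1. exact Hpt0. }
  { exists Ts; auto. }
  assert (HTst : 0 < Tst) by (specialize (Hub1 Ts Hgs); lra).
  assert (Hgood : forall t, t < Tst -> good g m c0 U t).
  { intros t Ht. apply NNPP. intros Hng.
    assert (Tst <= t); [|lra]. apply Hlub. intros T HT. apply Rnot_lt_le. intros Hlt.
    apply Hng. apply (Hgood_lt T); auto. }
  specialize (Hub Tst HTst Hgood). specialize (Hzm Tst HTst Hgood).
  specialize (Hder Tst HTst Hgood). specialize (Hlip Tst HTst Hgood).
  exists Tst, (rho c). split; auto.
  assert (Hr : forall t, t < Tst -> rapid (c t)) by (intros t Ht; apply (crapid Tst c Hub t Ht)).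
  assert (HI := ex_RInt_Linf Tst c Hub Hlip).
  split; [|split; [|split; [exact HI|]]].
  - split; [exact Hp0|]. split; [intros t _; apply (prof_per (c t))|].
    split; [apply (pd_regular g (mk a)); auto|]. split.
    (* The solution is extended to negative times, so the one-sided limit at [t = 0] follows from
       two-sided continuity. *)
    + intros n t x Ht. eapply filterlim_filter_le_1; [apply filter_le_within|].
      apply (iter_pdx_cont Tst c Hub Hlip n t x). lra.
    + intros t x Ht. exists (vel a (c t) x). split; [apply (Ha_prof a (c t)); auto; apply Hr; lra|].
      rewrite (slope_pdx Tst c Hub) by lra.
      pose proof (is_derive_unique _ _ _ (rho_t a g Ha Hg Tst c Hub Hzm Hder t x Ht)) as Hpdt.
      change (pdt (rho c) t x = - (g * vel a (c t) x * slope (c t) x)) in Hpdt. rewrite Hpdt. ring.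
  - intros t Ht. split; [|split].
    + apply cosS_smooth. apply Hr; lra.
    + apply (prof_bounded (c t)). apply Hr; lra.
    + intros x. apply (prof_nonneg a g Ha Hg Tst c Hub Hzm Hder Hlip Hinit t x Ht).
  - apply filterlim_at_left_p_infty with 0; auto.
    + intros x y Hxy Hy.
      assert (HIxy : ex_RInt (fun s => Linf (pdx (rho c) s)) x y).
      { apply (@ex_RInt_Chasles_2 R_CompleteNormedModule _ 0 x y); [lra|]. apply HI; lra. }
      apply Rminus_le_0. rewrite (RInt_Chasles_R (fun s => Linf (pdx (rho c) s)) 0 x y); [|apply HI; lra|exact HIxy].
      apply RInt_nonneg; [lra|exact HIxy|]. intros s Hs.
      eapply Rle_trans; [apply Rabs_pos|apply (Linf_slope Tst c Hub s 0); lra].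
    + intros K. apply NNPP. intros Hno.
      destruct (E2_bounded a g Ha Hg Tst c HTst Hub Hzm Hder Hlip K) as [B HB].
      { intros t Ht. apply Rnot_lt_le. intros HK. apply Hno. exists t. auto. }
      destruct (good_extend g m c0 U Hg Hm Hc00 Hc0r HUn HUu Tst B HTst Hgood HB) as [T [HT1 HT2]].
      specialize (Hub1 T HT2). lra.
Qed.
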